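(* Let $K$ be a polyhedron satisfying the mesh assumptions with parameter $\rho$, with tetrahedral subdivision $\mathcal T_K$, let $k\ge1$, let $V_k^{\mathrm c}(K)$ be the 3D enhanced conforming virtual element space, and let $\widetilde J_k^K:V_k^{\mathrm c}(K)\to\widetilde W_k(\mathcal T_K)$ be the interpolation operator, all as defined in the context. Then there is a constant $C>0$, depending only on $k$, $\rho$ and the regularity constants of $\mathcal T_K$ (not on $h_K$), such that for all $v_h\in V_k^{\mathrm c}(K)$ $$|v_h|_{m,K}\le C|\widetilde J_k^Kv_h|_{m,K},\qquad m=0,1.$$
   Context: Notation: $(\cdot,\cdot)_S$, $\|\cdot\|_S$ are the $L^2(S)$ inner product and norm; $|\cdot|_{1,S}$ is the $H^1(S)$ seminorm and $|\cdot|_{0,S}=\|\cdot\|_S$. $\mathbb P_m(S)$ is the space of polynomials of degree $\le m$ on $S$ (in intrinsic coordinates of the line/plane containing $S$ if $S$ is an edge/face; $\{0\}$ if $m<0$); $\overline{\mathbb P}_m(S)$ is the subspace of homogeneous polynomials of degree $m$ in $\bm x-\bm x_S$ ($\{0\}$ if $m<0$), $\bm x_S$ the barycenter of $S$. $\mathbb M_m(S)=\{((\bm x-\bm x_S)/h_S)^{\bm\beta}:|\bm\beta|\le m\}$ is the scaled monomial basis of $\mathbb P_m(S)$ ($h_S$ the diameter; empty if $m<0$). Mesh assumptions: $K\subset\mathbb R^3$ is a polyhedron of diameter $h_K$, star-shaped with respect to a ball of radius $\ge\rho h_K$; every edge has length $\ge\rho h_K$; every face is star-shaped in the same sense with parameter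 $\rho$. $\mathcal T_K$ is a conforming shape-regular tetrahedral subdivision of $K$ whose tetrahedra have diameters comparable to $h_K$, such that the edges of $K$ are not subdivided; it induces a triangulation of each face of $K$. $\mathcal V(K),\mathcal E(K),\mathcal F(K)$ are the vertices, edges, faces of $K$; $\mathcal V^\partial(\mathcal T_K),\mathcal E^\partial(\mathcal T_K),\mathcal F^\partial(\mathcal T_K)$ (resp. $\mathcal V^{\mathrm{int}}(\mathcal T_K),\mathcal E^{\mathrm{int}}(\mathcal T_K),\mathcal F^{\mathrm{int}}(\mathcal T_K)$) are the vertices, edges, triangular faces of $\mathcal T_K$ located on $\partial K$ (resp. in the interior of $K$). Projections: for $S=K$ or $S=F\in\mathcal F(K)$, $Q_k^S$ is the $L^2(S)$ projection onto $\mathbb P_k(S)$, and for $v\in H^1(S)$, $\Pi_k^Sv\in\mathbb P_k(S)$ is defined by $(\nabla\Pi_k^Sv,\nabla q)_S=(\nabla v,\nabla q)_S$ for all $q\in\mathbb P_k(S)$ and $\int_{\partial S}\Pi_k^Sv\,\mathrm ds=\int_{\partial S}v\,\mathrm ds$. Set $\Pi_{k,h}^{\partial K}|_F=\Pi_k^F$, $Q_{k,h}^{\partial K}|_F=Q_k^F$ for $F\in\mathcal F(K)$. Virtual element spaces: for a face $F$ (a polygon), with $\mathbb B_k(\partial F)=\{v\in C^0(\partial F):v|_e\in\mathbb P_k(e)$ for each edge $e$ of $F\}$, $V_k^{\mathrm c}(F)=\{v\in H^1(F):\Delta v\in\mathbb P_k(F),\ v|_{\partial F}\in\mathbb B_k(\partial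 F),\ (v,q)_F=(\Pi_k^Fv,q)_F\ \forall q\in\overline{\mathbb P}_k(F)\oplus\overline{\mathbb P}_{k-1}(F)\}$. With $\mathbb B_k(\partial K)=\{v\in H^1(\partial K):v|_F\in V_k^{\mathrm c}(F)\ \forall F\in\mathcal F(K)\}$, $$V_k^{\mathrm c}(K)=\{v\in H^1(K):\Delta v\in\mathbb P_k(K),\ v|_{\partial K}\in\mathbb B_k(\partial K),\ (v,q)_K=(\Pi_k^Kv,q)_K\ \forall q\in\overline{\mathbb P}_k(K)\oplus\overline{\mathbb P}_{k-1}(K)\}.$$ Macro finite element space: for a tetrahedron $T$ let $b_T$ be the product of its four barycentric coordinates and, for a face $F$ of $T$, $b_F$ the product of the three barycentric coordinates of the vertices of $F$; polynomials on $F$ are extended to $T$ via their Bernstein form in the barycentric coordinates. Then $$\widetilde W_k(T)=\mathbb P_k(T)\oplus b_T\overline{\mathbb P}_{k-3}(T)\oplus b_T\overline{\mathbb P}_{k-2}(T)\oplus\sum_{F\in\mathcal F(T)}b_F\overline{\mathbb P}_{k-2}(F),$$ with unisolvent degrees of freedom: vertex values; $\frac1{|e|}(v,q)_e$, $q\in\mathbb M_{k-2}(e)$, on edges; $\frac1{|F|}(v,q)_F$, $q\in\mathbb M_{k-2}(F)$, on faces; $\frac1{|T|}(v,q)_T$, $q\in\mathbb M_{k-2}(T)$. $\widetilde W_k(\mathcal T_K)=\{v\in C^0(K):v|_T\in\widetilde W_k(T)\ \forall T\in\mathcal T_K\}$. Interpolation: for $v_h\in V_k^{\mathrm c}(K)$,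 $w:=\widetilde J_k^Kv_h\in\widetilde W_k(\mathcal T_K)$ is determined by - $w(\delta)=v_h(\delta)$, $\delta\in\mathcal V(K)$; $w(\delta)=\Pi_{k,h}^{\partial K}v_h(\delta)$, $\delta\in\mathcal V^\partial(\mathcal T_K)\setminus\mathcal V(K)$; $w(\delta)=\Pi_k^Kv_h(\delta)$, $\delta\in\mathcal V^{\mathrm{int}}(\mathcal T_K)$; - for all $q\in\mathbb M_{k-2}(e)$: $(w-v_h,q)_e=0$, $e\in\mathcal E(K)$; $(w-\Pi_{k,h}^{\partial K}v_h,q)_e=0$, $e\in\mathcal E^\partial(\mathcal T_K)\setminus\mathcal E(K)$; $(w-\Pi_k^Kv_h,q)_e=0$, $e\in\mathcal E^{\mathrm{int}}(\mathcal T_K)$; - for all $q\in\mathbb M_{k-2}(F)$: $(w-Q_{k,h}^{\partial K}v_h,q)_F=0$, $F\in\mathcal F^\partial(\mathcal T_K)$; $(w-\Pi_k^Kv_h,q)_F=0$, $F\in\mathcal F^{\mathrm{int}}(\mathcal T_K)$; - $(w-Q_k^Kv_h,q)_T=0$, $q\in\mathbb M_{k-2}(T)$, $T\in\mathcal T_K$. *)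

(* Defs.v *)
From HB Require Import structures.
From mathcomp Require Import all_boot all_order all_algebra.
From mathcomp Require Import all_classical all_reals all_analysis.
Set Implicit Arguments.
Unset Strict Implicit.
Unset Printing Implicit Defensive.
Import Order.TTheory GRing.Theory Num.Theory numFieldNormedType.Exports.
Local Open Scope classical_set_scope.
Local Open Scope ring_scope.

Section measurable_rV.
Context {d} {T : sigmaRingType d} (n : nat).
Let coors : 'I_n -> 'rV[T]_n -> T := fun i x => x 0 i.

Let rV_set0 : g_sigma_preimage coors set0.
Proof. exact: sigma_algebra0. Qed.

Let rV_setC A : g_sigma_preimage coors A -> g_sigma_preimage coors (~` A).
Proof. exact: sigma_algebraC. Qed.

Let rV_bigcup (F : _^nat) : (forall i, g_sigma_preimage coors (F i)) ->
  g_sigma_preimage coors (\bigcup_i (F i)).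
Proof. exact: sigma_algebra_bigcup. Qed.

HB.instance Definition _ := @isMeasurable.Build (measure_tuple_display d)
  'rV[T]_n (g_sigma_preimage coors) rV_set0 rV_setC rV_bigcup.
End measurable_rV.

Lemma measurable_coord d (T : sigmaRingType d) n (i : 'I_n) :
  measurable_fun [set: 'rV[T]_n] (fun x : 'rV[T]_n => x 0 i).
Proof.
move=> _ Y mY; rewrite setTI; apply: sub_sigma_algebra => /=.
rewrite -bigcup_seq/=; exists i => /=; first by rewrite mem_index_enum.
by exists Y => //; rewrite setTI.
Qed.

Lemma measurable_fun_rV d1 d2 (T1 : measurableType d1) (T2 : measurableType d2)
    n (f : T1 -> 'rV[T2]_n) :
  (forall i, measurable_fun [set: T1] (fun x => f x 0 i)) ->
  measurable_fun [set: T1] f.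
Proof.
move=> mf; apply: (@measurability _ _ _ _ _ _
  (\big[setU/set0]_(i < n) preimage_set_system setT
     (fun x : 'rV[T2]_n => x 0 i) measurable)) => //.
move=> _ [B + <-].
rewrite -bigcup_seq => -[i _ [C mC <-]].
by rewrite setTI; have := mf i measurableT C mC.
Qed.

Section lebesgue_rV.
Variable R : realType.

Definition rV_cons n (p : R * 'rV[R]_n) : 'rV[R]_n.+1 :=
  \row_i (if unlift ord0 i is Some j then p.2 0 j else p.1).

Definition rV_uncons n (x : 'rV[R]_n.+1) : R * 'rV[R]_n :=
  (x 0 ord0, \row_j x 0 (lift ord0 j)).

Lemma rV_consK n : cancel (@rV_cons n) (@rV_uncons n).
Proof.
move=> [a y]; rewrite /rV_uncons mxE unlift_none; congr pair.
by apply/rowP => j; rewrite !mxE liftK.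
Qed.

Lemma measurable_rV_cons n : measurable_fun setT (@rV_cons n).
Proof.
apply: measurable_fun_rV => i.
case: (unliftP ord0 i) => [j|] ->.
  under eq_fun do rewrite mxE liftK.
  apply: (measurableT_comp (@measurable_coord _ _ n j)).
  exact: measurable_snd.
under eq_fun do rewrite mxE unlift_none.
exact: measurable_fst.
Qed.

Lemma measurable_rV_uncons n : measurable_fun setT (@rV_uncons n).
Proof.
apply: measurable_fun_pair; first exact: measurable_coord.
apply: measurable_fun_rV => j; under eq_fun do rewrite mxE.
exact: measurable_coord.
Qed.

Section step.
Variables (n : nat) (m : {sigma_finite_measure set 'rV[R]_n -> \bar R}).

Definition leb_step : set 'rV[R]_n.+1 -> \bar R :=
  pushforward (@lebesgue_measure R \x m)%E (@rV_cons n).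

Let leb_step0 : leb_step set0 = 0%E.
Proof. by rewrite /leb_step /pushforward preimage_set0 measure0. Qed.

Let leb_step_ge0 A : (0 <= leb_step A)%E.
Proof. exact: (measure_ge0 (@lebesgue_measure R \x m)%E). Qed.

Let preimage_cons A : measurable A -> measurable (@rV_cons n @^-1` A).
Proof.
by move=> mA; rewrite -[X in measurable X]setTI; exact: measurable_rV_cons.
Qed.

Let leb_step_sigma_additive : semi_sigma_additive leb_step.
Proof.
move=> F mF tF mUF; rewrite /leb_step /pushforward preimage_bigcup.
apply: (@measure_semi_sigma_additive _ _ _ (@lebesgue_measure R \x m)%E).
- by move=> i; exact: preimage_cons.
- apply/trivIsetP => i j _ _ ij; rewrite -preimage_setI.
  by move/trivIsetP : tF => /(_ _ _ _ _ ij) ->//; rewrite preimage_set0.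
- by rewrite -preimage_bigcup; exact: preimage_cons.
Qed.

HB.instance Definition _ := isMeasure.Build _ _ _ leb_step
  leb_step0 leb_step_ge0 leb_step_sigma_additive.

Let leb_step_sigma_finite : sigma_finite setT leb_step.
Proof.
have /sigma_finiteP[F [TF ndF Foo]] := sigma_finiteT (@lebesgue_measure R).
have /sigma_finiteP[G [TG ndG Goo]] := sigma_finiteT m.
exists (fun i => @rV_uncons n @^-1` (F i `*` G i)).
  rewrite -preimage_bigcup (_ : \bigcup_i _ = setT) ?preimage_setT//.
  rewrite -subTset => -[a y] _.
  have : [set: measurableTypeR R] a by [].
  have : [set: 'rV[R]_n] y by [].
  rewrite TF TG => -[j _ Gjy] [i _ Fia]; exists (maxn i j) => //; split.
  - by move: a Fia; exact/subsetPset/ndF/leq_maxl.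
  - by move: y Gjy; exact/subsetPset/ndG/leq_maxr.
move=> i; have [mF Fi] := Foo i; have [mG Gi] := Goo i; split.
  rewrite -[X in measurable X]setTI; apply: measurable_rV_uncons => //.
  exact: measurableX.
rewrite /leb_step /pushforward -comp_preimage.
rewrite (_ : _ \o _ = id) ?preimage_id; last first.
  by apply/funext => p; exact: rV_consK.
by rewrite product_measure1E// lte_mul_pinfty// ge0_fin_numE.
Qed.

HB.instance Definition _ :=
  Measure_isSigmaFinite.Build _ _ _ leb_step leb_step_sigma_finite.
End step.

(* Lebesgue measure on R^n: the image of the product of the Lebesgue measures
   of R and R^(n-1), starting from the unit mass on the point R^0. *)
Fixpoint leb n : {sigma_finite_measure set 'rV[R]_n -> \bar R} :=
  match n with
  | 0 => \d_(0 : 'rV[R]_0)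
  | m.+1 => leb_step (leb m)
  end.
End lebesgue_rV.

Section euclidean.
Context {R : realType} {n : nat}.
Implicit Types (x y p q : 'rV[R]_n) (D : set 'rV[R]_n).

(* Euclidean norm; the norm `|x| of the library is the sup norm. *)
Definition enorm x : R := Num.sqrt (\sum_i x 0 i ^+ 2).

Definition seg p q : set 'rV[R]_n :=
  [set x | exists2 t : R, 0 <= t <= 1 & x = p + t *: (q - p)].

Definition diam D : R :=
  sup [set r | exists x y, [/\ D x, D y & r = enorm (x - y)]].

Definition barycenter D : 'rV[R]_n :=
  \row_i ((\int[leb R n]_(x in D) x 0 i) / (\int[leb R n]_(x in D) 1)).

Definition boundary D : set 'rV[R]_n := closure D `\` interior D.

Definition contains_ball r D :=
  exists x0, [set x | enorm (x - x0) <= r] `<=` D.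

(* D is star-shaped with respect to a ball of radius at least rho * diam D *)
Definition star_shaped (rho : R) D :=
  exists x0 r, rho * diam D <= r /\
    forall y, enorm (y - x0) <= r -> forall x, D x -> seg y x `<=` D.

End euclidean.

Section polynomials.
Context {R : realType} {n : nat}.
Implicit Types (x y : 'rV[R]_n) (D : set 'rV[R]_n) (f q : 'rV[R]_n -> R).

Definition mdeg N (b : {ffun 'I_n -> 'I_N}) : nat := (\sum_i b i)%N.

(* Degrees are integers: the spaces are {0} and the basis is empty for m < 0. *)
Definition polyfun (m : int) : set ('rV[R]_n -> R) :=
  [set f | exists c : {ffun 'I_n -> 'I_`|m|.+1} -> R,
    forall x, f x = \sum_(b | ((mdeg b)%:Z <= m)%R) c b * \prod_i x 0 i ^+ b i].

Definition homfun D (m : int) : set ('rV[R]_n -> R) :=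
  [set f | exists c : {ffun 'I_n -> 'I_`|m|.+1} -> R,
    forall x, f x = \sum_(b | (mdeg b)%:Z == m)
      c b * \prod_i (x - barycenter D) 0 i ^+ b i].

Definition scaled_monomial D (m : int) : set ('rV[R]_n -> R) :=
  [set f | exists2 b : 'I_n -> nat, ((\sum_i b i)%N%:Z <= m)%R &
    forall x, f x =
      \prod_i (((diam D)^-1 *: (x - barycenter D)) 0 i) ^+ b i].

End polynomials.

Section sobolev.
Context {R : realType} {n : nat}.
Implicit Types (D : set 'rV[R]_n) (u v f p phi : 'rV[R]_n -> R).

Definition ip D u v : R := \int[leb R n]_(x in D) (u x * v x).

Definition L2 D : set ('rV[R]_n -> R) :=
  [set u : 'rV[R]_n -> R | measurable_fun D u /\
     (leb R n).-integrable D (fun x => (u x ^+ 2)%:E)].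

Definition L2norm D u : R := Num.sqrt (ip D u u).

Definition pd (i : 'I_n) f : 'rV[R]_n -> R := 'D_(delta_mx 0 i) f.

Fixpoint is_Ck (k : nat) f : Prop :=
  match k with
  | 0 => continuous f
  | j.+1 => continuous f /\ forall i,
      (forall x, derivable f x (delta_mx 0 i)) /\ is_Ck j (pd i f)
  end.

Definition smooth f := forall k, is_Ck k f.

Definition test_fun D : set ('rV[R]_n -> R) :=
  [set phi | [/\ smooth phi, compact (closure [set x | phi x != 0]) &
                 closure [set x | phi x != 0] `<=` interior D]].

Definition is_wgrad D u (g : 'I_n -> 'rV[R]_n -> R) :=
  forall i, L2 D (g i) /\
    forall phi, test_fun D phi -> ip D u (pd i phi) = - ip D (g i) phi.

Definition H1 D : set ('rV[R]_n -> R) :=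
  [set u | L2 D u /\ exists g, is_wgrad D u g].

Definition wgrad D u : 'I_n -> 'rV[R]_n -> R :=
  xget (fun=> fun=> 0) [set g | is_wgrad D u g].

Definition H1seminorm D u : R :=
  Num.sqrt (\sum_i ip D (wgrad D u i) (wgrad D u i)).

(* Delta u = p in the sense of distributions in the interior of D *)
Definition laplacian_eq D u p := forall phi, test_fun D phi ->
  ip D u (fun x => \sum_i pd i (pd i phi) x) = ip D p phi.

End sobolev.

Section cells.
Context {R : realType}.

(* A flat d-dimensional piece of R^n, in coordinates t |-> o + t *m U of the
   affine subspace containing it; [isometric] says the coordinates are
   orthonormal, so that integrals over the piece are integrals over [cdom]. *)
Record cell d n := Cell {
  cdom : set 'rV[R]_d ; corg : 'rV[R]_n ; cdir : 'M[R]_(d, n) }.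

Context {d n : nat}.
Implicit Types (c : cell d n) (D : set 'rV[R]_n).

Definition chart c (t : 'rV[R]_d) : 'rV[R]_n := corg c + t *m cdir c.
Definition coord c (x : 'rV[R]_n) : 'rV[R]_d := (x - corg c) *m (cdir c)^T.
Definition cset c : set 'rV[R]_n := chart c @` cdom c.
Definition isometric c := cdir c *m (cdir c)^T = 1%:M.

Definition segcell (p q : 'rV[R]_n) : cell 1 n :=
  Cell [set t : 'rV[R]_1 | 0 <= t 0 0 <= enorm (q - p)] p ((enorm (q - p))^-1 *: (q - p)).

(* g is the trace of u \in H^1(D) on the piece c of the boundary of D *)
Definition trace_on D (u : 'rV[R]_n -> R) c (g : 'rV[R]_d -> R) :=
  L2 (cdom c) g /\ exists phi : nat -> 'rV[R]_n -> R,
    [/\ forall j, smooth (phi j),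
        L2norm D (phi j \- u) @[j --> \oo] --> (0 : R),
        forall i, L2norm D (pd i (phi j) \- wgrad D u i) @[j --> \oo] --> (0 : R) &
        L2norm (cdom c) ((phi j \o chart c) \- g) @[j --> \oo] --> (0 : R)].

(* integral of v over the union of the pieces bd *)
Definition bint (bd : seq (cell d n)) (v : 'rV[R]_n -> R) : R :=
  \sum_(c <- bd) \int[leb R d]_(t in cdom c) v (chart c t).

(* The H^1 projection onto P_k, with the boundary of D cut in the pieces bd. *)
Definition PiH1 D (bd : seq (cell d n)) (k : nat) (v : 'rV[R]_n -> R) :=
  xget (fun=> 0) [set p | [/\ polyfun k%:Z p,
    forall q, polyfun k%:Z q ->
      \sum_i ip D (pd i p) (pd i q) = \sum_i ip D (wgrad D v i) (pd i q) &
    bint bd p = bint bd v]].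

(* (v, q)_D = (Pi_k v, q)_D for q in the two top-degree homogeneous parts *)
Definition enhanced D (bd : seq (cell d n)) (k : nat) (v : 'rV[R]_n -> R) :=
  forall q1 q2, homfun D k%:Z q1 -> homfun D (k%:Z - 1) q2 ->
    ip D v (q1 \+ q2) = ip D (PiH1 D bd k v) (q1 \+ q2).

End cells.
Arguments cell R d n : clear implicits.

(* The L^2 projection onto P_k. *)
Definition QL2 {R : realType} {n} (D : set 'rV[R]_n) (k : nat)
    (v : 'rV[R]_n -> R) : 'rV[R]_n -> R :=
  xget (fun=> 0) [set p | polyfun k%:Z p /\
    forall q, polyfun k%:Z q -> ip D (v \- p) q = 0].

Section polyhedra.
Context {R : realType}.

(* A face is a plane region fcell together with the cyclic list of its
   vertices, in the intrinsic coordinates of the plane. *)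
Record face := Face { fcell :> cell R 2 3 ; fvs : seq 'rV[R]_2 }.

Definition fedges (F : face) : seq ('rV[R]_2 * 'rV[R]_2) :=
  [seq (p, next (fvs F) p) | p <- fvs F].

Definition fbd (F : face) : seq (cell R 1 2) :=
  [seq segcell e.1 e.2 | e <- fedges F].

(* The region is the closed domain enclosed by a simple closed polygonal line;
   consecutive edges are allowed to be aligned. *)
Definition is_polygon (F : face) :=
  [/\ (2 < size (fvs F))%N /\ uniq (fvs F),
      forall e e', e \in fedges F -> e' \in fedges F -> e != e' ->
        forall x, seg e.1 e.2 x -> seg e'.1 e'.2 x ->
          (x \in [:: e.1; e.2]) && (x \in [:: e'.1; e'.2]),
      compact (cdom F), closure (interior (cdom F)) = cdom F &
      boundary (cdom F) =
        [set x | exists2 e, e \in fedges F & seg e.1 e.2 x]].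

Record polyhedron := Polyhedron {
  pdom :> set 'rV[R]_3 ; nfaces : nat ; pface : 'I_nfaces -> face }.
Arguments pface : clear implicits.

Implicit Type K : polyhedron.

Definition is_fvertex (F : face) (x : 'rV[R]_3) :=
  exists2 p, p \in fvs F & x = chart F p.
Definition is_fedge (F : face) (S : set 'rV[R]_3) :=
  exists2 e, e \in fedges F & S = seg (chart F e.1) (chart F e.2).
Definition is_vertex K x := exists i, is_fvertex (pface K i) x.
Definition is_edge K S := exists i, is_fedge (pface K i) S.

Definition pbd K : seq (cell R 2 3) :=
  [seq fcell (pface K i) | i <- enum 'I_(nfaces K)].

(* Distinct faces meet in common vertices and common edges only. *)
Definition is_polyhedron K :=
  [/\ compact K, closure (interior K) = K,
      forall i, isometric (pface K i) /\ is_polygon (pface K i),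
      boundary K = [set x | exists i, cset (pface K i) x] &
      forall i j, i != j ->
        forall x, cset (pface K i) x -> cset (pface K j) x ->
          (is_fvertex (pface K i) x /\ is_fvertex (pface K j) x) \/
          exists S, [/\ is_fedge (pface K i) S, is_fedge (pface K j) S & S x]].

Definition mesh_assumption (rho : R) K :=
  [/\ is_polyhedron K, star_shaped rho K,
      forall i e, e \in fedges (pface K i) -> rho * diam K <= enorm (e.2 - e.1) &
      forall i, star_shaped rho (cdom (pface K i))].

End polyhedra.
Arguments face R : clear implicits.
Arguments polyhedron R : clear implicits.
Arguments pface {R} p i : rename.

Section virtual_elements.
Context {R : realType}.

Definition Bk_face (k : nat) (F : face R) (v : 'rV[R]_2 -> R) :=
  {within boundary (cdom F), continuous v} /\
  forall e, e \in fedges F -> exists2 q, polyfun k%:Z q &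
    forall t, cdom (segcell e.1 e.2) t -> v (chart (segcell e.1 e.2) t) = q t.

(* An element of a virtual element space is represented by a function whose
   pointwise values on the lower-dimensional pieces of the boundary (faces, and
   then edges of the faces) are its traces there. *)
Definition has_own_trace d n (D : set 'rV[R]_n) (v : 'rV[R]_n -> R)
    (c : cell R d n) := trace_on D v c (v \o chart c).

Definition Vc_face (k : nat) (F : face R) : set ('rV[R]_2 -> R) :=
  [set v : 'rV[R]_2 -> R | [/\ H1 (cdom F) v,
      exists2 p, polyfun k%:Z p & laplacian_eq (cdom F) v p,
      forall e, e \in fedges F -> has_own_trace (cdom F) v (segcell e.1 e.2),
      Bk_face k F v &
      enhanced (cdom F) (fbd F) k v]].

(* H^1 on each face, the two traces on each common edge being equal, namely to
   the values of v on the edge *)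
Definition H1_boundary (K : polyhedron R) : set ('rV[R]_3 -> R) :=
  [set v : 'rV[R]_3 -> R | forall i, H1 (cdom (pface K i)) (v \o chart (pface K i)) /\
     forall e, e \in fedges (pface K i) ->
       has_own_trace (cdom (pface K i)) (v \o chart (pface K i))
         (segcell e.1 e.2)].

Definition Bk_boundary (k : nat) (K : polyhedron R) : set ('rV[R]_3 -> R) :=
  [set v : 'rV[R]_3 -> R | H1_boundary K v /\
     forall i, Vc_face k (pface K i) (v \o chart (pface K i))].

Definition Vc (k : nat) (K : polyhedron R) : set ('rV[R]_3 -> R) :=
  [set v : 'rV[R]_3 -> R | [/\ H1 K v,
      exists2 p, polyfun k%:Z p & laplacian_eq K v p,
      forall i, has_own_trace K v (pface K i),
      Bk_boundary k K v &
      enhanced K (pbd K) k v]].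

(* The projections on a face, as functions on the plane of the face in R^3. *)
Definition Pi_face (k : nat) (F : face R) (v : 'rV[R]_3 -> R) :=
  PiH1 (cdom F) (fbd F) k (v \o chart F) \o coord F.
Definition Q_face (k : nat) (F : face R) (v : 'rV[R]_3 -> R) :=
  QL2 (cdom F) k (v \o chart F) \o coord F.
Definition Pi_K (k : nat) (K : polyhedron R) v := PiH1 K (pbd K) k v.
Definition Q_K (k : nat) (K : polyhedron R) v := QL2 K k v.

End virtual_elements.

Section tetrahedra.
Context {R : realType}.
Implicit Type p : 'I_4 -> 'rV[R]_3.

(* the closed subsimplex of the tetrahedron p spanned by the vertices in A *)
Definition subsimplex p (A : {set 'I_4}) : set 'rV[R]_3 :=
  [set x | exists a : 'I_4 -> R,
    [/\ forall j, 0 <= a j, forall j, j \notin A -> a j = 0, \sum_j a j = 1 &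
        x = \sum_j a j *: p j]].

Definition tet p := subsimplex p [set: 'I_4].

Definition vertex_mx p : 'M[R]_(3 + 1) := \matrix_(i < 3 + 1) row_mx (p i) 1%:M.

Definition nondegenerate_tet p := vertex_mx p \in unitmx.

(* barycentric coordinates: the solution of
   \sum_i l_i = 1 and \sum_i l_i p_i = x *)
Definition bcoord p (i : 'I_4) (x : 'rV[R]_3) : R :=
  (row_mx x 1%:M *m invmx (vertex_mx p)) 0 i.

Definition b_tet p x : R := \prod_i bcoord p i x.

(* The face opposite to the vertex i has index i. *)
Definition b_face p (i : 'I_4) x : R := \prod_(j | j != i) bcoord p j x.

(* Extensions to R^3, through the Bernstein form of degree m in the barycentric
   coordinates of the face, of the polynomials on the face opposite to the
   vertex i that are homogeneous of degree m about its barycenter. *)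
Definition homfun_face p (i : 'I_4) (m : int) : set ('rV[R]_3 -> R) :=
  [set f : 'rV[R]_3 -> R | (exists c : {ffun 'I_4 -> 'I_`|m|.+1} -> R, forall x,
      f x = \sum_(a | ((mdeg a)%:Z == m) && (a i == ord0))
        c a * \prod_j bcoord p j x ^+ a j) /\
    exists F : cell R 2 3, [/\ isometric F, cset F = subsimplex p (~: [set i]) &
      homfun (cdom F) m (f \o chart F)]].

Definition Wloc (k : nat) p : set ('rV[R]_3 -> R) :=
  [set f : 'rV[R]_3 -> R | exists (q0 q1 q2 : 'rV[R]_3 -> R) (qF : 'I_4 -> 'rV[R]_3 -> R),
    [/\ polyfun k%:Z q0, homfun (tet p) (k%:Z - 3) q1,
        homfun (tet p) (k%:Z - 2) q2,
        forall i, homfun_face p i (k%:Z - 2) (qF i) &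
        forall x, f x = q0 x + b_tet p x * q1 x + b_tet p x * q2 x
                        + \sum_i b_face p i x * qF i x]].

Record tmesh := TMesh { ntets : nat ; tets : 'I_ntets -> 'I_4 -> 'rV[R]_3 }.
Arguments tets : clear implicits.
Implicit Types (K : polyhedron R) (T : tmesh).

(* The regularity constants: sigma bounds from below the ratio of inradius to
   diameter of the tetrahedra, and gamma the ratio of their diameters to that of
   K. The last three clauses are conformity, edges of K not being subdivided, and
   the induced triangulation of the faces of K. *)
Definition subdivision (sigma gamma : R) K T :=
  [/\ pdom K = [set x | exists i, tet (tets T i) x],
      (forall i, [/\ nondegenerate_tet (tets T i),
         contains_ball (sigma * diam (tet (tets T i))) (tet (tets T i)) &
         gamma * diam K <= diam (tet (tets T i))]),
      (forall i j, i != j -> range (tets T i) <> range (tets T j) /\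
         tet (tets T i) `&` tet (tets T j) =
           subsimplex (tets T i) [set a | `[< range (tets T j) (tets T i a) >]]),
      (forall S, is_edge K S ->
         exists i (A : {set 'I_4}), #|A| = 2%N /\ S = subsimplex (tets T i) A) &
      (forall l x, cset (pface K l) x -> exists i (A : {set 'I_4}),
         [/\ #|A| = 3%N, subsimplex (tets T i) A `<=` cset (pface K l) &
             subsimplex (tets T i) A x])].

Definition W (k : nat) K T : set ('rV[R]_3 -> R) :=
  [set w : 'rV[R]_3 -> R | {within K, continuous w} /\ forall i, exists2 f, Wloc k (tets T i) f &
     forall x, tet (tets T i) x -> w x = f x].

(* (f, q)_S = 0 for all scaled monomials q of degree at most m on the
   d-dimensional flat set S, in any orthonormal coordinates *)
Definition moments0 (d : nat) (S : set 'rV[R]_3) (m : int) (f : 'rV[R]_3 -> R) :=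
  forall c : cell R d 3, isometric c -> cset c = S ->
    forall q, scaled_monomial (cdom c) m q -> ip (cdom c) (f \o chart c) q = 0.

(* w is the interpolant of v *)
Definition is_interpolant (k : nat) K T (v w : 'rV[R]_3 -> R) :=
  [/\ W k K T w,
    (forall i a, let x := tets T i a in
       [/\ is_vertex K x -> w x = v x,
           ~ is_vertex K x -> forall l, cset (pface K l) x ->
             w x = Pi_face k (pface K l) v x &
           interior K x -> w x = Pi_K k K v x]),
    (forall i (A : {set 'I_4}), #|A| = 2%N -> let e := subsimplex (tets T i) A in
       [/\ is_edge K e -> moments0 1 e (k%:Z - 2) (w \- v),
           ~ is_edge K e -> forall l, e `<=` cset (pface K l) ->
             moments0 1 e (k%:Z - 2) (w \- Pi_face k (pface K l) v) &
           ~ e `<=` boundary K -> moments0 1 e (k%:Z - 2) (w \- Pi_K k K v)]),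
    (forall i (A : {set 'I_4}), #|A| = 3%N -> let f := subsimplex (tets T i) A in
       (forall l, f `<=` cset (pface K l) ->
          moments0 2 f (k%:Z - 2) (w \- Q_face k (pface K l) v)) /\
       (~ f `<=` boundary K -> moments0 2 f (k%:Z - 2) (w \- Pi_K k K v))) &
    (forall i q, scaled_monomial (tet (tets T i)) (k%:Z - 2) q ->
       ip (tet (tets T i)) (w \- Q_K k K v) q = 0)].

End tetrahedra.
Arguments tmesh R : clear implicits.
Arguments tets {R} t _ _.

(* Main.v *)
(* Subtract from v and w a constant (0 if m = 0, a value of w if m = 1) and let
   M bound |w| and h |grad w|. By inverse inequalities on balls inside the
   tetrahedra, M <= C h^(-3/2) ||w|| if m = 0 and M <= C h^(-1/2) |w|_1 if m = 1,
   so it suffices to prove |v|_1 <= C h^(1/2) M and ||v|| <= C h^(3/2) M.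
   On an edge of K the bubbles vanish, and the vertex values and the moments of
   degree k - 2 force w = v. Let S be a face or K, of dimension n, and let u be a
   smooth function whose trace approximates that of v, with |u|_1 <= E. Testing
   with v - u,
     (grad v, grad v) = (grad v, grad u) + (Delta v, u - v)
   up to a small error; Delta v is a polynomial p of degree k with
   ||p|| <= (C / h) |v|_1, and (p, v) is computed from the moments of degree
   k - 2, which v and w share, and, by the enhancement, from the projection
   Pi v. The same identity with Pi v in place of grad v bounds Pi v, hence
   |v|_1 <= C E. On a face u is a smoothing of w, and E = C h^(n/2 - 1) M. In K,
   u is a smoothing of w plus, for each face, the homogeneous extension along the
   rays from the star centre of a function with compact support in the face, close
   to v - w; by the estimates on the face its energy is again C h^(n/2 - 1) M.
   Shape constants enter through the ratios h / r and h / q of a domain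
   star-shaped with respect to a cube of half-side r, whose boundary pieces
   contain cubes of half-side q. *)
Require Import Defs.
From HB Require Import structures.
From mathcomp Require Import all_boot all_order all_algebra.
From mathcomp Require Import all_classical all_reals all_analysis.
From mathcomp Require Import measurable_realfun ring lra zify.
Set Implicit Arguments.
Unset Strict Implicit.
Unset Printing Implicit Defensive.
Import Order.TTheory GRing.Theory Num.Theory numFieldNormedType.Exports.
Local Open Scope classical_set_scope.
Local Open Scope ring_scope.

(** The obstacle is that traces are known only through approximation: each boundary piece comes with
    its own sequence of smooth functions, so there is no trace operator to integrate by parts with.
    Green's formula is replaced by a statement on small traces: given the field, its divergence and
    a bound on the gradient of v, the boundary term is below any tolerance once the traces of v are
    below some threshold. A cutoff proves it; its gradient, of size 1/(e r) in a boundary layer of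
    relative width e, is compensated by a Hardy inequality along the rays. This is why a lifting
    matches v on the boundary only up to an arbitrary error, but with an energy bound independent of
    that error. The functions lifted from the faces have compact support in the open face so that
    the cone over one of them has zero values on all the others. Everything is proved once for
    domains of R^(d+1) with d-dimensional flat pieces, then used with d = 1 on the faces and with d
    = 2 in K. All lengths share the scale of the diameter of K, faces included. *)

Lemma eq_ler (R : porderType ring_display) (x y : R) : x = y -> x <= y.
Proof. by move=> ->. Qed.

#[global] Hint Extern 0 (is_true (0 <= _ * _)) => solve [apply: mulr_ge0; trivial] : core.
#[global] Hint Extern 0 (is_true (0 <= _ + _)) => solve [apply: addr_ge0; trivial] : core.
#[global] Hint Extern 0 (is_true (0 <= _ ^+ 2)) => exact: sqr_ge0 : core.
#[global] Hint Extern 0 (is_true (0 <= _ ^+ _)) => solve [apply: exprn_ge0; trivial] : core.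
#[global] Hint Extern 0 (is_true (0 <= _^-1)) => solve [rewrite invr_ge0; trivial] : core.
#[global] Hint Extern 0 (is_true (0 <= \sum_(_ <- _ | _) _)) => solve [apply: sumr_ge0; intros; trivial] : core.
#[global] Hint Extern 0 (is_true (0 <= Num.sqrt _)) => exact: sqrtr_ge0 : core.
#[global] Hint Extern 0 (is_true (0 <= _)) => solve [apply: ltW; assumption] : core.
#[global] Hint Extern 0 (is_true (0 < _ * _)) => solve [apply: mulr_gt0; trivial] : core.
#[global] Hint Extern 0 (is_true (0 < _ ^+ _)) => solve [apply: exprn_gt0; trivial] : core.
#[global] Hint Extern 0 (is_true (0 < _^-1)) => solve [rewrite invr_gt0; trivial] : core.
#[global] Hint Extern 0 (is_true (0 < _ + _)) => solve [apply: ltr_pwDl; trivial | apply: ltr_wpDl; trivial] : core.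
#[global] Hint Extern 0 (is_true (_ != 0)) => solve [apply: lt0r_neq0; trivial] : core.

Notation lebn := (leb _ _).

(** * Square-integrable functions *)

Section SquareIntegrable.
Context {d} {T : measurableType d} {R : realType} (mu : {measure set T -> \bar R}).
Implicit Types (D : set T) (u v f g b : T -> R).

Definition I1 D f := mu.-integrable D (EFin \o f).
(** For the Lebesgue measure, [S2], [dot] and [nrm] are convertible to [L2], [ip] and [L2norm]. An
    arbitrary measure lets them serve on intervals of R too. *)
Definition S2 D u := measurable_fun D u /\ mu.-integrable D (fun x => (u x ^+ 2)%:E).
Definition dot D u v : R := \int[mu]_(x in D) (u x * v x).
Definition nrm D u : R := Num.sqrt (dot D u u).

Lemma I1_le D f g : measurable D -> measurable_fun D f -> I1 D g ->
  (forall x, D x -> `|f x| <= g x) -> I1 D f.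
Proof.
move=> mD mf ig fg; apply: (le_integrable mD _ _ ig).
  exact/measurable_EFinP.
by move=> x Dx /=; rewrite lee_fin (le_trans (fg x Dx))// ler_norm.
Qed.

Lemma I1D D f g : measurable D -> I1 D f -> I1 D g -> I1 D (fun x => f x + g x).
Proof. by move=> mD jf jg; have := integrableD mD jf jg. Qed.

Lemma I1Z D f k : measurable D -> I1 D f -> I1 D (fun x => k * f x).
Proof. by move=> mD jf; have := integrableZl mD k jf. Qed.

Lemma I1N D f : measurable D -> I1 D f -> I1 D (fun x => - f x).
Proof.
move=> mD /(I1Z (-1) mD); apply: eq_integrable => // x _ /=.
by rewrite mulN1r.
Qed.

Lemma I1B D f g : measurable D -> I1 D f -> I1 D g -> I1 D (fun x => f x - g x).
Proof. by move=> mD jf /(I1N mD) jg; exact: I1D. Qed.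

Lemma I1_meas D f : I1 D f -> measurable_fun D f.
Proof. by move/integrableP => [/measurable_EFinP]. Qed.

Lemma S2_mul D u v : measurable D -> S2 D u -> S2 D v -> I1 D (fun x => u x * v x).
Proof.
move=> mD [mu1 iu] [mv iv].
apply: (@I1_le _ _ (fun x => u x ^+ 2 + v x ^+ 2)) => //.
- exact: measurable_funM.
- exact: I1D.
- move=> x _; rewrite ler_norml; nra.
Qed.

Lemma S2D D u v : measurable D -> S2 D u -> S2 D v -> S2 D (fun x => u x + v x).
Proof.
move=> mD su sv; have [mu1 iu] := su; have [mv iv] := sv; split.
  exact: measurable_funD.
apply: (@I1_le _ _ (fun x => 2 * (u x ^+ 2 + v x ^+ 2))) => //.
- by apply: measurable_funX; exact: measurable_funD.
- by apply: I1Z => //; exact: I1D.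
- move=> x _; rewrite ger0_norm//.
  have := sqr_ge0 (u x - v x); nra.
Qed.

Lemma S2Z D u k : measurable D -> S2 D u -> S2 D (fun x => k * u x).
Proof.
move=> mD [mu1 iu]; split; first by apply: measurable_funM.
have := I1Z (k ^+ 2) mD iu; apply: eq_integrable => // x _ /=.
by rewrite exprMn.
Qed.

Lemma S2N D u : measurable D -> S2 D u -> S2 D (fun x => - u x).
Proof. by move=> mD /(S2Z (-1) mD); under eq_fun do rewrite mulN1r. Qed.

Lemma S2B D u v : measurable D -> S2 D u -> S2 D v -> S2 D (fun x => u x - v x).
Proof. by move=> mD su /(S2N mD) sv; exact: S2D. Qed.

Lemma S2_0 D : measurable D -> S2 D (fun=> 0).
Proof.
move=> mD; split; first exact: measurable_cst.
by under eq_fun do rewrite expr0n /=; exact: integrable0.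
Qed.

Lemma S2_sum D (I : Type) (s : seq I) (P : pred I) (F : I -> T -> R) : measurable D ->
  (forall i, P i -> S2 D (F i)) -> S2 D (fun x => \sum_(i <- s | P i) F i x).
Proof.
move=> mD h; elim: s => [|i s ih].
  by under eq_fun do rewrite big_nil; exact: S2_0.
case Pi: (P i); under eq_fun do rewrite big_cons Pi; last exact: ih.
by apply: S2D => //; exact: h.
Qed.

Lemma S2_ext D u v : measurable D -> (forall x, D x -> u x = v x) -> S2 D u -> S2 D v.
Proof.
move=> mD uv [mu1 iu]; split.
  by apply: eq_measurable_fun mu1 => x /[!inE] /uv.
by apply: eq_integrable iu => // x /[!inE] /uv ->.
Qed.

Lemma I1_bounded D u M : measurable D -> (mu D < +oo)%E -> measurable_fun D u ->
  (forall x, D x -> `|u x| <= M) -> I1 D u.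
Proof.
move=> mD muD mu1 uM; apply: (@I1_le _ _ (fun=> M)) => //.
have := @finite_measure_integrable_cst _ _ R; move=> _.
apply/integrableP; split; first exact/measurable_EFinP.
by rewrite /= integral_cst//= lte_mul_pinfty//.
Qed.

Lemma S2_bounded D u M : measurable D -> (mu D < +oo)%E -> measurable_fun D u ->
  (forall x, D x -> `|u x| <= M) -> S2 D u.
Proof.
move=> mD muD mu1 uM; split=> //.
apply: (@I1_bounded _ _ (M ^+ 2)) => //; first exact: measurable_funX.
by move=> x Dx; rewrite normrX lerXn2r ?nnegrE ?(le_trans _ (uM x Dx)).
Qed.

Lemma S2_mulb D b u M : measurable D -> measurable_fun D b ->
  (forall x, D x -> `|b x| <= M) -> S2 D u -> S2 D (fun x => b x * u x).
Proof.
move=> mD mb bM [mu1 iu]; split; first exact: measurable_funM.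
apply: (@I1_le _ _ (fun x => M ^+ 2 * u x ^+ 2)) => //.
- by apply: measurable_funX; exact: measurable_funM.
- exact: I1Z.
- move=> x Dx; rewrite normrX normrM exprMn real_normK ?num_real//.
  rewrite -[u x ^+ 2]real_normK ?num_real// ler_wpM2r//.
  by rewrite -[leLHS]real_normK ?num_real// lerXn2r ?nnegrE ?(le_trans _ (bM x Dx)).
Qed.

Lemma S2_subset D D' u : measurable D -> measurable D' -> D' `<=` D -> S2 D u -> S2 D' u.
Proof.
move=> mD mD' sub [mu1 iu]; split; first exact: measurable_funS mu1.
exact: integrableS iu.
Qed.

Lemma dotC D u v : dot D u v = dot D v u.
Proof. by apply: eq_Rintegral => x _; rewrite mulrC. Qed.

Lemma dotDl D u v w : measurable D -> S2 D u -> S2 D v -> S2 D w ->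
  dot D (fun x => u x + v x) w = dot D u w + dot D v w.
Proof.
move=> mD su sv sw; rewrite /dot -RintegralD//; try exact: S2_mul.
by apply: eq_Rintegral => x _; rewrite mulrDl.
Qed.

Lemma dotDr D u v w : measurable D -> S2 D u -> S2 D v -> S2 D w ->
  dot D w (fun x => u x + v x) = dot D w u + dot D w v.
Proof. by move=> *; rewrite dotC dotDl// dotC (dotC _ v). Qed.

Lemma dotZl D u w k : measurable D -> S2 D u -> S2 D w ->
  dot D (fun x => k * u x) w = k * dot D u w.
Proof.
move=> mD su sw; rewrite /dot -RintegralZl//; last exact: S2_mul.
by apply: eq_Rintegral => x _; rewrite mulrA.
Qed.

Lemma dotZr D u w k : measurable D -> S2 D u -> S2 D w ->
  dot D w (fun x => k * u x) = k * dot D w u.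
Proof. by move=> *; rewrite dotC dotZl// dotC. Qed.

Lemma dotNl D u w : measurable D -> S2 D u -> S2 D w ->
  dot D (fun x => - u x) w = - dot D u w.
Proof.
move=> mD su sw; rewrite -mulN1r -dotZl//.
by apply: eq_Rintegral => x _; rewrite mulN1r.
Qed.

Lemma dotBl D u v w : measurable D -> S2 D u -> S2 D v -> S2 D w ->
  dot D (fun x => u x - v x) w = dot D u w - dot D v w.
Proof. by move=> mD su sv sw; rewrite dotDl ?dotNl//; exact: S2N. Qed.

Lemma dotBr D u v w : measurable D -> S2 D u -> S2 D v -> S2 D w ->
  dot D w (fun x => u x - v x) = dot D w u - dot D w v.
Proof. by move=> *; rewrite dotC dotBl// dotC (dotC _ v). Qed.

Lemma dot_suml D (I : Type) (s : seq I) (P : pred I) (F : I -> T -> R) w : measurable D ->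
  (forall i, P i -> S2 D (F i)) -> S2 D w ->
  dot D (fun x => \sum_(i <- s | P i) F i x) w = \sum_(i <- s | P i) dot D (F i) w.
Proof.
move=> mD h sw; elim: s => [|i s ih].
  rewrite big_nil /dot; under eq_Rintegral do rewrite big_nil mul0r.
  by rewrite Rintegral_cst// mul0r.
rewrite big_cons -ih /dot; case: ifPn => Pi; last first.
  by apply: eq_Rintegral => x _; rewrite big_cons (negbTE Pi).
rewrite -dotDl//; [|exact: h|exact: S2_sum].
by apply: eq_Rintegral => x _; rewrite big_cons Pi.
Qed.

Lemma dot_ext D u v u' v' : (forall x, D x -> u x = u' x) ->
  (forall x, D x -> v x = v' x) -> dot D u v = dot D u' v'.
Proof. by move=> uu vv; apply: eq_Rintegral => x /[!inE] Dx; rewrite uu ?vv. Qed.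

Lemma nrm_ext D u u' : (forall x, D x -> u x = u' x) -> nrm D u = nrm D u'.
Proof. by move=> h; rewrite /nrm (dot_ext h h). Qed.

Lemma dot_ge0 D u : 0 <= dot D u u.
Proof. by apply: Rintegral_ge0 => x _; rewrite -expr2. Qed.

Lemma nrm_ge0 D u : 0 <= nrm D u. Proof. exact: sqrtr_ge0. Qed.

Lemma nrm_sqr D u : nrm D u ^+ 2 = dot D u u.
Proof. by rewrite sqr_sqrtr// dot_ge0. Qed.

Lemma nrm_le D u M : 0 <= M -> dot D u u <= M ^+ 2 -> nrm D u <= M.
Proof. by move=> M0 h; rewrite -(ler_sqrt _ (sqr_ge0 M)) in h *; rewrite sqrtr_sqr ger0_norm in h. Qed.

Lemma cauchy_schwarz D u v : measurable D -> S2 D u -> S2 D v ->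
  `|dot D u v| <= nrm D u * nrm D v.
Proof.
move=> mD su sv.
have key t : 0 <= nrm D u ^+ 2 + 2 * t * dot D u v + t ^+ 2 * nrm D v ^+ 2.
  rewrite !nrm_sqr; have stv : S2 D (fun x => t * v x) by exact: S2Z.
  have := dot_ge0 D (fun x => u x + t * v x).
  rewrite dotDl//; last exact: S2D.
  rewrite !dotDr// !dotZl// !dotZr// (dotC _ v u); lra.
have := nrm_ge0 D u; have := nrm_ge0 D v.
set a := nrm D u in key *; set c := nrm D v in key *; set b := dot D u v in key *.
move=> c0 a0; have [c1|c1] := eqVneq c 0.
  rewrite c1 mulr0; have [->|b0] := eqVneq b 0; first by rewrite normr0.
  (* When [c] is 0 the quadratic is affine in [t]; this [t] gives it the value -1. *)
  have := key (- (a ^+ 2 + 1) / (2 * b)); rewrite c1.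
  have -> : 2 * (- (a ^+ 2 + 1) / (2 * b)) * b = - (a ^+ 2 + 1) by field.
  rewrite expr0n /= mulr0; lra.
have {}c0 : 0 < c by lra.
have := key (- b / c ^+ 2).
have -> : a ^+ 2 + 2 * (- b / c ^+ 2) * b + (- b / c ^+ 2) ^+ 2 * c ^+ 2
  = ((a * c) ^+ 2 - b ^+ 2) / c ^+ 2 by field.
rewrite pmulr_lge0// subr_ge0 => h.
by rewrite -[leRHS]ger0_norm// -ler_sqr// !real_normK ?num_real.
Qed.

Lemma nrmD D u v : measurable D -> S2 D u -> S2 D v ->
  nrm D (fun x => u x + v x) <= nrm D u + nrm D v.
Proof.
move=> mD su sv; apply: nrm_le; first by rewrite addr_ge0// nrm_ge0.
rewrite dotDl//; last exact: S2D.
rewrite !dotDr// (dotC _ v u) -!nrm_sqr.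
have := cauchy_schwarz mD su sv; rewrite ler_norml => /andP[_]; nra.
Qed.

Lemma nrmZ D u k : measurable D -> S2 D u -> nrm D (fun x => k * u x) = `|k| * nrm D u.
Proof.
move=> mD su; rewrite /nrm dotZl ?dotZr//; last exact: S2Z.
by rewrite mulrA -expr2 sqrtrM// sqrtr_sqr.
Qed.

Lemma nrmN D u : nrm D (fun x => - u x) = nrm D u.
Proof. by rewrite /nrm /dot; under eq_Rintegral do rewrite mulrNN. Qed.

Lemma nrmB D u v : measurable D -> S2 D u -> S2 D v ->
  nrm D (fun x => u x - v x) <= nrm D u + nrm D v.
Proof. by move=> mD su sv; rewrite -[nrm D v]nrmN; apply: nrmD => //; exact: S2N. Qed.

Lemma nrm_sum D (I : Type) (s : seq I) (P : pred I) (F : I -> T -> R) : measurable D ->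
  (forall i, P i -> S2 D (F i)) ->
  nrm D (fun x => \sum_(i <- s | P i) F i x) <= \sum_(i <- s | P i) nrm D (F i).
Proof.
move=> mD h; elim: s => [|i s ih].
  rewrite big_nil /nrm /dot; under eq_Rintegral do rewrite big_nil mul0r.
  by rewrite Rintegral_cst// mul0r sqrtr0.
rewrite big_cons; case: ifPn => Pi; last first.
  apply: le_trans ih; apply: eq_ler.
  by apply: nrm_ext => x _; rewrite big_cons (negbTE Pi).
apply: le_trans (lerD (lexx _) ih).
rewrite -(nrm_ext (u := fun x => F i x + \sum_(j <- s | P j) F j x)); last first.
  by move=> x _; rewrite big_cons Pi.
by apply: nrmD => //; [exact: h|exact: S2_sum].
Qed.

Lemma nrm_mulb D b u M : measurable D -> measurable_fun D b -> 0 <= M ->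
  (forall x, D x -> `|b x| <= M) -> S2 D u -> nrm D (fun x => b x * u x) <= M * nrm D u.
Proof.
move=> mD mb M0 bM su; apply: nrm_le; first by rewrite mulr_ge0 ?nrm_ge0.
have sbu := S2_mulb mD mb bM su.
rewrite exprMn nrm_sqr /dot -RintegralZl//; last exact: S2_mul.
apply: le_Rintegral => //; [exact: S2_mul|by apply: I1Z => //; exact: S2_mul|].
move=> x Dx; rewrite -!expr2 exprMn ler_wpM2r//.
by rewrite -[leLHS]real_normK ?num_real// lerXn2r ?bM.
Qed.

Lemma Rintegral_subset D D' f : measurable D -> measurable D' -> D' `<=` D -> I1 D f ->
  (forall x, D x -> 0 <= f x) ->
  \int[mu]_(x in D') f x <= \int[mu]_(x in D) f x.
Proof.
move=> mD mD' sub jf f0; have jf' : I1 D' f by exact: integrableS jf.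
apply: fine_le; [exact: integrable_fin_num|exact: integrable_fin_num|].
apply: ge0_subset_integral => //.
by apply/measurable_EFinP; exact: I1_meas jf.
Qed.

Lemma nrm_subset D D' u : measurable D -> measurable D' -> D' `<=` D -> S2 D u ->
  nrm D' u <= nrm D u.
Proof.
move=> mD mD' sub su; rewrite ler_wsqrtr// Rintegral_subset//; first exact: S2_mul.
by move=> x _; rewrite -expr2.
Qed.

Lemma nrm_bounded D u M : measurable D -> (mu D < +oo)%E -> measurable_fun D u ->
  0 <= M -> (forall x, D x -> `|u x| <= M) -> nrm D u <= M * Num.sqrt (fine (mu D)).
Proof.
move=> mD muD mu1 M0 uM; apply: nrm_le => //.
have su := S2_bounded mD muD mu1 uM.
rewrite exprMn sqr_sqrtr// -Rintegral_cst//.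
apply: le_Rintegral => //; first exact: S2_mul.
  by apply: (@I1_bounded _ _ (M ^+ 2)) => // x _; rewrite ger0_norm.
move=> x Dx; rewrite -expr2 -[leLHS]real_normK ?num_real//.
by rewrite lerXn2r ?uM.
Qed.

End SquareIntegrable.

#[global] Hint Resolve nrm_ge0 : core.

(** * Lebesgue measure on R^n *)

(** Pins the type at which [measurable] is read, hence the sigma-algebra of [leb]. *)
Definition mrV {R : realType} {n : nat} : set (set 'rV[R]_n) := measurable.

Section LebesgueSpace.
Context {R : realType}.
Implicit Types (n : nat).

Lemma rVnormE n (x : 'rV[R]_n) : `|x| = \big[Num.max/0]_ij `|x ij.1 ij.2|.
Proof. exact: mx_normrE. Qed.

Lemma rVnorm_leP n (x : 'rV[R]_n) (r : R) : 0 <= r ->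
  `|x| <= r <-> forall i, `|x 0 i| <= r.
Proof.
move=> r0; rewrite rVnormE; split=> [h i|h].
  by apply: le_trans h; exact: (le_bigmax _ (fun ij => `|x ij.1 ij.2|) (0, i)).
by apply/bigmax_leP; split=> // -[i j] _ /=; rewrite ord1.
Qed.

Lemma rVnorm_ltP n (x : 'rV[R]_n) (r : R) : 0 < r ->
  `|x| < r <-> forall i, `|x 0 i| < r.
Proof.
move=> r0; rewrite rVnormE; split=> [h i|h].
  by apply: le_lt_trans h; exact: (le_bigmax _ (fun ij => `|x ij.1 ij.2|) (0, i)).
by apply/bigmax_ltP; split=> // -[i j] _ /=; rewrite ord1.
Qed.

Lemma coord_le_norm n (x : 'rV[R]_n) i : `|x 0 i| <= `|x|.
Proof. by have /rVnorm_leP := lexx `|x|; apply. Qed.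

Lemma ball_rVE n (x : 'rV[R]_n) (r : R) : ball x r = [set y | `|x - y| < r].
Proof. by rewrite -ball_normE. Qed.

Lemma rat_point n (x : 'rV[R]_n) (e : R) : 0 < e ->
  exists q : 'rV[rat]_n, `|x - map_mx ratr q| < e.
Proof.
move=> e0; have H i : exists q : rat, `|x 0 i - ratr q| < e.
  have [|q] := @rat_in_itvoo R (x 0 i - e) (x 0 i + e); first lra.
  by rewrite in_itv/= => /andP[? ?]; exists q; rewrite ltr_norml; lra.
have [f fP] := choice H; exists (\row_i f i).
by apply/rVnorm_ltP => // i; rewrite !mxE.
Qed.

Lemma measurable_rVball n (x : 'rV[R]_n) (r : R) :
  mrV [set y | `|x - y| < r].
Proof.
have [r0|r0] := leP r 0.
  have -> : [set y | `|x - y| < r] = set0; last exact: measurable0.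
  apply/seteqP; split=> // y /= h.
  by have := lt_le_trans h r0; rewrite normr_lt0.
rewrite (_ : mkset _ = \bigcap_(i in [set: 'I_n])
    ((fun y : 'rV[R]_n => y 0 i) @^-1` [set t | `|x 0 i - t| < r])); last first.
  apply/seteqP; split=> y /=.
    by move=> /(rVnorm_ltP _ r0) h i _ /=; have := h i; rewrite !mxE.
  by move=> h; apply/(rVnorm_ltP _ r0) => i; rewrite !mxE; exact: h.
apply: fin_bigcap_measurable => // i _.
rewrite -[X in measurable X]setTI; apply: measurable_coord => //.
have := @open_measurable R (ball (x 0 i) r); rewrite -ball_normE; apply.
rewrite ball_normE; exact: ball_open.
Qed.

(** The sigma-algebra is generated by the coordinates, so an open set is reduced to countably many
    cubes: it is the union of those with rational centre and radius 1/(m+1) that it contains. *)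
Lemma open_rV_measurable n (A : set 'rV[R]_n) : open A ->
  mrV A.
Proof.
move=> oA.
pose B (p : 'rV[rat]_n * nat) : set 'rV[R]_n :=
  [set y | `|map_mx ratr p.1 - y| < p.2.+1%:R^-1].
rewrite (_ : A = \bigcup_(p in [set p | B p `<=` A]) B p); last first.
  apply/seteqP; split=> [x Ax|x [p pA]]; last exact: pA.
  have /nbhs_ballP[e /= e0 eA] : nbhs x A by exact: open_nbhs_nbhs.
  rewrite ball_rVE in eA.
  have [m me] : exists m : nat, m.+1%:R^-1 < e / 2.
    have e2 : 0 < e / 2 by [].
    have := @near_infty_natSinv_lt R (PosNum e2) => -[m _ /(_ m (leqnn m))]/=.
    by exists m.
  have m0 : 0 < m.+1%:R^-1 :> R by [].
  have [q qx] := rat_point x m0.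
  exists (q, m); rewrite /B/=; last by rewrite distrC.
  move=> y /= qy; apply: eA => /=.
  rewrite -(subrKA (map_mx ratr q)) (le_lt_trans (ler_normD _ _))//.
  by rewrite [e]splitr ltrD ?(lt_trans _ me).
rewrite bigcup_mkcond; apply: countable_bigcupT_measurable => [|p]; first exact: countableP.
by case: ifP => _; [exact: measurable_rVball|exact: measurable0].
Qed.

Lemma closed_rV_measurable n (A : set 'rV[R]_n) : closed A ->
  mrV A.
Proof.
move=> cA; rewrite -[A]setCK; apply: measurableC.
by apply: open_rV_measurable; rewrite openC.
Qed.

Lemma compact_rV_measurable n (A : set 'rV[R]_n) : compact A ->
  mrV A.
Proof. move=> cA; apply: closed_rV_measurable; apply: compact_closed => //; exact: norm_hausdorff. Qed.

Lemma continuous_rV_measurable n (f : 'rV[R]_n -> R) : continuous f ->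
  measurable_fun [set: 'rV[R]_n] f.
Proof.
move=> cf; apply: (measurability _ (RGenOpens.measurableE R)).
move=> _ [_ [a [b ->]] <-]; rewrite setTI; apply: open_rV_measurable.
by apply: open_comp => // x _; exact: cf.
Qed.

Lemma measurable_affine m n (B : 'M[R]_(m, n)) (b : 'rV[R]_n) :
  measurable_fun [set: 'rV[R]_m] (fun x : 'rV[R]_m => x *m B + b).
Proof.
apply: measurable_fun_rV => j.
under eq_fun do rewrite !mxE.
apply: measurable_funD => //; apply: measurable_sum => i.
apply: measurable_funM => //; exact: measurable_coord.
Qed.

Lemma measurable_preim d1 d2 (T1 : measurableType d1) (T2 : measurableType d2)
    (f : T1 -> T2) (A : set T2) : measurable_fun setT f -> measurable A ->
  measurable [set x | A (f x)].
Proof. by move=> mf mA; rewrite -[X in measurable X]setTI; exact: mf. Qed.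

Lemma rV_consE n (a : R) (y : 'rV[R]_n) : rV_cons (a, y) = row_mx a%:M y.
Proof.
apply/rowP => i; rewrite mxE; case: (split_ordP (i : 'I_(1 + n))) => j ->.
  rewrite (row_mxEl a%:M y) ord1 (_ : lshift n 0 = ord0) ?unlift_none ?mxE//=; exact: val_inj.
by rewrite (row_mxEr a%:M y) (_ : rshift 1 j = lift ord0 j) ?liftK//; exact: val_inj.
Qed.

Lemma leb_consE n (A : set 'rV[R]_n.+1) : mrV A ->
  leb R n.+1 A = (\int[@lebesgue_measure R]_a leb R n [set y | A (rV_cons (a, y))])%E.
Proof.
move=> mA; rewrite /= /leb_step /pushforward /product_measure1.
by apply: eq_integral => a _ /=; rewrite xsectionE.
Qed.

Lemma measurable_cons n (A : set 'rV[R]_n.+1) : mrV A ->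
  measurable [set p : measurableTypeR R * 'rV[R]_n | A (rV_cons p)].
Proof.
by move=> mA; apply: measurable_preim mA; exact: measurable_rV_cons.
Qed.

(** [leb] integrates the first coordinate last; the other order comes from the uniqueness of the
    product measure. *)
Lemma leb_consE2 n (A : set 'rV[R]_n.+1) : mrV A ->
  leb R n.+1 A = (\int[leb R n]_y (@lebesgue_measure R [set a | A (rV_cons (a, y))]))%E.
Proof.
move=> mA; rewrite /= /leb_step /pushforward.
transitivity (((@lebesgue_measure R) \x^ (leb R n))%E (rV_cons (n:=n) @^-1` A)).
  apply: (product_measure_unique (m' := ((@lebesgue_measure R) \x^ (leb R n))%E)).
    by move=> B C mB mC; exact: product_measure2E.
  exact: measurable_cons.
by rewrite /product_measure2; apply: eq_integral => y _ /=; rewrite ysectionE.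
Qed.

Lemma integral_image d1 d2 (T1 : measurableType d1) (T2 : measurableType d2)
    (m1 : {measure set T1 -> \bar R}) (m2 : {measure set T2 -> \bar R})
    (f : T1 -> T2) (c : R) : measurable_fun setT f -> 0 <= c ->
    (forall A, measurable A -> m1 (f @^-1` A) = (c%:E * m2 A)%E) ->
  forall g : T2 -> \bar R, measurable_fun setT g -> (forall x, (0 <= g x)%E) ->
  (\int[m1]_x g (f x) = c%:E * \int[m2]_x g x)%E.
Proof.
move=> mf c0 fc g mg g0.
have := @ge0_integral_pushforward _ _ _ _ R f mf m1 setT g measurableT mg (fun x _ => g0 x).
rewrite preimage_setT => <-.
rewrite -(@ge0_integral_mscale _ _ R m2 setT measurableT (NngNum c0))//.
by apply: (@eq_measure_integral _ _ _ _ (mscale (NngNum c0) m2)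
  (measure_function_pushforward__canonical__measure_function_Measure m1 mf)) => A mA _; exact: fc.
Qed.

Lemma lebesgue_measure_affine (c e : R) (A : set (measurableTypeR R)) :
  c != 0 -> measurable A ->
  lebesgue_measure [set a | A (c * a + e)] = (`|c|^-1%:E * lebesgue_measure A)%E.
Proof.
move=> c0 mA.
have mf : measurable_fun [set: measurableTypeR R] (fun a : R => c * a + e : measurableTypeR R).
  by apply: measurable_funD => //; exact: measurable_funM.
pose m' := mscale (NngNum (normr_ge0 c))
  (measure_function_pushforward__canonical__measure_function_Measure
     (@lebesgue_measure R) mf).
have cp : 0 < `|c| by rewrite normr_gt0.
suff -> : lebesgue_measure A = m' A.
  by rewrite /m' /mscale /= /pushforward muleA -EFinM mulVf// mul1e.
apply: lebesgue_measure_unique mA => _ [[x y] _ <-] /=.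
rewrite /m' /mscale /= /pushforward lebesgue_measure_itv /= lte_fin.
have [cn|cn] := ltP c 0.
  have -> : (fun a => c * a + e) @^-1` [set` `]x, y]] = [set` `[(y - e) / c, (x - e) / c[].
    apply/seteqP; split=> a /=; rewrite !in_itv/= ler_ndivrMr// ltr_ndivlMr//; lra.
  rewrite lebesgue_measure_itv /= lte_fin ltr_nM2r ?invr_lt0// ltrD2r.
  case: ifP => xy; last by rewrite mule0.
  by rewrite -!EFinD -EFinM; congr (_%:E); rewrite ltr0_norm//; field.
have {}cn : 0 < c by lra.
have -> : (fun a => c * a + e) @^-1` [set` `]x, y]] = [set` `](x - e) / c, (y - e) / c]].
  apply/seteqP; split=> a /=; rewrite !in_itv/= ler_pdivlMr// ltr_pdivrMr//; lra.
rewrite lebesgue_measure_itv /= lte_fin ltr_pM2r// ltrD2r.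
case: ifP => xy; last by rewrite mule0.
by rewrite -!EFinD -EFinM; congr (_%:E); rewrite gtr0_norm//; field.
Qed.

Lemma integral_affine1 (c e : R) (g : R -> \bar R) : c != 0 ->
  measurable_fun [set: measurableTypeR R] g -> (forall x, (0 <= g x)%E) ->
  (\int[@lebesgue_measure R]_a g (c * a + e)%R = `|c|^-1%:E * \int[@lebesgue_measure R]_a g a)%E.
Proof.
move=> c0; apply: (@integral_image _ _ (measurableTypeR R) (measurableTypeR R) _ _ (fun a => c * a + e)) => //.
- by apply: measurable_funD => //; exact: measurable_funM.
- by move=> A mA; exact: lebesgue_measure_affine.
Qed.

Lemma measurable_slice n (A : set 'rV[R]_n.+1) : mrV A ->
  measurable_fun [set: measurableTypeR R] (fun a => leb R n [set y | A (rV_cons (a, y))]).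
Proof.
move=> mA; have := @measurable_fun_xsection _ _ (measurableTypeR R) _ R (leb R n) _ (measurable_cons mA).
rewrite /= (_ : _ \o _ = fun a => leb R n [set y | A (rV_cons (a, y))])//.
by apply/funext => a /=; rewrite xsectionE.
Qed.

Lemma measurable_slice1 n (A : set 'rV[R]_n.+1) (a : R) : mrV A ->
  mrV [set y | A (rV_cons (a, y))].
Proof.
move=> mA; have := @measurable_xsection _ _ (measurableTypeR R) 'rV[R]_n _ a (measurable_cons mA).
by rewrite xsectionE.
Qed.

Lemma measurable_slice2 n (A : set 'rV[R]_n.+1) (y : 'rV[R]_n) : mrV A ->
  @measurable _ (measurableTypeR R) [set a | A (rV_cons (a, y))].
Proof.
move=> mA; have := @measurable_ysection _ _ (measurableTypeR R) 'rV[R]_n _ y (measurable_cons mA).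
by rewrite ysectionE.
Qed.

Lemma leb_shift n (b : 'rV[R]_n) (A : set 'rV[R]_n) : mrV A ->
  leb R n [set x | A (x + b)] = leb R n A.
Proof.
elim: n b A => [|n ih] b A mA.
  by congr (leb R 0 _); apply/funext => x /=; rewrite [b]thinmx0 addr0.
have mA' : mrV [set x | A (x + b)].
  have := measurable_affine 1%:M b => /measurable_preim /(_ mA).
  by under eq_set do rewrite mulmx1.
rewrite leb_consE// leb_consE//.
have E a y : rV_cons (a, y) + b = rV_cons (a + b 0 ord0, y + (rV_uncons b).2).
  apply/rowP => i; rewrite !mxE; case: (unliftP ord0 i) => [j|] -> //.
  by rewrite !mxE.
under eq_integral => a _.
  rewrite /=; under eq_set do rewrite E.
  rewrite (ih _ [set y | A (rV_cons (a + b 0 ord0, y))]); last exact: measurable_slice1.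
  over.
have := @integral_affine1 1 (b 0 ord0) (fun a => leb R n [set y | A (rV_cons (a, y))]).
rewrite normr1 invr1 mul1e => <-//; last exact: measurable_slice.
by apply: eq_integral => a _; rewrite mul1r.
Qed.

(** The constant is 1/|det B|. It is left abstract, so that it can be obtained by elimination,
    factor by factor. *)
Definition Lin n (B : 'M[R]_n) (c : R) := 0 < c /\ forall A, mrV A ->
  leb R n [set x | A (x *m B)] = (c%:E * leb R n A)%E.

Lemma measurable_lin n (B : 'M[R]_n) (A : set 'rV[R]_n) : mrV A ->
  mrV [set x | A (x *m B)].
Proof.
move=> mA; have := measurable_affine B 0 => /measurable_preim /(_ mA).
by under eq_set do rewrite addr0.
Qed.

Lemma Lin_mul n (B C : 'M[R]_n) b c : Lin B b -> Lin C c -> Lin (B *m C) (b * c).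
Proof.
move=> [b0 hB] [c0 hC]; split=> [|A mA]; first exact: mulr_gt0.
under eq_set do rewrite mulmxA.
rewrite (hB [set x | A (x *m C)]); last exact: measurable_lin.
by rewrite hC// EFinM muleA.
Qed.

Lemma Lin1 n : Lin (1%:M : 'M[R]_n) 1.
Proof. by split=> // A mA; rewrite mul1e; under eq_set do rewrite mulmx1. Qed.

Lemma Lin_upper n (u : R) (r : 'rV[R]_n) (S : 'M[R]_n) c : u != 0 -> Lin S c ->
  Lin (block_mx u%:M r 0 S : 'M[R]_n.+1) (c / `|u|).
Proof.
move=> u0 [c0 hS]; split=> [|A mA]; first by rewrite divr_gt0// normr_gt0.
have E a y : rV_cons (a, y) *m (block_mx u%:M r 0 S : 'M[R]_n.+1) =
    rV_cons (u * a, y *m S + a *: r).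
  rewrite !rV_consE; apply: (etrans (@mul_row_block R 1 1 n 1 n a%:M y u%:M r 0 S)).
  rewrite mulmx0 addr0 -scalar_mxM mulrC.
  by rewrite mul_scalar_mx addrC.
rewrite leb_consE; last exact: measurable_lin.
under eq_integral => a _.
  rewrite /=; under eq_set do rewrite E.
  rewrite (hS [set y | A (rV_cons (u * a, y + a *: r))]); last first.
    have := measurable_affine 1%:M (a *: r) => /measurable_preim.
    move=> /(_ _ (measurable_slice1 (u * a) mA)).
    by under eq_set do rewrite mulmx1.
  rewrite (@leb_shift _ _ [set y | A (rV_cons (u * a, y))]); last exact: measurable_slice1.
  over.
have mf : measurable_fun [set: measurableTypeR R] (fun a : measurableTypeR R => u * a : measurableTypeR R).
  exact: measurable_funM.
rewrite ge0_integralZl//=.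
- rewrite EFinM -muleA; congr (_ * _)%E.
  have := @integral_affine1 u 0 (fun a => leb R n [set y | A (rV_cons (a, y))]) u0.
  rewrite (leb_consE mA) => <-//; last exact: measurable_slice.
  by apply: eq_integral => a _; rewrite addr0.
- exact: measurableT_comp (measurable_slice mA) mf.
- by rewrite lee_fin.
Qed.

(** The shear translates the first coordinate by an amount depending on the others, so the slices
    are taken at fixed values of the others. *)
Lemma Lin_lower n (l : 'cV[R]_n) : Lin (block_mx 1%:M 0 l 1%:M : 'M[R]_n.+1) 1.
Proof.
split=> // A mA; rewrite mul1e.
have E a y : rV_cons (a, y) *m (block_mx 1%:M 0 l 1%:M : 'M[R]_n.+1) =
    rV_cons (1 * a + (y *m l) 0 0, y).
  rewrite !rV_consE; apply: (etrans (@mul_row_block R 1 1 n 1 n a%:M y 1%:M 0 l 1%:M)).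
  rewrite !mulmx1 mulmx0 add0r.
  by rewrite mul1r raddfD/= -mx11_scalar.
rewrite leb_consE2; last exact: measurable_lin.
rewrite leb_consE2//; apply: eq_integral => y _ /=.
under eq_set do rewrite E.
rewrite (@lebesgue_measure_affine _ _ [set a | A (rV_cons (a, y))])//.
  by rewrite normr1 invr1 mul1e.
exact: measurable_slice2.
Qed.

Lemma Lin_scalar n (s : R) : 0 < s -> Lin (s%:M : 'M[R]_n) (s ^+ n)^-1.
Proof.
move=> s0; elim: n => [|n ih].
  rewrite expr0 invr1 (_ : s%:M = 1%:M); first exact: Lin1.
  by apply/matrixP => -[].
have := @Lin_upper n s 0 s%:M _ (lt0r_neq0 s0) ih.
by rewrite -scalar_mx_block gtr0_norm// exprS invfM mulrC.
Qed.

(** Gaussian elimination by blocks. If the corner entry is nonzero, the matrix is a lower unipotent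
    block matrix times an upper one with the Schur complement on the diagonal; otherwise a row with
    a nonzero first entry is added to the first row. *)
Lemma Lin_unit n (B : 'M[R]_n) : B \in unitmx -> exists c, Lin B c.
Proof.
elim: n B => [|n ih] B uB.
  by exists 1; rewrite (_ : B = 1%:M); [exact: Lin1|apply/matrixP => -[]].
suff H (C : 'M[R]_(1 + n)) : C \in unitmx -> C 0 0 != 0 -> exists c, Lin C c.
  have [B0|B0] := boolP ((B : 'M[R]_(1 + n)) 0 0 != 0); first exact: H.
  have [i Bi] : exists i, (B : 'M[R]_(1 + n)) (rshift 1 i) 0 != 0.
    apply: contrapT => h; have : (B : 'M[R]_(1 + n)) *m delta_mx 0 (0 : 'I_1) = 0.
      apply/matrixP => i j; rewrite ord1 !mxE (bigD1 0)//= big1.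
        rewrite mxE !eqxx mulr1 addr0; case: (split_ordP i) => k ->.
          rewrite ord1 (_ : lshift n 0 = 0); last exact: val_inj.
          by lra.
        by apply: contrapT => /eqP nz; apply: h; exists k.
      by move=> k k0; rewrite mxE (negbTE k0) mulr0.
    move/(congr1 (mulmx (invmx B))); rewrite mulmxA mulVmx// mul1mx mulmx0.
    by move/matrixP => /(_ 0 0); rewrite !mxE !eqxx => /eqP; rewrite oner_eq0.
  pose E (t : R) : 'M[R]_(1 + n) := block_mx 1%:M (t *: delta_mx 0 i) 0 1%:M.
  have EE : E (-1) *m E 1 = 1%:M.
    rewrite /E mulmx_block !mulmx0 !mul0mx !mul1mx !mulmx1 !addr0 add0r.
    by rewrite scaleN1r scale1r subrr -scalar_mx_block.
  have LE t : Lin (E t) (1 / `|1|).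
    apply: (@Lin_upper n 1 (t *: delta_mx 0 i) 1%:M 1); first exact: oner_neq0.
    exact: Lin1.
  have [|| c cP] := H (E 1 *m B).
  - by rewrite unitmx_mul uB andbT; have [] := mulmx1_unit EE.
  - rewrite mxE big_split_ord /= big_ord1 (_ : lshift n 0 = 0); last exact: val_inj.
    rewrite /E (_ : 0 = lshift n 0 :> 'I_(1 + n)); last exact: val_inj.
    rewrite block_mxEul mxE mul1r (bigD1 i)//= big1 => [|k ki].
      rewrite (block_mxEur 1%:M) !mxE !eqxx mul1r mul1r addr0.
      rewrite (_ : lshift n 0 = 0); last exact: val_inj.
      by move: B0; rewrite negbK => /eqP ->; rewrite add0r.
    by rewrite (block_mxEur 1%:M) !mxE (negbTE ki) andbF mulr0 mul0r.
  exists (1 / `|1| * c); have := Lin_mul (LE (-1)) cP.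
  by rewrite mulmxA EE mul1mx.
move=> uC C0.
pose u := C 0 0; pose l : 'cV[R]_n := u^-1 *: dlsubmx C.
pose S := drsubmx C - l *m ursubmx C.
have CE : C = (block_mx 1%:M 0 l 1%:M : 'M[R]_(1 + n)) *m block_mx u%:M (ursubmx C) 0 S.
  rewrite mulmx_block !mul1mx !mul0mx !addr0 mul_mx_scalar scalerA.
  rewrite mulfV// scale1r /S addrCA subrr addr0 -{1}[C]submxK; congr block_mx.
  by rewrite [ulsubmx C]mx11_scalar !mxE (_ : lshift n 0 = 0)//; exact: val_inj.
have uS : S \in unitmx.
  have := uC; rewrite CE unitmx_mul => /andP[_].
  rewrite !unitmxE (_ : \det _ = \det (u%:M : 'M[R]_1) * \det S); last exact: det_ublock.
  by rewrite unitrM => /andP[].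
have [c cP] := ih _ uS.
exists (1 * (c / `|u|)); rewrite CE; apply: Lin_mul; first exact: Lin_lower.
exact: Lin_upper.
Qed.

Lemma integral_lin n (B : 'M[R]_n) (b : 'rV[R]_n) c (g : 'rV[R]_n -> \bar R) : Lin B c ->
  measurable_fun setT g -> (forall x, (0 <= g x)%E) ->
  (\int[leb R n]_x g (x *m B + b)%R = c%:E * \int[leb R n]_x g x)%E.
Proof.
move=> [c0 LB]; apply: integral_image; [exact: measurable_affine|exact: ltW|].
move=> A mA; have mA' : mrV [set x | A (x + b)].
  have := measurable_affine 1%:M b => /measurable_preim /(_ mA).
  by under eq_set do rewrite mulmx1.
by have := LB _ mA'; rewrite leb_shift.
Qed.

Lemma measurable_coordP n (i : 'I_n) (A : set R) : measurable A ->
  mrV [set x | A (x 0 i)].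
Proof. by move=> mA; apply: measurable_preim mA; exact: measurable_coord. Qed.

Lemma measurable_box n (A : 'I_n -> set R) : (forall i, measurable (A i)) ->
  mrV [set x | forall i, A i (x 0 i)].
Proof.
move=> mA; rewrite (_ : mkset _ = \bigcap_(i in [set: 'I_n]) [set x | A i (x 0 i)]).
  by apply: fin_bigcap_measurable => // i _; exact: measurable_coordP.
by apply/seteqP; split=> x /= h; [move=> i _; exact: h|move=> i; exact: h].
Qed.

Lemma leb_box n (A : 'I_n -> set R) (m : 'I_n -> R) :
  (forall i, measurable (A i)) -> (forall i, @lebesgue_measure R (A i) = (m i)%:E) ->
  leb R n [set x | forall i, A i (x 0 i)] = (\prod_i m i)%:E.
Proof.
elim: n A m => [|n ih] A m mA hm.
  by rewrite big_ord0 /= /dirac indicE mem_set//= => -[].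
rewrite big_ord_recl leb_consE; last exact: measurable_box.
transitivity (\int[@lebesgue_measure R]_(a in A ord0) (\prod_i m (lift ord0 i))%:E)%E.
  rewrite [RHS]integral_mkcond; apply: eq_integral => a _ /=; rewrite patchE.
  have [|aA] := boolP (a \in A ord0).
    rewrite inE => aA; rewrite -(ih (fun i => A (lift ord0 i)))//.
    congr (leb R n _); apply/seteqP; split=> y /= h i.
      by have := h (lift ord0 i); rewrite mxE liftK.
    by case: (unliftP ord0 i) => [j|] ->; rewrite mxE ?liftK// unlift_none.
  rewrite (_ : mkset _ = set0) ?measure0//; apply/seteqP; split=> // y /= h.
  by move/negP: aA; apply; rewrite inE; have := h ord0; rewrite mxE unlift_none.
have /= h0 := hm ord0.
by rewrite EFinM muleC -[(m ord0)%:E]h0; apply: integral_cst; exact: mA.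
Qed.

Lemma closed_cball n (x : 'rV[R]_n) (r : R) : closed [set y | `|y - x| <= r].
Proof.
apply: (@preimage_closed _ _ (fun y : 'rV[R]_n => `|y - x|) [set t | t <= r]).
  move=> y _; apply: (@continuous_comp _ _ _ (fun y : 'rV[R]_n => y - x) (fun z => `|z|)).
    by apply: (@continuousB _ _ _ id (fun=> x)) => //; exact: cst_continuous.
  exact: norm_continuous.
exact: closed_le.
Qed.

Lemma cball_measurable n (x : 'rV[R]_n) (r : R) : mrV [set y | `|y - x| <= r].
Proof. by apply: closed_rV_measurable; exact: closed_cball. Qed.

Lemma leb_cball n (x : 'rV[R]_n) (r : R) : 0 <= r ->
  leb R n [set y | `|y - x| <= r] = ((2 * r) ^+ n)%:E.
Proof.
move=> r0; have := @leb_box n (fun i => [set` `[x 0 i - r, x 0 i + r]]) (fun=> 2 * r).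
rewrite prodr_const card_ord => <-.
- congr (leb R n _); apply/seteqP; split=> y /=.
    move=> /(rVnorm_leP _ r0) h i; have := h i; rewrite !mxE in_itv/= ler_norml; lra.
  move=> h; apply/(rVnorm_leP _ r0) => i; have := h i; rewrite !mxE in_itv/= ler_norml; lra.
- by [].
- move=> i; rewrite lebesgue_measure_itv/= lte_fin; case: ltP => h.
    by rewrite -EFinD; congr (_%:E); lra.
  by congr (_%:E); lra.
Qed.

Lemma leb_fin_bounded n (D : set 'rV[R]_n) x r : mrV D -> 0 <= r ->
  (forall y, D y -> `|y - x| <= r) -> (leb R n D <= ((2 * r) ^+ n)%:E)%E.
Proof.
move=> mD r0 h; rewrite -(leb_cball x r0); apply: le_measure; rewrite ?inE//.
by apply: closed_rV_measurable; exact: (@closed_cball n x r).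
Qed.

Lemma continuous_linform n (a : 'cV[R]_n) : continuous (fun x : 'rV[R]_n => (x *m a) 0 0).
Proof.
under eq_fun do rewrite mxE.
apply: (@continuous_big _ _ _ _ _ _ _ _ (fun i (x : 'rV[R]_n) => x 0 i * a i 0)).
  by apply: add_continuous.
move=> i _ x; apply: (@continuousM _ _ (fun x : 'rV[R]_n => x 0 i) (fun=> a i 0)).
  exact: coord_continuous.
exact: cst_continuous.
Qed.

Lemma measurable_hyperplane n (a : 'cV[R]_n) (e : R) : mrV [set x | (x *m a) 0 0 = e].
Proof.
apply: closed_rV_measurable.
apply: (@preimage_closed _ _ (fun x : 'rV[R]_n => (x *m a) 0 0) [set e]).
  by move=> y _; exact: continuous_linform.
exact: closed_eq.
Qed.

Lemma leb_hyperplane n (a : 'cV[R]_n) (e : R) : a != 0 ->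
  leb R n [set x | (x *m a) 0 0 = e] = 0%E.
Proof.
elim: n a e => [|n ih] a e a0; first by move/eqP: a0; rewrite [a]flatmx0.
pose a' : 'cV[R]_n := \col_i a (lift ord0 i) 0.
have E c y : ((rV_cons (c, y) *m a) 0 0 = c * a ord0 0 + (y *m a') 0 0).
  rewrite !mxE big_ord_recl mxE unlift_none; congr (_ + _).
  by apply: eq_bigr => i _; rewrite !mxE liftK.
have [a00|a00] := eqVneq (a ord0 0) 0.
  rewrite leb_consE; last exact: measurable_hyperplane.
  rewrite (eq_integral (fun=> 0%E)); first exact: integral0.
  move=> c _ /=; under eq_set do rewrite E a00 mulr0 add0r.
  apply: ih; apply: contra_neq a0 => h; apply/matrixP => i j; rewrite ord1.
  case: (unliftP ord0 i) => [k|] ->; rewrite mxE//.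
  by move/matrixP : h => /(_ k 0); rewrite !mxE.
rewrite leb_consE2; last exact: measurable_hyperplane.
rewrite (eq_integral (fun=> 0%E)); first exact: integral0.
move=> y _ /=; under eq_set do rewrite E.
rewrite (_ : mkset _ = [set (e - (y *m a') 0 0) / a ord0 0]) ?lebesgue_measure_set1//.
apply/seteqP; split=> c /=; first by move=> <-; rewrite addrK mulfK.
by move=> ->; rewrite divfK// subrK.
Qed.

End LebesgueSpace.

(** * Differential calculus *)

Section Gradient.
Context {R : realType}.
Implicit Types (n m : nat).

Definition ev {n} (i : 'I_n) : 'rV[R]_n := delta_mx 0 i.

(** Differentiability with a named gradient. Partial derivatives, which [pd] computes, do not by
    themselves obey the chain rule. *)
Definition hasgrad n (f : 'rV[R]_n -> R) (x : 'rV[R]_n) (a : 'I_n -> R) :=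
  forall e : R, 0 < e -> exists2 d : R, 0 < d & forall y : 'rV[R]_n, `|y - x| < d ->
    `|f y - f x - \sum_i (y - x) 0 i * a i| <= e * `|y - x|.

Definition hasder (g : R -> R) (t d : R) :=
  forall e : R, 0 < e -> exists2 r : R, 0 < r & forall s : R, `|s - t| < r ->
    `|g s - g t - (s - t) * d| <= e * `|s - t|.

Lemma hasder_is_derive g t d : hasder g t d <-> is_derive t 1 g d.
Proof.
split=> [h|[dg <-] e e0].
- have cv : (fun h => h^-1 *: (g (h *: (1 : R) + t) - g t)) @ 0^' --> d.
    apply/cvgrPdist_le => /= e e0; have [r r0 hr] := h _ e0.
    near=> s; have s0 : s != 0 by near: s; exact: nbhs_dnbhs_neq.
    have sr : `|s| < r by near: s; exact: dnbhs0_lt.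
    rewrite [s%:A]mulr1 /GRing.scale/=; have := hr (s + t).
    rewrite addrK => /(_ sr) => hs.
    have -> : d - s^-1 * (g (s + t) - g t) = - (s^-1 * (g (s + t) - g t - s * d)).
      by field.
    rewrite normrN normrM normfV mulrC ler_pdivrMr// normr_gt0//.
  apply: DeriveDef; last exact: cvg_lim cv.
  by apply/cvg_ex; exists d.
- have /cvgrPdist_le/(_ e e0)[r /= r0 hr] := dg.
  exists r => // s st; have [->|ns] := eqVneq s t.
    by rewrite !subrr mul0r subrr !normr0.
  have := hr (s - t); rewrite /= sub0r normrN => /(_ st).
  rewrite subr_eq0 => /(_ ns); rewrite [(s - t)%:A]mulr1 subrK => hs.
  have n0 : s - t != 0 by lra.
  have -> : g s - g t - (s - t) * 'D_1 g t = (s - t) * ((s - t)^-1 * (g s - g t) - 'D_1 g t).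
    by field.
  by rewrite normrM mulrC ler_wpM2r// distrC.
Unshelve. all: by end_near. Qed.

Lemma hasgrad_line n (f : 'rV[R]_n -> R) (x v : 'rV[R]_n) t a :
  hasgrad f (x + t *: v) a -> hasder (fun s => f (x + s *: v)) t (\sum_i v 0 i * a i).
Proof.
move=> h e e0; have v0 : 0 < `|v| + 1 by rewrite ltr_wpDl.
have [d d0 hd] := h _ (divr_gt0 e0 v0).
exists (d / (`|v| + 1)); first exact: divr_gt0.
move=> s st; have E : x + s *: v - (x + t *: v) = (s - t) *: v.
  by rewrite opprD addrACA subrr add0r scalerBl.
have lt1 : `|v| < `|v| + 1 by lra.
have := hd (x + s *: v); rewrite E normrZ => h1.
have : `|s - t| * `|v| < d.
  rewrite ltr_pdivlMr// in st; apply: le_lt_trans st.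
  by rewrite ler_wpM2l// ltW.
move=> /h1; rewrite mulr_sumr (eq_bigr (fun i => (s - t) * (v 0 i * a i))); last first.
  by move=> i _; rewrite mxE mulrA.
move=> /le_trans; apply.
have -> : e / (`|v| + 1) * (`|s - t| * `|v|) = e * `|s - t| * (`|v| / (`|v| + 1)) by ring.
by rewrite ler_piMr// ler_pdivrMr// mul1r ltW.
Qed.

Lemma hasgrad_derive n (f : 'rV[R]_n -> R) (x v : 'rV[R]_n) a :
  hasgrad f x a -> is_derive x v f (\sum_i v 0 i * a i).
Proof.
move=> h; have /hasder_is_derive [d1 d2] : hasder (fun s => f (x + s *: v)) 0 (\sum_i v 0 i * a i).
  by apply: hasgrad_line; rewrite scale0r addr0.
have E : (fun s => f (x + s *: v)) = (fun h : R => f (h *: v + x)).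
  by apply/funext => s; rewrite addrC.
rewrite E in d1 d2; apply: DeriveDef; first exact/derivable1P.
rewrite -d2 /derive; set F := (X in lim (X @ _)); set G := (X in _ = lim (X @ _)).
suff -> : F = G by [].
by apply/funext => s; rewrite /F /G /= scale0r add0r addr0 [s%:A]mulr1.
Qed.

Lemma hasgrad_pd n (f : 'rV[R]_n -> R) (x : 'rV[R]_n) a i : hasgrad f x a -> pd i f x = a i.
Proof.
move=> /(hasgrad_derive (delta_mx 0 i)) [_ h]; rewrite /pd h (bigD1 i)//= mxE !eqxx mul1r.
by rewrite big1 ?addr0// => j ji; rewrite mxE (negbTE ji) andbF mul0r.
Qed.

Lemma hasgrad_near n (f g : 'rV[R]_n -> R) (x : 'rV[R]_n) a (r : R) : 0 < r ->
  (forall y : 'rV[R]_n, `|y - x| < r -> f y = g y) -> hasgrad f x a -> hasgrad g x a.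
Proof.
move=> r0 fg h e e0; have [d d0 hd] := h _ e0.
exists (Num.min d r); first by rewrite lt_min d0.
move=> y; rewrite lt_min => /andP[yd yr]; rewrite -fg// -fg ?subrr ?normr0//.
exact: hd.
Qed.

Lemma hasgrad_ext n (f g : 'rV[R]_n -> R) (x : 'rV[R]_n) a b :
  (forall y, f y = g y) -> (forall i, a i = b i) -> hasgrad f x a -> hasgrad g x b.
Proof. by move=> /funext <- /funext <-. Qed.

Lemma hasgrad_cst n (c : R) (x : 'rV[R]_n) : hasgrad (fun=> c) x (fun=> 0).
Proof.
move=> e e0; exists 1 => // y _; rewrite subrr sub0r normrN big1 ?normr0//.
by move=> i _; rewrite mulr0.
Qed.

Lemma hasgradD n (f g : 'rV[R]_n -> R) x a b : hasgrad f x a -> hasgrad g x b ->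
  hasgrad (fun y => f y + g y) x (fun i => a i + b i).
Proof.
move=> hf hg e e0; have e2 : 0 < e / 2 by [].
have [d d0 hd] := hf _ e2; have [r r0 hr] := hg _ e2.
exists (Num.min d r); first by rewrite lt_min d0.
move=> y; rewrite lt_min => /andP[/hd h1 /hr h2].
under eq_bigr do rewrite mulrDr.
rewrite big_split /=; set A := \sum_i _; set B := \sum_i _.
have -> : f y + g y - (f x + g x) - (A + B) = (f y - f x - A) + (g y - g x - B) by ring.
by rewrite (le_trans (ler_normD _ _))// (le_trans (lerD h1 h2))//; nra.
Qed.

Lemma hasgrad_bound n (f : 'rV[R]_n -> R) x a : hasgrad f x a ->
  exists2 d : R, 0 < d & forall y : 'rV[R]_n, `|y - x| < d ->
    `|f y - f x| <= (1 + \sum_i `|a i|) * `|y - x|.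
Proof.
move=> /(_ 1 ltr01)[d d0 hd]; exists d => // y /hd; rewrite mul1r => h.
have -> : f y - f x = (f y - f x - \sum_i (y - x) 0 i * a i) + \sum_i (y - x) 0 i * a i by lra.
rewrite (le_trans (ler_normD _ _))// mulrDl mul1r lerD//.
rewrite (le_trans (ler_norm_sum _ _ _))// mulr_suml ler_sum// => i _.
by rewrite normrM mulrC ler_wpM2l// coord_le_norm.
Qed.

Lemma pos_lower_bound (I : finType) (r : I -> R) : (forall i, 0 < r i) ->
  exists2 d : R, 0 < d & forall i, d <= r i.
Proof.
move=> r0; exists (\big[Num.min/1]_i r i).
  by elim/big_ind : _ => // u v u0 v0; rewrite lt_min u0.
by move=> i; rewrite (bigD1 i)//= ge_min lexx.
Qed.

Lemma hasgrad_comp n m (h : 'rV[R]_m -> R) (f : 'rV[R]_n -> 'rV[R]_m) x b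
    (A : 'I_m -> 'I_n -> R) :
  hasgrad h (f x) b -> (forall j, hasgrad (fun y => f y 0 j) x (A j)) ->
  hasgrad (fun y => h (f y)) x (fun i => \sum_j b j * A j i).
Proof.
move=> hh hf e e0.
(* [L] bounds the difference quotients of all the components near x. The remainder of [h] is then
   asked to be e/(2L) and those of the components e/(2B), so that each contributes half of e. *)
pose L := 1 + \sum_j (1 + \sum_i `|A j i|).
have L1 : 1 <= L by rewrite lerDl sumr_ge0// => j _; rewrite addr_ge0// sumr_ge0.
have L0 : 0 < L by lra.
pose B := 1 + \sum_j `|b j|.
have B0 : 0 < B by rewrite ltr_pwDl//.
have [d d0 hd] := hh (e / (2 * L)) (divr_gt0 e0 (mulr_gt0 (ltr0Sn _ 1) L0)).
have fbd j : exists r : R, 0 < r /\ forall y : 'rV[R]_n, `|y - x| < r ->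
   `|f y 0 j - f x 0 j| <= L * `|y - x| /\
   `|f y 0 j - f x 0 j - \sum_i (y - x) 0 i * A j i| <= e / (2 * B) * `|y - x|.
  have [r1 r10 h1] := hasgrad_bound (hf j).
  have [r2 r20 h2] := hf j (e / (2 * B)) (divr_gt0 e0 (mulr_gt0 (ltr0Sn _ 1) B0)).
  exists (Num.min r1 r2); split=> [|y]; first by rewrite lt_min r10.
  rewrite lt_min => /andP[/h1 k1 /h2 k2]; split=> //.
  apply: (le_trans k1); rewrite ler_wpM2r// /L (bigD1 j)//=.
  have : 0 <= \sum_(i < m | i != j) (1 + \sum_i0 `|A i i0|).
    by [].
  set s1 := \sum_(i < m | _) _; set s2 := \sum_i _; move: s1 s2 => s1 s2; lra.
have [r hr] := choice fbd.
have [r0 r00 rr0] := pos_lower_bound (fun j => (hr j).1).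
pose rr := Num.min r0 (d / (2 * L)).
have rrp : 0 < rr by rewrite lt_min r00 divr_gt0// mulr_gt0.
have rrj j : rr <= r j by rewrite ge_min rr0.
have rrd : rr <= d / (2 * L) by rewrite ge_min lexx orbT.
exists rr => // y yr.
have k1 j : `|f y 0 j - f x 0 j| <= L * `|y - x| by have [_ /(_ y (lt_le_trans yr (rrj j)))[]] := hr j.
have k2 j : `|f y 0 j - f x 0 j - \sum_i (y - x) 0 i * A j i| <= e / (2 * B) * `|y - x|.
  by have [_ /(_ y (lt_le_trans yr (rrj j)))[]] := hr j.
have fyx : `|f y - f x| <= L * `|y - x|.
  by apply/rVnorm_leP => [|j]; [rewrite mulr_ge0// ltW|rewrite !mxE].
have fyd : `|f y - f x| < d.
  apply: (le_lt_trans fyx); rewrite mulrC -ltr_pdivlMr//; apply: (lt_le_trans yr).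
  apply: (le_trans rrd).
  have -> : d / (2 * L) = d / L / 2 by lra.
  by lra.
have := hd _ fyd => h1.
set S := \sum_(i < n) _.
have SE : S = \sum_j b j * (\sum_i (y - x) 0 i * A j i).
  rewrite /S; under eq_bigr do rewrite mulr_sumr.
  rewrite exchange_big /=; apply: eq_bigr => j _; rewrite mulr_sumr.
  by apply: eq_bigr => i _; ring.
set T := \sum_(i < m) _ in h1.
have -> : h (f y) - h (f x) - S = (h (f y) - h (f x) - T) + (T - S) by ring.
have TS : `|T - S| <= e / 2 * `|y - x|.
  rewrite SE /T -sumrB (le_trans (ler_norm_sum _ _ _))//.
  apply: (@le_trans _ _ (\sum_j `|b j| * (e / (2 * B) * `|y - x|))).
    apply: ler_sum => j _; rewrite !mxE mulrC -mulrBr normrM ler_wpM2l//; exact: k2.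
  rewrite -mulr_suml mulrA ler_wpM2r//.
  have -> : e / 2 = B * (e / (2 * B)) by field; rewrite gt_eqF.
  rewrite ler_wpM2r//.
  by rewrite lerDr.
rewrite (le_trans (ler_normD _ _))//.
have : e / (2 * L) * `|f y - f x| <= e / 2 * `|y - x|.
  rewrite (le_trans (ler_wpM2l _ fyx))//.
  by rewrite mulrA ler_wpM2r//; apply: eq_ler; field; rewrite gt_eqF.
move=> h2; have := le_trans h1 h2; lra.
Qed.

Lemma hasgradM n (f g : 'rV[R]_n -> R) x a b : hasgrad f x a -> hasgrad g x b ->
  hasgrad (fun y => f y * g y) x (fun i => f x * b i + g x * a i).
Proof.
move=> hf hg.
have [d1 d10 hd1] := hasgrad_bound hf; have [d2 d20 hd2] := hasgrad_bound hg.
set A := 1 + _ in hd1; set B := 1 + _ in hd2.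
have A0 : 0 < A by rewrite ltr_pwDl//.
have B0 : 0 < B by rewrite ltr_pwDl//.
move=> e e0; pose F := `|f x| + 1; pose G := `|g x| + 1.
have F0 : 0 < F by rewrite ltr_wpDl.
have G0 : 0 < G by rewrite ltr_wpDl.
have e3 : 0 < e / 3 by [].
have [r1 r10 hr1] := hf _ (divr_gt0 e3 G0); have [r2 r20 hr2] := hg _ (divr_gt0 e3 F0).
(* Within this radius the product of the two increments, at most A B |y - x|^2, stays below e/3 |y -
   x|. *)
pose r3 := e / 3 / (A * B).
have r30 : 0 < r3 by rewrite divr_gt0// mulr_gt0.
exists (Num.min (Num.min d1 d2) (Num.min (Num.min r1 r2) r3)); first by rewrite !lt_min d10 d20 r10 r20.
move=> y; rewrite !lt_min => /andP[/andP[/hd1 k1 /hd2 k2] /andP[/andP[/hr1 l1 /hr2 l2] yr]].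
set SA := \sum_i _ in l1; set SB := \sum_i _ in l2.
have -> : \sum_i (y - x) 0 i * (f x * b i + g x * a i) = f x * SB + g x * SA.
  by rewrite !mulr_sumr -big_split; apply: eq_bigr => i _ /=; ring.
have -> : f y * g y - f x * g x - (f x * SB + g x * SA) =
  g x * (f y - f x - SA) + f x * (g y - g x - SB) + (f y - f x) * (g y - g x) by ring.
have t1 : `|g x * (f y - f x - SA)| <= e / 3 * `|y - x|.
  rewrite normrM; apply: (@le_trans _ _ (G * (e / 3 / G * `|y - x|))).
    by apply: ler_pM => //; rewrite lerDl.
  by rewrite mulrA mulrCA mulfV// mulr1.
have t2 : `|f x * (g y - g x - SB)| <= e / 3 * `|y - x|.
  rewrite normrM; apply: (@le_trans _ _ (F * (e / 3 / F * `|y - x|))).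
    by apply: ler_pM => //; rewrite lerDl.
  by rewrite mulrA mulrCA mulfV// mulr1.
have t3 : `|(f y - f x) * (g y - g x)| <= e / 3 * `|y - x|.
  rewrite normrM; apply: (@le_trans _ _ ((A * `|y - x|) * (B * `|y - x|))).
    by apply: ler_pM.
  have -> : A * `|y - x| * (B * `|y - x|) = (`|y - x| * (A * B)) * `|y - x| by ring.
  by rewrite ler_wpM2r// -ler_pdivlMr// ltW.
rewrite (le_trans (ler_normD _ _))//; have := ler_normD (g x * (f y - f x - SA)) (f x * (g y - g x - SB)).
lra.
Qed.

Lemma hasgradZ n (f : 'rV[R]_n -> R) x a c : hasgrad f x a ->
  hasgrad (fun y => c * f y) x (fun i => c * a i).
Proof.
move=> h; have := hasgradM (hasgrad_cst c x) h.
by under [X in hasgrad _ _ X]eq_fun do rewrite mulr0 addr0.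
Qed.

Lemma hasgradN n (f : 'rV[R]_n -> R) x a : hasgrad f x a ->
  hasgrad (fun y => - f y) x (fun i => - a i).
Proof.
move=> /(hasgradZ (-1)); under eq_fun do rewrite mulN1r.
by under [X in hasgrad _ _ X]eq_fun do rewrite mulN1r.
Qed.

Lemma hasgradB n (f g : 'rV[R]_n -> R) x a b : hasgrad f x a -> hasgrad g x b ->
  hasgrad (fun y => f y - g y) x (fun i => a i - b i).
Proof. by move=> hf /hasgradN; exact: hasgradD. Qed.

Lemma hasgrad_affine n (a : 'I_n -> R) (c : R) x :
  hasgrad (fun y : 'rV[R]_n => \sum_i y 0 i * a i + c) x a.
Proof.
move=> e e0; exists 1 => // y _.
have -> : \sum_i (y - x) 0 i * a i = \sum_i y 0 i * a i - \sum_i x 0 i * a i.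
  by rewrite -sumrB; apply: eq_bigr => i _; rewrite !mxE mulrBl.
rewrite (_ : _ - _ - _ = 0) ?normr0//; ring.
Qed.

Lemma hasgrad_coord n i (x : 'rV[R]_n) :
  hasgrad (fun y : 'rV[R]_n => y 0 i) x (fun j => (j == i)%:R).
Proof.
have := @hasgrad_affine n (fun j => (j == i)%:R) 0 x.
rewrite (_ : (fun y => _) = (fun y : 'rV[R]_n => y 0 i))//.
apply/funext => y; rewrite addr0 (bigD1 i)//= eqxx mulr1 big1 ?addr0// => j ji.
by rewrite (negbTE ji) mulr0.
Qed.

Lemma hasgrad_comp1 n (h : R -> R) (f : 'rV[R]_n -> R) x a b :
  hasder h (f x) b -> hasgrad f x a -> hasgrad (fun y => h (f y)) x (fun i => b * a i).
Proof.
move=> hh hf.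
have h1 : hasgrad (fun z : 'rV[R]_1 => h (z 0 0)) (f x)%:M (fun=> b).
  move=> e e0; have [d d0 hd] := hh e e0; exists d => // y.
  have E : `|y - (f x)%:M| = `|y 0 0 - f x|.
    apply/eqP; rewrite eq_le; apply/andP; split.
      by apply/rVnorm_leP => // i; rewrite ord1 !mxE eqxx mulr1n.
    by have := coord_le_norm (y - (f x)%:M) 0; rewrite !mxE eqxx mulr1n.
  by rewrite E big_ord1 !mxE eqxx mulr1n => /hd.
have h2 (j : 'I_1) : hasgrad (fun y => ((f y)%:M : 'rV[R]_1) 0 j) x a.
  by apply: hasgrad_ext hf => // y; rewrite ord1 mxE eqxx mulr1n.
apply: hasgrad_ext (hasgrad_comp h1 h2) => [y|i]; last by rewrite big_ord1.
by rewrite mxE.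
Qed.

Lemma hasgrad_cont n (f : 'rV[R]_n -> R) x a : hasgrad f x a -> {for x, continuous f}.
Proof.
move=> /hasgrad_bound[d d0 hd]; have FF : Filter (nbhs x) by exact: nbhs_filter.
rewrite /continuous_at; apply/(@cvgrPdist_le _ _ _ _ FF) => e e0.
set L := 1 + _ in hd; have L0 : 0 < L by rewrite ltr_pwDl//.
have : 0 < Num.min d (e / L) by rewrite lt_min d0 divr_gt0.
move=> r0; apply/nbhs_ballP; exists (Num.min d (e / L)) => //= y.
rewrite ball_rVE /= distrC lt_min => /andP[/hd h yd].
rewrite distrC (le_trans h)// mulrC -ler_pdivlMr// ltW//.
Qed.


(** The corners of a path from x to y with one step along each axis. On a step the mean value
    theorem involves a single partial derivative. *)
Definition mix n (x y : 'rV[R]_n) (k : nat) : 'rV[R]_n :=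
  \row_j (if (j < k)%N then y 0 j else x 0 j).

Lemma mixS n (x y : 'rV[R]_n) (i : 'I_n) :
  mix x y i.+1 = mix x y i + (y 0 i - x 0 i) *: delta_mx 0 i.
Proof.
apply/rowP => j; rewrite !mxE eqxx /= ltnS leq_eqVlt.
rewrite (_ : (j == i :> nat) = (j == i))//.
have [->|ji] := eqVneq j i; first by rewrite ltnn mulr1 addrC subrK.
by rewrite mulr0 addr0.
Qed.

Lemma mix_near n (x y : 'rV[R]_n) (i : 'I_n) (t : R) : 0 <= t <= 1 ->
  `|mix x y i + (t * (y 0 i - x 0 i)) *: delta_mx 0 i - x| <= `|y - x|.
Proof.
move=> /andP[t0 t1]; apply/rVnorm_leP => // j; rewrite !mxE eqxx /=.
have := coord_le_norm (y - x) j; rewrite !mxE.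
have [->|ji] := eqVneq j i.
  rewrite ltnn mulr1 addrAC subrr add0r normrM ger0_norm// => h.
  by rewrite (le_trans _ h)// ler_piMl.
by rewrite mulr0 addr0; case: ifP => // _; rewrite subrr normr0.
Qed.

Lemma derivable_line n (f : 'rV[R]_n -> R) (z v : 'rV[R]_n) :
  (forall x, derivable f x v) -> forall t : R,
  is_derive t 1 (fun s => f (z + s *: v)) ('D_v f (z + t *: v)).
Proof.
move=> df t; apply/hasder_is_derive => e e0.
have := df (z + t *: v) => /derivable1P h.
have [d1 d2] := derivableP h.
have hd : hasder (fun h : R => f (h *: v + (z + t *: v))) 0 ('D_v f (z + t *: v)).
  apply/hasder_is_derive; apply: DeriveDef => //.
  rewrite /derive; set F := (X in lim (X @ _)); set G := (X in _ = lim (X @ _)).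
  suff -> : F = G by [].
  by apply/funext => s; rewrite /F /G /= scale0r add0r addr0 [s%:A]mulr1.
have [r r0 hr] := hd e e0; exists r => // s st.
have := hr (s - t); rewrite !subr0 => /(_ st).
by rewrite scale0r add0r scalerBl addrCA addrNK.
Qed.

Lemma C1_hasgrad n (f : 'rV[R]_n -> R) (x : 'rV[R]_n) : is_Ck 1 f ->
  hasgrad f x (fun i => pd i f x).
Proof.
move=> [cf /= hf] e e0.
(* Each of the n steps contributes at most this multiple of |y - x|; n + 1 instead of n keeps the
   quotient meaningful for n = 0. *)
have en : 0 < e / n.+1%:R by [].
have hc (i : 'I_n) : exists r : R, 0 < r /\ forall y : 'rV[R]_n, `|y - x| < r ->
    `|pd i f y - pd i f x| <= e / n.+1%:R.
  have [_ cpi] := hf i; have := cpi x.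
  move=> /(@cvgrPdist_le _ _ _ _ (nbhs_filter x)) /(_ _ en) /nbhs_ballP[r /= r0 hr].
  exists r; split=> // y yx; rewrite distrC; apply: hr.
  by rewrite ball_rVE /= distrC.
have [r hr] := choice hc.
have [d d0 dr] := pos_lower_bound (fun i => (hr i).1).
exists d => // y yd.
have fE : f y - f x = \sum_(i < n) (f (mix x y i.+1) - f (mix x y i)).
  rewrite -(big_mkord predT (fun i => f (mix x y i.+1) - f (mix x y i))) telescope_sumr//.
  congr (f _ - f _); apply/rowP => j; rewrite mxE ?ltn_ord//.
have step (i : 'I_n) : `|f (mix x y i.+1) - f (mix x y i) - (y - x) 0 i * pd i f x| <=
    e / n.+1%:R * `|y - x|.
  pose c := y 0 i - x 0 i.
  pose g := fun t : R => f (mix x y i + t *: (c *: delta_mx 0 i)).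
  have dg (t : R) : is_derive t 1 g (c * pd i f (mix x y i + t *: (c *: delta_mx 0 i))).
    have := @derivable_line n f (mix x y i) (delta_mx 0 i) (hf i).1 (t * c).
    move=> /hasder_is_derive h; apply/hasder_is_derive => e' e'0.
    have c1 : 0 < `|c| + 1 by [].
    have [r' r'0 hr'] := h _ (divr_gt0 e'0 c1).
    exists (r' / (`|c| + 1)); first exact: divr_gt0.
    move=> s; rewrite ltr_pdivlMr// => st; rewrite /g !scalerA.
    have sc : `|s * c - t * c| < r'.
      rewrite -mulrBl normrM (le_lt_trans _ st)// ler_wpM2l// lerDl//.
    have := hr' _ sc; rewrite -mulrBl mulrA => /le_trans; apply.
    rewrite normrM (_ : e' / (`|c| + 1) * (`|s - t| * `|c|) = e' * `|s - t| * (`|c| / (`|c| + 1))); last ring.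
    by rewrite ler_piMr// ler_pdivrMr// mul1r lerDl.
  have cg : {within `[0, 1], continuous g}.
    apply: continuous_subspaceT => t; apply: differentiable_continuous.
    by apply/derivable1_diffP; have [] := dg t.
  have [t t01 gE] := MVT_segment ler01 (fun t _ => dg t) cg.
  have -> : f (mix x y i.+1) = g 1 by rewrite mixS /g scale1r.
  have -> : f (mix x y i) = g 0 by rewrite /g scale0r addr0.
  rewrite gE subr0 mulr1 !mxE -/c -mulrBr normrM mulrC ler_pM//.
    apply: (hr i).2; apply: lt_le_trans (dr i); apply: le_lt_trans yd.
    by rewrite scalerA; apply: mix_near; move: t01; rewrite in_itv.
  by have := coord_le_norm (y - x) i; rewrite !mxE.
rewrite fE -sumrB (le_trans (ler_norm_sum _ _ _))//.
apply: (@le_trans _ _ (\sum_(i < n) e / n.+1%:R * `|y - x|)); first exact: ler_sum.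
rewrite sumr_const card_ord -[leLHS]mulr_natr.
have -> : e / n.+1%:R * `|y - x| * n%:R = e * `|y - x| * (n%:R / n.+1%:R) by ring.
by rewrite ler_piMr// ler_pdivrMr// mul1r ler_nat.
Qed.

End Gradient.

(** * Calculus of smooth functions of several variables *)

Section Smooth.
Context {R : realType} {n : nat}.
Implicit Types (f g : 'rV[R]_n -> R) (i j : 'I_n).

Lemma is_CkW k f : is_Ck k.+1 f -> is_Ck k f.
Proof.
elim: k f => [|k ih] f [cf h] //; split=> // i.
by have [d1 d2] := h i; split=> //; exact: ih.
Qed.

Lemma smooth_cont f : smooth f -> continuous f. Proof. by move/(_ 0%N). Qed.
Lemma smooth_pd f i : smooth f -> smooth (pd i f).
Proof. by move=> sf k; have [_ /(_ i)[]] := sf k.+1. Qed.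

Lemma smooth_hasgrad f x : smooth f -> hasgrad f x (fun i => pd i f x).
Proof. by move=> sf; apply: C1_hasgrad; exact: sf. Qed.
Lemma smooth_measurable f : smooth f -> measurable_fun [set: 'rV[R]_n] f.
Proof. by move=> /smooth_cont; exact: continuous_rV_measurable. Qed.

(* A coinduction principle for smoothness. *)
Lemma smooth_class (P : ('rV[R]_n -> R) -> Prop) :
  (forall f, P f -> forall x, exists a, hasgrad f x a) ->
  (forall f, P f -> forall i, P (pd i f)) -> forall f, P f -> smooth f.
Proof.
move=> P1 P2 f Pf k; elim: k f Pf => [|k ih] f Pf.
  by move=> x; have [a /hasgrad_cont] := P1 f Pf x.
split=> [x|i]; first by have [a /hasgrad_cont] := P1 f Pf x.
split=> [x|]; last by apply: ih; exact: P2.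
by have [a /(hasgrad_derive (delta_mx 0 i))[]] := P1 f Pf x.
Qed.

Lemma pdD i f g : smooth f -> smooth g -> pd i (fun x => f x + g x) = (fun x => pd i f x + pd i g x).
Proof.
move=> sf sg; apply/funext => x.
exact: (hasgrad_pd i (hasgradD (smooth_hasgrad x sf) (smooth_hasgrad x sg))).
Qed.

Lemma pdM i f g : smooth f -> smooth g ->
  pd i (fun x => f x * g x) = (fun x => f x * pd i g x + g x * pd i f x).
Proof.
move=> sf sg; apply/funext => x.
exact: (hasgrad_pd i (hasgradM (smooth_hasgrad x sf) (smooth_hasgrad x sg))).
Qed.

Lemma pd_cst i c : pd i (fun=> c : R) = (fun=> 0) :> ('rV[R]_n -> R).
Proof. by apply/funext => x; exact: (hasgrad_pd i (hasgrad_cst c x)). Qed.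

Lemma pdZ i c f : smooth f -> pd i (fun x => c * f x) = (fun x => c * pd i f x).
Proof.
by move=> sf; apply/funext => x; exact: (hasgrad_pd i (hasgradZ c (smooth_hasgrad x sf))).
Qed.

Lemma pdB i f g : smooth f -> smooth g -> pd i (fun x => f x - g x) = (fun x => pd i f x - pd i g x).
Proof.
move=> sf sg; apply/funext => x.
exact: (hasgrad_pd i (hasgradB (smooth_hasgrad x sf) (smooth_hasgrad x sg))).
Qed.

Lemma smooth_cst c : smooth (fun _ : 'rV[R]_n => c : R).
Proof.
apply: (smooth_class (P := fun f => exists c, f = fun _ : 'rV[R]_n => c)) => [f [k ->] x|f [k ->] i|].
- by exists (fun=> 0); exact: hasgrad_cst.
- by exists 0; rewrite pd_cst.
- by exists c.
Qed.

Lemma is_CkD k f g : is_Ck k f -> is_Ck k g -> is_Ck k (fun x => f x + g x).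
Proof.
elim: k f g => [|k ih] f g; first by move=> cf cg x; apply: (@continuousD _ _ _ f g x); [exact: cf|exact: cg].
move=> hf hg; have [cf df] := hf; have [cg dg] := hg; split=> [x|i].
  by apply: (@continuousD _ _ _ f g x); [exact: cf|exact: cg].
have [df1 df2] := df i; have [dg1 dg2] := dg i; split=> [x|]; first exact: derivableD.
rewrite (_ : pd i _ = fun x => pd i f x + pd i g x); first exact: ih.
by apply/funext => x; rewrite /pd -deriveD.
Qed.

Lemma is_CkM k f g : is_Ck k f -> is_Ck k g -> is_Ck k (fun x => f x * g x).
Proof.
elim: k f g => [|k ih] f g; first by move=> cf cg x; apply: (@continuousM _ _ f g x); [exact: cf|exact: cg].
move=> hf hg; have [cf df] := hf; have [cg dg] := hg; split=> [x|i].
  by apply: (@continuousM _ _ f g x); [exact: cf|exact: cg].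
have [df1 df2] := df i; have [dg1 dg2] := dg i; split=> [x|]; first exact: derivableM.
rewrite (_ : pd i _ = fun x => f x * pd i g x + g x * pd i f x).
  by apply: is_CkD; apply: ih => //; exact: is_CkW.
by apply/funext => x; rewrite /pd -[f x * _]/(f x *: _) -[g x * _]/(g x *: _) -deriveM.
Qed.

Lemma smoothD f g : smooth f -> smooth g -> smooth (fun x => f x + g x).
Proof. by move=> sf sg k; exact: is_CkD. Qed.
Lemma smoothM f g : smooth f -> smooth g -> smooth (fun x => f x * g x).
Proof. by move=> sf sg k; exact: is_CkM. Qed.
Lemma smoothZ c f : smooth f -> smooth (fun x => c * f x).
Proof. by apply: smoothM; exact: smooth_cst. Qed.
Lemma smoothN f : smooth f -> smooth (fun x => - f x).
Proof. by move=> /(smoothZ (-1)); under eq_fun do rewrite mulN1r. Qed.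
Lemma smoothB f g : smooth f -> smooth g -> smooth (fun x => f x - g x).
Proof. by move=> sf /smoothN; exact: smoothD. Qed.

Lemma smooth_sum (I : Type) (s : seq I) (P : pred I) (F : I -> 'rV[R]_n -> R) :
  (forall i : I, P i -> smooth (F i)) -> smooth (fun x => \sum_(i <- s | P i) F i x).
Proof.
move=> h; elim: s => [|i s ih]; first by under eq_fun do rewrite big_nil; exact: smooth_cst.
case Pi : (P i); under eq_fun do rewrite big_cons Pi; last exact: ih.
by apply: smoothD => //; exact: h.
Qed.

Lemma smooth_prod (I : Type) (s : seq I) (P : pred I) (F : I -> 'rV[R]_n -> R) :
  (forall i : I, P i -> smooth (F i)) -> smooth (fun x => \prod_(i <- s | P i) F i x).
Proof.
move=> h; elim: s => [|i s ih]; first by under eq_fun do rewrite big_nil; exact: smooth_cst.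
case Pi : (P i); under eq_fun do rewrite big_cons Pi; last exact: ih.
by apply: smoothM => //; exact: h.
Qed.

Lemma smoothX f m : smooth f -> smooth (fun x => f x ^+ m).
Proof.
move=> sf; elim: m => [|m ih]; first by under eq_fun do rewrite expr0; exact: smooth_cst.
by under eq_fun do rewrite exprS; exact: smoothM.
Qed.

Lemma pd_sum i (I : Type) (s : seq I) (P : pred I) (F : I -> 'rV[R]_n -> R) :
  (forall i : I, P i -> smooth (F i)) ->
  pd i (fun x => \sum_(k <- s | P k) F k x) = fun x => \sum_(k <- s | P k) pd i (F k) x.
Proof.
move=> h; elim: s => [|k s ih].
  by under eq_fun do rewrite big_nil; rewrite pd_cst; apply/funext => x; rewrite big_nil.
case Pk : (P k); under eq_fun do rewrite big_cons Pk; last first.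
  by rewrite ih; apply/funext => x; rewrite big_cons Pk.
rewrite pdD//; [|exact: h|exact: smooth_sum].
by rewrite ih; apply/funext => x; rewrite big_cons Pk.
Qed.

Lemma smooth_affine (a : 'I_n -> R) c : smooth (fun x => \sum_i x 0 i * a i + c).
Proof.
move=> [|k]; first by move=> x; exact: hasgrad_cont (hasgrad_affine a c x).
split=> [x|i]; first exact: hasgrad_cont (hasgrad_affine a c x).
split=> [x|]; first by have [] := hasgrad_derive (delta_mx 0 i) (hasgrad_affine a c x).
rewrite (_ : pd i _ = fun=> a i); first exact: smooth_cst.
by apply/funext => x; exact: hasgrad_pd (hasgrad_affine a c x).
Qed.

Lemma smooth_coord i : smooth (fun x : 'rV[R]_n => x 0 i).
Proof.
have := smooth_affine (fun j => (j == i)%:R) 0.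
rewrite (_ : (fun y => _) = (fun y : 'rV[R]_n => y 0 i))//.
apply/funext => y; rewrite addr0 (bigD1 i)//= eqxx mulr1 big1 ?addr0// => j ji.
by rewrite (negbTE ji) mulr0.
Qed.

End Smooth.

(** * Smooth steps on the line *)

Section Smooth1D.
Context {R : realType}.
Implicit Types (f g : R -> R) (P : {poly R}).

(** k-fold differentiability, the derivatives being witnesses. The last one may be discontinuous, so
    smoothness is [C1k k] for all k. *)
Fixpoint C1k (k : nat) g : Prop :=
  if k is j.+1 then exists2 g' : R -> R, (forall x : R, is_derive x 1 g (g' x)) & C1k j g' else True.

Lemma C1kW k g : C1k k.+1 g -> C1k k g.
Proof.
elim: k g => [|k ih] g // [g' dg h]; exists g' => //; exact: ih.
Qed.

Lemma C1kD k f g : C1k k f -> C1k k g -> C1k k (fun x => f x + g x).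
Proof.
elim: k f g => [|k ih] f g // [f' df hf] [g' dg hg].
by exists (fun x => f' x + g' x) => [x|]; [exact: is_deriveD|exact: ih].
Qed.

Lemma C1kM k f g : C1k k f -> C1k k g -> C1k k (fun x => f x * g x).
Proof.
elim: k f g => [|k ih] f g // hf hg; have [f' df hf'] := hf; have [g' dg hg'] := hg.
exists (fun x => f x * g' x + g x * f' x) => [x|]; first exact: is_deriveM.
by apply: C1kD; apply: ih => //; exact: C1kW.
Qed.

Lemma C1k_cst k c : C1k k (fun=> c).
Proof.
elim: k c => [|k ih] c //; exists (fun=> 0) => // x; exact: is_derive_cst.
Qed.

Lemma C1kV k g : (forall x, g x != 0) -> C1k k g -> C1k k (fun x => (g x)^-1).
Proof.
move=> g0; elim: k => [|k ih] // hg; have [g' dg hg'] := hg.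
exists (fun x => - 1 * ((g x)^-1 * (g x)^-1) * g' x) => [x|].
  apply: is_derive_eq (is_deriveV (g0 x) (dg x)) _.
  by rewrite /GRing.scale/= expr2 invfM mulN1r.
by apply: C1kM => //; apply: C1kM; [exact: C1k_cst|apply: C1kM; apply: ih; exact: C1kW].
Qed.

Lemma C1k_affine k g a b : C1k k g -> C1k k (fun x => g (a * x + b)).
Proof.
elim: k g => [|k ih] g // [g' dg hg'].
exists (fun x => g' (a * x + b) * a) => [x|]; last first.
  by apply: C1kM; [exact: ih|exact: C1k_cst].
apply: (@is_derive1_comp _ g (fun x => a * x + b)).
apply/hasder_is_derive => e e0; exists 1 => // s _.
by rewrite (_ : _ - _ - _ = 0) ?normr0//; ring.
Qed.

(** The factor P(1/x) in front of exp(-1/x) makes the family closed under derivation, which sends P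
    to X^2 (P - P'). *)
Definition flat P (x : R) : R := if 0 < x then P.[x^-1] * expR (- x^-1) else 0.

Lemma expR_inv_le (m : nat) (x : R) : 0 < x -> expR (- x^-1) <= m.+1`!%:R * x ^+ m.+1.
Proof.
move=> x0; have xi : 0 <= x^-1 by [].
have := expR_ge1Dxn m xi; rewrite expRN => h.
rewrite -[leRHS]invrK lef_pV2 ?posrE ?expR_gt0//.
rewrite (le_trans _ h)// invfM -exprVn mulrC; lra.
Qed.

(** A quadratic bound gives the derivative 0 at 0. The exponential is estimated by a power of x two
    degrees above the size of P. *)
Lemma flat_small P : exists2 C : R, 0 <= C & forall x, `|x| <= 1 -> `|flat P x| <= C * x ^+ 2.
Proof.
pose S := \sum_(i < size P) `|P`_i|.
have S0 : 0 <= S by exact: sumr_ge0.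
exists (S * (size P).+2`!%:R) => [|x x1] => //.
rewrite /flat; case: ifPn => x0; last by rewrite normr0.
rewrite normrM [`|expR _|]ger0_norm//.
have xi : 1 <= x^-1 by rewrite invf_ge1// (le_trans _ x1)// ler_norm.
have Pb : `|P.[x^-1]| <= S * x^-1 ^+ size P.
  rewrite horner_coef (le_trans (ler_norm_sum _ _ _))// mulr_suml ler_sum// => i _.
  rewrite normrM ler_wpM2l// normrX ger0_norm//.
  by apply: ler_weXn2l => //; exact: ltnW.
apply: (le_trans (ler_pM (normr_ge0 _) (expR_ge0 _) Pb (expR_inv_le (size P).+1 x0))).
have -> : S * x^-1 ^+ size P * ((size P).+2`!%:R * x ^+ (size P).+2) =
   S * (size P).+2`!%:R * x ^+ 2 * (x^-1 ^+ size P * x ^+ size P).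
  by rewrite -addn2 exprD; ring.
by rewrite -exprMn mulVf// expr1n mulr1.
Qed.

Lemma flat_derive P (x : R) : is_derive x 1 (flat P) (flat ('X ^+ 2 * (P - P^`())) x).
Proof.
have [x0|x0] := ltP 0 x.
  have nr : \near x, P.[x^-1] * expR (- x^-1) = flat P x.
    by near=> y; rewrite /flat ifT//; near: y; exact: lt_nbhsr.
  apply: near_eq_is_derive nr _.
  have dV : is_derive x 1 (fun y : R => y^-1) (- x ^- 2).
    apply: is_derive_eq (is_deriveV (lt0r_neq0 x0 : id x != 0) (is_derive_id x 1)) _.
    by rewrite /GRing.scale/= mulr1.
  have d1 : is_derive x 1 (fun y => P.[y^-1]) (P^`().[x^-1] * (- x ^- 2)).
    exact: (@is_derive1_comp _ (horner P) (fun y => y^-1)).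
  have d2 : is_derive x 1 (fun y => expR (- y^-1)) (expR (- x^-1) * (- - x ^- 2)).
    exact: (@is_derive1_comp _ expR (fun y => - y^-1)).
  apply: is_derive_eq (is_deriveM d1 d2) _.
  rewrite /GRing.scale/= /flat x0 hornerM hornerXn hornerD hornerN -exprVn; ring.
apply/hasder_is_derive; have [C C0 hC] := flat_small P.
have fx Q : flat Q x = 0 by rewrite /flat ltNge x0.
move=> e e0; rewrite !fx.
have m0 : 0 < Num.min 1 (e / (C + 1)) by rewrite lt_min ltr01 divr_gt0// ltr_wpDl.
exists (Num.min 1 (e / (C + 1))) => // s; rewrite lt_min => /andP[s1 s2].
rewrite mulr0 !subr0.
have [s0|s0] := leP s 0; first by rewrite /flat ltNge s0 normr0.
have sx : s <= `|s - x| by rewrite ger0_norm; lra.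
rewrite (le_trans (hC s _))//; first by rewrite ger0_norm ?ltW// (le_lt_trans sx).
apply: (@le_trans _ _ (C * `|s - x| * `|s - x|)).
  by rewrite -mulrA ler_wpM2l// expr2 ler_pM//.
rewrite ler_wpM2r//; move: s2; rewrite ltr_pdivlMr// => s2.
have := normr_ge0 (s - x); nra.
Unshelve. all: by end_near. Qed.

Lemma C1k_flat k P : C1k k (flat P).
Proof.
elim: k P => [|k ih] P //; exists (flat ('X ^+ 2 * (P - P^`()))) => //.
exact: flat_derive.
Qed.

(** The classical smooth step from 0 (for x <= 0) to 1 (for x >= 1); the denominator never vanishes,
    as x and 1 - x are not both nonpositive. *)
Definition sstep (x : R) : R := flat 1 x / (flat 1 x + flat 1 (1 - x)).

Lemma flat1_ge0 x : 0 <= flat 1 x.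
Proof. by rewrite /flat; case: ifP => // _; rewrite hornerE. Qed.

Lemma flat1_gt0 x : 0 < x -> 0 < flat 1 x.
Proof. by move=> x0; rewrite /flat x0 hornerE mul1r expR_gt0. Qed.

Lemma sstep_den x : 0 < flat 1 x + flat 1 (1 - x).
Proof.
have [x0|x0] := ltP 0 x; first by rewrite ltr_pwDl ?flat1_gt0// flat1_ge0.
by rewrite ltr_wpDl ?flat1_ge0// flat1_gt0//; lra.
Qed.

Lemma sstep_C1k k : C1k k sstep.
Proof.
apply: C1kM; first exact: C1k_flat.
apply: C1kV => [x|]; first by rewrite gt_eqF// sstep_den.
apply: C1kD; first exact: C1k_flat.
have := C1k_affine (-1) 1 (C1k_flat k 1).
by under eq_fun do rewrite mulN1r addrC.
Qed.

Lemma sstep0 x : x <= 0 -> sstep x = 0.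
Proof. by move=> x0; rewrite /sstep /flat ltNge x0 mul0r. Qed.

Lemma sstep1 x : 1 <= x -> sstep x = 1.
Proof.
move=> x1; rewrite /sstep [flat 1 (1 - x)]/flat ifF ?addr0 ?divff//.
  by rewrite gt_eqF// flat1_gt0; lra.
by lra.
Qed.

Lemma sstep_itv x : 0 <= sstep x <= 1.
Proof.
rewrite /sstep divr_ge0 ?flat1_ge0 ?(ltW (sstep_den x))//= ler_pdivrMr ?sstep_den//.
by rewrite mul1r lerDl flat1_ge0.
Qed.

Definition sstep' (x : R) : R := 'D_1 sstep x.

Lemma sstep_derive (x : R) : is_derive x 1 sstep (sstep' x).
Proof. by have [g' dg _] := sstep_C1k 1; have [] := dg x. Qed.

Lemma sstep'_out x : x < 0 \/ 1 < x -> sstep' x = 0.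
Proof.
move=> h; have := hasder_is_derive sstep x (sstep' x) => -[_ /(_ (sstep_derive x)) hd].
have h0 : hasder sstep x 0.
  move=> e e0; case: h => h.
    exists (- x) => [|s]; first lra; rewrite ltr_norml => /andP[s1 s2].
    by rewrite !sstep0 ?mulr0 ?subrr ?normr0//; lra.
  exists (x - 1) => [|s]; first lra; rewrite ltr_norml => /andP[s1 s2].
  by rewrite !sstep1 ?mulr0 ?subrr ?normr0//; lra.
by have /hasder_is_derive[_ <-] := h0.
Qed.

Lemma sstep'_bounded : exists2 C : R, 0 < C & forall x, `|sstep' x| <= C.
Proof.
have [g' dg [g'' dg' _]] := sstep_C1k 2.
have E x : sstep' x = g' x by have [_ <-] := dg x.
have cg : {within `[(0:R), 1], continuous (fun x => `|g' x|)}.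
  apply: continuous_subspaceT => x; apply: continuous_comp; last exact: norm_continuous.
  by apply: differentiable_continuous; apply/derivable1_diffP; have [] := dg' x.
have [c c01 hc] := EVT_max ler01 cg.
exists (`|g' c| + 1) => [|x] => //.
have [x0|x0] := ltP x 0; first by rewrite sstep'_out ?normr0//; left.
have [x1|x1] := ltP 1 x; first by rewrite sstep'_out ?normr0//; right.
by rewrite E ler_wpDr// hc// in_itv/= x0.
Qed.

End Smooth1D.

Lemma smooth_comp1 {R : realType} n (g : R -> R) (i : 'I_n) (c e : R) :
  (forall k, C1k k g) -> smooth (fun x : 'rV[R]_n => g (c * x 0 i + e)).
Proof.
move=> sg k.
have gr (h h' : R -> R) : (forall x : R, is_derive x 1 h (h' x)) -> forall x : 'rV[R]_n,
    hasgrad (fun x : 'rV[R]_n => h (c * x 0 i + e)) x (fun j => h' (c * x 0 i + e) * (c * (j == i)%:R)).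
  move=> dh x; apply: (@hasgrad_comp1 _ _ h (fun x : 'rV[R]_n => c * x 0 i + e)).
    exact/hasder_is_derive.
  have := hasgradD (hasgradZ c (hasgrad_coord i x)) (hasgrad_cst e x).
  by apply: hasgrad_ext => // j; rewrite addr0.
have cont (h : R -> R) : C1k 1 h -> continuous (fun x : 'rV[R]_n => h (c * x 0 i + e)).
  by move=> [h' dh _] x; exact: hasgrad_cont (gr h h' dh x).
elim: k g sg => [|k ih] g sg; first exact: cont.
split=> [|j]; first exact: cont.
have [g' dg _] := sg 1%N; split=> [x|].
  by have [] := hasgrad_derive (delta_mx 0 j) (gr g g' dg x).
rewrite (_ : pd j _ = fun x => (c * (j == i)%:R) * g' (c * x 0 i + e)).
  apply: is_CkM; first exact: smooth_cst.
  (* The hypothesis gives a separate derivative witness for each order; they agree by uniqueness of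
     the derivative. *)
  apply: ih => m; have [h dh hm] := sg m.+1.
  suff -> : g' = h by [].
  by apply/funext => x; have [_ <-] := dg x; have [_ <-] := dh x.
by apply/funext => x; rewrite (hasgrad_pd j (gr g g' dg x)) mulrC.
Qed.

(** * Partitions of unity on lattices *)

Section PartitionOfUnity.
Context {R : realType}.

(** A bump on [-1, 1], written as a difference of consecutive steps so that the sums of its integer
    translates telescope. *)
Definition rho1 (t : R) : R := sstep (t + 1) - sstep t.
Definition rho1' (t : R) : R := sstep' (t + 1) - sstep' t.

Lemma rho1_out t : 1 <= `|t| -> rho1 t = 0.
Proof.
rewrite ler_normr => /orP[t1|t1]; rewrite /rho1.
  by rewrite !sstep1//; lra.
by rewrite !sstep0//; lra.
Qed.

Lemma rho1_itv t : 0 <= rho1 t <= 1.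
Proof.
rewrite /rho1; have := sstep_itv t; have := sstep_itv (t + 1).
have [t0|t0] := leP t 0; first by rewrite (sstep0 t0); lra.
by rewrite (@sstep1 _ (t + 1)); lra.
Qed.

Lemma rho1_0 : rho1 0 = 1.
Proof. by rewrite /rho1 add0r sstep1// sstep0// subr0. Qed.

Lemma rho1_C1k k : C1k k rho1.
Proof.
apply: C1kD.
  rewrite (_ : (fun x => sstep (x + 1)) = (fun x => sstep (1 * x + 1))).
    exact: C1k_affine (sstep_C1k k).
  by apply/funext => x; rewrite mul1r.
rewrite (_ : (fun x => - sstep x) = (fun x => -1 * sstep x)).
  by apply: C1kM; [exact: C1k_cst|exact: sstep_C1k].
by apply/funext => x; rewrite mulN1r.
Qed.

Lemma rho1_hasder t : hasder rho1 t (rho1' t).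
Proof.
have /hasder_is_derive h1 := sstep_derive (t + 1).
have /hasder_is_derive h2 := sstep_derive t.
apply/hasder_is_derive; apply: is_deriveB; last exact: sstep_derive.
apply/hasder_is_derive => e e0; have [r r0 hr] := h1 e e0.
exists r => // s st; have := hr (s + 1).
by rewrite (_ : s + 1 - (t + 1) = s - t); [exact|ring].
Qed.

(** The majorant is the sum of three consecutive translates of [rho1], hence sums of |rho1'| over
    the lattice are bounded independently of the number of nodes. *)
Lemma rho1'_bound : exists2 C : R, 0 < C &
  forall t, `|rho1' t| <= C * (sstep (t + 2) - sstep (t - 1)).
Proof.
have [C C0 hC] := @sstep'_bounded R; exists (2 * C) => [|t] => //.
have [t1|t1] := ltP 1 `|t|.
  have -> : rho1' t = 0.
    rewrite /rho1' !sstep'_out ?subrr//; move: t1; rewrite ltr_normr => /orP[] ?;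
    by [left; lra|right; lra].
  rewrite normr0 mulr_ge0// subr_ge0.
  have := sstep_itv (t + 2); have := sstep_itv (t - 1).
  have [h|h] := leP 1 (t + 2); first by rewrite (sstep1 h); lra.
  by rewrite (@sstep0 _ (t - 1)); lra.
move: t1; rewrite ler_norml => /andP[ta tb].
rewrite (@sstep1 _ (t + 2)) ?(@sstep0 _ (t - 1)); try lra.
rewrite subr0 mulr1 (le_trans (ler_normB _ _))//.
by rewrite mulrDl mul1r lerD//; exact: hC.
Qed.

Lemma sum_rho1 (M : nat) (y : R) :
  \sum_(j < M) rho1 (y - j%:R) = sstep (y + 1) - sstep (y + 1 - M%:R).
Proof.
elim: M => [|M ih]; first by rewrite big_ord0 subr0 subrr.
rewrite big_ord_recr /= ih /rho1.
have -> : y - M%:R + 1 = y + 1 - M%:R by ring.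
have -> : y + 1 - M.+1%:R = y - M%:R by lra.
by ring.
Qed.

Lemma sum_rho1_itv (M : nat) (y : R) : 0 <= \sum_(j < M) rho1 (y - j%:R) <= 1.
Proof.
apply/andP; split; first by apply: sumr_ge0 => j _; have /andP[] := rho1_itv (y - j%:R).
rewrite sum_rho1; have := sstep_itv (y + 1); have := sstep_itv (y + 1 - M%:R); lra.
Qed.

Lemma sum_rho1' : exists2 C : R, 0 < C &
  forall (M : nat) (y : R), \sum_(j < M) `|rho1' (y - j%:R)| <= C.
Proof.
have [C C0 hC] := rho1'_bound; exists (3 * C) => [|M y] => //.
apply: (@le_trans _ _ (\sum_(j < M) C * (rho1 (y + 1 - j%:R) + rho1 (y - j%:R) + rho1 (y - 1 - j%:R)))).
  apply: ler_sum => j _; apply: (le_trans (hC _)); rewrite ler_pM2l// /rho1.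
  have -> : y + 1 - j%:R + 1 = y - j%:R + 2 by ring.
  have -> : y + 1 - j%:R = y - j%:R + 1 by ring.
  have -> : y - 1 - j%:R + 1 = y - j%:R by ring.
  have -> : y - 1 - j%:R = y - j%:R - 1 by ring.
  by lra.
rewrite -mulr_sumr [leRHS]mulrC ler_pM2l// big_split /= [X in X + _ <= _]big_split /=.
have := sum_rho1_itv M (y + 1); have := sum_rho1_itv M y; have := sum_rho1_itv M (y - 1).
lra.
Qed.

Section Lattice.
Context (n N : nat) (delta : R) (d0 : 0 < delta).
Local Notation idx := {ffun 'I_n -> 'I_(N.*2.+1)}.
Implicit Types (k : idx) (x : 'rV[R]_n).

(** Tensor products of bumps at the nodes delta (k - N), with k - N running over {-N, ..., N}^n: a
    partition of unity on the cube of half-side delta N about 0. *)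
Definition pou k x : R := \prod_a rho1 (delta^-1 * x 0 a + (N%:R - (k a)%:R)).
Definition node k : 'rV[R]_n := \row_a (delta * ((k a)%:R - N%:R)).

Lemma pou_smooth k : smooth (pou k).
Proof. by apply: smooth_prod => a _; apply: smooth_comp1 => m; exact: rho1_C1k. Qed.

Lemma pou_itv k x : 0 <= pou k x <= 1.
Proof.
rewrite /pou; apply/andP; split.
  by apply: prodr_ge0 => a _; have /andP[] := rho1_itv (delta^-1 * x 0 a + (N%:R - (k a)%:R)).
by apply: prodr_ile1 => a _; exact: rho1_itv.
Qed.

Lemma far_coord k x : delta < `|x - node k| -> exists a,
  1 < `|delta^-1 * x 0 a + (N%:R - (k a)%:R)|.
Proof.
move=> h; apply: contrapT => hn; move: h; rewrite ltNge => /negP; apply.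
apply/rVnorm_leP => [|a]; first exact: ltW.
rewrite !mxE leNgt; apply/negP => h; apply: hn; exists a.
have -> : delta^-1 * x 0 a + (N%:R - (k a)%:R) = delta^-1 * (x 0 a - delta * ((k a)%:R - N%:R)).
  by field; rewrite gt_eqF.
by rewrite normrM gtr0_norm// ltr_pdivlMl// mulr1.
Qed.

Lemma pou_supp k x : pou k x != 0 -> `|x - node k| <= delta.
Proof.
apply: contra_neqT; rewrite -ltNge => /far_coord[a ha].
by rewrite /pou (bigD1 a)//= rho1_out ?mul0r// ltW.
Qed.

Lemma sum_pou x : `|x| <= delta * N%:R -> \sum_k pou k x = 1.
Proof.
move=> xN; rewrite /pou -(bigA_distr_bigA (fun a (j : 'I_(N.*2.+1)) => rho1 (delta^-1 * x 0 a + (N%:R - j%:R)))).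
apply: big1 => a _; under eq_bigr do rewrite addrA; rewrite sum_rho1.
have : `|delta^-1 * x 0 a| <= N%:R.
  by rewrite normrM gtr0_norm// ler_pdivrMl// (le_trans (coord_le_norm _ _)).
rewrite ler_norml => /andP[h1 h2].
rewrite sstep1 ?(@sstep0 _ (_ - N.*2.+1%:R)) ?subr0//; last by lra.
by rewrite -addnn -natr1 natrD; lra.
Qed.

Lemma pd_pou b k x : pd b (pou k) x = delta^-1 *
  (\prod_a (if a == b then rho1' else rho1) (delta^-1 * x 0 a + (N%:R - (k a)%:R))).
Proof.
have h1 : hasder (fun s => pou k (x + s *: delta_mx 0 b)) 0 (pd b (pou k) x).
  have := @hasgrad_line _ _ (pou k) x (delta_mx 0 b) 0 (fun i => pd i (pou k) x).
  rewrite scale0r addr0 (bigD1 b)//= big1 => [|i ib].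
    by rewrite mxE !eqxx mul1r addr0; apply; apply: smooth_hasgrad; exact: pou_smooth.
  by rewrite mxE (negbTE ib) andbF mul0r.
have h2 : hasder (fun s => pou k (x + s *: delta_mx 0 b)) 0 (delta^-1 *
  (\prod_a (if a == b then rho1' else rho1) (delta^-1 * x 0 a + (N%:R - (k a)%:R)))).
  pose y := delta^-1 * x 0 b + (N%:R - (k b)%:R).
  pose P := \prod_(a | a != b) rho1 (delta^-1 * x 0 a + (N%:R - (k a)%:R)).
  have E : (fun s => pou k (x + s *: delta_mx 0 b)) = fun s => P * rho1 (delta^-1 * s + y).
    apply/funext => s; rewrite /pou (bigD1 b)//= mulrC; congr (_ * _).
      by apply: eq_bigr => a ab; rewrite !mxE (negbTE ab) andbF mulr0 addr0.
    by rewrite !mxE !eqxx mulr1 /y; congr rho1; ring.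
  rewrite E (bigD1 b)//= eqxx.
  rewrite (eq_bigr (fun a => rho1 (delta^-1 * x 0 a + (N%:R - (k a)%:R)))); last first.
    by move=> a ab; rewrite (negbTE ab).
  rewrite -/P -/y; apply/hasder_is_derive.
  have dr : is_derive (0 : R) (1 : R) (fun s : R => rho1 (delta^-1 * s + y)) (rho1' y * delta^-1).
    apply: (@is_derive1_comp _ rho1 (fun s => delta^-1 * s + y)).
      by rewrite mulr0 add0r; apply/hasder_is_derive; exact: rho1_hasder.
    apply/hasder_is_derive => e e0; exists 1 => // s _.
    by rewrite (_ : _ - _ - _ = 0) ?normr0//; ring.
  apply: is_derive_eq (is_deriveZ P dr) _.
  by rewrite /GRing.scale/=; ring.
by have /hasder_is_derive[_ <-] := h1; have /hasder_is_derive[_ <-] := h2.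
Qed.

Lemma pd_pou_supp b k x : pd b (pou k) x != 0 -> `|x - node k| <= delta.
Proof.
apply: contra_neqT; rewrite -ltNge => /far_coord[a ha].
rewrite pd_pou (bigD1 a)//=; case: ifPn => _; last by rewrite rho1_out ?mul0r ?mulr0// ltW.
have [C C0 hC] := rho1'_bound.
rewrite (_ : rho1' _ = 0) ?mul0r ?mulr0//; move: ha; set z := _ + _ => ha.
rewrite /rho1' !sstep'_out ?subrr//; move: ha; rewrite ltr_normr => /orP[] ?;
by [left; lra|right; lra].
Qed.

Lemma sum_pd_pou0 b x : `|x| < delta * N%:R -> \sum_k pd b (pou k) x = 0.
Proof.
move=> xN; have sp : smooth (fun y => \sum_k pou k y).
  by apply: smooth_sum => k _; exact: pou_smooth.
have -> : \sum_k pd b (pou k) x = pd b (fun y => \sum_k pou k y) x.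
  by rewrite pd_sum// => k _; exact: pou_smooth.
have h : hasgrad (fun y => \sum_k pou k y) x (fun=> 0).
  apply: (@hasgrad_near _ _ (fun=> 1) _ _ _ (delta * N%:R - `|x|)).
  - by lra.
  - move=> y yx; rewrite sum_pou// -(subrK x y) (le_trans (ler_normD _ _))//.
    by lra.
  - exact: hasgrad_cst.
by rewrite (hasgrad_pd b h).
Qed.

End Lattice.

(** The constant depends on n only. The sum over the lattice is a product of sums over the axes: the
    differentiated factor is bounded by [sum_rho1'] and every other one by 1. *)
Lemma sum_pd_pou n : exists2 C : R, 0 < C & forall (N : nat) (delta : R) (b : 'I_n) (x : 'rV[R]_n),
  0 < delta -> \sum_(k : {ffun 'I_n -> 'I_(N.*2.+1)}) `|pd b (pou delta k) x| <= C / delta.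
Proof.
have [C C0 hC] := sum_rho1'; exists C => // N delta b x d0.
under eq_bigr => k _ do rewrite pd_pou// normrM [`|delta^-1|]gtr0_norm// normr_prod.
rewrite -mulr_sumr mulrC ler_pM2r//.
rewrite -(bigA_distr_bigA (fun a (j : 'I_(N.*2.+1)) =>
  `|(if a == b then rho1' else rho1) (delta^-1 * x 0 a + (N%:R - j%:R))|)).
rewrite (bigD1 b)//= eqxx -[leRHS]mulr1 ler_pM//.
- by apply: prodr_ge0 => a _; exact: sumr_ge0.
- by under eq_bigr do rewrite addrA; exact: hC.
- apply: (@le_trans _ _ (\prod_(a | a != b) 1)); last by rewrite big1.
  apply: ler_prod => a ab; rewrite sumr_ge0//= (negbTE ab).
  under eq_bigr => j _ do rewrite addrA ger0_norm ?(andP (rho1_itv _)).1//.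
  by have /andP[] := sum_rho1_itv N.*2.+1 (delta^-1 * x 0 a + N%:R).
Qed.

End PartitionOfUnity.

(** * Polynomials and inverse estimates *)

Section FiniteLinear.
Context {R : realType}.

(** Both sides of the inverse are stated: the first recovers coefficients from moments, the second
    solves for prescribed moments. *)
Lemma fin_linear_inverse (I : finType) (L : I -> I -> R) :
  (forall c, (forall j, \sum_i c i * L i j = 0) -> forall i, c i = 0) ->
  exists K : I -> I -> R,
    (forall c i, c i = \sum_j (\sum_l c l * L l j) * K j i) /\
    (forall r j, \sum_i (\sum_l r l * K l i) * L i j = r j).
Proof.
move=> inj.
pose M : 'M[R]_#|I| := \matrix_(i, j) L (enum_val i) (enum_val j).
have uM : M \in unitmx.
  rewrite -row_free_unit -kermx_eq0; apply/eqP/matrixP => a b; rewrite [RHS]mxE.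
  have := inj (fun i => kermx M a (enum_rank i)) _ (enum_val b).
  rewrite enum_valK; apply => j.
  have : (kermx M *m M) a (enum_rank j) = 0 by rewrite mulmx_ker mxE.
  move=> h; rewrite -[RHS]h [RHS]mxE (reindex (@enum_val I I))/=; last first.
    by apply: onW_bij; exact: enum_val_bij.
  apply: eq_bigr => i _; rewrite enum_valK; congr (_ * _).
  by rewrite mxE enum_rankK.
exists (fun j i => invmx M (enum_rank j) (enum_rank i)); split=> [c i|r j].
- pose v : 'rV[R]_#|I| := \row_j c (enum_val j).
  have : (v *m M *m invmx M) 0 (enum_rank i) = c i by rewrite mulmxK// mxE enum_rankK.
  move=> <-; rewrite mxE (reindex (@enum_rank I))/=; last first.
    by apply: onW_bij; exact: enum_rank_bij.
  apply: eq_bigr => j _; congr (_ * _); rewrite mxE (reindex (@enum_rank I))/=; last first.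
    by apply: onW_bij; exact: enum_rank_bij.
  by apply: eq_bigr => l _; rewrite !mxE !enum_rankK.
- pose v : 'rV[R]_#|I| := \row_j r (enum_val j).
  have : (v *m invmx M *m M) 0 (enum_rank j) = r j by rewrite mulmxKV// mxE enum_rankK.
  move=> <-; rewrite mxE (reindex (@enum_rank I))/=; last first.
    by apply: onW_bij; exact: enum_rank_bij.
  apply: eq_bigr => i _; congr (_ * _); last by rewrite mxE !enum_rankK.
  rewrite mxE (reindex (@enum_rank I))/=; last first.
    by apply: onW_bij; exact: enum_rank_bij.
  by apply: eq_bigr => l _; rewrite !mxE !enum_rankK.
Qed.

End FiniteLinear.

Section Polynomials.
Context {R : realType}.
Implicit Types (n : nat) (m : int).

(** An inductive form of [polyfun], equivalent to it by [Pol_polyfun], that allows proofs by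
    structural induction on the function. [Pol_0] is available in every degree because the space is
    {0}, not empty, in negative degree. *)
Inductive Pol {n} : int -> ('rV[R]_n -> R) -> Prop :=
| Pol_0 m : Pol m (fun=> 0)
| Pol_cst m (c : R) : 0 <= m -> Pol m (fun=> c)
| Pol_add m f g : Pol m f -> Pol m g -> Pol m (fun x => f x + g x)
| Pol_X m i f : Pol m f -> Pol (m + 1) (fun x => x 0 i * f x).

Lemma PolW n m m' (f : 'rV[R]_n -> R) : m <= m' -> Pol m f -> Pol m' f.
Proof.
move=> mm' h; elim: h m' mm' => {m f}.
- by move=> m m' _; exact: Pol_0.
- by move=> m c m0 m' mm'; apply: Pol_cst; exact: le_trans mm'.
- by move=> m f g _ hf _ hg m' mm'; apply: Pol_add; [exact: hf|exact: hg].
- move=> m i f _ hf m' mm'; rewrite -[m'](subrK 1); apply: Pol_X; apply: hf.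
  by lra.
Qed.

Lemma Pol_neg n m (f : 'rV[R]_n -> R) : m < 0 -> Pol m f -> f = fun=> 0.
Proof.
move=> m0 h; elim: h m0 => {m f}.
- by [].
- by move=> m c h m0; move: h; rewrite leNgt m0.
- by move=> m f g _ hf _ hg m0; rewrite hf// hg//; apply/funext => x; rewrite addr0.
- move=> m i f _ hf m0; rewrite hf; first by apply/funext => x; rewrite mulr0.
  by lra.
Qed.

Lemma Pol_scale n m (f : 'rV[R]_n -> R) c : Pol m f -> Pol m (fun x => c * f x).
Proof.
elim=> {m f}.
- by move=> m; under eq_fun do rewrite mulr0; exact: Pol_0.
- by move=> m a m0; exact: Pol_cst.
- by move=> m f g _ hf _ hg; under eq_fun do rewrite mulrDr; exact: Pol_add.
- by move=> m i f _ hf; under eq_fun do rewrite mulrCA; exact: Pol_X.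
Qed.

Lemma Pol_opp n m (f : 'rV[R]_n -> R) : Pol m f -> Pol m (fun x => - f x).
Proof. by move=> /(Pol_scale (-1)); under eq_fun do rewrite mulN1r. Qed.

Lemma Pol_sub n m (f g : 'rV[R]_n -> R) : Pol m f -> Pol m g -> Pol m (fun x => f x - g x).
Proof. by move=> hf /Pol_opp; exact: Pol_add. Qed.

Lemma Pol_sum n m (I : Type) (s : seq I) (P : pred I) (F : I -> 'rV[R]_n -> R) :
  (forall i, P i -> Pol m (F i)) -> Pol m (fun x => \sum_(i <- s | P i) F i x).
Proof.
move=> h; elim: s => [|i s ih]; first by under eq_fun do rewrite big_nil; exact: Pol_0.
case Pi : (P i); under eq_fun do rewrite big_cons Pi; last exact: ih.
by apply: Pol_add => //; exact: h.
Qed.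

Lemma Pol_mul n m m' (f g : 'rV[R]_n -> R) : Pol m f -> Pol m' g ->
  Pol (m + m') (fun x => f x * g x).
Proof.
move=> hf hg; elim: hf => {m f}.
- by move=> m; under eq_fun do rewrite mul0r; exact: Pol_0.
- move=> m c m0; apply: (PolW (m := m')); first by lra.
  exact: Pol_scale.
- by move=> m f1 f2 _ h1 _ h2; under eq_fun do rewrite mulrDl; exact: Pol_add.
- by move=> m i f _ h; rewrite addrAC; under eq_fun do rewrite -mulrA; exact: Pol_X.
Qed.

Lemma Pol_prod n (I : Type) (s : seq I) (e : I -> nat) (F : I -> 'rV[R]_n -> R) :
  (forall i, Pol (e i) (F i)) ->
  Pol (\sum_(i <- s) e i)%N%:Z (fun x => \prod_(i <- s) F i x).
Proof.
move=> h; elim: s => [|i s ih].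
  by rewrite big_nil; under eq_fun do rewrite big_nil; exact: Pol_cst.
rewrite big_cons PoszD (_ : (fun x => _) = fun x => F i x * \prod_(j <- s) F j x).
  exact: Pol_mul.
by apply/funext => x; rewrite big_cons.
Qed.

Lemma Pol_coord n (i : 'I_n) : Pol 1 (fun x => x 0 i).
Proof.
have := Pol_X i (@Pol_cst n 0 1 isT); rewrite add0r.
by under eq_fun do rewrite mulr1.
Qed.

Lemma Pol_exp n (e : nat) (f : 'rV[R]_n -> R) : Pol 1 f -> Pol e (fun x => f x ^+ e).
Proof.
move=> h; elim: e => [|e ih]; first by under eq_fun do rewrite expr0; exact: Pol_cst.
by under eq_fun do rewrite exprS; rewrite -add1n PoszD; exact: Pol_mul.
Qed.

Lemma Pol_comp n n' m (f : 'rV[R]_n -> R) (g : 'rV[R]_n' -> 'rV[R]_n) :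
  (forall i, Pol 1 (fun x => g x 0 i)) -> Pol m f -> Pol m (fun x => f (g x)).
Proof.
move=> hg; elim=> {m f}.
- by move=> m; exact: Pol_0.
- by move=> m c m0; exact: Pol_cst.
- by move=> m f1 f2 _ h1 _ h2; exact: Pol_add.
- by move=> m i f _ h; rewrite addrC; exact: Pol_mul.
Qed.

Lemma Pol_affine n n' m (f : 'rV[R]_n -> R) (B : 'M[R]_(n', n)) b : Pol m f ->
  Pol m (fun x : 'rV[R]_n' => f (x *m B + b)).
Proof.
apply: Pol_comp => i; under eq_fun do rewrite !mxE.
apply: Pol_add; last exact: Pol_cst.
by apply: Pol_sum => j _; under eq_fun do rewrite mulrC; apply: Pol_scale; exact: Pol_coord.
Qed.

Lemma Pol_smooth n m (f : 'rV[R]_n -> R) : Pol m f -> smooth f.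
Proof.
elim=> {m f}.
- by move=> m; exact: smooth_cst.
- by move=> m c _; exact: smooth_cst.
- by move=> m f g _ hf _ hg; exact: smoothD.
- by move=> m i f _ hf; apply: smoothM => //; exact: smooth_coord.
Qed.

Lemma pd_coord n (i j : 'I_n) : pd i (fun x : 'rV[R]_n => x 0 j) = fun=> (i == j)%:R.
Proof. by apply/funext => x; exact: hasgrad_pd (hasgrad_coord j x). Qed.

Lemma Pol_pd n m (f : 'rV[R]_n -> R) i : Pol m f -> Pol (m - 1) (pd i f).
Proof.
elim=> {m f}.
- by move=> m; rewrite pd_cst; exact: Pol_0.
- by move=> m c _; rewrite pd_cst; exact: Pol_0.
- by move=> m f g hf ihf hg ihg; rewrite pdD; [exact: Pol_add|exact: Pol_smooth hf|exact: Pol_smooth hg].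
- move=> m j f hf ihf; rewrite pdM; [|exact: smooth_coord|exact: Pol_smooth hf].
  apply: Pol_add; first by rewrite addrAC; exact: Pol_X.
  rewrite addrK pd_coord; under eq_fun do rewrite mulrC; exact: Pol_scale.
Qed.

Definition mono {n} (b : 'I_n -> nat) (x : 'rV[R]_n) : R := \prod_i x 0 i ^+ b i.
Definition mdg {n} (b : 'I_n -> nat) : nat := (\sum_i b i)%N.

Lemma Pol_mono n (b : 'I_n -> nat) : Pol (mdg b) (mono b).
Proof. by apply: Pol_prod => i; apply: Pol_exp; exact: Pol_coord. Qed.

Lemma Pol_seq n m (f : 'rV[R]_n -> R) : Pol m f ->
  exists s : seq (R * ('I_n -> nat)),
    (forall p, List.In p s -> (mdg p.2)%:Z <= m) /\
    forall x, f x = \sum_(p <- s) p.1 * mono p.2 x.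
Proof.
elim=> {m f}.
- by move=> m; exists [::]; split=> // x; rewrite big_nil.
- move=> m c m0; exists [:: (c, fun=> 0%N)]; split=> [p [<-|//]|x] /=.
    by rewrite /mdg big1.
  by rewrite big_seq1 /mono big1 ?mulr1// => i _; rewrite expr0.
- move=> m f g _ [s [hs sE]] _ [t [ht tE]]; exists (s ++ t); split=> [p|x].
    by move=> /(@List.in_app_or _ s t p)[]; [exact: hs|exact: ht].
  by rewrite big_cat sE tE.
- move=> m i f _ [s [hs sE]].
  exists [seq (p.1, fun j => (p.2 j + (j == i))%N) | p <- s]; split=> [p|x].
    move=> /List.in_map_iff[q [<- /hs qm]] /=.
    rewrite /mdg big_split /= PoszD lerD// (bigD1 i)//= eqxx big1// => j ji.
    by rewrite (negbTE ji).
  rewrite sE mulr_sumr big_map; apply: eq_bigr => p _ /=.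
  rewrite mulrCA; congr (_ * _); rewrite /mono [RHS](bigD1 i)//= eqxx addn1 exprS -mulrA.
  congr (_ * _); rewrite (bigD1 i)//=; congr (_ * _); apply: eq_bigr => j ji.
  by rewrite (negbTE ji) addn0.
Qed.

Lemma polyfun_sum n m (I : Type) (s : seq I) (F : I -> 'rV[R]_n -> R) :
  (forall i, List.In i s -> polyfun m (F i)) -> polyfun m (fun x => \sum_(i <- s) F i x).
Proof.
elim: s => [|i s ih] h.
  exists (fun=> 0) => x; rewrite big_nil big1// => b _; by lra.
have [c cE] := h i (or_introl erefl).
have [d dE] := ih (fun j hj => h j (or_intror hj)).
exists (fun b => c b + d b) => x; rewrite big_cons cE dE -big_split /=.
by apply: eq_bigr => b _; rewrite mulrDl.
Qed.

Lemma mdg_coord n (b : 'I_n -> nat) i : (b i <= mdg b)%N.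
Proof. by rewrite /mdg (bigD1 i)//= leq_addr. Qed.

Lemma mono_ffun n (b : 'I_n -> nat) (N : nat) (hb : forall i, (b i < N)%N) :
  let b' := [ffun i => Ordinal (hb i)] in
  mdeg b' = mdg b /\ forall x : 'rV[R]_n, \prod_i x 0 i ^+ b' i = mono b x.
Proof.
by split=> [|x]; apply: eq_bigr => i _; rewrite ffunE.
Qed.

Lemma Pol_polyfun n m (f : 'rV[R]_n -> R) : Pol m f <-> polyfun m f.
Proof.
split=> [/Pol_seq[s [hs sE]]|[c cE]].
  rewrite (_ : f = fun x => \sum_(p <- s) p.1 * mono p.2 x); last exact/funext.
  apply: polyfun_sum => -[a b] /hs /= bm.
  have hb i : (b i < `|m|.+1)%N.
    rewrite ltnS (leq_trans (mdg_coord b i))//; move: bm; case: m {hs} => //= m.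
  have [b1 b2] := mono_ffun hb; set b' := [ffun i => _] in b1 b2.
  exists (fun d => if d == b' then a else 0) => x.
  rewrite (bigD1 b') ?b1//= eqxx b2 big1 ?addr0// => d /andP[_ db].
  by rewrite (negbTE db) mul0r.
rewrite (_ : f = fun x => \sum_(b : {ffun 'I_n -> 'I_`|m|.+1} | ((mdeg b)%:Z <= m)%R)
    c b * \prod_i x 0 i ^+ b i); last exact/funext.
apply: Pol_sum => b bm; apply: Pol_scale; apply: (PolW bm).
by apply: (@Pol_mono n (fun i => b i)).
Qed.

Lemma Pol_ext n m (f g : 'rV[R]_n -> R) : (forall x, f x = g x) -> Pol m f -> Pol m g.
Proof. by move=> /funext ->. Qed.

Lemma Pol_centered n m (f : 'rV[R]_n -> R) (x0 : 'rV[R]_n) (h : R) : h != 0 -> Pol m f ->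
  exists s : seq (R * ('I_n -> nat)),
    (forall p, List.In p s -> (mdg p.2)%:Z <= m) /\
    forall x, f x = \sum_(p <- s) p.1 * mono p.2 (h^-1 *: (x - x0)).
Proof.
move=> h0 hf; have /Pol_seq[s [hs sE]] := Pol_affine h%:M x0 hf.
exists s; split=> // x; rewrite -sE; congr f.
by rewrite mul_mx_scalar scalerA mulfV// scale1r subrK.
Qed.

Lemma homfun_sum n (D : set 'rV[R]_n) m (I : Type) (s : seq I) (F : I -> 'rV[R]_n -> R) :
  (forall i, List.In i s -> homfun D m (F i)) -> homfun D m (fun x => \sum_(i <- s) F i x).
Proof.
elim: s => [|i s ih] h.
  exists (fun=> 0) => x; rewrite big_nil big1// => b _; by lra.
have [c cE] := h i (or_introl erefl).
have [d dE] := ih (fun j hj => h j (or_intror hj)).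
exists (fun b => c b + d b) => x; rewrite big_cons cE dE -big_split /=.
by apply: eq_bigr => b _; rewrite mulrDl.
Qed.

Lemma homfun_mono n (D : set 'rV[R]_n) a (b : 'I_n -> nat) :
  homfun D (mdg b) (fun x => a * mono b (x - barycenter D)).
Proof.
have hb i : (b i < `|(mdg b)%:Z|.+1)%N by rewrite ltnS mdg_coord.
have [b1 b2] := mono_ffun hb; set b' := [ffun i => _] in b1 b2.
exists (fun d => if d == b' then a else 0) => x.
rewrite (bigD1 b') ?b1//= eqxx b2 big1 ?addr0// => d /andP[_ db].
by rewrite (negbTE db) mul0r.
Qed.

Lemma homfun_Pol n (D : set 'rV[R]_n) m f : homfun D m f -> Pol m f.
Proof.
move=> [c cE]; rewrite (_ : f = fun x => \sum_(b : {ffun 'I_n -> 'I_`|m|.+1} | (mdeg b)%:Z == m)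
    c b * \prod_i (x - barycenter D) 0 i ^+ b i); last exact/funext.
apply: Pol_sum => b /eqP bm; apply: Pol_scale; apply: (PolW (m := mdeg b)); first by rewrite bm.
apply: Pol_ext (Pol_affine 1%:M (- barycenter D) (@Pol_mono n (fun i => b i))) => x.
by rewrite mulmx1.
Qed.

Lemma digits_inj (M n : nat) (b b' : nat -> nat) :
  (forall i, (b i < M)%N) -> (forall i, (b' i < M)%N) ->
  (\sum_(i < n) b i * M ^ i = \sum_(i < n) b' i * M ^ i)%N ->
  forall i, (i < n)%N -> b i = b' i.
Proof.
elim: n b b' => [|n ih] b b' hb hb' //; rewrite !big_ord_recl /= !expn0 !muln1.
have E (f : nat -> nat) : (\sum_(i < n) f (bump 0 i) * M ^ bump 0 i =
    M * \sum_(i < n) f i.+1 * M ^ i)%N.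
  by rewrite big_distrr; apply: eq_bigr => i _; rewrite /bump add1n expnS mulnCA.
rewrite !E => h.
have M0 : (0 < M)%N by rewrite (leq_ltn_trans _ (hb 0%N)).
have e0 : b 0%N = b' 0%N.
  have := congr1 (modn^~ M) h; rewrite -!(addnC (M * _)%N) ![(M * _)%N]mulnC !modnMDl.
  by rewrite !modn_small.
move: h; rewrite e0 => /eqP; rewrite eqn_add2l eqn_pmul2l// => /eqP h [|i] // iN.
exact: (ih (fun i => b i.+1) (fun i => b' i.+1)).
Qed.

Lemma poly_inf_roots (p : {poly R}) (r : R) : 0 < r ->
  (forall t, 0 < t < r -> p.[t] = 0) -> p = 0.
Proof.
move=> r0 h; apply: contrapT => /eqP p0.
pose rs := [seq r / (j.+2)%:R | j <- iota 0 (size p)].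
have := @max_poly_roots R p rs p0; rewrite size_map size_iota ltnn => /(_ _ _)/negP; case.
- apply/allP => _ /mapP[j _ ->]; rewrite rootE h// divr_gt0//=.
  by rewrite ltr_pdivrMr// ltr_pMr// ltr1n.
- rewrite map_inj_uniq ?iota_uniq// => i j /(mulfI (lt0r_neq0 r0)) /invr_inj /eqP.
  by rewrite eqr_nat => /eqP [].
- by [].
Qed.

(* The substitution x_i = t^(M^i), M > N, maps distinct monomials to distinct powers of t. *)
Lemma mono_indep n N (c : {ffun 'I_n -> 'I_N.+1} -> R) r : 0 < r ->
  (forall x : 'rV[R]_n, `|x| < r -> \sum_b c b * mono (fun i => b i) x = 0) ->
  forall b, c b = 0.
Proof.
move=> r0 h b; pose M := N.+1.
pose kap (b : {ffun 'I_n -> 'I_N.+1}) := (\sum_(i < n) b i * M ^ i)%N.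
pose p : {poly R} := \sum_b c b *: 'X^(kap b).
have kinj b1 b2 : kap b1 = kap b2 -> b1 = b2.
  move=> k12; apply/ffunP => i; apply/val_inj => /=.
  pose ext (b : {ffun 'I_n -> 'I_N.+1}) (j : nat) : nat :=
    if insub j is Some i then b i else 0%N.
  have extb d (j : 'I_n) : ext d j = d j by rewrite /ext valK.
  have := @digits_inj M n (ext b1) (ext b2) _ _ _ i (ltn_ord i).
  rewrite !extb; apply.
  - by move=> j; rewrite /ext; case: insubP => //= *; exact: ltn_ord.
  - by move=> j; rewrite /ext; case: insubP => //= *; exact: ltn_ord.
  - by move: k12; rewrite /kap; under eq_bigr do rewrite -extb; under [in RHS]eq_bigr do rewrite -extb.
have p0 : p = 0.
  apply: (@poly_inf_roots _ (Num.min r 1)); first by rewrite lt_min r0 ltr01.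
  move=> t /andP[t0]; rewrite lt_min => /andP[tr t1].
  pose x : 'rV[R]_n := \row_i t ^+ (M ^ i).
  have xr : `|x| < r.
    apply/rVnorm_ltP => // i; rewrite mxE ger0_norm//.
    rewrite (le_lt_trans _ tr)// -[leRHS]expr1 ler_wiXn2l ?ltW//.
    by rewrite expn_gt0.
  rewrite -(h x xr) /p horner_sum; apply: eq_bigr => d _; rewrite hornerZ hornerXn.
  congr (_ * _); rewrite /kap /mono -prodrXr; apply: eq_bigr => i _.
  by rewrite mxE -exprM mulnC.
have := congr1 (fun q : {poly R} => q`_(kap b)) p0; rewrite coef0 /p coef_sum (bigD1 b)//=.
rewrite coefZ coefXn eqxx mulr1 big1 ?addr0// => d db; rewrite coefZ coefXn.
case: eqP => [/kinj bd|_]; last by rewrite mulr0.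
by rewrite bd eqxx in db.
Qed.

Lemma cont_rV_bounded n (f : 'rV[R]_n -> R) (x0 : 'rV[R]_n) (r : R) : continuous f ->
  exists2 C : R, 0 < C & forall x, `|x - x0| <= r -> `|f x| <= C.
Proof.
move=> cf; have [r0|r0] := ltP r 0.
  by exists 1 => // x h; move: (le_lt_trans h r0); rewrite normr_lt0.
have cQ : compact [set x : 'rV[R]_n | `|x - x0| <= r].
  apply: bounded_closed_compact; last exact: closed_cball.
  exists (r + `|x0|); split; first exact: num_real.
  move=> M rM x /= xr; rewrite -(subrK x0 x) (le_trans (ler_normD _ _))//.
  by lra.
have [||c cQ' hc] := @EVT_max_rV R n (fun x => `|f x|) [set x : 'rV[R]_n | `|x - x0| <= r] _ cQ.
- by exists x0; rewrite /= subrr normr0.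
- by apply: continuous_subspaceT => x; apply: continuous_comp; [exact: cf|exact: norm_continuous].
exists (`|f c| + 1) => [|x xr] => //.
by rewrite ler_wpDr// hc// inE.
Qed.

Lemma integral0_cont n (D : set 'rV[R]_n) (F : 'rV[R]_n -> R) (x : 'rV[R]_n) (r : R) :
  mrV D -> 0 < r -> (forall y, `|y - x| < r -> D y) -> continuous F ->
  (forall y, D y -> 0 <= F y) -> I1 lebn D F ->
  \int[lebn]_(y in D) F y = 0 -> F x = 0.
Proof.
move=> mD r0 xD cF F0 iF h; apply: contrapT => /eqP Fx.
have Dx : D x by apply: xD; rewrite subrr normr0.
have Fx0 : 0 < F x by rewrite lt_neqAle eq_sym Fx F0.
have F2 : 0 < F x / 2 by [].
have := cF x => /(@cvgrPdist_le _ _ _ _ (nbhs_filter x)) /(_ _ F2) /nbhs_ballP[s /= s0 hs].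
pose t := Num.min (r / 2) (s / 2).
have t0 : 0 < t by rewrite lt_min !divr_gt0.
have tr : t < r by rewrite /t gt_min; apply/orP; left; lra.
have ts : t < s by rewrite /t gt_min; apply/orP; right; lra.
pose Q := [set y : 'rV[R]_n | `|y - x| <= t].
have mQ : mrV Q by exact: cball_measurable.
have QD : Q `<=` D by move=> y /= yt; apply: xD; exact: le_lt_trans tr.
have iQ : I1 lebn Q F by exact: integrableS iF.
have : \int[lebn]_(y in Q) F y <= 0 by rewrite -h; exact: Rintegral_subset.
apply/negP; rewrite -ltNge.
have : \int[lebn]_(y in Q) (F x / 2) <= \int[lebn]_(y in Q) F y.
  apply: le_Rintegral => //.
    apply: (@I1_bounded _ _ _ _ _ _ (`|F x / 2|)) => //.
    by apply: le_lt_trans (leb_fin_bounded mQ (ltW t0) (fun y h => h)) _; exact: ltry.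
  move=> y /= yt; have := hs y; rewrite ball_rVE /= distrC => /(_ (le_lt_trans yt ts)).
  by rewrite ler_norml => /andP[]; lra.
apply: lt_le_trans; rewrite Rintegral_cst// mulr_gt0//.
rewrite (_ : fine _ = (2 * t) ^+ n)//.
exact: (congr1 fine (leb_cball x (ltW t0))).
Qed.

Definition cball0 n : set 'rV[R]_n := [set y | `|y - 0| <= 1].

Lemma measurable_cball0 n : mrV (@cball0 n).
Proof. exact: cball_measurable. Qed.

Lemma leb_cball0_fin n : (lebn (@cball0 n) < +oo)%E.
Proof. by rewrite /cball0 leb_cball// ltry. Qed.

(** A smooth weight on the unit cube. A polynomial times this weight vanishes outside the cube, so
    weighted norms can be computed by testing a weak derivative. *)
Definition beta n (y : 'rV[R]_n) : R := \prod_i rho1 (y 0 i).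

Lemma beta_smooth n : smooth (@beta n).
Proof.
apply: smooth_prod => i _.
have := @smooth_comp1 R n _ i 1 0 rho1_C1k.
by under eq_fun do rewrite mul1r addr0.
Qed.

Lemma beta_itv n (y : 'rV[R]_n) : 0 <= beta y <= 1.
Proof.
apply/andP; split; last by apply: prodr_ile1 => i _; exact: rho1_itv.
by apply: prodr_ge0 => i _; have /andP[] := rho1_itv (y 0 i).
Qed.

Lemma beta_out n (y : 'rV[R]_n) : beta y != 0 -> `|y| <= 1.
Proof.
apply: contra_neqT; rewrite -ltNge => h.
have [i hi] : exists i, 1 < `|y 0 i|.
  apply: contrapT => hn; move: h; rewrite ltNge => /negP; apply.
  by apply/rVnorm_leP => // i; rewrite leNgt; apply/negP => hi; apply: hn; exists i.
by rewrite /beta (bigD1 i)//= rho1_out ?mul0r// ltW.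
Qed.

Lemma cont_rV_eps n (f : 'rV[R]_n -> R) (x : 'rV[R]_n) (e : R) : {for x, continuous f} ->
  0 < e -> exists2 r : R, 0 < r & forall y : 'rV[R]_n, `|y - x| < r -> `|f y - f x| <= e.
Proof.
move=> cf e0; have := cf => /(@cvgrPdist_le _ _ _ _ (nbhs_filter x)) /(_ e e0).
move=> /nbhs_ballP[r /= r0 hr]; exists r => // y yx; rewrite distrC; apply: hr.
by rewrite ball_rVE /= distrC.
Qed.

Lemma beta_near0 n : exists2 r : R, 0 < r & forall y : 'rV[R]_n, `|y| < r -> 0 < beta y.
Proof.
have cb : continuous (@beta n) by exact: smooth_cont (@beta_smooth n).
have b0 : beta (0 : 'rV[R]_n) = 1.
  by rewrite /beta big1// => i _; rewrite mxE rho1_0.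
have h2 : 0 < 2^-1 :> R by [].
have [r r0 hr] := cont_rV_eps (cb (0 : 'rV[R]_n)) h2.
exists r => // y yr; have := hr y; rewrite subr0 b0 => /(_ yr).
by rewrite ler_norml => /andP[]; lra.
Qed.

Definition wdot n (f g : 'rV[R]_n -> R) : R :=
  \int[lebn]_(y in @cball0 n) (beta y * f y * g y).

Lemma cont_S2 n (f : 'rV[R]_n -> R) (x0 : 'rV[R]_n) r (D : set 'rV[R]_n) : continuous f ->
  mrV D -> (forall x, D x -> `|x - x0| <= r) -> 0 <= r -> S2 lebn D f.
Proof.
move=> cf mD h r0; have [C C0 hC] := @cont_rV_bounded n f x0 r cf.
apply: (@S2_bounded _ _ _ _ _ _ C) => //.
- by apply: le_lt_trans (leb_fin_bounded mD r0 h) _; exact: ltry.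
- by apply: measurable_funTS; exact: continuous_rV_measurable.
- by move=> x /h; exact: hC.
Qed.

Lemma cont_S2_cball0 n (f : 'rV[R]_n -> R) : continuous f -> S2 lebn (@cball0 n) f.
Proof.
by move=> cf; apply: (@cont_S2 n f 0 1) => //; exact: measurable_cball0.
Qed.

Lemma wdot_I1 n (f g : 'rV[R]_n -> R) : continuous f -> continuous g ->
  I1 lebn (@cball0 n) (fun y => beta y * f y * g y).
Proof.
move=> cf cg; apply: S2_mul; [exact: measurable_cball0| |exact: cont_S2_cball0].
apply: cont_S2_cball0 => x; apply: (@continuousM _ _ (@beta n) f); last exact: cf.
exact: (smooth_cont (@beta_smooth n)).
Qed.

(** Multiplication by the square root of the weight turns [wdot] into an inner product of L^2, which
    gives bilinearity and Cauchy-Schwarz. Continuity of the root is enough for that. *)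
Definition sqb n (y : 'rV[R]_n) : R := Num.sqrt (beta y).

Lemma sqb_cont n : continuous (@sqb n).
Proof.
move=> x; apply: (@continuous_comp _ _ _ (@beta n) Num.sqrt).
  exact: (smooth_cont (@beta_smooth n)).
exact: sqrt_continuous.
Qed.

Lemma wdot_dot n (f g : 'rV[R]_n -> R) :
  wdot f g = dot lebn (@cball0 n) (fun y => sqb y * f y) (fun y => sqb y * g y).
Proof.
apply: eq_Rintegral => y _; rewrite mulrACA -expr2 /sqb sqr_sqrtr ?mulrA//.
by have /andP[] := beta_itv y.
Qed.

Lemma sqbS2 n (f : 'rV[R]_n -> R) : continuous f ->
  S2 lebn (@cball0 n) (fun y => sqb y * f y).
Proof.
move=> cf; apply: cont_S2_cball0 => x; apply: (@continuousM _ _ (@sqb n) f); last exact: cf.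
exact: sqb_cont.
Qed.

Lemma smooth_monoC n (b : 'I_n -> nat) : smooth (@mono n b).
Proof. exact: Pol_smooth (Pol_mono b). Qed.

(** Equivalence of norms in finite dimension, through the Gram matrix of the monomials. It is
    injective because the weight is positive near 0 and monomials are independent on any
    neighbourhood of 0; Cauchy-Schwarz then bounds the moments from which the coefficients are
    recovered. *)
Lemma gram_coef n N : exists2 C : R, 0 < C & forall (c : {ffun 'I_n -> 'I_N.+1} -> R) b,
  `|c b| <= C * Num.sqrt (wdot (fun y => \sum_b c b * mono (fun i => b i) y)
                              (fun y => \sum_b c b * mono (fun i => b i) y)).
Proof.
pose I := {ffun 'I_n -> 'I_N.+1}.
pose e (b : I) : 'rV[R]_n -> R := mono (fun i => b i).
have ce b : continuous (e b) by exact/smooth_cont/smooth_monoC.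
pose G (c : I -> R) y := \sum_b c b * e b y.
have sG c : smooth (G c).
  by apply: smooth_sum => b _; apply: smoothZ; exact: smooth_monoC.
have cG c : continuous (G c) by exact: smooth_cont.
have mQ := @measurable_cball0 n.
have wE c f : continuous f -> \sum_b c b * wdot (e b) f = wdot (G c) f.
  move=> cf; rewrite wdot_dot (_ : dot _ _ _ _ = dot lebn (@cball0 n)
    (fun y => \sum_(b : I) c b * (sqb y * e b y)) (fun y => sqb y * f y)); last first.
    apply: dot_ext => // y _; rewrite /G mulr_sumr; apply: eq_bigr => b _; ring.
  rewrite dot_suml//; last 2 first.
  - by move=> b _; apply: S2Z => //; exact: sqbS2.
  - exact: sqbS2.
  by apply: eq_bigr => b _; rewrite dotZl ?wdot_dot//; exact: sqbS2.
have [|K [K1 _]] := @fin_linear_inverse R I (fun b d => wdot (e b) (e d)).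
  move=> c hc; have [r r0 hr] := beta_near0 n.
  have rr0 : 0 < Num.min r 1 by rewrite lt_min r0 ltr01.
  apply: (@mono_indep n N c _ rr0) => x; rewrite lt_min => /andP[xr x1].
  have w0 : wdot (G c) (G c) = 0.
    rewrite -(wE c)//; apply: big1 => b _.
    suff -> : wdot (e b) (G c) = 0 by lra.
    rewrite wdot_dot dotC -wdot_dot -(wE c)//; exact: hc.
  have [z z1] : exists z : R, z = 1 - `|x| by exists (1 - `|x|).
  have F0 : beta x * G c x * G c x = 0.
    apply: (@integral0_cont n (@cball0 n) (fun y => beta y * G c y * G c y) x (1 - `|x|)) => //.
    - by lra.
    - move=> y yx; rewrite /cball0 /= subr0 -(subrK x y) (le_trans (ler_normD _ _))//.
      by lra.
    - by apply: smooth_cont; apply: smoothM => //; apply: smoothM => //; exact: beta_smooth.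
    - by move=> y _; rewrite -mulrA mulr_ge0 -?expr2//; have /andP[] := beta_itv y.
    - exact: wdot_I1.
  have := hr x xr; move: F0 => /eqP; rewrite !mulf_eq0 -orbA orbb => /orP[/eqP ->|/eqP//].
  by rewrite ltxx.
pose B := \sum_b \sum_d Num.sqrt (wdot (e b) (e b)) * `|K b d|.
have B0 : 0 <= B.
  by apply: sumr_ge0 => b _; apply: sumr_ge0 => d _; rewrite mulr_ge0// sqrtr_ge0.
exists (B + 1) => [|c b] => //.
rewrite (K1 c b) (le_trans (ler_norm_sum _ _ _))//.
apply: (@le_trans _ _ (B * Num.sqrt (wdot (G c) (G c)))); last first.
  by rewrite ler_wpM2r// lerDl.
rewrite /B mulr_suml; apply: ler_sum => d _; rewrite [in leRHS](bigD1 b)//= mulrDl.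
rewrite -[leLHS]addr0 lerD//; last first.
rewrite normrM mulrAC ler_wpM2r// wE// mulrC !wdot_dot.
by apply: cauchy_schwarz => //; exact: sqbS2.
Qed.

Lemma scaled_nat n (x0 x : 'rV[R]_n) (d : R) : d != 0 -> x = d *: (d^-1 *: (x - x0)) + x0.
Proof. by move=> d0; rewrite scalerA mulfV// scale1r subrK. Qed.

(* The L2 norm of f, weighted by the bump, over the cube of centre x0 and half-side d,
   in the coordinates where this cube is the unit one. *)
Definition enm n (x0 : 'rV[R]_n) (d : R) (f : 'rV[R]_n -> R) : R :=
  Num.sqrt (wdot (fun y => f (d *: y + x0)) (fun y => f (d *: y + x0))).

Lemma enm_ge0 n (x0 : 'rV[R]_n) d f : 0 <= enm x0 d f. Proof. exact: sqrtr_ge0. Qed.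

Lemma Pol_scaled n m (f : 'rV[R]_n -> R) (x0 : 'rV[R]_n) (d : R) : Pol m f ->
  Pol m (fun y => f (d *: y + x0)).
Proof.
move=> /(Pol_affine d%:M x0); apply: Pol_ext => y.
by rewrite mul_mx_scalar.
Qed.

Lemma pd_scaled n (f : 'rV[R]_n -> R) (x0 : 'rV[R]_n) (d : R) i y : smooth f ->
  pd i (fun y => f (d *: y + x0)) y = d * pd i f (d *: y + x0).
Proof.
move=> sf; have h := smooth_hasgrad (d *: y + x0) sf.
have hl (j : 'I_n) : hasgrad (fun y : 'rV[R]_n => (d *: y + x0) 0 j) y (fun k => d * (k == j)%:R).
  have := hasgradD (hasgradZ d (hasgrad_coord j y)) (hasgrad_cst (x0 0 j) y).
  by apply: hasgrad_ext => [z|k]; rewrite ?addr0// !mxE.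
rewrite (hasgrad_pd i (@hasgrad_comp _ _ _ f (fun z => d *: z + x0) y _ _ h hl)) (bigD1 i)//= eqxx mulr1 mulrC big1 ?addr0// => j ji.
by rewrite eq_sym (negbTE ji) !mulr0.
Qed.

Lemma inverse_estimate n (N : nat) (L : R) : exists2 C : R, 0 < C &
  forall (f : 'rV[R]_n -> R) (x0 : 'rV[R]_n) (d : R) x, Pol N f -> 0 < d -> `|x - x0| <= L * d ->
    `|f x| <= C * enm x0 d f /\ forall i, `|pd i f x| <= C / d * enm x0 d f.
Proof.
have [C0 C00 hC0] := gram_coef n N.
pose I := {ffun 'I_n -> 'I_N.+1}.
have H (b : I) : exists M : R, 0 < M /\ forall y : 'rV[R]_n, `|y - 0| <= L ->
    `|mono (fun i => b i) y| <= M /\ forall i, `|pd i (mono (fun i => b i)) y| <= M.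
  have sm : smooth (@mono n (fun i => b i)) by exact: smooth_monoC.
  have [M0 M00 h0] := @cont_rV_bounded n _ 0 L (smooth_cont sm).
  have hi i : exists M : R, 0 < M /\ forall y : 'rV[R]_n, `|y - 0| <= L -> `|pd i (mono (fun i => b i)) y| <= M.
    by have [M M1 hM] := @cont_rV_bounded n _ 0 L (smooth_cont (smooth_pd i sm)); exists M.
  have [M hM] := choice hi.
  exists (M0 + \sum_i M i); split=> [|y yL].
    by rewrite ltr_pwDl// sumr_ge0// => i _; apply: ltW; have [] := hM i.
  have s0 : 0 <= \sum_i M i by apply: sumr_ge0 => i _; apply: ltW; have [] := hM i.
  split=> [|i]; first by rewrite (le_trans (h0 y yL))// lerDl.
  have [_ /(_ y yL) h] := hM i; apply: (le_trans h); rewrite (bigD1 i)//=.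
  rewrite addrCA lerDl addr_ge0//.
  by apply: sumr_ge0 => j _; apply: ltW; have [] := hM j.
have [M hM] := choice H.
pose C := \sum_b C0 * M b + 1.
have s0 : 0 <= \sum_b C0 * M b.
  by apply: sumr_ge0 => b _; rewrite mulr_ge0//; apply: ltW; have [] := hM b.
exists C => [|f x0 d x pf d0 xL]; first by rewrite ltr_wpDl.
have sf := Pol_smooth pf.
pose g y := f (d *: y + x0).
have /Pol_polyfun[c cE] := Pol_scaled x0 d pf.
pose c' (b : I) := if ((mdeg b)%:Z <= N%:Z)%R then c b else 0.
have gE y : g y = \sum_(b : I) c' b * mono (fun i => b i) y.
  rewrite /g cE big_mkcond; apply: eq_bigr => b _; rewrite /c'.
  by case: ifP => // _; rewrite mul0r.
have cb b : `|c' b| <= C0 * enm x0 d f.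
  have := hC0 [ffun b => c' b] b; rewrite ffunE => h; apply: (le_trans h).
  rewrite /enm -/(g); apply: eq_ler; congr (_ * Num.sqrt _).
  by apply: eq_Rintegral => y _; rewrite -!/(g y) gE; under eq_bigr do rewrite ffunE.
pose y := d^-1 *: (x - x0).
have yL : `|y - 0| <= L.
  by rewrite subr0 normrZ gtr0_norm// mulrC ler_pdivrMr.
have xE : x = d *: y + x0 by exact: scaled_nat (lt0r_neq0 d0).
have e0 := enm_ge0 x0 d f.
have sumb (F : I -> R) : (forall b, `|F b| <= M b) -> `|\sum_b c' b * F b| <= C * enm x0 d f.
  move=> FM; apply: (le_trans (ler_norm_sum _ _ _)).
  apply: (@le_trans _ _ (\sum_b (C0 * M b) * enm x0 d f)).
    by apply: ler_sum => b _; rewrite normrM mulrAC ler_pM.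
  by rewrite -mulr_suml ler_wpM2r// lerDl.
split=> [|i].
  rewrite xE -/(g y) gE; apply: sumb => b; have [_ /(_ y yL)[]] := hM b; done.
have -> : pd i f x = d^-1 * pd i g y.
  by rewrite /g pd_scaled// mulrA mulVf// mul1r -xE.
rewrite normrM gtr0_norm// [C / d]mulrC -mulrA ler_pM2l//.
have -> : pd i g y = \sum_b c' b * pd i (mono (fun j => b j)) y.
  rewrite (_ : g = fun y => \sum_(b : I) c' b * mono (fun i => b i) y); last exact/funext.
  rewrite pd_sum; last by move=> b _; apply: smoothZ; exact: smooth_monoC.
  by apply: eq_bigr => b _; rewrite pdZ//; exact: smooth_monoC.
by apply: sumb => b; have [_ /(_ y yL)[]] := hM b.
Qed.

Lemma wdot_le n (f : 'rV[R]_n -> R) : continuous f ->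
  wdot f f <= dot lebn (@cball0 n) f f.
Proof.
move=> cf; apply: le_Rintegral; [exact: measurable_cball0|exact: wdot_I1| |].
  by apply: S2_mul; [exact: measurable_cball0|exact: cont_S2_cball0|exact: cont_S2_cball0].
move=> y _; rewrite -mulrA -[leRHS]mul1r ler_wpM2r -?expr2//.
by have /andP[] := beta_itv y.
Qed.

Lemma scaled_cont n (f : 'rV[R]_n -> R) (x0 : 'rV[R]_n) (d : R) : continuous f ->
  continuous (fun y : 'rV[R]_n => f (d *: y + x0)).
Proof.
move=> cf y; apply: (@continuous_comp _ _ _ (fun y : 'rV[R]_n => d *: y + x0) f); last exact: cf.
apply: (@continuousD _ _ _ (fun y : 'rV[R]_n => d *: y) (fun=> x0)); last exact: cst_continuous.
exact: scaler_continuous.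
Qed.

Lemma enm_le_sup n : exists2 C : R, 0 < C & forall (f : 'rV[R]_n -> R) (x0 : 'rV[R]_n) (d M : R),
  continuous f -> 0 < d -> (forall x : 'rV[R]_n, `|x - x0| <= d -> `|f x| <= M) -> enm x0 d f <= C * M.
Proof.
pose C := Num.sqrt (fine (lebn (@cball0 n))).
exists (C + 1) => [|f x0 d M cf d0 fM]; first by rewrite ltr_wpDl// sqrtr_ge0.
have cg := @scaled_cont n f x0 d cf.
have M0 : 0 <= M by apply: le_trans (fM x0 _); rewrite // subrr normr0.
apply: (@le_trans _ _ (nrm lebn (@cball0 n) (fun y => f (d *: y + x0)))).
  by rewrite /enm ler_wsqrtr// wdot_le.
rewrite (le_trans (@nrm_bounded _ _ _ lebn _ _ M _ _ _ M0 _))//.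
- exact: measurable_cball0.
- exact: leb_cball0_fin.
- by apply: measurable_funTS; exact: continuous_rV_measurable.
- move=> y; rewrite /cball0 /= subr0 => y1; apply: fM; rewrite addrK normrZ gtr0_norm//.
  by rewrite ler_piMr//.
- by rewrite mulrC ler_wpM2r// lerDl.
Qed.

Definition cball n (x0 : 'rV[R]_n) (d : R) : set 'rV[R]_n := [set x | `|x - x0| <= d].

Definition qbump n (x0 : 'rV[R]_n) (d : R) (x : 'rV[R]_n) : R := beta (d^-1 *: (x - x0)).

Lemma qbump_out n (x0 : 'rV[R]_n) d x : 0 < d -> qbump x0 d x != 0 -> cball x0 d x.
Proof.
move=> d0 /beta_out; rewrite normrZ gtr0_norm// mulrC ler_pdivrMr//.
by rewrite mul1r.
Qed.

Lemma qbump_itv n (x0 : 'rV[R]_n) d x : 0 <= qbump x0 d x <= 1.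
Proof. exact: beta_itv. Qed.

Lemma Rintegral_supp d (T : measurableType d) (mu : {measure set T -> \bar R})
    (D : set T) (F : T -> R) :
  (forall x, ~ D x -> F x = 0) -> \int[mu]_(x in D) F x = \int[mu]_x F x.
Proof.
move=> h; rewrite Rintegral_mkcond; apply: eq_Rintegral => x _; rewrite patchE.
by case: ifPn => //; rewrite notin_setE => /h ->.
Qed.

Lemma qbump_smooth n (x0 : 'rV[R]_n) d : smooth (qbump x0 d).
Proof.
apply: smooth_prod => i _.
have := @smooth_comp1 R n _ i d^-1 (- (d^-1 * x0 0 i)) rho1_C1k.
rewrite (_ : (fun x : 'rV[R]_n => _) = fun x => rho1 ((d^-1 *: (x - x0)) 0 i))//.
by apply/funext => x; rewrite !mxE mulrBr.
Qed.

Lemma cball_le_S2 n (f : 'rV[R]_n -> R) (x0 : 'rV[R]_n) (d : R) : continuous f -> 0 < d ->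
  S2 lebn (cball x0 d) f.
Proof.
move=> cf d0; apply: (@cont_S2 n f x0 d) => //.
exact: cball_measurable.
Qed.

Lemma Rintegral_scaled n (F : 'rV[R]_n -> R) (x0 : 'rV[R]_n) (d : R) : 0 < d ->
  measurable_fun setT F -> (forall x, 0 <= F x) ->
  d ^+ n * \int[lebn]_y F (d *: y + x0) = \int[lebn]_x F x.
Proof.
move=> d0 mF F0; have dn : 0 < d ^+ n by [].
have := @integral_lin R n _ x0 _ (fun x => (F x)%:E) (Lin_scalar n d0).
move=> /(_ _ _)/(congr1 fine) h.
rewrite /Rintegral; under eq_integral do rewrite -mul_mx_scalar.
rewrite h; [|exact/measurable_EFinP|by move=> x; rewrite lee_fin].
have : (0 <= \int[lebn]_x (F x)%:E)%E by apply: integral_ge0 => x _; rewrite lee_fin.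
case: (\int[lebn]_x (F x)%:E)%E => [r|_|//].
  by move=> _ /=; rewrite mulrA mulfV// mul1r.
by rewrite gt0_muley ?lte_fin//= mulr0.
Qed.

(** In this form the weighted norm is the pairing of f with [qbump] times f, a smooth function
    supported in the cube, which can serve as a test function. *)
Lemma enm_integral n (f : 'rV[R]_n -> R) (x0 : 'rV[R]_n) (d : R) (S : set 'rV[R]_n) :
  continuous f -> 0 < d -> cball x0 d `<=` S ->
  d ^+ n * enm x0 d f ^+ 2 = \int[lebn]_(x in S) (qbump x0 d x * f x * f x).
Proof.
move=> cf d0 QS; rewrite Rintegral_supp; last first.
  move=> x nS; have [->|b0] := eqVneq (qbump x0 d x) 0; first by lra.
  by exfalso; apply: nS; apply: QS; exact: qbump_out b0.
have bf0 x : 0 <= qbump x0 d x * f x * f x.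
  by rewrite -mulrA mulr_ge0 -?expr2//; have /andP[] := qbump_itv x0 d x.
have cb := smooth_cont (qbump_smooth x0 d).
rewrite -(@Rintegral_scaled n _ x0 d)//; last first.
  by apply: measurable_funM; [apply: measurable_funM|]; exact: continuous_rV_measurable.
congr (_ * _); rewrite /enm sqr_sqrtr; last first.
  apply: Rintegral_ge0 => y _; rewrite -mulrA mulr_ge0 -?expr2//.
  by have /andP[] := beta_itv y.
rewrite /wdot Rintegral_supp; last first.
  move=> y ny; have [->|b0] := eqVneq (beta y) 0; first by lra.
  by exfalso; apply: ny; rewrite /cball0 /= subr0; exact: beta_out.
apply: eq_Rintegral => y _; rewrite /qbump addrK scalerA mulVf// scale1r//.
Qed.

Lemma enm_le_nrm n (f : 'rV[R]_n -> R) (x0 : 'rV[R]_n) (d : R) (S : set 'rV[R]_n) :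
  continuous f -> 0 < d -> mrV S -> cball x0 d `<=` S -> S2 lebn S f ->
  d ^+ n * enm x0 d f ^+ 2 <= nrm lebn S f ^+ 2.
Proof.
move=> cf d0 mS QS sf; rewrite (enm_integral cf d0 QS) nrm_sqr.
have mb : measurable_fun S (qbump x0 d).
  by apply: measurable_funTS; exact: smooth_measurable (qbump_smooth x0 d).
apply: le_Rintegral => //; [|exact: S2_mul|].
  apply: S2_mul => //; apply: (@S2_mulb _ _ _ _ _ _ _ 1) => // x _.
  by have := qbump_itv x0 d x => /andP[b0 b1]; rewrite ger0_norm.
move=> x _; rewrite -mulrA -[leRHS]mul1r ler_wpM2r -?expr2//.
by have /andP[] := qbump_itv x0 d x.
Qed.

End Polynomials.

(** * Star-shaped domains with flat boundary pieces *)

(* A domain of R^(d+1), star-shaped with respect to the cube of centre gx0 and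
   half-side gr, whose boundary is cut in flat pieces, each containing a cube of
   half-side gq, with disjoint relative interiors. All lengths are in the sup norm. *)
Record gdom (R : realType) (d : nat) := GDom {
  gN : nat;
  gD : set 'rV[R]_d.+1;
  gx0 : 'rV[R]_d.+1;
  gr : R;
  gh : R;
  gq : R;
  gbd : 'I_gN -> cell R d d.+1;
  gt : 'I_gN -> 'rV[R]_d;
  g_compact : compact gD;
  g_nonempty : exists x, gD x;
  g_r0 : 0 < gr;
  g_q0 : 0 < gq;
  g_diam : forall x y, gD x -> gD y -> `|x - y| <= gh;
  g_star : forall y, `|y - gx0| <= gr -> forall x, gD x -> seg y x `<=` gD;
  g_iso : forall i, isometric (gbd i);
  g_cdom : forall i, compact (cdom (gbd i));
  g_bd : boundary gD = [set x | exists i, cset (gbd i) x];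
  g_disc : forall i t, `|t - gt i| <= gq -> cdom (gbd i) t;
  g_sep : forall i j, i != j -> forall t, interior (cdom (gbd i)) t -> ~ cset (gbd j) (chart (gbd i) t)
}.

Lemma cone_point {R : realType} m (p b x : 'rV[R]_m) (s : R) :
  p + b + s *: (x - (p + b)) = p + s *: (x - p) + (1 - s) *: b.
Proof. by apply/rowP => k; rewrite !mxE; ring. Qed.

Lemma cone_point' {R : realType} m (p b x : 'rV[R]_m) (s : R) :
  p + b + (1 - s) *: (x - (p + b)) = x + s *: (p - x) + s *: b.
Proof. by apply/rowP => k; rewrite !mxE; ring. Qed.

Section Domain.
Context {R : realType} {d : nat} (G : gdom R d).
Local Notation n := d.+1.
Local Notation D := (gD G).
Local Notation x0 := (gx0 G).
Local Notation r := (gr G).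
Local Notation h := (gh G).
Local Notation N := (gN G).
Local Notation bd := (gbd (g := G)).
Implicit Types (x y : 'rV[R]_n) (i j : 'I_N) (t : 'rV[R]_d) (s : R).

Lemma g_closed : closed D.
Proof. by apply: compact_closed (g_compact (g := G)); exact: norm_hausdorff. Qed.

Lemma g_measurable : mrV D.
Proof. exact: compact_rV_measurable (g_compact (g := G)). Qed.

Lemma g_cube x : `|x - x0| <= r -> D x.
Proof.
move=> hx; have [z Dz] := g_nonempty G.
apply: (g_star hx Dz); exists 0; first by lra.
by rewrite scale0r addr0.
Qed.

Lemma g_center : D x0.
Proof. by apply: g_cube; rewrite subrr normr0 ltW// g_r0. Qed.

Lemma g_near x : D x -> `|x - x0| <= h.
Proof. by move=> Dx; apply: g_diam => //; exact: g_center. Qed.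

Lemma g_rh : r <= h.
Proof.
have r0 := g_r0 G.
have E : (const_mx r : 'rV[R]_n) = r *: const_mx 1.
  by apply/matrixP => a b; rewrite !mxE mulr1.
have N1 : `|const_mx 1 : 'rV[R]_n| = 1.
  apply/eqP; rewrite eq_le; apply/andP; split.
    by apply/rVnorm_leP => // i; rewrite mxE normr1.
  by have := coord_le_norm (const_mx 1 : 'rV[R]_n) ord0; rewrite mxE normr1.
have := @g_near (x0 + const_mx r).
rewrite addrAC subrr add0r E normrZ N1 mulr1 gtr0_norm//; apply.
by apply: g_cube; rewrite addrAC subrr add0r normrZ N1 mulr1 gtr0_norm.
Qed.

Lemma g_h0 : 0 < h. Proof. exact: lt_le_trans (g_r0 G) g_rh. Qed.

(** The cube of half-side (1 - s) r about x0 + s (x - x0) is the image of the star cube under the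
    homothety of centre x and ratio 1 - s. *)
Lemma g_inner x s y : D x -> 0 <= s <= 1 ->
  `|y - (x0 + s *: (x - x0))| <= (1 - s) * r -> D y.
Proof.
move=> Dx /andP[s0]; rewrite le_eqVlt => /predU1P[->|s1].
  rewrite subrr mul0r normr_le0 subr_eq0 scale1r => /eqP ->.
  by rewrite addrC subrK.
move=> yr; have s10 : 0 < 1 - s by lra.
pose b := (1 - s)^-1 *: (y - (x0 + s *: (x - x0))).
have br : `|x0 + b - x0| <= r.
  rewrite addrAC subrr add0r normrZ gtr0_norm//.
  by rewrite mulrC ler_pdivrMr// mulrC.
apply: (g_star br Dx); exists s; first by lra.
have bE : (1 - s) *: b = y - (x0 + s *: (x - x0)) by rewrite scalerA mulfV// scale1r.
by rewrite cone_point bE addrC subrK.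
Qed.

Lemma interior_rV (A : set 'rV[R]_n) x : interior A x <->
  exists2 e : R, 0 < e & forall y, `|y - x| < e -> A y.
Proof.
split=> [/nbhs_ballP[e /= e0 he]|[e e0 he]].
  by exists e => // y yx; apply: he; rewrite ball_rVE /= distrC.
by apply/nbhs_ballP; exists e => //= y; rewrite ball_rVE /= distrC => /he.
Qed.

Lemma boundary_gdom x : boundary D x <-> D x /\ ~ interior D x.
Proof.
rewrite /boundary (_ : closure D = D)//.
by apply/esym/closure_id; exact: g_closed.
Qed.

Lemma bd_in i t : cdom (bd i) t -> D (chart (bd i) t) /\ ~ interior D (chart (bd i) t).
Proof.
move=> ct; apply/boundary_gdom; rewrite g_bd; exists i; by exists t.
Qed.

Lemma g_inner_int x s : D x -> 0 <= s < 1 -> interior D (x0 + s *: (x - x0)).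
Proof.
move=> Dx /andP[s0 s1]; apply/interior_rV; exists ((1 - s) * r).
  by rewrite mulr_gt0 ?subr_gt0// g_r0.
by move=> y /ltW; apply: g_inner => //; rewrite s0 ltW.
Qed.

Lemma chart_comb i t t' s : chart (bd i) (t + s *: (t' - t)) =
  chart (bd i) t + s *: (chart (bd i) t' - chart (bd i) t).
Proof.
by rewrite /chart mulmxDl -scalemxAl mulmxBl opprD addrACA subrr add0r addrA.
Qed.

(* The star-shapedness keeps the planes of the boundary pieces off the cube. *)
Lemma g_plane i t : r <= `|chart (bd i) t - x0|.
Proof.
rewrite leNgt; apply/negP => lt_r.
have q0 := g_q0 G; pose c := gt i.
have Dc : cdom (bd i) c by apply: g_disc; rewrite subrr normr0.
have [Dy _] := bd_in Dc.
have m0 : 0 < Num.min (1 / 2) (gq G / (2 * (`|t - c| + 1))).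
  by rewrite lt_min !divr_gt0//.
(* With this ratio the point c + s (t - c) stays in the cube of half-side [gq] about c, hence in the
   piece. If the point over t were in the star cube, this boundary point would be interior to D,
   being strictly between it and a point of D. *)
pose s := Num.min (1 / 2) (gq G / (2 * (`|t - c| + 1))).
have s1 : s < 1 by rewrite gt_min; apply/orP; left; lra.
have Dt : cdom (bd i) (c + s *: (t - c)).
  apply: g_disc; rewrite addrAC subrr add0r normrZ gtr0_norm//.
  apply: (@le_trans _ _ (gq G / (2 * (`|t - c| + 1)) * `|t - c|)).
    by rewrite ler_wpM2r// ge_min lexx orbT.
  rewrite mulrAC ler_pdivrMr// ler_pM2l//.
  by have := normr_ge0 (t - c); lra.
have [_ []] := bd_in Dt; rewrite chart_comb.
set b := chart (bd i) t in lt_r *; set y := chart (bd i) c in Dy *.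
apply/interior_rV; exists (s * (r - `|b - x0|)); first by rewrite mulr_gt0// subr_gt0.
move=> z hz.
pose b' := b + s^-1 *: (z - (y + s *: (b - y))).
have b'r : `|b' - x0| <= r.
  rewrite /b' addrAC (le_trans (ler_normD _ _))// -lerBrDl normrZ gtr0_norm//.
  by rewrite mulrC ler_pdivrMr// mulrC ltW.
apply: (g_star b'r Dy); exists (1 - s); first by rewrite subr_ge0 ltW//= lerBlDr lerDl.
have bE : s *: (s^-1 *: (z - (y + s *: (b - y)))) = z - (y + s *: (b - y)).
  by rewrite scalerA mulfV// scale1r.
by rewrite cone_point' bE addrC subrK.
Qed.

Definition gB i : 'M[R]_(1 + d, n) := col_mx (chart (bd i) (gt i) - x0) (cdir (bd i)).

Lemma gB_mul i (l : R) (v : 'rV[R]_d) :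
  rV_cons (l, v) *m gB i = l *: (chart (bd i) (gt i) - x0) + v *m cdir (bd i).
Proof. by rewrite rV_consE /gB (mul_row_col l%:M) mul_scalar_mx. Qed.

(** The rows of [cdir] are independent by isometry, and a relation involving the first row would put
    x0 on the plane of the piece, against [g_plane]. *)
Lemma gB_unit i : (gB i : 'M[R]_n) \in unitmx.
Proof.
rewrite -row_free_unit -kermx_eq0; apply/eqP/row_matrixP => k; rewrite row0.
have : row k (kermx (gB i : 'M[R]_n)) *m (gB i : 'M[R]_n) = 0 by rewrite -row_mul mulmx_ker row0.
set u := row k _ => hu; rewrite -(_ : rV_cons (rV_uncons u) = u); last first.
  apply/rowP => j; rewrite mxE; case: (unliftP ord0 j) => [l|] ->//=.
  by rewrite mxE.
have := hu; rewrite -{1}(_ : rV_cons (rV_uncons u) = u); last first.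
  apply/rowP => j; rewrite mxE; case: (unliftP ord0 j) => [l|] ->//=.
  by rewrite mxE.
rewrite /rV_uncons gB_mul; set l := u 0 ord0; set v := \row__ _ => E.
have l0 : l = 0.
  apply: contrapT => /eqP nl; have := @g_plane i (gt i - l^-1 *: - v).
  have -> : chart (bd i) (gt i - l^-1 *: - v) - x0 = 0.
    apply: (scalerI nl); rewrite scaler0 -E /chart scalerN opprK mulmxDl -scalemxAl.
    by rewrite !scalerDr scalerA mulfV// scale1r; rewrite -!addrA; congr (_ + (_ + _)); rewrite addrC.
  by rewrite normr0 leNgt g_r0.
have v0 : v = 0.
  move: E; rewrite l0 scale0r add0r => /(congr1 (mulmx^~ (cdir (bd i))^T)).
  by rewrite -mulmxA (g_iso (g := G) i) mulmx1 mul0mx.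
by rewrite l0 v0; apply/rowP => j; rewrite !mxE; case: unlift => [?|]; rewrite ?mxE.
Qed.

Definition gX i (s : R) t : 'rV[R]_n := x0 + s *: (chart (bd i) t - x0).

(* Conical coordinates: x = gX i (gl i x) (gtau i x) wherever gl i x != 0. *)
Definition gy i x : 'rV[R]_n := (x - x0) *m invmx (gB i : 'M[R]_n).
Definition gl i x : R := gy i x 0 ord0.
Definition gtau i x : 'rV[R]_d := gt i + (gl i x)^-1 *: (rV_uncons (gy i x)).2.

Lemma rV_unconsK m : cancel (@rV_uncons R m) (@rV_cons R m).
Proof.
by move=> u; apply/rowP => j; rewrite mxE; case: (unliftP ord0 j) => [l|] ->//=; rewrite mxE.
Qed.

Lemma gX_cons i s t : gX i s t = rV_cons (s, s *: (t - gt i)) *m gB i + x0.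
Proof.
rewrite gB_mul /gX addrC; congr (_ + _); rewrite -scalemxAl -scalerDr; congr (_ *: _).
by rewrite /chart mulmxBl; apply/rowP => k; rewrite !mxE; ring.
Qed.

Lemma gy_cons i u : gy i (u *m (gB i : 'M[R]_n) + x0) = u.
Proof. by rewrite /gy addrK mulmxK// gB_unit. Qed.

Lemma gl_X i s t : gl i (gX i s t) = s.
Proof. by rewrite /gl gX_cons gy_cons mxE unlift_none. Qed.

Lemma gtau_X i s t : s != 0 -> gtau i (gX i s t) = t.
Proof.
move=> s0; rewrite /gtau gl_X gX_cons gy_cons rV_consK /= scalerA mulVf// scale1r.
by rewrite addrC subrK.
Qed.

Lemma gX_K i x : gl i x != 0 -> gX i (gl i x) (gtau i x) = x.
Proof.
move=> l0; rewrite gX_cons /gtau [gt i + _]addrC addrK scalerA mulfV// scale1r.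
rewrite (_ : rV_cons _ = gy i x); last by rewrite -[RHS]rV_unconsK.
by rewrite /gy mulmxKV ?subrK// gB_unit.
Qed.

Definition gP i (a : R) : set 'rV[R]_n := [set x | a < gl i x <= 1 /\ cdom (bd i) (gtau i x)].

Lemma gP_X i a s t : 0 <= a -> a < s -> gP i a (gX i s t) <-> s <= 1 /\ cdom (bd i) t.
Proof.
move=> a0 as1; have s0 : s != 0 by lra.
by rewrite /gP /= gl_X gtau_X// as1.
Qed.

Lemma gP_ex i a x : 0 <= a -> gP i a x ->
  exists s t, [/\ a < s <= 1, cdom (bd i) t & x = gX i s t].
Proof.
move=> a0 [/andP[al l1] ct]; exists (gl i x), (gtau i x); split=> //.
  by rewrite al.
by rewrite gX_K// gt_eqF// (le_lt_trans a0).
Qed.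

Lemma gX_D i s t : 0 <= s <= 1 -> cdom (bd i) t -> D (gX i s t).
Proof.
move=> s01 ct; have [Dy _] := bd_in ct.
apply: (@g_inner (chart (bd i) t) s) => //; rewrite subrr normr0 mulr_ge0 ?(ltW (g_r0 G))//.
by lra.
Qed.

Lemma gP_D i a : 0 <= a -> gP i a `<=` D.
Proof.
move=> a0 x /(gP_ex a0)[s [t [/andP[as1 s1] ct ->]]]; apply: gX_D => //.
by lra.
Qed.

(** By [g_inner_int] a point of D other than the end of its ray is interior, so each ray meets the
    boundary only once. *)
Lemma ray_unique i j s s' t t' : 0 < s -> 0 < s' -> cdom (bd i) t -> cdom (bd j) t' ->
  gX i s t = gX j s' t' -> s = s' /\ chart (bd i) t = chart (bd j) t'.
Proof.
move=> s0 s'0 ct ct' E.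
have key (y y' : 'rV[R]_n) (a b : R) : 0 < a -> 0 < b -> D y' -> ~ interior D y ->
    x0 + a *: (y - x0) = x0 + b *: (y' - x0) -> a <= b.
  move=> a0 b0 Dy' ny /addrI h; rewrite leNgt; apply/negP => ba; apply: ny.
  rewrite (_ : y = x0 + (b / a) *: (y' - x0)).
    by apply: g_inner_int => //; rewrite divr_ge0//= ltr_pdivrMr// mul1r.
  by rewrite mulrC -scalerA -h scalerA mulVf// scale1r addrC subrK.
have [Dy ny] := bd_in ct; have [Dy' ny'] := bd_in ct'.
have ss' : s = s'.
  apply/eqP; rewrite eq_le (key _ _ _ _ s0 s'0 Dy' ny E)//=.
  exact: (key _ _ _ _ s'0 s0 Dy ny' (esym E)).
split=> //; move: E; rewrite ss' /gX => /addrI.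
by move=> /(scalerI (lt0r_neq0 s'0)) /addIr.
Qed.

(** The ray from x0 through x leaves D at the parameter T >= 1; this last point is on the boundary,
    hence in some piece, and x sits at height 1/T below it. *)
Lemma g_cover x : D x -> x != x0 -> exists i, gP i 0 x.
Proof.
move=> Dx xx0.
have xn : 0 < `|x - x0| by rewrite normr_gt0 subr_eq0.
pose A := [set t : R | 0 <= t /\ D (x0 + t *: (x - x0))].
have A1 : A 1 by split=> //; rewrite scale1r addrC subrK.
have ubA : ubound A (h / `|x - x0|).
  move=> t [t0 /g_near]; rewrite addrAC subrr add0r normrZ ger0_norm// => ht.
  by rewrite ler_pdivlMr.
have supA : has_sup A by split; [exists 1|exists (h / `|x - x0|)].
pose T := sup A.
have T1 : 1 <= T by apply: ub_le_sup => //; exists (h / `|x - x0|).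
have T0 : 0 < T by lra.
have clA : closed [set t : R | D (x0 + t *: (x - x0))].
  apply: (@preimage_closed _ _ (fun t : R => x0 + t *: (x - x0)) D); last exact: g_closed.
  move=> t _; apply: (@continuousD _ _ _ (fun=> x0) (fun t : R => t *: (x - x0))).
    exact: cst_continuous.
  exact: scalel_continuous.
have DT : D (x0 + T *: (x - x0)).
  apply: clA => B /nbhs_ballP[e /= e0 eB].
  have [t At tT] := sup_adherent e0 supA.
  exists t; split; first by have [] := At.
  apply: eB; rewrite -ball_normE /=.
  have tle : t <= T by apply: ub_le_sup => //; exists (h / `|x - x0|).
  by rewrite ger0_norm ?subr_ge0// ltrBlDr -ltrBlDl.
have nT : ~ interior D (x0 + T *: (x - x0)).
  move=> /interior_rV[e e0 he].
  pose u := e / (2 * `|x - x0|).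
  have u0 : 0 < u by rewrite divr_gt0// mulr_gt0.
  have : A (T + u).
    split => //.
    apply: he; rewrite opprD addrACA subrr add0r -scalerBl addrAC subrr add0r normrZ gtr0_norm//.
    rewrite /u (_ : e / (2 * `|x - x0|) * `|x - x0| = e / 2); last by field; rewrite gt_eqF.
    by lra.
  move=> /(ub_le_sup (ex_intro _ _ ubA)); rewrite -/T; lra.
have : boundary D (x0 + T *: (x - x0)) by apply/boundary_gdom.
rewrite g_bd => -[i [t ct tE]]; exists i.
have E : x = gX i T^-1 t.
  rewrite /gX tE addrAC subrr add0r scalerA mulVf// scale1r addrC subrK//.
rewrite E; apply/(gP_X _ _ (lexx 0)) => //.
by split=> //; rewrite invf_le1.
Qed.

Definition glayer (e : R) : set 'rV[R]_n := [set x | exists i, gP i (1 - e) x].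

(** Outside the layer a point sits at height s <= 1 - e on its ray, so that [g_inner] leaves a cube
    of half-side (1 - s) r >= e r around it. *)
Lemma g_layer e x : 0 <= e <= 1 -> D x -> ~ glayer e x ->
  forall y, `|y - x| <= e * r -> D y.
Proof.
move=> /andP[e0 e1] Dx nl y yx; have [xE|xx0] := eqVneq x x0.
  by apply: g_cube; rewrite -xE (le_trans yx)// ler_piMl// (ltW (g_r0 G)).
have [i /(gP_ex (lexx 0))[s [t [/andP[s0 s1] ct xX]]]] := g_cover Dx xx0.
have se : s <= 1 - e.
  rewrite leNgt; apply/negP => h1; apply: nl; exists i; rewrite xX.
  by apply/gP_X; rewrite ?subr_ge0.
have [Dy _] := bd_in ct.
apply: (@g_inner (chart (bd i) t) s) => //; first by rewrite ltW.
rewrite -/(gX i s t) -xX (le_trans yx)// ler_wpM2r ?(ltW (g_r0 G))//; lra.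
Qed.

Lemma glayer_D e : 0 <= e <= 1 -> glayer e `<=` D.
Proof. by move=> /andP[e0 e1] x [i]; apply: gP_D; rewrite subr_ge0. Qed.

Lemma measurable_invR : measurable_fun [set: R] (fun x : R => x^-1).
Proof.
have E : [set: R] = [set x | x != 0] `|` [set 0].
  apply/seteqP; split=> // x _; have [->|x0] := eqVneq x 0; [by right|by left].
have o0 : open [set x : R | x != 0].
  rewrite (_ : mkset _ = ~` [set 0]); first exact: closed_openC (@closed_eq _ 0).
  by apply/seteqP; split=> x /=; [move=> /eqP|move=> /eqP].
rewrite E; apply/measurable_funU => //; first exact: open_measurable.
split; last exact: measurable_fun_set1.
apply: open_continuous_measurable_fun => // x; rewrite inE /= => xn.
exact: inv_continuous.
Qed.

Lemma gy_measurable i : measurable_fun setT (@gy i).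
Proof.
have := measurable_affine (invmx (gB i : 'M[R]_n)) (- (x0 *m invmx (gB i : 'M[R]_n))).
by rewrite /gy; under eq_fun do rewrite -mulmxBl.
Qed.

Lemma gl_measurable i : measurable_fun setT (@gl i).
Proof. exact: measurableT_comp (@measurable_coord _ R n ord0) (@gy_measurable i). Qed.

Lemma gtau_measurable i : measurable_fun setT (@gtau i).
Proof.
apply: measurable_fun_rV => j; rewrite /gtau.
have -> : (fun x => (gt i + (gl i x)^-1 *: (rV_uncons (gy i x)).2) 0 j) =
    (fun x => gt i 0 j + (gl i x)^-1 * gy i x 0 (lift ord0 j)).
  by apply/funext => x; rewrite !mxE /=; congr (_ + _ * _); rewrite mxE.
apply: measurable_funD => //; apply: measurable_funM.
  exact: measurableT_comp measurable_invR (@gl_measurable i).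
exact: measurableT_comp (@measurable_coord _ R n _) (@gy_measurable i).
Qed.

Lemma gcdom_measurable i : mrV (cdom (bd i)).
Proof. apply: compact_rV_measurable; exact: g_cdom. Qed.

Lemma gP_measurable i a : mrV (gP i a).
Proof.
have -> : gP i a = [set x | `]a, 1]%classic (gl i x)] `&` [set x | cdom (bd i) (gtau i x)].
  by [].
apply: measurableI.
  by apply: (measurable_preim (@gl_measurable i)); exact: measurable_itv.
by apply: (measurable_preim (@gtau_measurable i)); exact: gcdom_measurable.
Qed.

Lemma gX_measurable i : measurable_fun [set: measurableTypeR R * 'rV[R]_d] (fun p => gX i p.1 p.2).
Proof.
apply: measurable_fun_rV => j; rewrite /gX /chart.
under eq_fun do rewrite !mxE.
apply: measurable_funD => //; apply: measurable_funM; first exact: measurable_fst.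
apply: measurable_funB => //; apply: measurable_funD => //.
apply: measurable_sum => k; apply: measurable_funM => //.
exact: (measurableT_comp (@measurable_coord _ R d k) measurable_snd).
Qed.

Lemma gc_ex i : exists c, 0 < c /\ Lin (gB i : 'M[R]_n) c^-1.
Proof.
have [c Lc] := Lin_unit (gB_unit i); exists c^-1; rewrite invrK; split=> //.
by rewrite invr_gt0; case: Lc.
Qed.

(** This is |det gB|, the distance from x0 to the plane of the piece, selected by its effect on
    measures. *)
Definition gc i : R := xget 0 [set c | 0 < c /\ Lin (gB i : 'M[R]_n) c^-1].

Lemma gcP i : 0 < gc i /\ Lin (gB i : 'M[R]_n) (gc i)^-1.
Proof. exact: xgetPex (gc_ex i). Qed.

Lemma integral_cons (K : 'rV[R]_n -> \bar R) : measurable_fun setT K -> (forall x, (0 <= K x)%E) ->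
  (\int[lebn]_x K x = \int[@lebesgue_measure R]_s \int[lebn]_y K (rV_cons (s, y)))%E.
Proof.
move=> mK K0.
have := @integral_image _ _ _ _ _ (product_measure1 (@lebesgue_measure R) lebn) lebn (@rV_cons R d) 1
  (@measurable_rV_cons R d) ler01.
move=> /(_ _ K mK K0); rewrite mul1e => <-; last by move=> A mA; rewrite mul1e.
apply: (@fubini_tonelli1 _ _ (measurableTypeR R) _ _ _ _ (fun p => K (rV_cons p))).
  exact: measurableT_comp mK (@measurable_rV_cons R d).
by [].
Qed.

(** Integration in conical coordinates. The section of the cone at height s is the piece scaled by
    s, whence the factor s^d; the linear map [gB] contributes [gc]. *)
Lemma polar i a (F : 'rV[R]_n -> \bar R) : 0 <= a -> measurable_fun setT F ->
  (forall x, (0 <= F x)%E) ->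
  (\int[lebn]_(x in gP i a) F x = (gc i)%:E *
    \int[@lebesgue_measure R]_(s in `]a, 1%R]) \int[lebn]_(t in cdom (bd i)) ((s ^+ d)%:E * F (gX i s t)))%E.
Proof.
move=> a0 mF F0; have [c0 Lc] := gcP i; have mP := gP_measurable i a.
pose H := F \_ (gP i a).
have mH : measurable_fun setT H.
  by apply/(measurable_restrictT _ _).1 => //; exact: measurable_funTS.
have H0 x : (0 <= H x)%E by rewrite /H patchE; case: ifP.
rewrite integral_mkcond -/H.
have -> : (\int[lebn]_x H x = (gc i)%:E * \int[lebn]_y H (y *m (gB i : 'M[R]_n) + x0)%R)%E.
  by rewrite (integral_lin x0 Lc mH H0) muleA -EFinM mulfV// mul1e.
congr (_ * _)%E; rewrite integral_cons//; last first.
  exact: measurableT_comp mH (measurable_affine (gB i : 'M[R]_n) x0).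
rewrite [RHS]integral_mkcond; apply: eq_integral => s _; rewrite patchE /=.
case: ifPn => [|ns]; last first.
  rewrite integral0_eq// => y _; rewrite /H patchE memNset//= => -[].
  by rewrite /gl gy_cons mxE unlift_none => /andP[h1 h2] _; move/negP: ns; apply; rewrite inE /= in_itv/= h1.
rewrite inE /= in_itv/= => /andP[as1 s1]; have s0 : 0 < s by lra.
pose K' (y : 'rV[R]_d) := H (rV_cons (s, y) *m (gB i : 'M[R]_n) + x0).
have mK' : measurable_fun setT K'.
  apply: (measurableT_comp mH); apply: (measurableT_comp (measurable_affine (gB i : 'M[R]_n) x0)).
  apply: (measurableT_comp (@measurable_rV_cons R d)).
  exact: (@pair1_measurable _ _ (measurableTypeR R)).
have -> : (\int[lebn]_y K' y = (s ^+ d)%:E * \int[lebn]_t K' (t *m s%:M - s *: gt i)%R)%E.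
  rewrite (integral_lin _ (Lin_scalar d s0) mK') ?muleA -?EFinM ?mulfV ?mul1e//.
  by move=> y; exact: H0.
rewrite -ge0_integralZl_EFin//; last 2 first.
- by move=> t _; exact: H0.
- exact: measurableT_comp mK' (measurable_affine s%:M _).
rewrite [RHS]integral_mkcond; apply: eq_integral => t _.
have -> : K' (t *m s%:M - s *: gt i) = H (gX i s t).
  by rewrite /K' gX_cons mul_mx_scalar scalerBr.
rewrite /H !patchE; have [/set_mem ct|nt] := boolP (t \in cdom (bd i)).
  by rewrite mem_set//; apply/gP_X.
by rewrite memNset ?mule0// => /(gP_X _ _ a0 as1)[_ ct]; move/negP: nt; apply; rewrite inE.
Qed.

End Domain.

Lemma segment_fin {R : realType} (a b : R) : (@lebesgue_measure R `[a, b]%classic < +oo)%E.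
Proof. by rewrite lebesgue_measure_itv/=; case: ifP => _; rewrite// -EFinD ltry. Qed.

Lemma left_open_measure {R : realType} (a b : R) : a <= b ->
  @lebesgue_measure R `]a, b]%classic = (b - a)%:E.
Proof.
move=> ab; rewrite lebesgue_measure_itv/= lte_fin; case: ltP => h => //.
by congr (_%:E); lra.
Qed.

(** The fundamental theorem of calculus followed by Cauchy-Schwarz against the constant 1. *)
Lemma ftc_sq {R : realType} (g g' : R -> R) (a b : R) : a < b ->
  (forall s, hasder g s (g' s)) -> continuous g' ->
  (g b - g a) ^+ 2 <= (b - a) * \int[@lebesgue_measure R]_(s in `[a, b]) (g' s ^+ 2).
Proof.
move=> ab gd cg'; pose mu := @lebesgue_measure R.
have gi s : is_derive (s : R) (1 : R) g (g' s) by apply/hasder_is_derive.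
have cg : continuous g by move=> s; apply: differentiable_continuous; apply/derivable1_diffP; case: (gi s).
have mab : measurable `[a, b]%classic by [].
have muab : (mu `[a, b]%classic < +oo)%E.
  exact: segment_fin.
have mg' : measurable_fun [set: R] g' by exact: continuous_measurable_fun.
have [M hM] : exists M, forall s, `[a, b]%classic s -> `|g' s| <= M.
  have /compact_bounded[M [_ hM]] : compact (g' @` `[a, b]%classic).
    by apply: continuous_compact; [exact: continuous_subspaceT|exact: segment_compact].
  by exists (M + 1) => s abs; apply: (hM (M + 1)); [rewrite ltrDl|exists s].
have E : \int[mu]_(s in `[a, b]) g' s = g b - g a.
  rewrite /Rintegral (@continuous_FTC2 _ g' g a b ab)//.
  - exact: continuous_subspaceT.
  - split; first by move=> s _; case: (gi s).
      by apply: cvg_at_right_filter; exact: cg.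
    by apply: cvg_at_left_filter; exact: cg.
  - by move=> s _; rewrite derive1E; apply: derive_val.
have s1 : S2 mu `[a, b]%classic (fun=> 1).
  by apply: (@S2_bounded _ _ _ _ _ _ 1) => // s _; rewrite normr1.
have s2 : S2 mu `[a, b]%classic g'.
  by apply: (@S2_bounded _ _ _ _ _ _ M) => //; exact: measurable_funTS.
have := @cauchy_schwarz _ _ _ mu _ _ _ mab s1 s2.
rewrite /dot; under eq_Rintegral do rewrite mul1r.
rewrite E => h; rewrite -[leLHS]real_normK ?num_real//.
apply: (@le_trans _ _ ((nrm mu `[a, b]%classic (fun=> 1) * nrm mu `[a, b]%classic g') ^+ 2)).
  by rewrite lerXn2r ?nnegrE ?mulr_ge0 ?nrm_ge0.
rewrite exprMn !nrm_sqr /dot mulr1; under [X in _ * X <= _]eq_Rintegral do rewrite -expr2.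
rewrite Rintegral_cst// mul1r.
suff -> : fine (mu `[a, b]%classic) = b - a by [].
by rewrite /mu lebesgue_measure_itv/= lte_fin ab.
Qed.

Lemma sum_sqr_le {R : realType} n (G : 'I_n -> R) : (\sum_j G j) ^+ 2 <= n%:R * \sum_j G j ^+ 2.
Proof.
set S := \sum_j G j; set Q := \sum_j _.
have [n0|n0] := posnP n; first by rewrite /S /Q; move: G @S @Q; rewrite n0 => G; rewrite !big_ord0 expr0n mulr0.
have n0' : (0 : R) < n%:R by rewrite ltr0n.
have key : 0 <= \sum_j (n%:R * G j - S) ^+ 2 by [].
have E : \sum_j (n%:R * G j - S) ^+ 2 = n%:R ^+ 2 * Q - 2 * n%:R * S * S + n%:R * S ^+ 2.
  rewrite (eq_bigr (fun j => n%:R ^+ 2 * G j ^+ 2 - 2 * n%:R * S * G j + S ^+ 2)); last by move=> j _; ring.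
  rewrite big_split /= sumrB -!mulr_sumr; congr (_ - _ + _).
  by rewrite sumr_const card_ord -mulr_natr; ring.
rewrite -(ler_pM2l n0'); move: key; rewrite E; nra.
Qed.

Lemma smooth_compose {R : realType} n m (f : 'rV[R]_m -> R) (T : 'rV[R]_n -> 'rV[R]_m) :
  smooth f -> (forall j, smooth (fun x => T x 0 j)) -> smooth (fun x => f (T x)).
Proof.
move=> sf sT.
have gr (h : 'rV[R]_m -> R) (x : 'rV[R]_n) : smooth h ->
    hasgrad (fun y => h (T y)) x (fun i => \sum_j pd j h (T x) * pd i (fun y => T y 0 j) x).
  by move=> sh; apply: hasgrad_comp; [exact: smooth_hasgrad|move=> j; exact: smooth_hasgrad (sT j)].
move=> k; elim: k f sf => [|k ih] f sf; first by move=> x; exact: hasgrad_cont (gr f x sf).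
split=> [x|i]; first exact: hasgrad_cont (gr f x sf).
split=> [x|]; first by have [] := hasgrad_derive (delta_mx 0 i) (gr f x sf).
rewrite (_ : pd i _ = fun x => \sum_j pd j f (T x) * pd i (fun y => T y 0 j) x); last first.
  by apply/funext => x; exact: hasgrad_pd (gr f x sf).
have : forall s : seq 'I_m, is_Ck k (fun x => \sum_(j <- s) pd j f (T x) * pd i (fun y => T y 0 j) x).
  elim=> [|j s ihs]; first by under eq_fun do rewrite big_nil; exact: smooth_cst.
  under eq_fun do rewrite big_cons; apply: is_CkD => //; apply: is_CkM.
    exact: ih (smooth_pd j sf).
  exact: smooth_pd (sT j) k.
exact.
Qed.

Lemma smooth_scalar {R : realType} n (g : R -> R) (f : 'rV[R]_n -> R) :
  (forall k, C1k k g) -> smooth f -> smooth (fun x => g (f x)).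
Proof.
move=> sg sf; have := @smooth_compose R n 1 (fun y => g (1 * y 0 0 + 0)) (fun x => (f x)%:M).
have E x : 1 * ((f x)%:M : 'rV[R]_1) 0 0 + 0 = f x by rewrite mxE eqxx mulr1n mul1r addr0.
rewrite (_ : (fun x => g (1 * _ + 0)) = (fun x => g (f x))); last by apply/funext => x; rewrite E.
apply; first exact: smooth_comp1.
move=> j; rewrite (_ : (fun x => _) = f)//.
by apply/funext => x; rewrite ord1 mxE eqxx mulr1n.
Qed.

Lemma smooth_affine_map {R : realType} n m (B : 'M[R]_(n, m)) (b : 'rV[R]_m) j :
  smooth (fun x : 'rV[R]_n => (x *m B + b) 0 j).
Proof.
rewrite (_ : (fun x => _) = (fun x : 'rV[R]_n => \sum_i x 0 i * B i j + b 0 j)); first exact: smooth_affine.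
by apply/funext => x; rewrite !mxE.
Qed.

Lemma smooth_chart {R : realType} d n (c : cell R d n) f : smooth f -> smooth (f \o chart c).
Proof.
move=> sf; apply: (smooth_compose (T := chart c)) => // j; rewrite /chart.
by under eq_fun do rewrite addrC; exact: smooth_affine_map.
Qed.

(** * Hardy inequality on the cones over the boundary pieces *)

Section Hardy.
Context {R : realType} {d : nat} (G : gdom R d).
Local Notation n := d.+1.
Local Notation D := (gD G).
Local Notation x0 := (gx0 G).
Local Notation h := (gh G).
Local Notation bd := (gbd (g := G)).
Local Notation lam := (@lebesgue_measure R).

Definition EE (f : 'rV[R]_n -> R) (x : 'rV[R]_n) : R := \sum_j pd j f x ^+ 2.

Lemma EE_ge0 f x : 0 <= EE f x.
Proof. by apply: sumr_ge0 => j _; rewrite sqr_ge0. Qed.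

Lemma smooth_EE f : smooth f -> smooth (EE f).
Proof. by move=> sf; apply: smooth_sum => j _; apply: smoothX; exact: smooth_pd. Qed.

Lemma gX1 (i : 'I_(gN G)) t : gX i 1 t = chart (bd i) t.
Proof. by rewrite /gX scale1r addrC subrK. Qed.

(** The value at height s is compared with the boundary value by integrating the derivative along
    the ray. Since s <= u on the way, s^d <= u^d, and the weight required by [polar] can be moved
    under the integral. *)
Lemma hardy_line f i (a s : R) (t : 'rV[R]_d) : smooth f -> 0 <= a -> a < s <= 1 -> cdom (bd i) t ->
  ((s ^+ d * f (gX i s t) ^+ 2)%:E <= (2 * f (chart (bd i) t) ^+ 2)%:E +
   (2 * (1 - a) * (n%:R * h ^+ 2))%:E * \int[lam]_(u in `]a, 1%R]) (u ^+ d * EE f (gX i u t))%:E)%E.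
Proof.
move=> sf a0 /andP[as1 s1] ct.
have s0 : 0 < s by lra.
pose w := chart (bd i) t - x0.
have wh j : `|w 0 j| <= h.
  by apply: le_trans (coord_le_norm _ _) _; apply: g_near; case: (bd_in ct).
pose g u := f (gX i u t); pose g' u := \sum_j pd j f (gX i u t) * w 0 j.
have gd u : hasder g u (g' u).
  rewrite /g' (eq_bigr (fun j => w 0 j * pd j f (gX i u t))); last by move=> j _; rewrite mulrC.
  apply: (@hasgrad_line R _ f x0 w u (fun j => pd j f (gX i u t))); exact: smooth_hasgrad.
have cX : continuous (fun u : R => gX i u t).
  move=> u; apply: (@continuousD _ _ _ (fun=> x0) (fun u : R => u *: w)); first exact: cst_continuous.
  exact: scalel_continuous.
have cg' : continuous g'.
  apply: (@continuous_big _ _ _ _ _ _ _ _ (fun j (u : R) => pd j f (gX i u t) * w 0 j)).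
    by apply: add_continuous.
  move=> j _ u; apply: (@continuousM _ _ (fun u : R => pd j f (gX i u t)) (fun=> w 0 j)).
    by apply: (@continuous_comp _ _ _ (fun u : R => gX i u t) (pd j f)); [exact: cX|exact/smooth_cont/smooth_pd].
  exact: cst_continuous.
have g'E u : g' u ^+ 2 <= n%:R * h ^+ 2 * EE f (gX i u t).
  rewrite /g' /EE; set F := fun j => pd j f (gX i u t).
  have h1 : `|\sum_j F j * w 0 j| <= h * \sum_j `|F j|.
    rewrite (le_trans (ler_norm_sum _ _ _))// mulr_sumr ler_sum// => j _.
    by rewrite normrM mulrC ler_wpM2r.
  have h2 : (\sum_j `|F j|) ^+ 2 <= n%:R * \sum_j F j ^+ 2.
    by have := sum_sqr_le (fun j => `|F j|); under [X in _ * X]eq_bigr do rewrite real_normK ?num_real//.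
  rewrite -[leLHS]real_normK ?num_real//.
  apply: (@le_trans _ _ ((h * \sum_j `|F j|) ^+ 2)).
    by rewrite lerXn2r ?nnegrE ?mulr_ge0 ?(ltW (g_h0 G)).
  rewrite [leRHS](_ : _ = h ^+ 2 * (n%:R * \sum_j F j ^+ 2)); last by lra.
  by nra.
pose P u := u ^+ d * EE f (gX i u t).
have P0 u : 0 <= u -> 0 <= P u by move=> u0; rewrite mulr_ge0 ?EE_ge0.
have cP : continuous P.
  move=> u; apply: (@continuousM _ _ (fun u : R => u ^+ d) (fun u => EE f (gX i u t))).
    exact: exprn_continuous.
  by apply: (@continuous_comp _ _ _ (fun u : R => gX i u t) (EE f)); [exact: cX|exact/smooth_cont/smooth_EE].
have mP : measurable_fun [set: R] P by exact: continuous_measurable_fun.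
have bdd c (F : R -> R) : continuous F -> I1 lam `[c, 1%R]%classic F.
  move=> cF; have /compact_bounded[M [_ hM]] : compact (F @` `[c, 1%R]%classic).
    by apply: continuous_compact; [exact: continuous_subspaceT|exact: segment_compact].
  apply: (@I1_bounded _ _ _ _ _ _ (M + 1)) => //.
  - exact: segment_fin.
  - by apply: measurable_funTS; exact: continuous_measurable_fun.
  - by move=> u cu; apply: (hM (M + 1)); [rewrite ltrDl|exists u].
have iP := bdd a P cP.
have main : s ^+ d * g s ^+ 2 <= 2 * g 1 ^+ 2 + 2 * (1 - a) * (n%:R * h ^+ 2) * \int[lam]_(u in `[a, 1]) P u.
  have h1 : g s ^+ 2 <= 2 * g 1 ^+ 2 + 2 * (g 1 - g s) ^+ 2 by have := sqr_ge0 (2 * g 1 - g s); nra.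
  have sd1 : s ^+ d <= 1 by rewrite exprn_ile1//.
  have sd0 : 0 <= s ^+ d by [].
  have h2 : s ^+ d * (g 1 - g s) ^+ 2 <= (1 - a) * (n%:R * h ^+ 2 * \int[lam]_(u in `[a, 1]) P u).
    have I0 : 0 <= \int[lam]_(u in `[a, 1]) P u.
      by apply: Rintegral_ge0 => u; rewrite /= in_itv/= => /andP[au _]; apply: P0; exact: le_trans au.
    have a1 : a <= 1 by lra.
    move: s1; rewrite le_eqVlt => /predU1P[->|s1].
      by rewrite subrr expr0n /= mulr0 mulr_ge0 ?subr_ge0//.
    apply: (@le_trans _ _ (s ^+ d * ((1 - s) * \int[lam]_(u in `[s, 1]) (g' u ^+ 2)))).
      by rewrite ler_wpM2l//; exact: ftc_sq.
    rewrite mulrCA; apply: ler_pM; rewrite ?subr_ge0 ?(ltW s1)//.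
    - by rewrite mulr_ge0// Rintegral_ge0// => u _; rewrite sqr_ge0.
    - by lra.
    - have ig : I1 lam `[s, 1%R]%classic (fun u => g' u ^+ 2).
        apply: bdd => u; apply: (@continuous_comp _ _ _ g' (fun x => x ^+ 2)); first exact: cg'.
        exact: exprn_continuous.
      rewrite (_ : s ^+ d * _ = \int[lam]_(u in `[s, 1]) (s ^+ d * g' u ^+ 2)); last by rewrite RintegralZl.
      apply: (@le_trans _ _ (\int[lam]_(u in `[s, 1]) (n%:R * h ^+ 2 * P u))).
        apply: le_Rintegral => //; [exact: I1Z|by apply: I1Z => //; exact: bdd|].
        move=> u; rewrite /= in_itv/= => /andP[su u1].
        apply: (@le_trans _ _ (u ^+ d * (n%:R * h ^+ 2 * EE f (gX i u t)))); last by rewrite /P mulrCA.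
        have u0 : 0 < u by lra.
        by apply: ler_pM; rewrite ?lerXn2r ?nnegrE.
      rewrite RintegralZl//; last exact: bdd.
      apply: ler_wpM2l; first by apply: mulr_ge0; rewrite ?sqr_ge0.
      apply: Rintegral_subset => //.
        by move=> u /=; rewrite !in_itv/= => /andP[su ->]; rewrite (le_trans _ su)// ltW.
      by move=> u; rewrite /= in_itv/= => /andP[au _]; apply: P0; exact: le_trans au.
  nra.
have -> : (\int[lam]_(u in `]a, 1%R]) (u ^+ d * EE f (gX i u t))%:E)%E = (\int[lam]_(u in `[a, 1]) P u)%:E.
  rewrite integral_itv_obnd_cbnd; last by apply: measurable_funTS; apply/measurable_EFinP.
  by rewrite /Rintegral fineK//; exact: integrable_fin_num.
by rewrite -EFinM -EFinD lee_fin -gX1.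
Qed.

Lemma gD_fin : (lebn D < +oo)%E.
Proof.
apply: le_lt_trans (ltry _); apply: (leb_fin_bounded (@g_measurable R d G) (ltW (g_h0 G))) => y.
exact: g_near.
Qed.

Lemma gD_S2 f A : continuous f -> mrV A -> A `<=` D -> S2 lebn A f.
Proof.
move=> cf mA AD; apply: (@cont_S2 _ n f x0 h) => //; last by apply: ltW; exact: g_h0.
by move=> y /AD; exact: g_near.
Qed.

Lemma gbd_bounded i t t' : cdom (bd i) t -> cdom (bd i) t' -> `|t - t'| <= n%:R * h.
Proof.
move=> ct ct'; have h0 := ltW (g_h0 G).
have -> : t - t' = (chart (bd i) t - chart (bd i) t') *m (cdir (bd i))^T.
  rewrite /chart opprD addrACA subrr add0r -mulmxBl -mulmxA.
  by rewrite (_ : cdir (bd i) *m _ = 1%:M) ?mulmx1//; exact: g_iso.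
apply/rVnorm_leP => //.
move=> j; rewrite mxE (le_trans (ler_norm_sum _ _ _))// mulr_natl -[X in _ *+ X](card_ord n) -sumr_const ler_sum// => k _.
have e1 : `|(cdir (bd i))^T k j| <= 1.
  rewrite mxE; have := congr1 (fun M : 'M[R]_d => M j j) (g_iso (g := G) i); rewrite !mxE eqxx mulr1n.
  rewrite (bigD1 k)//= !mxE => E.
  have : cdir (bd i) j k ^+ 2 <= 1.
    rewrite -E expr2 lerDl sumr_ge0// => l _; rewrite !mxE -expr2 sqr_ge0//.
  by rewrite -[leLHS]real_normK ?num_real// expr_le1.
rewrite normrM -[h]mulr1 ler_pM//.
apply: le_trans (coord_le_norm _ _) _; apply: g_diam; first by case: (bd_in ct).
by case: (bd_in ct').
Qed.

Lemma gbd_fin i : (lebn (cdom (bd i)) < +oo)%E.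
Proof.
apply: le_lt_trans (ltry ((2 * (n%:R * h)) ^+ d)).
have ci : cdom (bd i) (gt i) by apply: g_disc; rewrite subrr normr0 ltW// g_q0.
apply: (@leb_fin_bounded _ _ _ (gt i)); [exact: gcdom_measurable| |].
  by rewrite mulr_ge0// ltW// g_h0.
by move=> t ct; exact: gbd_bounded ct ci.
Qed.

Lemma gbd_S2 i f : continuous f -> S2 lebn (cdom (bd i)) f.
Proof.
move=> cf; have ci : cdom (bd i) (gt i) by apply: g_disc; rewrite subrr normr0 ltW// g_q0.
apply: (@cont_S2 _ d f (gt i) (n%:R * h)) => //; first exact: gcdom_measurable.
  by move=> t ct; exact: gbd_bounded ct ci.
by rewrite mulr_ge0// ltW// g_h0.
Qed.

Lemma integral_sqr (dd : measure_display) (T : measurableType dd) (mu : {measure set T -> \bar R}) A (f : T -> R) :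
  measurable A -> S2 mu A f ->
  (\int[mu]_(x in A) (f x ^+ 2)%:E = (nrm mu A f ^+ 2)%:E)%E.
Proof.
move=> mA [mf jf]; rewrite nrm_sqr /dot /Rintegral fineK; first by apply: eq_integral => x _; rewrite expr2.
by apply: integrable_fin_num; move: jf; under eq_fun do rewrite expr2.
Qed.

(** One measurable function on the product whose partial integrals are those of the polar formula:
    it provides the measurability of both iterated integrals and lets Tonelli exchange them. *)
Lemma conic_kernel i (a : R) (g : 'rV[R]_n -> R) : 0 <= a -> measurable_fun setT g -> (forall x, 0 <= g x) ->
  exists J : measurableTypeR R * 'rV[R]_d -> \bar R, [/\ measurable_fun setT J, forall p, (0 <= J p)%E,
    forall s, (\int[lebn]_t J (s, t) = if s \in `]a, 1%R]%classic then
      \int[lebn]_(t in cdom (bd i)) ((s ^+ d)%:E * (g (gX i s t))%:E) else 0)%E &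
    forall t, (\int[lam]_s J (s, t) = if t \in cdom (bd i) then
      \int[lam]_(u in `]a, 1%R]) (u ^+ d * g (gX i u t))%:E else 0)%E].
Proof.
move=> a0 mg g0.
pose J (p : measurableTypeR R * 'rV[R]_d) : \bar R :=
  if (p.1 \in `]a, 1%R]%classic) && (p.2 \in cdom (bd i)) then (p.1 ^+ d * g (gX i p.1 p.2))%:E else 0%E.
exists J; split.
- have -> : J = (fun p => (p.1 ^+ d * g (gX i p.1 p.2))%:E) \_ (`]a, 1%R]%classic `*` cdom (bd i)).
    by apply/funext => p; rewrite patchE /J in_setX.
  apply/(measurable_restrictT _ _).1.
    by apply: measurableX; [exact: measurable_itv|exact: gcdom_measurable].
  apply: measurable_funTS; apply/measurable_EFinP; apply: measurable_funM.
    by apply: measurable_funX; exact: measurable_fst.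
  exact: measurableT_comp mg (@gX_measurable R d G i).
- move=> p; rewrite /J; case: ifP => // /andP[/set_mem + _]; rewrite /= in_itv/= => /andP[ap _].
  by rewrite lee_fin mulr_ge0// exprn_ge0// ltW// (le_lt_trans a0).
- move=> s; case: ifP => [sa|ns]; last by rewrite integral0_eq// => t _; rewrite /J /= ns.
  rewrite [RHS]integral_mkcond; apply: eq_integral => t _; rewrite patchE /J /= sa /=.
  by [].
- move=> t; case: ifP => [ct|nt]; last by rewrite integral0_eq// => u _; rewrite /J /= nt andbF.
  rewrite [RHS]integral_mkcond; apply: eq_integral => u _; rewrite patchE /J /= ct andbT.
  by [].
Qed.

(** [hardy_line] integrated over the piece and over ]a, 1]. The range of s gives a factor 1 - a to
    both terms, and the gradient term has a second one from the length of the ray: this second power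
    is what later absorbs the gradient of a cutoff. *)
Lemma hardy f i (a : R) : smooth f -> 0 <= a <= 1 ->
  nrm lebn (gP i a) f ^+ 2 <=
    2 * gc i * (1 - a) * nrm lebn (cdom (bd i)) (f \o chart (bd i)) ^+ 2 +
    2 * (1 - a) ^+ 2 * n%:R * h ^+ 2 * \sum_j nrm lebn (gP i a) (pd j f) ^+ 2.
Proof.
move=> sf /andP[a0 a1]; have mP := gP_measurable i a; have mc := gcdom_measurable (G := G) i.
have PD := @gP_D _ _ G i _ a0; have [c0 _] := gcP i.
have mf := smooth_measurable sf.
have mF : measurable_fun [set: 'rV[R]_n] (fun x => (f x ^+ 2)%:E).
  by apply/measurable_EFinP; exact: measurable_funX.
have mE : measurable_fun [set: 'rV[R]_n] (EFin \o EE f) by apply/measurable_EFinP; apply: smooth_measurable; exact: smooth_EE.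
have mX := @gX_measurable R d G i.
have sB : S2 lebn (cdom (bd i)) (f \o chart (bd i)).
  by apply: gbd_S2; exact/smooth_cont/smooth_chart.
rewrite -lee_fin -integral_sqr//; last exact: gD_S2 (smooth_cont sf) _ _.
rewrite polar//; last by move=> x; rewrite lee_fin.
set A := fun t => (\int[lam]_(u in `]a, 1%R]) (u ^+ d * EE f (gX i u t))%:E)%E.
have [J [mJ J0 J1 J2]] := conic_kernel i a0 (smooth_measurable (smooth_EE sf)) (EE_ge0 f).
have A0 t : (0 <= A t)%E.
  apply: integral_ge0 => u; rewrite /= in_itv/= => /andP[au _]; rewrite lee_fin mulr_ge0 ?EE_ge0//.
  by rewrite exprn_ge0// ltW// (le_lt_trans a0).
have AE t : cdom (bd i) t -> A t = (\int[lam]_u J (u, t))%E by rewrite J2 => ct; rewrite mem_set.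
have mA : measurable_fun (cdom (bd i)) A.
  apply: (@eq_measurable_fun _ _ _ _ _ (fun t => \int[lam]_u J (u, t))%E).
    by move=> t; rewrite inE => ct; rewrite AE.
  apply: measurable_funTS.
  exact: (@measurable_fun_fubini_tonelli_G _ _ (measurableTypeR R) _ R lam J).
pose B t := (2 * f (chart (bd i) t) ^+ 2)%:E.
have mB : measurable_fun (cdom (bd i)) B.
  by apply/measurable_EFinP; apply: measurable_funM => //; apply: measurable_funX; case: sB.
have B0 t : (0 <= B t)%E by rewrite lee_fin.
pose k := 2 * (1 - a) * (n%:R * h ^+ 2).
have k0 : 0 <= k.
  rewrite /k; apply: mulr_ge0; first by lra.
  by [].
have [I IE] : exists I, I = (\int[lebn]_(t in cdom (bd i)) (B t + k%:E * A t))%E by eexists.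
have h1 : (\int[lam]_(s in `]a, 1%R]) \int[lebn]_(t in cdom (bd i)) ((s ^+ d)%:E * (f (gX i s t) ^+ 2)%:E) <=
    \int[lam]_(s in `]a, 1%R]) I)%E.
  apply: ge0_le_integral => //.
  - move=> s; rewrite /= in_itv/= => /andP[ap _]; apply: integral_ge0 => t _.
    by rewrite -EFinM lee_fin mulr_ge0// exprn_ge0// ltW// (le_lt_trans a0).
  - have [K [mK K0 K1 _]] := conic_kernel i a0 (measurable_funX 2 mf) (fun x => sqr_ge0 (f x)).
    apply: (@eq_measurable_fun _ _ _ _ _ (fun s => \int[lebn]_t K (s, t))%E).
      by move=> s sa; rewrite K1 sa.
    apply: measurable_funTS.
    exact: (@measurable_fun_fubini_tonelli_F _ _ (measurableTypeR R) _ R lebn K).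
  - move=> s; rewrite /= in_itv/= => /andP[ap s1]; rewrite IE; apply: ge0_le_integral => //.
    + by move=> t _; rewrite -EFinM lee_fin mulr_ge0// exprn_ge0// ltW// (le_lt_trans a0).
    + apply: measurable_funTS; under eq_fun do rewrite -EFinM; apply/measurable_EFinP.
      apply: measurable_funM => //; apply: measurable_funX; apply: (measurableT_comp mf).
      exact: (measurableT_comp mX (@pair1_measurable _ _ (measurableTypeR R) _ s)).
    + by apply: emeasurable_funD => //; exact: measurable_funeM.
    + by move=> t ct; rewrite -EFinM; apply: hardy_line => //; rewrite ap.
apply: (le_trans (lee_wpmul2l _ h1)); first by rewrite lee_fin.
have -> : (\int[lam]_(s in `]a, 1%R]) I = I * (1 - a)%:E)%E.
  rewrite integral_cst; last exact: measurable_itv.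
  by congr (_ * _)%E; exact: left_open_measure.
have -> : I = ((2 * nrm lebn (cdom (bd i)) (f \o chart (bd i)) ^+ 2)%:E +
     k%:E * \int[lebn]_(t in cdom (bd i)) A t)%E.
  rewrite IE ge0_integralD//; [|by move=> t _; exact: mule_ge0|exact: measurable_funeM].
  rewrite ge0_integralZl_EFin//; congr (_ + _)%E.
  rewrite /B; under eq_integral do rewrite EFinM.
  rewrite ge0_integralZl_EFin//; last 2 first.
  - by move=> t _; rewrite lee_fin.
  - by apply/measurable_EFinP; apply: measurable_funX; case: sB.
  by rewrite EFinM -integral_sqr.
have -> : (\int[lebn]_(t in cdom (bd i)) A t = \int[lam]_(s in `]a, 1%R]) \int[lebn]_(t in cdom (bd i)) ((s ^+ d)%:E * (EFin \o EE f) (gX i s t)))%E.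
  transitivity (\int[lebn]_t \int[lam]_u J (u, t))%E.
    by rewrite integral_mkcond; apply: eq_integral => t _; rewrite patchE.
  rewrite -(@fubini_tonelli _ _ (measurableTypeR R) _ _ lam lebn J)//.
  by rewrite [RHS]integral_mkcond; apply: eq_integral => s _; rewrite patchE.
rewrite [X in (X <= _)%E](_ : _ = (2 * gc i * (1 - a) * nrm lebn (cdom (bd i)) (f \o chart (bd i)) ^+ 2)%:E +
   ((1 - a) * k)%:E * ((gc i)%:E * \int[lam]_(s in `]a, 1%R]) \int[lebn]_(t in cdom (bd i)) ((s ^+ d)%:E * (EFin \o EE f) (gX i s t))))%E; last first.
  set Z := (\int[lam]_(s in _) _)%E.
  have Z0 : (0 <= Z)%E.
    apply: integral_ge0 => s; rewrite /= in_itv/= => /andP[ap _]; apply: integral_ge0 => t _.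
    by rewrite -EFinM lee_fin mulr_ge0 ?EE_ge0// exprn_ge0// ltW// (le_lt_trans a0).
  rewrite ge0_muleDl; [|by rewrite lee_fin|exact: mule_ge0].
  rewrite ge0_muleDr; last 2 first.
    by apply: mule_ge0; rewrite lee_fin ?subr_ge0//.
    by apply: mule_ge0; [exact: mule_ge0|rewrite lee_fin subr_ge0].
  congr (_ + _)%E; first by rewrite -!EFinM; congr (_%:E); ring.
  by rewrite [RHS]muleCA; congr (_ * _)%E; rewrite EFinM muleC muleA.
rewrite -polar//; last by move=> x; rewrite lee_fin EE_ge0.
have sp j : S2 lebn (gP i a) (pd j f) by apply: gD_S2 => //; exact/smooth_cont/smooth_pd.
have -> : (\int[lebn]_(x in gP i a) (EFin \o EE f) x = (\sum_j nrm lebn (gP i a) (pd j f) ^+ 2)%:E)%E.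
  rewrite -sumEFin; under [RHS]eq_bigr do rewrite -integral_sqr//.
  rewrite -ge0_integral_sum//; first by apply: eq_integral => x _; rewrite /= /EE sumEFin.
  - by move=> j; apply/measurable_EFinP; apply: measurable_funX; case: (sp j).
  - by move=> j x _; rewrite lee_fin.
by rewrite -EFinM -EFinD lee_fin; apply: eq_ler; rewrite /k; ring.
Qed.

End Hardy.

(** * Traces and Green formula *)

Arguments leb : simpl never.

Lemma le_eps {R : realType} (x y C : R) : 0 <= C -> (forall e, 0 < e -> x <= y + C * e) -> x <= y.
Proof.
move=> C0 H; apply/ler_addgt0Pr => e e0; have C1 : 0 < C + 1 by lra.
apply: (le_trans (H (e / (C + 1)) (divr_gt0 e0 C1))); rewrite lerD2l mulrCA ler_piMr//.
by rewrite ler_pdivrMr// mul1r lerDl.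
Qed.

Lemma eq0_eps {R : realType} (x C : R) : 0 <= C -> (forall e, 0 < e -> `|x| <= C * e) -> x = 0.
Proof.
move=> C0 H; apply/eqP; rewrite -normr_le0; apply: (@le_eps _ _ _ C C0) => e e0.
by rewrite add0r; exact: H.
Qed.

Lemma sqrt_sum_le {R : realType} (I : finType) (X A T B : R) (F : I -> R) :
  0 <= X -> 0 <= A -> 0 <= T -> 0 <= B -> (forall i, 0 <= F i) ->
  X ^+ 2 <= A * T ^+ 2 + B * \sum_i F i ^+ 2 ->
  X <= Num.sqrt A * T + Num.sqrt B * \sum_i F i.
Proof.
move=> X0 A0 T0 B0 F0 H.
have S0 : 0 <= \sum_i F i by [].
have HS : \sum_i F i ^+ 2 <= (\sum_i F i) ^+ 2.
  rewrite expr2 mulr_suml ler_sum// => i _; rewrite expr2 ler_wpM2l//.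
  by rewrite (bigD1 i)//= lerDl.
have sA := sqr_sqrtr A0; have sB := sqr_sqrtr B0.
have a0 := sqrtr_ge0 A; have b0 := sqrtr_ge0 B.
set a := Num.sqrt A in sA a0 *; set b := Num.sqrt B in sB b0 *; set S := \sum_i F i in S0 HS *.
have Y0 : 0 <= a * T + b * S by [].
rewrite -(@ler_pXn2r _ 2)//; apply: (le_trans H); rewrite -sA -sB.
have h2 : 0 <= (a * T) * (b * S) by [].
nra.
Qed.

Section SquareIntegrableCover.
Context {d} {T : measurableType d} {R : realType} (mu : {measure set T -> \bar R}).

Lemma dot_supp (L D : set T) (u v : T -> R) : L `<=` D -> (forall x, D x -> ~ L x -> v x = 0) ->
  dot mu D u v = dot mu L u v.
Proof.
move=> LD v0; rewrite /dot /Rintegral; congr fine.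
rewrite integral_mkcond [RHS]integral_mkcond; apply: eq_integral => x _; rewrite !patchE.
case: ifPn => [/set_mem Dx|nD]; case: ifPn => [/set_mem Lx|nL]//.
  by rewrite v0 ?mulr0// => Lx; move/negP: nL; apply; rewrite inE.
by move/negP: nD; case; rewrite inE; exact: LD.
Qed.

Lemma nrm_cover (I : finType) (L : set T) (A : I -> set T) (u : T -> R) : measurable L ->
  (forall i, measurable (A i)) -> S2 mu L u -> (forall i, S2 mu (A i) u) ->
  (forall x, L x -> exists i, A i x) -> nrm mu L u <= \sum_i nrm mu (A i) u.
Proof.
move=> mL mA sL sA cov.
apply: (@le_trans _ _ (Num.sqrt 1 * 0 + Num.sqrt 1 * \sum_i nrm mu (A i) u)); last first.
  by rewrite mulr0 add0r sqrtr1 mul1r.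
apply: sqrt_sum_le => //.
rewrite expr0n /= mulr0 add0r mul1r -lee_fin -sumEFin -integral_sqr//.
under [leRHS]eq_bigr do rewrite -integral_sqr//.
have mf i : measurable_fun setT ((fun x => (u x ^+ 2)%:E) \_ (A i)).
  apply/(measurable_restrictT _ _).1 => //; apply/measurable_EFinP; apply: measurable_funX.
  by case: (sA i).
have f0 i x : (0 <= ((fun x => (u x ^+ 2)%:E) \_ (A i)) x)%E.
  by rewrite patchE; case: ifP; rewrite ?lee_fin.
rewrite integral_mkcond; under [leRHS]eq_bigr do rewrite integral_mkcond.
rewrite -ge0_integral_sum//; apply: ge0_le_integral => //.
- by move=> x _; rewrite patchE; case: ifP; rewrite ?lee_fin.
- apply/(measurable_restrictT _ _).1 => //; apply/measurable_EFinP; apply: measurable_funX.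
  by case: sL.
- by apply: emeasurable_sum.
move=> x _; rewrite patchE; case: ifPn => [/set_mem Lx|_]; last exact: sume_ge0.
have [i Ai] := cov x Lx; rewrite (bigD1 i)//= [X in (_ <= X + _)%E]patchE mem_set//.
by rewrite leeDl// sume_ge0.
Qed.

Lemma fin_null (I : finType) (F : I -> set T) : (forall i, measurable (F i)) ->
  (forall i, mu (F i) = 0%E) ->
  measurable (\bigcup_(i in [set: I]) F i) /\ mu (\bigcup_(i in [set: I]) F i) = 0%E.
Proof.
move=> mF F0; have fT : finite_set [set: I] by exact: finite_finset.
have mU : measurable (\bigcup_(i in [set: I]) F i) by apply: fin_bigcup_measurable.
split=> //; apply/eqP; rewrite -measure_le0.
apply: le_trans (content_sub_fsum _ fT (fun i _ => mF i) mU (@subset_refl _ _)) _.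
by rewrite fsbig1//= => i _; rewrite F0.
Qed.

Lemma nrm_triangle_le D u v : measurable D -> S2 mu D u -> S2 mu D v ->
  nrm mu D u <= nrm mu D v + nrm mu D (fun x => u x - v x).
Proof.
move=> mD su sv; rewrite -[X in X <= _](nrm_ext mu (u := fun x => v x + (u x - v x))); last first.
  by move=> x _; rewrite addrC subrK.
by apply: nrmD => //; exact: S2B.
Qed.

Lemma nrm_null D u : measurable D -> S2 mu D u -> mu D = 0%E -> nrm mu D u = 0.
Proof.
move=> mD su D0; apply/eqP; rewrite -sqrf_eq0; apply/eqP; apply: (@EFin_inj R).
rewrite -integral_sqr// null_set_integral//; apply/measurable_EFinP; apply: measurable_funX.
by case: su.
Qed.

Lemma nrm_vanish D (L : nat -> set T) u : measurable D -> (forall m, measurable (L m)) ->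
  (forall m, L m `<=` D) -> S2 mu D u ->
  {ae mu, forall x, D x -> exists M, forall m, (M <= m)%N -> ~ L m x} ->
  forall e, 0 < e -> exists M, forall m, (M <= m)%N -> nrm mu (L m) u <= e.
Proof.
move=> mD mL LD su hae e e0.
pose f_ m := (fun x => (u x ^+ 2)%:E) \_ (L m).
have mu2 : measurable_fun D (fun x => (u x ^+ 2)%:E).
  by apply/measurable_EFinP; apply: measurable_funX; case: su.
have mf m : measurable_fun D (f_ m).
  apply/(measurable_restrict _ _ _).1 => //.
  by apply: measurable_funS mu2 => // x [].
have [] := @dominated_convergence _ _ _ mu D mD f_ (cst 0%E) (fun x => (u x ^+ 2)%:E) mf.
- exact: measurable_cst.
- apply: filterS hae => x hx Dx; have [M hM] := hx Dx.
  apply: cvg_near_cst; exists M => // m /= Mm; rewrite /f_ patchE memNset//; exact: hM.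
- by case: su.
- apply/aeW => x m Dx; rewrite /f_ patchE; case: ifP => _; rewrite ?abse0 ?lee_fin//.
  by rewrite ger0_norm.
move=> _ _; rewrite integral_cst// mul0e => /fine_cvgP[_ /cvgrPdist_le/(_ (e ^+ 2))].
move=> /(_ (exprn_gt0 2 e0))[M _ hM]; exists M => m Mm; apply: nrm_le; first exact: ltW.
have sm : S2 mu (L m) u by exact: S2_subset su.
have := hM m Mm; rewrite /= sub0r normrN -nrm_sqr => h; apply: le_trans h.
rewrite -[leLHS]/(fine (nrm mu (L m) u ^+ 2)%:E) -integral_sqr//.
rewrite (_ : (\int[mu]_(x in D) f_ m x)%E = (\int[mu]_(x in L m) (u x ^+ 2)%:E)%E) ?ler_norm//.
rewrite integral_mkcond [RHS]integral_mkcond; apply: eq_integral => x _; rewrite /f_ !patchE.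
case: ifPn => // nD; case: ifPn => // /set_mem/LD; by move/negP: nD => nD Dx; case: nD; rewrite inE.
Qed.

End SquareIntegrableCover.

Section Traces.
Context {R : realType} {d : nat} (G : gdom R d).
Local Notation n := d.+1.
Local Notation D := (gD G).
Local Notation x0 := (gx0 G).
Local Notation r := (gr G).
Local Notation h := (gh G).
Local Notation N := (gN G).
Local Notation bd := (gbd (g := G)).
Local Notation Dnrm := (nrm lebn D).
Local Notation Fnrm i := (nrm lebn (cdom (bd i))).
Implicit Types (v z f : 'rV[R]_n -> R) (g : 'I_n -> 'rV[R]_n -> R).

Lemma smooth_S2 f : smooth f -> S2 lebn D f.
Proof. by move=> sf; apply: gD_S2; [exact: smooth_cont|exact: g_measurable|exact: subset_refl]. Qed.

(* v has weak gradient g, and its values on the boundary pieces are its traces. *)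
Definition traced v g := [/\ S2 lebn D v, forall b, S2 lebn D (g b) &
  forall i, S2 lebn (cdom (bd i)) (v \o chart (bd i)) /\
    forall e : R, 0 < e -> exists f, [/\ smooth f, Dnrm (fun x => f x - v x) <= e,
      forall b, Dnrm (fun x => pd b f x - g b x) <= e &
      Fnrm i (fun t => f (chart (bd i) t) - v (chart (bd i) t)) <= e]].

Lemma traced_sub v g f : traced v g -> smooth f ->
  traced (fun x => v x - f x) (fun b x => g b x - pd b f x).
Proof.
move=> [sv sg tr] sf; have mD := @g_measurable R d G; split.
- by apply: S2B => //; exact: smooth_S2.
- by move=> b; apply: S2B => //; exact/smooth_S2/smooth_pd.
- move=> i; have [sT ap] := tr i; split.
    by apply: S2B => //; [exact: gcdom_measurable|apply: gbd_S2; exact/smooth_cont/smooth_chart].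
  move=> e e0; have [p [sp h1 h2 h3]] := ap e e0.
  exists (fun x => p x - f x); split.
  + exact: smoothB.
  + apply: le_trans h1; apply: eq_ler.
    by apply: nrm_ext => x _; ring.
  + move=> b; apply: le_trans (h2 b); apply: eq_ler.
    by apply: nrm_ext => x _; rewrite pdB//; ring.
  + apply: le_trans h3; apply: eq_ler.
    by apply: nrm_ext => x _; ring.
Qed.

Lemma hardy_traced v g i (e : R) : traced v g -> 0 <= e <= 1 ->
  nrm lebn (gP i (1 - e)) v <= Num.sqrt (2 * gc i * e) * Fnrm i (v \o chart (bd i)) +
    Num.sqrt (2 * e ^+ 2 * n%:R * h ^+ 2) * \sum_b nrm lebn (gP i (1 - e)) (g b).
Proof.
move=> [sv sg tr] /andP[e0 e1]; have [sT ap] := tr i.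
have mD := @g_measurable R d G; have mc := gcdom_measurable (G := G) i.
have a0 : 0 <= 1 - e by lra.
have mP := gP_measurable i (1 - e); have PD := gP_D a0 (i := i).
have [c0 _] := gcP i.
set A := Num.sqrt _; set B := Num.sqrt (_ * h ^+ 2).
have A0 : 0 <= A by exact: sqrtr_ge0.
have B0 : 0 <= B by exact: sqrtr_ge0.
apply: (@le_eps _ _ _ (1 + A + B * n%:R)) => //.
move=> k k0; have [f [sf h1 h2 h3]] := ap k k0.
have sfD : S2 lebn D f by exact: smooth_S2.
have spD b : S2 lebn D (pd b f) by exact/smooth_S2/smooth_pd.
have sub u : S2 lebn D u -> S2 lebn (gP i (1 - e)) u by exact: S2_subset.
have k1 : nrm lebn (gP i (1 - e)) v <= nrm lebn (gP i (1 - e)) f + k.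
  apply: le_trans (nrm_triangle_le mP (sub _ sv) (sub _ sfD)) _; rewrite lerD2l.
  rewrite -nrmN (nrm_ext _ (u' := fun x => f x - v x)); last by move=> x _; ring.
  by apply: le_trans h1; apply: nrm_subset => //; exact: S2B.
have k2 b : nrm lebn (gP i (1 - e)) (pd b f) <= nrm lebn (gP i (1 - e)) (g b) + k.
  apply: le_trans (nrm_triangle_le mP (sub _ (spD b)) (sub _ (sg b))) _; rewrite lerD2l.
  by apply: le_trans (h2 b); apply: nrm_subset => //; exact: S2B.
have k3 : Fnrm i (f \o chart (bd i)) <= Fnrm i (v \o chart (bd i)) + k.
  apply: (le_trans (nrm_triangle_le mc _ sT)); last by lra.
  by apply: gbd_S2; exact/smooth_cont/smooth_chart.
have := @hardy R d G f i (1 - e) sf; rewrite a0 lerBlDr lerDl e0 => /(_ isT).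
rewrite (_ : 1 - (1 - e) = e); last ring.
move=> /sqrt_sum_le; rewrite -/A -/B => H.
apply: (le_trans k1); rewrite (_ : _ + _ * k = (A * (Fnrm i (v \o chart (bd i)) + k) +
  B * (\sum_b nrm lebn (gP i (1 - e)) (g b) + n%:R * k)) + k); last ring.
rewrite lerD2r; apply: (@le_trans _ _ (A * Fnrm i (f \o chart (bd i)) + B * \sum_b nrm lebn (gP i (1 - e)) (pd b f))).
  by apply: H.
rewrite lerD// ler_wpM2l//.
have -> : n%:R * k = \sum_(b < n) k by rewrite sumr_const card_ord mulr_natl.
by rewrite -big_split ler_sum.
Qed.

Lemma glayer_measurable e : mrV (glayer G e).
Proof.
rewrite (_ : glayer G e = \bigcup_(i in [set: 'I_N]) gP i (1 - e)).
  by apply: fin_bigcup_measurable => // i _; exact: gP_measurable.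
by apply/seteqP; split=> x [i]; [exists i|move=> _; exists i].
Qed.

(** [ctr] always multiplies a trace that is made small after e has been fixed, so its size does not
    matter. [cgr] enters the final constants; the number of pieces in it is bounded by
    [piece_count]. *)
Definition ctr e := \sum_i Num.sqrt (2 * gc (i : 'I_N) * e).
Definition cgr := N%:R * Num.sqrt (2 * n%:R) * h.

Lemma ctr_ge0 e : 0 <= ctr e. Proof. by apply: sumr_ge0 => i _; exact: sqrtr_ge0. Qed.
Lemma cgr_ge0 : 0 <= cgr. Proof. by rewrite !mulr_ge0// ltW// g_h0. Qed.

Lemma layer_bound v g e k : traced v g -> 0 <= e <= 1 -> (forall i, Fnrm i (v \o chart (bd i)) <= k) ->
  nrm lebn (glayer G e) v <= ctr e * k + cgr * e * \sum_b nrm lebn (glayer G e) (g b).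
Proof.
move=> tv he tk; have [sv sg tr] := tv; have mD := @g_measurable R d G.
have := he => /andP[e0 e1]; have a0 : 0 <= 1 - e by lra.
have mL := glayer_measurable e; have LD := glayer_D (G := G) he.
have PL i : gP (G := G) i (1 - e) `<=` glayer G e by move=> x Px; exists i.
have mP i := gP_measurable (G := G) i (1 - e).
have sub u : S2 lebn D u -> S2 lebn (glayer G e) u by exact: S2_subset.
apply: le_trans (nrm_cover (A := fun i => gP i (1 - e)) mL mP (sub _ sv) _ _) _.
- by move=> i; exact: (S2_subset mD (mP i) (fun x Px => LD _ (PL i x Px)) sv).
- by [].
apply: le_trans (ler_sum _ (fun i _ => hardy_traced i tv he)) _.
rewrite big_split /=; apply: lerD.
  rewrite /ctr mulr_suml ler_sum// => i _; rewrite ler_wpM2l//.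
set S := \sum_b nrm lebn (glayer G e) (g b).
have SE : Num.sqrt (2 * e ^+ 2 * n%:R * h ^+ 2) = Num.sqrt (2 * n%:R) * h * e.
  have -> : 2 * e ^+ 2 * n%:R * h ^+ 2 = 2 * n%:R * (h * e) ^+ 2 by ring.
  have he0 : 0 <= h * e by rewrite mulr_ge0// ltW// g_h0.
  by rewrite (@sqrtrM _ (2 * n%:R) ((h * e) ^+ 2))// sqrtr_sqr ger0_norm// mulrA.
rewrite SE -mulr_sumr; apply: (@le_trans _ _ (Num.sqrt (2 * n%:R) * h * e * (N%:R * S))); last first.
  by rewrite /cgr; apply: eq_ler; ring.
apply: ler_wpM2l; first by rewrite !mulr_ge0 ?(ltW (g_h0 G)).
have -> : N%:R * S = \sum_(i < N) S by rewrite sumr_const card_ord mulr_natl.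
apply: ler_sum => i _; apply: ler_sum => b _; exact: (nrm_subset mL (mP i) (PL i) (sub _ (sg b))).
Qed.

(** The layer of relative width 1 is D without x0, and a point has measure 0: this is [layer_bound]
    at e = 1. *)
Lemma friedrichs v g k : traced v g -> (forall i, Fnrm i (v \o chart (bd i)) <= k) ->
  Dnrm v <= ctr 1 * k + cgr * \sum_b Dnrm (g b).
Proof.
move=> tv tk; have [sv sg tr] := tv; have mD := @g_measurable R d G.
have h1 : (0 : R) <= (1 : R) <= (1 : R) by lra.
have mL := glayer_measurable 1; have LD := glayer_D (G := G) h1.
have mx : mrV [set x0].
  by apply: closed_rV_measurable; apply: (compact_closed (@norm_hausdorff _ _)); exact: compact_set1.
pose A (c : bool) := if c then glayer G 1 else [set x0].
have sx u : S2 lebn D u -> S2 lebn [set x0] u.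
  by apply: S2_subset => // _ ->; exact: g_center.
have := @nrm_cover _ _ _ lebn bool D A v mD; rewrite big_bool /=.
move=> /(_ _ sv) H; apply: le_trans (H _ _ _) _.
- by case.
- by case=> /=; [exact: S2_subset sv|exact: sx].
- move=> x Dx; have [->|xx] := eqVneq x x0; first by exists false.
  have [i Px] := g_cover Dx xx; exists true, i; by rewrite subrr.
rewrite (nrm_null mx (sx _ sv)) ?addr0; last first.
  pose a : 'cV[R]_n := delta_mx ord0 0.
  have a1 : a != 0.
    by apply/eqP => /matrixP/(_ ord0 0); rewrite !mxE eqxx => /eqP; rewrite oner_eq0.
  apply: subset_measure0 (leb_hyperplane ((x0 *m a) 0 0) a1) => //.
    exact: measurable_hyperplane.
  by move=> _ ->.
apply: le_trans (layer_bound tv h1 tk) _; rewrite mulr1 lerD2l ler_wpM2l ?cgr_ge0//.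
by apply: ler_sum => b _; exact: (nrm_subset mD mL LD (sg b)).
Qed.

(** A point off the planes of the pieces, which are the sets where [gl i] is 1, leaves the layers
    for good when their width tends to 0. The planes are null, and dominated convergence
    concludes. *)
Lemma layer_small f : S2 lebn D f -> forall k, 0 < k ->
  exists M : nat, forall m, (M <= m)%N -> nrm lebn (glayer G m.+1%:R^-1) f <= k.
Proof.
move=> sf; have mD := @g_measurable R d G.
have m01 (m : nat) : 0 <= (m.+1%:R^-1 : R) <= 1.
  by rewrite invr_ge0 ler0n/= invf_le1// ler1n.
apply: (nrm_vanish mD) => //.
- by move=> m; exact: glayer_measurable.
- by move=> m; exact: glayer_D.
pose a i : 'cV[R]_n := col ord0 (invmx (gB (i : 'I_N) : 'M[R]_n)).
have aE i x : gl i x = (x *m a i) 0 0 - (x0 *m a i) 0 0.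
  by rewrite /gl /gy !mxE -sumrB; apply: eq_bigr => j _; rewrite !mxE; ring.
have a0 i : a i != 0.
  apply/eqP => ai; have := gl_X i (1 : R) (gt i); rewrite aE ai !mulmx0 !mxE subrr => /eqP.
  by rewrite eq_sym oner_eq0.
pose H i : set 'rV[R]_n := [set x | (x *m a i) 0 0 = 1 + (x0 *m a i) 0 0].
have [mH H0] : mrV (\bigcup_(i in [set: 'I_N]) H i) /\ lebn (\bigcup_(i in [set: 'I_N]) H i) = 0%E.
  by apply: fin_null => i; [exact: measurable_hyperplane|exact: leb_hyperplane].
exists (\bigcup_(i in [set: 'I_N]) H i); split=> //.
move=> x /= nx; apply: contrapT => nH; apply: nx => Dx.
have H1 (i : 'I_N) : gl i x != 1.
  apply/eqP => l1; apply: nH; exists i => //; rewrite /H /= -l1 aE; ring.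
have rp (i : 'I_N) : 0 < (if gl i x < 1 then 1 - gl i x else 1) by case: ifPn => l1; rewrite ?subr_gt0.
have [e e0 he] := pos_lower_bound rp.
have [M hM] := ltr_add_invr (y := 0) (x := e) e0.
exists M => m Mm [i [/andP[l1 l2] _]]; have := he i.
have lt1 : gl i x < 1 by rewrite lt_neqAle H1.
rewrite lt1 => h1; have : m.+1%:R^-1 <= (M.+1%:R^-1 : R) by rewrite lef_pV2 ?posrE// ler_nat.
rewrite add0r in hM; move=> h2; have : e < e; last by rewrite ltxx.
by apply: le_lt_trans (le_trans h1 (le_trans _ h2)) hM; rewrite lerBlDr -lerBlDl ltW.
Qed.

Lemma margin_test f : smooth f ->
  (exists2 m : R, 0 < m & forall x, f x != 0 -> forall y, `|y - x| <= m -> D y) -> test_fun D f.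
Proof.
move=> sf [m m0 hm].
have sub : closure [set x | f x != 0] `<=` interior D.
  move=> y cy; apply/interior_rV; exists (m / 2) => //.
  move=> z zy; have /cy[x [/= fx]] : nbhs y [set x | `|y - x| < m / 2].
    by apply/nbhs_ballP; exists (m / 2); rewrite /=// ball_rVE.
  move=> yx; apply: (hm x fx); rewrite -(subrKA y) (le_trans (ler_normD _ _))//.
  by lra.
split=> //; apply: subclosed_compact (g_compact (g := G)) _; first exact: closed_closure.
by move=> y /sub; exact: interior_subset.
Qed.

(* A sum of the lattice bumps that stay away from the boundary. *)
Lemma cutoff C : (forall N (dl : R) (b : 'I_n) (x : 'rV[R]_n),
    0 < dl -> \sum_(k : {ffun 'I_n -> 'I_(N.*2.+1)}) `|pd b (pou dl k) x| <= C / dl) ->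
  forall e, 0 < e <= 1 -> exists eta : 'rV[R]_n -> R, [/\ smooth eta,
  forall x, 0 <= eta x <= 1,
  exists2 m : R, 0 < m & forall x, eta x != 0 -> forall y, `|y - x| <= m -> D y,
  forall x, D x -> ~ glayer G e x -> eta x = 1 /\ forall b, pd b eta x = 0 &
  forall x b, `|pd b eta x| <= C * 4 / (e * r)].
Proof.
move=> hC e /andP[e0 e1]; have r0 := g_r0 G; have h0 := g_h0 G.
(* A bump has radius [dl] and is kept if the cube of half-side 2 [dl] about its node lies in D. As 3
   [dl] <= e r, every bump that is nonzero at a point outside the layer is kept, by [g_layer]. *)
pose dl := e * r / 4; have d0 : 0 < dl by rewrite !mulr_gt0.
pose M := (Num.truncn ((`|x0| + h) / dl)).+1.
have hM x : D x -> `|x| < dl * M%:R.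
  move=> Dx; apply: (@le_lt_trans _ _ (`|x0| + h)).
    by rewrite -[x](subrK x0) addrC (le_trans (ler_normD _ _))// lerD2l g_near.
  by rewrite mulrC -ltr_pdivrMr// truncnS_gt.
pose K := {ffun 'I_n -> 'I_(M.*2.+1)}.
pose P (k : K) := `[< forall y, `|y - node dl k| <= 2 * dl -> D y >].
pose eta x := \sum_(k | P k) pou dl k x.
have seta : smooth eta by apply: smooth_sum => k _; exact: pou_smooth.
have pdE b x : pd b eta x = \sum_(k | P k) pd b (pou dl k) x.
  by rewrite /eta pd_sum// => k _; exact: pou_smooth.
have good e' x : dl * 3 <= e' -> (forall y, `|y - x| <= e' -> D y) -> forall k : K, `|x - node dl k| <= dl -> P k.
  move=> de hx k xk; apply/asboolP => y yk; apply: hx; apply: le_trans de.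
  rewrite -(subrKA (node dl k)) (le_trans (ler_normD _ _))//.
  rewrite [`|node dl k - x|]distrC; apply: le_trans (lerD yk xk) _; lra.
exists eta; split => //.
- move=> x; have p0 (k : K) : 0 <= pou dl k x by case/andP: (pou_itv dl k x).
  rewrite sumr_ge0//=; have [[k [Pk pk]]|nk] := pselect (exists k : K, P k /\ pou dl k x != 0); last first.
    rewrite /eta big1// => k Pk; apply/eqP/negP => /negP pk; apply: nk; by exists k.
  have xk := pou_supp d0 pk; have Dx : D x by move/asboolP: Pk; apply; apply: le_trans xk _; lra.
  rewrite -(sum_pou d0 (ltW (hM x Dx))) [leRHS](bigID P)/= lerDl sumr_ge0//.
- exists dl => // x ex y yx.
  have [k [Pk pk]] : exists k : K, P k /\ pou dl k x != 0.
    apply: contrapT => nk; move/eqP: ex; apply; rewrite /eta big1// => k Pk.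
    by apply/eqP/negP => /negP pk; apply: nk; exists k.
  have xk := pou_supp d0 pk; move/asboolP: Pk; apply.
  rewrite -(subrKA x) (le_trans (ler_normD _ _))//; lra.
- move=> x Dx nL; have lay := g_layer _ Dx nL.
  have G1 := good (e * r) x; have {}G1 : forall k : K, `|x - node dl k| <= dl -> P k.
    have er0 : 0 < e * r by [].
    apply: G1; first by rewrite /dl; lra.
    by apply: lay; rewrite (ltW e0) e1.
  split.
    rewrite -(sum_pou d0 (ltW (hM x Dx))) [RHS](bigID P)/= [X in _ + X]big1 ?addr0// => k nP.
    by apply/eqP/negP => /negP pk; move/negP: nP; apply; apply: G1; exact: pou_supp pk.
  move=> b; rewrite pdE; transitivity (\sum_k pd b (pou (N:=M) dl k) x); last exact: sum_pd_pou0 (hM x Dx).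
  rewrite [RHS](bigID P)/= [X in _ + X]big1 ?addr0// => k nP.
  by apply/eqP/negP => /negP pk; move/negP: nP; apply; apply: G1; exact: pd_pou_supp pk.
- move=> x b; rewrite pdE (le_trans (ler_norm_sum _ _ _))//.
  rewrite (_ : C * 4 / (e * r) = C / dl); last by rewrite /dl; field; rewrite !gt_eqF.
  apply: le_trans (hC M dl b x d0); rewrite [leRHS](bigID P)/= lerDl sumr_ge0//.
Qed.

(** The test functions of D, with an explicit distance from their support to the complement;
    [margin_test] and [test_inner] pass from one form to the other. *)
Definition inner f := smooth f /\ exists2 m : R, 0 < m & forall x, f x != 0 -> forall y, `|y - x| <= m -> D y.

(* The distributional relation div g = p. *)
Definition wdiv g (p : 'rV[R]_n -> R) := [/\ forall b, S2 lebn D (g b), S2 lebn D p &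
  forall f, inner f -> \sum_b dot lebn D (g b) (pd b f) = - dot lebn D p f].

Lemma g_piece : exists i : 'I_N, True.
Proof.
have [i _] : exists i, gP (G := G) i 0 (x0 + const_mx r).
  apply: g_cover.
    apply: g_cube; rewrite addrAC subrr add0r; apply/rVnorm_leP; first exact: ltW (g_r0 G).
    by move=> j; rewrite mxE ger0_norm// ltW// g_r0.
  rewrite -subr_eq0 addrAC subrr add0r; apply/eqP => /matrixP/(_ 0 ord0); rewrite !mxE => rr.
  by have := g_r0 G; rewrite rr ltxx.
by [].
Qed.

Lemma cutoff_test v g eta (m B : R) : traced v g -> smooth eta ->
  0 < m -> (forall x, eta x != 0 -> forall y, `|y - x| <= m -> D y) ->
  (forall x, 0 <= eta x <= 1) -> 0 <= B -> (forall x b, `|pd b eta x| <= B) ->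
  forall k, 0 < k -> exists f, [/\ inner f,
    Dnrm (fun x => f x - eta x * v x) <= k &
    forall b, Dnrm (fun x => pd b f x - (eta x * g b x + pd b eta x * v x)) <= (1 + B) * k].
Proof.
move=> [sv sg tr] se m0 hm e01 B0 hB k k0; have [i _] := g_piece.
have [_ /(_ k k0)[f [sf h1 h2 _]]] := tr i; have mD := @g_measurable R d G.
have hm' x : eta x * f x != 0 -> forall y, `|y - x| <= m -> D y.
  by move=> nz; apply: hm; apply: contraNN nz => /eqP ->; rewrite mul0r.
have me := smooth_measurable se; have e1 x : D x -> `|eta x| <= 1.
  by move=> _; case/andP: (e01 x) => e0 e1; rewrite ger0_norm.
have meD : measurable_fun D eta by exact: measurable_funTS.
have mbD b : measurable_fun D (pd b eta) by apply: measurable_funTS; exact: (smooth_measurable (smooth_pd b se)).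
have sd : S2 lebn D (fun x => f x - v x) by apply: S2B => //; exact: smooth_S2.
have sdb b : S2 lebn D (fun x => pd b f x - g b x) by apply: S2B => //; exact/smooth_S2/smooth_pd.
exists (fun x => eta x * f x); split.
- by split; [exact: smoothM|exists m].
- rewrite (nrm_ext _ (u' := fun x => eta x * (f x - v x))); last by move=> x _; ring.
  by apply: le_trans (nrm_mulb mD meD ler01 e1 sd) _; rewrite mul1r.
- move=> b; rewrite pdM//.
  rewrite (nrm_ext _ (u' := fun x => eta x * (pd b f x - g b x) + pd b eta x * (f x - v x))); last by move=> x _; ring.
  apply: le_trans (nrmD mD _ _) _; [exact: S2_mulb (e1) _|exact: S2_mulb (fun x _ => hB x b) _|].
  rewrite mulrDl mul1r lerD//.
    by apply: le_trans (nrm_mulb mD meD ler01 e1 (sdb b)) _; rewrite mul1r.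
  by apply: le_trans (nrm_mulb mD (mbD b) B0 (fun x _ => hB x b) sd) _; rewrite ler_wpM2l.
Qed.

(** The relation div q = p extends by density to the test function eta v, whose approximations eta f
    keep the margin of eta. *)
Lemma wdiv_cutoff v g q p eta (m B : R) : traced v g -> wdiv q p -> smooth eta ->
  0 < m -> (forall x, eta x != 0 -> forall y, `|y - x| <= m -> D y) ->
  (forall x, 0 <= eta x <= 1) -> 0 <= B -> (forall x b, `|pd b eta x| <= B) ->
  \sum_b dot lebn D (q b) (fun x => eta x * g b x + pd b eta x * v x) =
  - dot lebn D p (fun x => eta x * v x).
Proof.
move=> tv wq se m0 hm e01 B0 hB; have [sv sg _] := tv; have [sq sp wt] := wq.
have mD := @g_measurable R d G; have me := smooth_measurable se.
have e1 x : D x -> `|eta x| <= 1.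
  by move=> _; case/andP: (e01 x) => e0 e1; rewrite ger0_norm.
have meD : measurable_fun D eta by exact: measurable_funTS.
have mbD b : measurable_fun D (pd b eta) by apply: measurable_funTS; exact: (smooth_measurable (smooth_pd b se)).
have s1 : S2 lebn D (fun x => eta x * v x) by exact: S2_mulb e1 sv.
have s2 b : S2 lebn D (fun x => eta x * g b x + pd b eta x * v x).
  by apply: S2D => //; [exact: S2_mulb e1 (sg b)|exact: S2_mulb (fun x _ => hB x b) sv].
apply/eqP; rewrite -subr_eq0 opprK; apply/eqP.
apply: (@eq0_eps _ _ (\sum_b Dnrm (q b) * (1 + B) + Dnrm p)).
  by rewrite addr_ge0 ?nrm_ge0// sumr_ge0// => b _; rewrite mulr_ge0 ?nrm_ge0.
move=> k k0; have [f [tf h1 h2]] := cutoff_test tv se m0 hm e01 B0 hB k0.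
have sf : smooth f by case: tf.
have := wt f tf => E0.
have sD b : S2 lebn D (pd b f) by exact/smooth_S2/smooth_pd.
have -> : \sum_b dot lebn D (q b) (fun x => eta x * g b x + pd b eta x * v x) + dot lebn D p (fun x => eta x * v x)
  = - (\sum_b dot lebn D (q b) (fun x => pd b f x - (eta x * g b x + pd b eta x * v x)) +
     dot lebn D p (fun x => f x - eta x * v x)).
  rewrite dotBr//; last exact: smooth_S2.
  under [in RHS]eq_bigr => b _ do rewrite dotBr//.
  rewrite sumrB E0; ring.
rewrite normrN (le_trans (ler_normD _ _))// mulrDl; apply: lerD.
  rewrite (le_trans (ler_norm_sum _ _ _))// mulr_suml ler_sum// => b _.
  apply: le_trans (cauchy_schwarz mD (sq b) _) _; first exact: S2B.
  by rewrite -mulrA ler_wpM2l ?nrm_ge0.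
apply: le_trans (cauchy_schwarz mD sp _) _; first by apply: S2B => //; exact: smooth_S2.
by rewrite ler_wpM2l ?nrm_ge0.
Qed.

Lemma dot_le L D' q f (C : R) : mrV L -> S2 lebn L q -> S2 lebn L f -> L `<=` D' ->
  (forall x, D' x -> ~ L x -> f x = 0) -> nrm lebn L f <= C ->
  `|dot lebn D' q f| <= nrm lebn L q * C.
Proof.
move=> mL sq sf LD f0 fC; rewrite (@dot_supp _ _ _ lebn L D' q f LD f0).
by apply: le_trans (cauchy_schwarz mL sq sf) _; rewrite ler_wpM2l ?nrm_ge0.
Qed.

(** By [wdiv_cutoff] the identity is exact for eta v. What remains involves 1 - eta and the gradient
    of eta, hence lives in the layer, where q and p are small by [layer_small]. There |v| has norm
    at most e V once its traces are small, and this e cancels the 1/e in the gradient of eta. The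
    width e depends on q, p and [La] only, and the threshold k is chosen after it, uniformly in
    v. *)
Lemma green q p : wdiv q p -> forall La dl : R, 0 <= La -> 0 < dl ->
  exists2 k : R, 0 < k & forall v g, traced v g ->
    (forall i, Fnrm i (v \o chart (bd i)) <= k) -> (forall b, Dnrm (g b) <= La) ->
    `|\sum_b dot lebn D (q b) (g b) + dot lebn D p v| <= dl.
Proof.
move=> wq La dl La0 dl0; have [sq sp _] := wq; have mD := @g_measurable R d G.
have [C1 C10 /cutoff hC] := @sum_pd_pou R n; have C0 : 0 < C1 * 4 by [].
move: (C1 * 4) C0 hC => C C0 hC; have r0 := g_r0 G; have h0 := g_h0 G.
pose V := 1 + cgr * (n%:R * La).
have V0 : 0 < V by rewrite /V ltr_wpDr// mulr_ge0 ?cgr_ge0//.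
pose K := La + C / r * V + V.
have K0 : 0 < K by rewrite ltr_wpDl//.
pose w := dl / ((n.+1)%:R * K).
have w0 : 0 < w by rewrite divr_gt0// mulr_gt0.
have [Mq hMq] : exists M : nat, forall b, forall m, (M <= m)%N -> nrm lebn (glayer G m.+1%:R^-1) (q b) <= w.
  have hb b := layer_small (sq b) w0.
  exists (\max_b sval (cid (hb b)))%N => b m hm; apply: (svalP (cid (hb b))).
  by apply: leq_trans hm; apply: (leq_bigmax_cond (F := fun b => sval (cid (hb b)))).
have [Mp hMp] := layer_small sp w0.
pose m := maxn Mq Mp; pose e : R := m.+1%:R^-1.
have e0 : 0 < e by rewrite invr_gt0.
have e1 : e <= 1 by rewrite invf_le1// ler1n.
have he : 0 <= e <= 1 by rewrite ltW.
have hq b : nrm lebn (glayer G e) (q b) <= w by apply: hMq; rewrite leq_maxl.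
have hp : nrm lebn (glayer G e) p <= w by apply: hMp; rewrite leq_maxr.
have [|eta [se e01 [mm mm0 hm] eoff egrad]] := hC e; first by rewrite e0.
have c0 := ctr_ge0 e.
exists (e / (ctr e + 1)) => //.
move=> v g tv tk tg; have [sv sg _] := tv.
set L := glayer G e in hq hp eoff.
have mL : mrV L by exact: glayer_measurable.
have LD : L `<=` D by exact: glayer_D.
have sub u : S2 lebn D u -> S2 lebn L u by exact: S2_subset.
have vL : nrm lebn L v <= e * V.
  apply: le_trans (layer_bound tv he tk) _; rewrite /V mulrDr mulr1 lerD//.
    by rewrite mulrCA ler_piMr// ler_pdivrMr// mul1r lerDl.
  rewrite -/L [cgr * e]mulrC -mulrA ler_wpM2l// ler_wpM2l ?cgr_ge0//.
  have -> : n%:R * La = \sum_(b < n) La by rewrite sumr_const card_ord mulr_natl.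
  by apply: ler_sum => b _; apply: le_trans (tg b); exact: (nrm_subset mD mL LD (sg b)).
pose B := C / (e * r); have B0 : 0 <= B by rewrite divr_ge0// mulr_ge0.
have hB x b : `|pd b eta x| <= B by [].
have me := smooth_measurable se.
have mb b : measurable_fun setT (pd b eta) by exact: (smooth_measurable (smooth_pd b se)).
have e1n x : `|eta x| <= 1 by case/andP: (e01 x) => ea eb; rewrite ger0_norm.
have e2n x : `|1 - eta x| <= 1 by case/andP: (e01 x) => ea eb; rewrite ger0_norm ?subr_ge0// lerBlDr lerDl.
have mT (A : set 'rV[R]_n) f : measurable_fun setT f -> measurable_fun A f by exact: measurable_funTS.
have m1 : measurable_fun setT (fun x => 1 - eta x) by apply: measurable_funB.
have mul A f u (c : R) : mrV A -> measurable_fun setT f -> (forall x, `|f x| <= c) -> S2 lebn A u ->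
    S2 lebn A (fun x => f x * u x).
  by move=> mA mf fc su; apply: (@S2_mulb _ _ _ _ _ _ _ c) => //; exact: mT.
have E := wdiv_cutoff tv wq se mm0 hm e01 B0 hB.
have -> : \sum_b dot lebn D (q b) (g b) + dot lebn D p v =
  \sum_b (dot lebn D (q b) (fun x => (1 - eta x) * g b x) - dot lebn D (q b) (fun x => pd b eta x * v x)) +
  dot lebn D p (fun x => (1 - eta x) * v x).
  have -> : dot lebn D p (fun x => (1 - eta x) * v x) = dot lebn D p v - dot lebn D p (fun x => eta x * v x).
    rewrite -dotBr//; last exact: mul e1n sv.
    by apply: dot_ext => // x _; ring.
  have -> : - dot lebn D p (fun x => eta x * v x) = \sum_b dot lebn D (q b) (fun x => eta x * g b x + pd b eta x * v x) by [].
  rewrite addrC [RHS]addrCA; congr (_ + _); rewrite -big_split /=; apply: eq_bigr => b _.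
  rewrite dotDr//; [|exact: mul e1n (sg b)|exact: mul (hB ^~ b) sv].
  have -> : dot lebn D (q b) (g b) = dot lebn D (q b) (fun x => (1 - eta x) * g b x) + dot lebn D (q b) (fun x => eta x * g b x).
    rewrite -dotDr//; [|exact: mul e2n (sg b)|exact: mul e1n (sg b)].
    by apply: dot_ext => // x _; ring.
  ring.
have bound : forall b, `|dot lebn D (q b) (fun x => (1 - eta x) * g b x) - dot lebn D (q b) (fun x => pd b eta x * v x)| <= w * (La + C / r * V).
  move=> b; rewrite (le_trans (ler_normB _ _))// mulrDr lerD//.
    apply: le_trans (dot_le (C := La) mL (sub _ (sq b)) _ LD _ _) _.
    - exact: mul e2n (sub _ (sg b)).
    - by move=> x Dx nL; have [-> _] := eoff x Dx nL; rewrite subrr mul0r.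
    - apply: le_trans (nrm_mulb mL (mT _ _ m1) ler01 (fun x _ => e2n x) (sub _ (sg b))) _; rewrite mul1r.
      by apply: le_trans (tg b); exact: (nrm_subset mD mL LD (sg b)).
    by rewrite ler_wpM2r.
  apply: le_trans (dot_le (C := C / r * V) mL (sub _ (sq b)) _ LD _ _) _.
  - exact: mul (hB ^~ b) (sub _ sv).
  - by move=> x Dx nL; have [_ ->] := eoff x Dx nL; rewrite mul0r.
  - apply: le_trans (nrm_mulb mL (mT _ _ (mb b)) B0 (fun x _ => hB x b) (sub _ sv)) _.
    apply: le_trans (ler_wpM2l B0 vL) _; rewrite /B; apply: eq_ler; field.
    by lra.
  by rewrite ler_wpM2r//.
have bp : `|dot lebn D p (fun x => (1 - eta x) * v x)| <= w * V.
  apply: le_trans (dot_le (C := V) mL (sub _ sp) _ LD _ _) _.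
  - exact: mul e2n (sub _ sv).
  - by move=> x Dx nL; have [-> _] := eoff x Dx nL; rewrite subrr mul0r.
  - apply: le_trans (nrm_mulb mL (mT _ _ m1) ler01 (fun x _ => e2n x) (sub _ sv)) _; rewrite mul1r.
    by nra.
  by rewrite ler_wpM2r//.
rewrite (le_trans (ler_normD _ _))//.
have : `|\sum_b (dot lebn D (q b) (fun x => (1 - eta x) * g b x) - dot lebn D (q b) (fun x => pd b eta x * v x))| <= n%:R * (w * K).
  rewrite (le_trans (ler_norm_sum _ _ _))//.
  have -> : n%:R * (w * K) = \sum_(b < n) w * K by rewrite sumr_const card_ord mulr_natl.
  by apply: ler_sum => b _; apply: le_trans (bound b) _; rewrite ler_wpM2l// /K lerDl.
have : w * V <= w * K by rewrite ler_wpM2l// /K lerDr.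
have -> : dl = n%:R * (w * K) + w * K.
  transitivity (n.+1%:R * (w * K)); last by lra.
  by rewrite /w mulrCA divfK.
by lra.
Qed.

End Traces.

(** * Representation of linear forms on polynomials *)

Section Riesz.
Context {R : realType} {n : nat} (k : nat).
Implicit Types (f q : 'rV[R]_n -> R).

Definition linear_on (L : ('rV[R]_n -> R) -> R) :=
  (forall f q, Pol k f -> Pol k q -> L (fun x => f x + q x) = L f + L q) /\
  (forall c f, Pol k f -> L (fun x => c * f x) = c * L f).

Lemma linear_onD L1 L2 : linear_on L1 -> linear_on L2 -> linear_on (fun f => L1 f + L2 f).
Proof.
move=> [D1 Z1] [D2 Z2]; split=> [f q hf hq|c f hf]; first by rewrite D1// D2// addrACA.
by rewrite Z1// Z2// mulrDr.
Qed.

Lemma linear_on_ext L1 L2 : (forall f, L1 f = L2 f) -> linear_on L1 -> linear_on L2.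
Proof. by move=> /funext ->. Qed.

Lemma linear_onZ c L : linear_on L -> linear_on (fun f => c * L f).
Proof.
move=> [D1 Z1]; split=> [f q hf hq|e f hf]; first by rewrite D1// mulrDr.
by rewrite Z1// mulrCA.
Qed.

Lemma linear_on_sum L (I : Type) (s : seq I) (P : pred I) (c : I -> R) (F : I -> 'rV[R]_n -> R) :
  linear_on L -> (forall i, P i -> Pol k (F i)) ->
  L (fun x => \sum_(i <- s | P i) c i * F i x) = \sum_(i <- s | P i) c i * L (F i).
Proof.
move=> [LD LZ] hF; elim: s => [|i s ih].
  have := LZ 0 (fun=> 0) (Pol_0 _); under eq_fun do rewrite mul0r.
  by rewrite mul0r big_nil => E; under eq_fun do rewrite big_nil.
case Pi: (P i); under eq_fun do rewrite big_cons Pi; last by rewrite big_cons Pi ih.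
rewrite big_cons Pi LD ?ih ?LZ//; [exact: hF|by apply: Pol_scale; exact: hF|].
by apply: Pol_sum => j Pj; apply: Pol_scale; exact: hF.
Qed.

Lemma poly_riesz (a : ('rV[R]_n -> R) -> ('rV[R]_n -> R) -> R) (L : ('rV[R]_n -> R) -> R) :
  (forall q, Pol k q -> linear_on (a^~ q)) -> (forall f, Pol k f -> linear_on (a f)) -> linear_on L ->
  (forall f, Pol k f -> a f f = 0 -> forall x, f x = 0) ->
  exists f, Pol k f /\ forall q, Pol k q -> a f q = L q.
Proof.
move=> a1 a2 aL def.
pose I := {ffun 'I_n -> 'I_k.+1}.
pose P (b : I) := ((mdeg b)%:Z <= k%:Z)%R.
pose m (b : I) : 'rV[R]_n -> R := mono (fun i => b i).
have Pm b : P b -> Pol k (m b) by move=> Pb; exact: PolW Pb (Pol_mono _).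
pose Q (c : I -> R) x := \sum_(b | P b) c b * m b x.
have PQ c : Pol k (Q c) by apply: Pol_sum => b Pb; apply: Pol_scale; exact: Pm.
have aQ1 c q : Pol k q -> a (Q c) q = \sum_(b | P b) c b * a (m b) q.
  by move=> hq; exact: (linear_on_sum _ _ (a1 q hq)).
have aQ2 c f : Pol k f -> a f (Q c) = \sum_(b | P b) c b * a f (m b).
  by move=> hf; exact: (linear_on_sum _ _ (a2 f hf)).
(* The index type also contains exponents of total degree above k; the matrix is completed by the
   identity on them to remain square and injective. *)
pose Lm (b b' : I) := if P b then (if P b' then a (m b) (m b') else 0) else (b == b')%:R.
have E c j : \sum_i c i * Lm i j = if P j then a (Q c) (m j) else c j.
  rewrite (bigID P) /=; case: ifPn => Pj.
    rewrite aQ1; last exact: Pm.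
    rewrite [X in _ + X]big1 ?addr0; first by apply: eq_bigr => i Pi; rewrite /Lm Pi Pj.
    move=> i nPi; rewrite /Lm (negbTE nPi); case: eqVneq => [ij|_]; last by rewrite mulr0.
    by move: nPi; rewrite ij Pj.
  rewrite big1 ?add0r; last by move=> i Pi; rewrite /Lm Pi (negbTE Pj) mulr0.
  rewrite (bigD1 j)//= /Lm (negbTE Pj) eqxx mulr1 big1 ?addr0// => i /andP[nPi ij].
  by rewrite (negbTE nPi) (negbTE ij) mulr0.
have [K [_ hK]] : exists K : I -> I -> R,
    (forall c i, c i = \sum_j (\sum_l c l * Lm l j) * K j i) /\
    (forall r j, \sum_i (\sum_l r l * K l i) * Lm i j = r j).
  apply: fin_linear_inverse => c hc i.
  have hc' j : (if P j then a (Q c) (m j) else c j) = 0 by rewrite -E.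
  have Q0 x : Q c x = 0.
    apply: def => //; rewrite aQ2// big1// => j Pj.
    by have := hc' j; rewrite Pj => ->; rewrite mulr0.
  have [Pi|nPi] := boolP (P i); last by have := hc' i; rewrite (negbTE nPi).
  have := @mono_indep _ n k (fun b => if P b then c b else 0) 1 ltr01.
  move=> /(_ _ i); rewrite Pi; apply => x _.
  rewrite -[RHS](Q0 x) /Q [RHS]big_mkcond; apply: eq_bigr => b _.
  by case: ifP => //; rewrite mul0r.
pose c i := \sum_l (if P l then L (m l) else 0) * K l i.
exists (Q c); split=> // q hq.
have hm j : P j -> a (Q c) (m j) = L (m j).
  by move=> Pj; have := hK (fun l => if P l then L (m l) else 0) j; rewrite -/c E Pj.
have /Pol_polyfun[c' qE] := hq.
have {qE} -> : q = Q c' by apply/funext.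
rewrite aQ2// (linear_on_sum _ _ aL)//; apply: eq_bigr => b Pb; by rewrite hm.
Qed.
End Riesz.

Lemma qbump_pd {R : realType} n : exists2 C : R, 0 < C & forall (x0 : 'rV[R]_n) (d : R) b x, 0 < d ->
  `|pd b (qbump x0 d) x| <= C / d.
Proof.
have H (b : 'I_n) : exists M : R, 0 < M /\ forall y : 'rV[R]_n, `|pd b (@beta R n) y| <= M.
  have [M M0 hM] := @cont_rV_bounded R n _ 0 1 (smooth_cont (smooth_pd b (@beta_smooth R n))).
  exists M; split=> // y; have [y1|y1] := leP `|y| 1; first by apply: hM; rewrite subr0.
  rewrite (hasgrad_pd b (a := fun=> 0)) ?normr0//.
  apply: (hasgrad_near (f := fun=> 0) (r := `|y| - 1)); rewrite ?subr_gt0//; last exact: hasgrad_cst.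
  move=> z zy; apply/esym/eqP/negP => /negP /beta_out z1.
  have := ler_normB z (z - y); rewrite opprB addrC subrK => h.
  by lra.
pose C := 1 + \sum_b sval (cid (H b)).
have hs b : 0 < sval (cid (H b)) by have [] := svalP (cid (H b)).
exists C; first by rewrite ltr_pwDl// sumr_ge0// => b _; exact: ltW.
move=> x0 d b x d0.
rewrite (_ : qbump x0 d = fun y => beta (d^-1 *: y + - (d^-1 *: x0))); last first.
  by apply/funext => y; rewrite /qbump scalerBr.
rewrite (pd_scaled _ _ _ _ (@beta_smooth R n)) normrM gtr0_norm// mulrC ler_pM2r//.
have [_ h] := svalP (cid (H b)); apply: le_trans (h _) _.
by rewrite /C (bigD1 b)//= addrA addrAC lerDr addr_ge0// sumr_ge0// => j _; exact: ltW.
Qed.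

Lemma norm_delta {R : realType} n (b : 'I_n) (t : R) : `|t *: (delta_mx 0 b : 'rV[R]_n)| <= `|t|.
Proof.
by rewrite normrZ ler_piMr//; apply/rVnorm_leP => // j; rewrite mxE eqxx /=; case: (j == b); rewrite ?normr1 ?normr0.
Qed.

(** * Integration by parts through difference quotients *)

Section Quotients.
Context {R : realType} {n : nat}.
Implicit Types (D : set 'rV[R]_n) (F w f : 'rV[R]_n -> R).

Lemma bounded_convergence D (F_ : nat -> 'rV[R]_n -> R) F (K : R) : mrV D -> (lebn D < +oo)%E ->
  (forall m, measurable_fun D (F_ m)) -> measurable_fun D F -> (forall m x, D x -> `|F_ m x| <= K) ->
  {ae leb R n, forall x, D x -> F_ m x @[m --> \oo] --> F x} ->
  \int[lebn]_(x in D) F_ m x @[m --> \oo] --> \int[lebn]_(x in D) F x.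
Proof.
move=> mD Dfin mF mF' FK cF.
have iK : I1 lebn D (fun=> K).
  by apply: (@I1_bounded _ _ _ _ _ _ `|K|) => // x _.
have [] := @dominated_convergence _ _ _ lebn D mD (fun m x => (F_ m x)%:E) (EFin \o F) (fun=> K%:E).
- by move=> m; exact/measurable_EFinP.
- exact/measurable_EFinP.
- apply: filterS cF => x hx Dx; apply: cvg_EFin; first exact: nearW.
  exact: hx.
- exact: iK.
- by apply: aeW => x m Dx; rewrite lee_fin; exact: FK.
move=> iF _ cv; apply: fine_cvg; rewrite /Rintegral fineK; last exact: integrable_fin_num.
exact: cv.
Qed.

Lemma Rintegral_shift F (c : 'rV[R]_n) : measurable_fun setT F ->
  \int[lebn]_x F (x + c) = \int[lebn]_x F x.
Proof.
move=> mF; rewrite /Rintegral; congr fine; rewrite integralE [RHS]integralE.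
have mE : measurable_fun setT (EFin \o F) by exact/measurable_EFinP.
have H (g : 'rV[R]_n -> \bar R) : measurable_fun setT g -> (forall x, (0 <= g x)%E) ->
    (\int[lebn]_x g (x + c)%R = \int[lebn]_x g x)%E.
  move=> mg g0; have := integral_lin c (@Lin1 R n) mg g0; rewrite mul1e => <-.
  by apply: eq_integral => x _; rewrite mulmx1.
congr (_ - _)%E.
  by rewrite -(H _ (measurable_funepos mE))//; apply: eq_integral => x _; rewrite !funeposE.
by rewrite -(H _ (measurable_funeneg mE))//; apply: eq_integral => x _; rewrite !funenegE.
Qed.

Lemma hasder_seq (g : R -> R) (a c : R) : hasder g 0 a -> c != 0 ->
  (c / m.+1%:R)^-1 * (g (c / m.+1%:R) - g 0) @[m --> \oo] --> a.
Proof.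
move=> hg c0; apply/cvgrPdist_le => e e0; have [r r0 hr] := hg e e0.
have cp : 0 < `|c| by rewrite normr_gt0.
have [M hM] := ltr_add_invr (y := 0) (x := r / `|c|) (divr_gt0 r0 cp).
exists M => // m /= Mm; set t := c / _.
have t0 : t != 0 by rewrite mulf_neq0// invr_eq0.
have tr : `|t - 0| < r.
  rewrite subr0 /t normrM normfV [`|m.+1%:R|]ger0_norm// mulrC -ltr_pdivlMr//.
  apply: le_lt_trans hM; rewrite add0r lef_pV2 ?posrE// ler_nat//.
have := hr t tr; rewrite !subr0 => h1.
have -> : a - t^-1 * (g t - g 0) = - (t^-1 * (g t - g 0 - t * a)) by field.
by rewrite normrN normrM normfV mulrC ler_pdivrMr// normr_gt0.
Qed.

Lemma smooth_quotient f (x : 'rV[R]_n) (b : 'I_n) (K : R) (t : R) : smooth f ->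
  (forall s, `|s| <= `|t| -> `|pd b f (x + s *: delta_mx 0 b)| <= K) ->
  `|f (x + t *: delta_mx 0 b) - f x| <= K * `|t|.
Proof.
move=> sf hK; set e := delta_mx 0 b.
have K0 : 0 <= K by apply: le_trans (hK 0 _); rewrite ?normr0.
pose g s := f (x + s *: (t *: e)); pose g' s := t * pd b f (x + s *: (t *: e)).
have hd s : hasder g s (g' s).
  have := @hasgrad_line R _ f x (t *: e) s _ (smooth_hasgrad _ sf).
  rewrite (bigD1 b)//= !mxE !eqxx mulr1 big1 ?addr0// => j jb.
  by rewrite !mxE (negbTE jb) andbF mulr0 mul0r.
have cg' : continuous g'.
  move=> s; apply: (@continuousM _ _ (fun=> t) (fun s : R => pd b f (x + s *: (t *: e)))); first exact: cst_continuous.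
  apply: (@continuous_comp _ _ _ (fun s : R => x + s *: (t *: e)) (pd b f)); last exact/smooth_cont/smooth_pd.
  apply: (@continuousD _ _ _ (fun=> x) (fun s : R => s *: (t *: e))); first exact: cst_continuous.
  exact: scalel_continuous.
have := ftc_sq ltr01 hd cg'; rewrite /g scale1r scale0r addr0 subr0 mul1r => h1.
have bd (s : R) : `[0%R, 1%R]%classic s -> `|g' s| <= `|t| * K.
  rewrite /= in_itv/= => /andP[s0 s1]; rewrite /g' normrM ler_wpM2l// scalerA; apply: hK.
  by rewrite normrM ger0_norm// ler_piMl.
have h2 : \int[@lebesgue_measure R]_(s in `[0, 1]) (g' s ^+ 2) <= \int[@lebesgue_measure R]_(s in `[0, 1]) ((`|t| * K) ^+ 2).
  have sq (s : R) : `[0%R, 1%R]%classic s -> g' s ^+ 2 <= (`|t| * K) ^+ 2.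
    by move=> /bd hs; rewrite -[leLHS]real_normK ?num_real// lerXn2r ?nnegrE.
  apply: le_Rintegral => //.
  - apply: (@I1_bounded _ _ _ _ _ _ ((`|t| * K) ^+ 2)) => //; first exact: segment_fin.
      by apply: measurable_funTS; apply: measurable_funX; exact: continuous_measurable_fun.
    by move=> s hs; rewrite ger0_norm//; exact: sq.
  - apply: (@I1_bounded _ _ _ _ _ _ ((`|t| * K) ^+ 2)) => //; first exact: segment_fin.
    by move=> s hs; rewrite ger0_norm.
rewrite Rintegral_cst// in h2.
have one : fine (@lebesgue_measure R `[0%R, 1%R]%classic) = 1.
  by rewrite lebesgue_measure_itv/= lte_fin ltr01 -EFinD subr0.
have := le_trans h1 h2; set q := fine _; have -> : q = 1 by exact: one.
rewrite mulr1.
rewrite -[X in X <= _]real_normK ?num_real// mulrC => h3.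
by rewrite -(@ler_pXn2r _ 2) ?nnegrE.
Qed.

Lemma dot0r D w f : mrV D -> (forall x, D x -> f x = 0) -> dot lebn D w f = 0.
Proof.
move=> mD f0; transitivity (\int[lebn]_(x in D) (0 : R)).
  by apply: eq_Rintegral => x /set_mem Dx; rewrite f0 ?mulr0.
by rewrite Rintegral_cst ?mul0r.
Qed.

(* The difference quotients of w and f converge boundedly. *)
Lemma by_parts D w g f (b : 'I_n) (m M L K : R) : mrV D -> (lebn D < +oo)%E ->
  smooth f -> 0 < m -> (forall x, f x != 0 -> forall y, `|y - x| <= m -> D y) ->
  (forall x, `|f x| <= K) -> (forall x, `|pd b f x| <= K) ->
  measurable_fun setT w -> (forall x, `|w x| <= M) -> measurable_fun D g ->
  (forall x, f x != 0 -> forall t, `|t| <= m -> `|w (x + t *: delta_mx 0 b) - w x| <= L * `|t|) ->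
  {ae leb R n, forall x, f x != 0 -> hasder (fun t => w (x + t *: delta_mx 0 b)) 0 (g x)} ->
  dot lebn D w (pd b f) = - dot lebn D g f.
Proof.
move=> mD Dfin sf m0 supp fK pK mw wM mg wL hw; set e : 'rV[R]_n := delta_mx 0 b.
pose t (j : nat) : R := m / j.+1%:R.
have t0 j : 0 < t j by rewrite divr_gt0.
have tm j : `|t j| <= m by rewrite gtr0_norm// ler_pdivrMr// ler_peMr// ler1n.
have K0 : 0 <= K by exact: le_trans (fK 0).
have mf := smooth_measurable sf; have mp := smooth_measurable (smooth_pd b sf).
have mshift (c : R) (F : 'rV[R]_n -> R) : measurable_fun setT F -> measurable_fun setT (fun x : 'rV[R]_n => F (x + c *: e)).
  move=> mF; apply: (measurableT_comp mF); have := measurable_affine 1%:M (c *: e).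
  by under eq_fun do rewrite mulmx1.
have TS (F : 'rV[R]_n -> R) : measurable_fun setT F -> measurable_fun D F by exact: measurable_funTS.
(* A translation of the integration variable turns the quotient of f at step t into the quotient of
   w at step -t, with the opposite sign: this is [AB]. The margin m keeps the translated supports in
   D. *)
pose A j x := w x * ((t j)^-1 * (f (x + t j *: e) - f x)).
pose B j x := (- t j)^-1 * (w (x + (- t j) *: e) - w x) * f x.
have suppD x : f x != 0 -> D x by move=> fx; apply: (supp x fx); rewrite subrr normr0.
have suppt j x : f (x + t j *: e) != 0 -> D x.
  move=> fx; apply: (supp _ fx); rewrite opprD addrA subrr sub0r normrN.
  exact: le_trans (norm_delta _ _) (tm j).
have cA : \int[lebn]_(x in D) A j x @[j --> \oo] --> \int[lebn]_(x in D) (w x * pd b f x).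
  apply: (@bounded_convergence _ _ _ (M * K)) => //.
  - move=> j; apply: TS; apply: measurable_funM => //; apply: measurable_funM => //.
    by apply: measurable_funB => //; exact: mshift.
  - by apply: TS; exact: measurable_funM.
  - move=> j x _; rewrite normrM ler_pM// normrM normfV (gtr0_norm (t0 j)) mulrC ler_pdivrMr//.
    rewrite -[X in K * X](gtr0_norm (t0 j)); exact: smooth_quotient.
  - apply: aeW => x _; apply: cvgM; first exact: cvg_cst.
    have := @hasder_seq (fun s => f (x + s *: e)) (pd b f x) m.
    rewrite scale0r addr0; apply => //.
    have := @hasgrad_line R n f x e 0 (fun j => pd j f (x + 0 *: e)) (smooth_hasgrad _ sf).
    rewrite scale0r addr0 (bigD1 b)//= !mxE !eqxx mul1r big1 ?addr0// => j jb.
    by rewrite !mxE (negbTE jb) andbF mul0r.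
have cB : \int[lebn]_(x in D) B j x @[j --> \oo] --> \int[lebn]_(x in D) (g x * f x).
  apply: (@bounded_convergence _ _ _ (`|L| * K)) => //.
  - move=> j; apply: TS; apply: measurable_funM => //; apply: measurable_funM => //.
    by apply: measurable_funB => //; exact: mshift.
  - by apply: measurable_funM => //; exact: TS.
  - move=> j x _; rewrite /B; have [->|fx] := eqVneq (f x) 0; first by rewrite mulr0 normr0.
    rewrite normrM ler_pM// normrM normfV normrN (gtr0_norm (t0 j)) mulrC ler_pdivrMr//.
    apply: le_trans (wL x fx (- t j) _) _; first by rewrite normrN.
    by rewrite normrN gtr0_norm// ler_wpM2r ?ler_norm// ltW.
  - apply: filterS hw => x hx _; have [fx|fx] := eqVneq (f x) 0.
      rewrite fx mulr0; apply: cvg_near_cst; apply: nearW => j; by rewrite /B fx mulr0.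
    apply: cvgM; last exact: cvg_cst.
    have := @hasder_seq (fun s => w (x + s *: e)) (g x) (- m) (hx fx).
    rewrite scale0r addr0 oppr_eq0 gt_eqF// => /(_ isT).
    by under eq_cvg do rewrite mulNr.
have AB j : \int[lebn]_(x in D) A j x = - \int[lebn]_(x in D) B j x.
  have i1 (F1 F2 : 'rV[R]_n -> R) : measurable_fun setT F1 -> measurable_fun setT F2 ->
      (forall x, `|F1 x| <= M) -> (forall x, `|F2 x| <= K) -> I1 lebn D (fun x => F1 x * F2 x).
    move=> m1 m2 h1 h2; apply: (@I1_bounded _ _ _ _ _ _ (M * K)) => //; first by apply: TS; exact: measurable_funM.
    by move=> x _; rewrite normrM ler_pM.
  have iA : I1 lebn D (fun x => w x * f (x + t j *: e)) by apply: i1 => //; exact: mshift.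
  have iB : I1 lebn D (fun x => w (x + (- t j) *: e) * f x) by apply: i1 => //; exact: mshift.
  have iC : I1 lebn D (fun x => w x * f x) by exact: i1.
  have -> : \int[lebn]_(x in D) A j x = (t j)^-1 * (\int[lebn]_(x in D) (w x * f (x + t j *: e)) - \int[lebn]_(x in D) (w x * f x)).
    rewrite -RintegralB// -RintegralZl//; last exact: I1B.
    by apply: eq_Rintegral => x _; rewrite /A; ring.
  have -> : \int[lebn]_(x in D) B j x = (- t j)^-1 * (\int[lebn]_(x in D) (w (x + (- t j) *: e) * f x) - \int[lebn]_(x in D) (w x * f x)).
    rewrite -RintegralB// -RintegralZl//; last exact: I1B.
    by apply: eq_Rintegral => x _; rewrite /B; ring.
  rewrite invrN mulNr opprK; congr (_ * (_ - _)).
  rewrite Rintegral_supp; last first.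
    move=> x nD; have [->|fx] := eqVneq (f (x + t j *: e)) 0; first by lra.
    by case: nD; exact: suppt fx.
  rewrite [RHS]Rintegral_supp; last first.
    move=> x nD; have [->|fx] := eqVneq (f x) 0; first by lra.
    by case: nD; exact: suppD.
  rewrite -[RHS](Rintegral_shift (t j *: e)); last by apply: measurable_funM => //; exact: mshift.
  by apply: eq_Rintegral => x _; rewrite scaleNr addrK.
have cA' : (fun j => - \int[lebn]_(x in D) B j x) @ \oo --> \int[lebn]_(x in D) (w x * pd b f x).
  by rewrite -(funext AB).
exact: (cvg_unique (@norm_hausdorff _ _) cA' (cvgN cB)).
Qed.

End Quotients.

(** * Projections onto polynomials and shape constants of a domain *)

Section PolynomialsOnDomain.
Context {R : realType} {d : nat} (G : gdom R d).
Local Notation n := d.+1.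
Local Notation D := (gD G).
Local Notation x0 := (gx0 G).
Local Notation r := (gr G).
Local Notation h := (gh G).
Local Notation N := (gN G).
Local Notation bd := (gbd (g := G)).
Local Notation Dnrm := (nrm lebn D).
Local Notation Ddot := (dot lebn D).

Lemma pol_S2 m f : Pol m f -> S2 lebn D f.
Proof. by move=> /Pol_smooth; exact: smooth_S2. Qed.

Lemma cube_sub : cball x0 r `<=` D. Proof. by move=> x; exact: g_cube. Qed.

Lemma pol_nrm0 k f : Pol (k : nat) f -> Dnrm f = 0 -> forall x, f x = 0.
Proof.
move=> pf f0 x; have [C C0 hC] := @inverse_estimate R n k (`|x - x0| / r).
have r0 := g_r0 G.
have [|h1 _] := hC f x0 r x pf r0; first by rewrite divfK//.
have := enm_le_nrm (smooth_cont (Pol_smooth pf)) r0 (@g_measurable R d G) cube_sub (pol_S2 pf).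
rewrite f0 expr0n /= pmulr_rle0// => h2.
have e0 : enm x0 r f = 0 by apply/eqP; rewrite -sqrf_eq0 eq_le h2 sqr_ge0.
by apply/eqP; rewrite -normr_le0; move: h1; rewrite e0 mulr0.
Qed.

Lemma QL2P (k : nat) v : S2 lebn D v -> Pol k (QL2 D k v) /\
  forall q, Pol k q -> Ddot v q = Ddot (QL2 D k v) q.
Proof.
move=> sv; have mD := @g_measurable R d G.
have sP q : Pol k q -> S2 lebn D q by exact: pol_S2.
have [f [pf hf]] : exists f, Pol k f /\ forall q, Pol k q -> Ddot f q = Ddot v q.
  apply: poly_riesz.
  - move=> q /sP sq; split=> [f1 f2 /sP s1 /sP s2|c f1 /sP s1]; first by rewrite dotDl.
    by rewrite dotZl.
  - move=> f /sP sf; split=> [f1 f2 /sP s1 /sP s2|c f1 /sP s1]; first by rewrite dotDr.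
    by rewrite dotZr.
  - split=> [f1 f2 /sP s1 /sP s2|c f1 /sP s1]; first by rewrite dotDr.
    by rewrite dotZr.
  - move=> f hf f0; apply: (pol_nrm0 hf); apply/eqP.
    by rewrite -sqrf_eq0 nrm_sqr f0.
pose P := [set f : 'rV[R]_n -> R | polyfun k%:Z f /\ forall q, polyfun k%:Z q -> ip D (v \- f) q = 0].
have Pex : exists f, P f.
  exists f; split; first exact/Pol_polyfun.
  move=> q /Pol_polyfun hq; rewrite -[LHS]/(Ddot (fun x => v x - f x) q).
  by rewrite dotBl ?hf ?subrr//; exact: sP.
have [] : P (QL2 D k v) by exact: xgetPex Pex.
move=> /Pol_polyfun hQ h0; split=> // q hq; have sq := sP _ hq; have sQ := sP _ hQ.
have := h0 q; rewrite -[ip _ _ _]/(Ddot (fun x => v x - QL2 D k v x) q) dotBl//.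
by move=> /(_ _)/eqP; rewrite subr_eq0 => H; apply/eqP/H/Pol_polyfun.
Qed.

Definition gbds : seq (cell R d n) := [seq bd i | i <- enum 'I_N].

Lemma bintE u : bint gbds u = \sum_i \int[lebn]_(t in cdom (bd i)) u (chart (bd i) t).
Proof. by rewrite /bint /gbds big_map big_enum. Qed.

Lemma gbd_I1 i f : smooth f -> I1 lebn (cdom (bd i)) (fun t => f (chart (bd i) t)).
Proof.
move=> sf; have mc := @gcdom_measurable R d G i.
have s1 : S2 lebn (cdom (bd i)) (fun=> 1).
  by apply: (@S2_bounded _ _ _ _ _ _ 1) => //; [exact: gbd_fin|move=> x _; rewrite normr1].
have s2 : S2 lebn (cdom (bd i)) (fun t => f (chart (bd i) t)).
  exact: (gbd_S2 i (smooth_cont (smooth_chart (bd i) sf))).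
by have := S2_mul mc s1 s2; rewrite /I1; under eq_fun do rewrite mul1r.
Qed.

Lemma gbd_area i : (2 * gq G) ^+ d <= fine (lebn (cdom (bd i))).
Proof.
have q0 := g_q0 G; rewrite -lee_fin fineK; last by rewrite ge0_fin_numE ?gbd_fin.
rewrite -(leb_cball (gt i) (ltW q0)); apply: le_measure; rewrite ?inE//.
- by apply: closed_rV_measurable; exact: (@closed_cball R d (gt i) (gq G)).
- exact: gcdom_measurable.
- by move=> t; exact: g_disc.
Qed.

Lemma grad0_cst (f : 'rV[R]_n -> R) : smooth f -> (forall b x, pd b f x = 0) -> forall x, f x = f 0.
Proof.
move=> sf f0 x.
have hd s : hasder (fun s => f (0 + s *: x)) s 0.
  have := @hasgrad_line R _ f 0 x s (fun j => pd j f (0 + s *: x)) (smooth_hasgrad _ sf).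
  by rewrite big1// => j _; rewrite f0 mulr0.
have := @ftc_sq R (fun s => f (0 + s *: x)) (fun=> 0) 0 1 ltr01 hd (fun x => @cst_continuous _ _ 0 x).
rewrite expr0n /= Rintegral_cst ?mul0r ?mulr0; last exact: measurable_itv.
rewrite scale0r scale1r !add0r => h1; apply/eqP; rewrite -subr_eq0 -sqrf_eq0 eq_le sqr_ge0 andbT.
exact: h1.
Qed.

Lemma PiH1P (k : nat) v : (forall b, S2 lebn D (wgrad D v b)) ->
  let p := PiH1 D gbds k v in
  [/\ Pol k p, forall q, Pol k q -> \sum_b Ddot (pd b p) (pd b q) = \sum_b Ddot (wgrad D v b) (pd b q) &
      bint gbds p = bint gbds v].
Proof.
move=> sg p; have mD := @g_measurable R d G.
have spd b q : Pol k q -> S2 lebn D (pd b q) by move=> /Pol_smooth/(smooth_pd b)/smooth_S2.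
have pdDq b (f q : 'rV[R]_n -> R) : Pol k f -> Pol k q -> pd b (fun x => f x + q x) = fun x => pd b f x + pd b q x.
  by move=> /Pol_smooth s1 /Pol_smooth s2; exact: pdD.
have pdZq b c (f : 'rV[R]_n -> R) : Pol k f -> pd b (fun x => c * f x) = fun x => c * pd b f x.
  by move=> /Pol_smooth s1; exact: pdZ.
have bD f q : Pol k f -> Pol k q -> bint gbds (fun x => f x + q x) = bint gbds f + bint gbds q.
  move=> /Pol_smooth s1 /Pol_smooth s2; rewrite !bintE -big_split /=; apply: eq_bigr => i _.
  by rewrite -RintegralD//; [exact: gcdom_measurable|exact: (gbd_I1 i s1)|exact: (gbd_I1 i s2)].
have bZ c f : Pol k f -> bint gbds (fun x => c * f x) = c * bint gbds f.
  move=> /Pol_smooth s1; rewrite !bintE mulr_sumr; apply: eq_bigr => i _.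
  by rewrite -RintegralZl//; [exact: gcdom_measurable|exact: (gbd_I1 i s1)].
have b1 : 0 < bint gbds (fun=> 1).
  have [i _] := @g_piece R d G; rewrite bintE (bigD1 i)//=.
  have F j : \int[lebn]_(t in cdom (bd j)) 1 = fine (lebn (cdom (bd j))).
    by rewrite Rintegral_cst ?mul1r//; exact: gcdom_measurable.
  apply: ltr_pwDl; last by apply: sumr_ge0 => j _; rewrite F fine_ge0// measure_ge0.
  rewrite F; apply: lt_le_trans (gbd_area i); by rewrite exprn_gt0// mulr_gt0// g_q0.
(* The product of boundary integrals makes the gradient form definite. Testing the solution with the
   constant 1 then gives the condition on boundary integrals, and subtracting it leaves the one on
   gradients. *)
pose a f q := \sum_b Ddot (pd b f) (pd b q) + bint gbds f * bint gbds q.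
pose L q := \sum_b Ddot (wgrad D v b) (pd b q) + bint gbds v * bint gbds q.
have linr (F : 'I_n -> 'rV[R]_n -> R) (e : R) : (forall b, S2 lebn D (F b)) ->
    linear_on k (fun q => \sum_b Ddot (F b) (pd b q) + e * bint gbds q).
  move=> sF; apply: linear_onD; last by apply: linear_onZ; split.
  split=> [f1 f2 h1 h2|c f1 h1].
    rewrite -big_split; apply: eq_bigr => b _ /=.
    by rewrite pdDq// dotDr//; exact: spd.
  rewrite mulr_sumr; apply: eq_bigr => b _.
  by rewrite pdZq// dotZr//; exact: spd.
have [f [pf hf]] : exists f, Pol k f /\ forall q, Pol k q -> a f q = L q.
  apply: poly_riesz.
  - move=> q hq; have := linr (fun b => pd b q) (bint gbds q) (fun b => spd b q hq).
    apply: linear_on_ext => f; apply: (congr2 +%R); last exact: mulrC.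
    by apply: eq_bigr => b _; exact: dotC.
  - by move=> f hf; apply: linr => b; exact: spd.
  - exact: linr.
  - move=> f hf af x.
    have S0 : 0 <= \sum_b Ddot (pd b f) (pd b f) by apply: sumr_ge0 => b _; exact: dot_ge0.
    have B0 : 0 <= bint gbds f * bint gbds f by rewrite -expr2.
    have /andP[/eqP S1 /eqP B1] : (\sum_b Ddot (pd b f) (pd b f) == 0) && (bint gbds f * bint gbds f == 0).
      by rewrite -paddr_eq0//; apply/eqP.
    have g0 b y : pd b f y = 0.
      apply: (@pol_nrm0 k); first by apply: PolW (Pol_pd b hf); rewrite lerBlDr lerDl.
      apply/eqP; rewrite -sqrf_eq0 nrm_sqr; apply/eqP.
      exact: (psumr_eq0P (fun b _ => dot_ge0 _ _ (pd b f)) S1).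
    have fc := grad0_cst (Pol_smooth hf) g0; rewrite fc.
    move/eqP: B1; rewrite -expr2 sqrf_eq0 (_ : f = fun x => f 0 * 1); last by apply/funext => y; rewrite mulr1 fc.
    by rewrite (bZ _ (fun=> 1)) ?mulf_eq0 ?(gt_eqF b1) ?orbF ?mulr1 => [/eqP|]//; exact: Pol_cst.
have P1 : Pol k (fun _ : 'rV[R]_n => 1 : R) by exact: Pol_cst.
have hb : bint gbds f = bint gbds v.
  have := hf _ P1; rewrite /a /L !big1 ?add0r; first by move/(mulIf (lt0r_neq0 b1)).
    by move=> b _; rewrite pd_cst dot0r.
  by move=> b _; rewrite pd_cst dot0r.
have hg q : Pol k q -> \sum_b Ddot (pd b f) (pd b q) = \sum_b Ddot (wgrad D v b) (pd b q).
  by move=> hq; have := hf q hq; rewrite /a /L hb => /addIr.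
pose P := [set p : 'rV[R]_n -> R | [/\ polyfun k%:Z p, forall q, polyfun k%:Z q ->
      \sum_i ip D (pd i p) (pd i q) = \sum_i ip D (wgrad D v i) (pd i q) & bint gbds p = bint gbds v]].
have Pex : exists f, P f.
  exists f; split=> //; first exact/Pol_polyfun.
  by move=> q /Pol_polyfun hq; exact: hg.
have [p1 p2 p3] : P p by exact: xgetPex Pex.
split; [exact/Pol_polyfun| |exact: p3].
by move=> q /Pol_polyfun hq; exact: p2.
Qed.

Lemma smooth_by_parts u f b : smooth u -> inner G f -> Ddot u (pd b f) = - Ddot (pd b u) f.
Proof.
move=> su [sf [m m0 supp]]; have mD := @g_measurable R d G; have h0 := g_h0 G.
have bnd q : smooth q -> exists2 M : R, 0 < M & forall x, `|x - x0| <= h + m -> `|q x| <= M.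
  by move=> /smooth_cont; exact: cont_rV_bounded.
have [M M0 hM] := bnd u su; have [L L0 hL] := bnd _ (smooth_pd b su).
have [K1 K10 hK1] := bnd f sf; have [K2 K20 hK2] := bnd _ (smooth_pd b sf).
have fD x : f x != 0 -> D x by move=> fx; apply: (supp x fx); rewrite subrr normr0.
have far x : ~ (`|x - x0| <= h + m) -> f x = 0 /\ pd b f x = 0.
  move=> nx; have nf y : `|y - x| < m -> f y = 0.
    move=> yx; apply/eqP/negP => /negP /fD /g_near yh; apply: nx.
    rewrite -(subrKA y) addrC (le_trans (ler_normD _ _))// lerD// distrC ltW//.
  split; first by apply: nf; rewrite subrr normr0.
  rewrite (hasgrad_pd b (a := fun=> 0))//.
  apply: (hasgrad_near (f := fun=> 0) m0); last exact: hasgrad_cst.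
  by move=> y yx; rewrite nf.
(* [by_parts] requires a function bounded on the whole space, so u is set to 0 outside a cube
   containing every point at distance at most m from D. *)
pose w x := u x * \1_(cball x0 (h + m)) x.
have mc : mrV (cball x0 (h + m)) by exact: cball_measurable.
have wE x : cball x0 (h + m) x -> w x = u x by move=> cx; rewrite /w indicE mem_set// mulr1.
have wD x : D x -> w x = u x by move=> /g_near xh; apply: wE; rewrite /cball /= (le_trans xh)// lerDl.
have near x : f x != 0 -> forall y, `|y - x| <= m -> w y = u y.
  by move=> /supp fx y /fx; exact: wD.
have -> : Ddot u (pd b f) = Ddot w (pd b f) by apply: dot_ext => // x Dx; rewrite wD.
apply: (@by_parts R n D w (pd b u) f b m M L (K1 + K2)) => //.
- exact: gD_fin.
- move=> x; have [hx|/negP hx] := boolP (`|x - x0| <= h + m); first by apply: (le_trans (hK1 x hx)); rewrite lerDl.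
  by have [-> _] := far x hx; rewrite normr0.
- move=> x; have [hx|/negP hx] := boolP (`|x - x0| <= h + m); first by apply: (le_trans (hK2 x hx)); rewrite lerDr.
  by have [_ ->] := far x hx; rewrite normr0.
- by apply: measurable_funM; [exact: smooth_measurable|exact: measurable_indic].
- move=> x; rewrite /w indicE; have [cx|cx] := boolP (x \in _); last by rewrite mulr0 normr0.
  by rewrite mulr1; apply: hM; move: cx; rewrite inE.
- by apply: measurable_funTS; exact: (smooth_measurable (smooth_pd b su)).
- move=> x fx t tm; have dx s : `|s| <= m -> `|x + s *: delta_mx 0 b - x| <= m.
    by move=> sm; rewrite addrAC subrr add0r (le_trans (norm_delta _ _)).
  rewrite (near x fx)//; last exact: dx.
  rewrite (near x fx); last by rewrite subrr normr0.
  apply: smooth_quotient => // s st; apply: hL; apply: (@le_trans _ _ h); last by lra.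
  by apply: g_near; apply: (supp x fx); apply: dx; exact: le_trans tm.
- apply: aeW => x fx e e0.
  have := @hasgrad_line R n u x (delta_mx 0 b) 0 (fun j => pd j u (x + 0 *: delta_mx 0 b)) (smooth_hasgrad _ su).
  rewrite scale0r addr0 (bigD1 b)//= !mxE !eqxx mul1r big1 ?addr0; last first.
    by move=> j jb; rewrite !mxE (negbTE jb) andbF mul0r.
  move=> /(_ e e0)[r' r'0 hr]; exists (Num.min r' m); first by rewrite lt_min r'0.
  move=> t; rewrite lt_min => /andP[tr tm].
  rewrite !(near x fx) ?subrr ?normr0//; last first.
    by rewrite addrAC subrr add0r (le_trans (norm_delta _ _))//; move: tm; rewrite subr0 => /ltW.
  by have := hr t tr; rewrite scale0r addr0.
Qed.

(** [gl] is affine and vanishes at x0. A point z at height l is x0 plus l times a vector reaching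
    the plane of the piece, of norm at least r by [g_plane]; hence |l| r <= |z - x0|. *)
Lemma gl_lip i (x y : 'rV[R]_n) : `|gl (i : 'I_N) x - gl i y| <= `|x - y| / r.
Proof.
have r0 := g_r0 G.
have -> : gl i x - gl i y = gl i (x0 + (x - y)).
  rewrite /gl /gy addrAC subrr add0r !mxE -sumrB; apply: eq_bigr => j _; rewrite !mxE; ring.
set z := x0 + (x - y); have [->|l0] := eqVneq (gl i z) 0; first by rewrite normr0.
rewrite ler_pdivlMr//; apply: (@le_trans _ _ (`|gl i z| * `|chart (bd i) (gtau i z) - x0|)).
  by rewrite ler_wpM2l//; exact: g_plane.
have := gX_K l0; rewrite /gX => /(congr1 (fun v => v - x0)).
by rewrite addrAC subrr add0r -normrZ => ->; rewrite /z addrAC subrr add0r.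
Qed.

Lemma chart_coord i (t t' : 'rV[R]_d) : `|t - t'| <= n%:R * `|chart (bd i) t - chart (bd i) t'|.
Proof.
have -> : t - t' = (chart (bd i) t - chart (bd i) t') *m (cdir (bd i))^T.
  rewrite /chart opprD addrACA subrr add0r -mulmxBl -mulmxA.
  by rewrite (_ : cdir (bd i) *m _ = 1%:M) ?mulmx1//; exact: g_iso.
apply/rVnorm_leP => //.
move=> j; rewrite mxE (le_trans (ler_norm_sum _ _ _))// mulr_natl -[X in _ *+ X](card_ord n) -sumr_const ler_sum// => k _.
have e1 : `|(cdir (bd i))^T k j| <= 1.
  rewrite mxE; have := congr1 (fun M : 'M[R]_d => M j j) (g_iso (g := G) i); rewrite !mxE eqxx mulr1n.
  rewrite (bigD1 k)//= !mxE => E.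
  have : cdir (bd i) j k ^+ 2 <= 1.
    rewrite -E expr2 lerDl sumr_ge0// => l _; rewrite !mxE -expr2 sqr_ge0//.
  by rewrite -[leLHS]real_normK ?num_real// expr_le1.
by rewrite normrM -[leRHS]mulr1 ler_pM//; exact: coord_le_norm.
Qed.

Lemma fsbig_finType (I : finType) (F : I -> \bar R) : (\sum_(i \in [set: I]) F i = \sum_i F i)%E.
Proof.
rewrite (fsbigE (index_enum I)) ?index_enum_uniq//; last first.
  by move=> i _; rewrite /= mem_index_enum.
by apply: eq_bigl => i; rewrite in_setT.
Qed.

Lemma piece_near i (e : R) (x : 'rV[R]_n) : 0 < e -> e <= r / 2 -> e * (4 * n%:R * h) < gq G * r ->
  `|x - chart (bd i) (gt i)| <= e -> 0 < gl i x /\ interior (cdom (bd i)) (gtau i x).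
Proof.
move=> e0 er eq xe; have r0 := g_r0 G; have h0 := g_h0 G.
set y := chart (bd i) (gt i) in xe.
have ly : gl i y = 1 by rewrite /y -(gX1 i (gt i)) gl_X.
have l1 : `|gl i x - 1| <= e / r.
  by rewrite -ly; apply: le_trans (gl_lip i x y) _; rewrite ler_pM2r.
have er2 : e / r <= 1 / 2 by rewrite ler_pdivrMr// mul1r mulrC.
have lp : 1 / 2 <= gl i x by move: l1; rewrite ler_norml; lra.
have l0 : 0 < gl i x by lra.
split=> //; have ln : gl i x != 0 by [].
have yD : D y by case: (bd_in (i := i) (t := gt i)) => //; apply: g_disc; rewrite subrr normr0 ltW// g_q0.
have E : chart (bd i) (gtau i x) - y = (gl i x)^-1 *: ((x - y) + (1 - gl i x) *: (y - x0)).
  have := gX_K ln; rewrite /gX => xE; apply: (scalerI ln).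
  rewrite [RHS]scalerA mulfV// scale1r.
  have -> : x - y = x0 + gl i x *: (chart (bd i) (gtau i x) - x0) - y by rewrite xE.
  by apply/rowP => k; rewrite !mxE; ring.
have b1 : `|chart (bd i) (gtau i x) - y| <= 4 * e * h / r.
  rewrite E normrZ normfV gtr0_norm//.
  have b2 : `|x - y + (1 - gl i x) *: (y - x0)| <= e + e / r * h.
    rewrite (le_trans (ler_normD _ _))// lerD// normrZ ler_pM//; first by rewrite distrC.
    exact: g_near.
  have b3 : e + e / r * h <= 2 * (e / r * h).
    have : e <= e / r * h by rewrite mulrAC ler_pdivlMr// ler_wpM2l// g_rh.
    lra.
  rewrite mulrC ler_pdivrMr//; apply: (le_trans b2); apply: (le_trans b3).
  rewrite (_ : 4 * e * h / r * gl i x = 4 * (e / r * h) * gl i x); last by ring.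
  have : 0 <= e / r * h by [].
  nra.
have b4 : `|gtau i x - gt i| < gq G.
  apply: le_lt_trans (chart_coord i _ _) _; apply: le_lt_trans (ler_wpM2l (ler0n _ _) b1) _.
  rewrite (_ : n%:R * (4 * e * h / r) = e * (4 * n%:R * h) / r); last by ring.
  by rewrite ltr_pdivrMr.
apply/nbhs_ballP; exists (gq G - `|gtau i x - gt i|); first by rewrite /= subr_gt0.
move=> t; rewrite ball_rVE /= => tt; apply: g_disc.
rewrite -(subrKA (gtau i x)) (le_trans (ler_normD _ _))// distrC -lerBrDr ltW//.
Qed.

Lemma piece_disjoint i j (x : 'rV[R]_n) : 0 < gl i x -> interior (cdom (bd i)) (gtau i x) ->
  0 < gl j x -> cdom (bd j) (gtau j x) -> i = j.
Proof.
move=> li ci lj cj; apply: contrapT => /eqP ij.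
have Ei := gX_K (lt0r_neq0 li); have Ej := gX_K (lt0r_neq0 lj).
have ci' := interior_subset ci.
have [_ ch] := ray_unique li lj ci' cj (etrans Ei (esym Ej)).
by apply: (g_sep ij ci); exists (gtau j x).
Qed.

(** Small cubes about the centres of the pieces lie in the cones over the interiors of these pieces
    ([piece_near]), hence are disjoint; comparison with the volume of a cube containing them bounds
    their number by shape constants. *)
Lemma piece_count (k : R) : h <= k * r -> h <= k * gq G ->
  N%:R <= (16 * n%:R * k ^+ 2) ^+ n.
Proof.
move=> kr kq; have r0 := g_r0 G; have h0 := g_h0 G; have q0 := g_q0 G.
have k1 : 1 <= k by rewrite -(ler_pM2r r0) mul1r (le_trans (@g_rh _ _ G)).
have k0 : 0 < k by lra.
have n1 : 1 <= n%:R :> R by rewrite ler1n.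
(* This half-side satisfies both smallness conditions of [piece_near], e <= r/2 and 4 n h e < q
   r. *)
have [e e0 eh] : exists2 e : R, 0 < e & e * (8 * n%:R * k ^+ 2) = h.
  exists (h / (8 * n%:R * k ^+ 2)) => //.
  by rewrite divfK//.
have nk : k <= n%:R * k ^+ 2.
  apply: (@le_trans _ _ (k ^+ 2)); last by rewrite ler_peMl.
  by rewrite expr2 ler_peMr//.
have e1 : e <= r / 2.
  rewrite ler_pdivlMr// -(ler_pM2r k0); apply: le_trans (_ : h <= r * k); last by lra.
  have : 0 <= e * (8 * n%:R * k ^+ 2 - 2 * k).
    by nra.
  by lra.
have e2 : e * (4 * n%:R * h) < gq G * r.
  rewrite -(ltr_pM2r (exprn_gt0 2 k0)).
  have -> : e * (4 * n%:R * h) * k ^+ 2 = (e * (8 * n%:R * k ^+ 2)) * h / 2 by field.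
  rewrite eh; apply: (@lt_le_trans _ _ (h * h)); first by rewrite ltr_pdivrMr// ltr_pMr// ltr1n.
  rewrite (_ : gq G * r * k ^+ 2 = (k * gq G) * (k * r)); last by ring.
  by rewrite ler_pM//.
have e3 : e <= h by rewrite -eh ler_peMr//; nra.
pose Q i := cball (chart (bd i) (gt i)) e.
have mQ i : mrV (Q i) by exact: cball_measurable.
have tQ : trivIset [set: 'I_N] Q.
  move=> i j _ _ [x [xi xj]].
  have [li ci] := piece_near e0 e1 e2 xi; have [lj cj] := piece_near e0 e1 e2 xj.
  exact: piece_disjoint li ci lj (interior_subset cj).
have fT : finite_set [set: 'I_N] by [].
have sub : \bigcup_(i in [set: 'I_N]) Q i `<=` cball x0 (2 * h).
  move=> x [i _ xi]; rewrite /cball /= -(subrKA (chart (bd i) (gt i))) (le_trans (ler_normD _ _))//.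
  rewrite mulr2n mulrDl mul1r lerD//; first exact: le_trans xi e3.
  by apply: g_near; case: (bd_in (i := i) (t := gt i)) => //; apply: g_disc; rewrite subrr normr0.
have : (lebn (\bigcup_(i in [set: 'I_N]) Q i) <= lebn (cball x0 (2 * h)))%E.
  apply: le_measure; rewrite ?inE//; first by apply: fin_bigcup_measurable => // i _; exact: mQ.
  exact: cball_measurable.
rewrite (measure_fin_bigcup lebn fT tQ); last by move=> i _; exact: mQ.
rewrite (leb_cball x0)//.
have -> : (\sum_(i \in [set: 'I_N]) lebn (Q i))%E = (N%:R * (2 * e) ^+ n)%:E.
  rewrite fsbig_finType (eq_bigr (fun=> ((2 * e) ^+ n)%:E)); last first.
    by move=> i _; exact: (leb_cball _ (ltW e0)).
  by rewrite sumEFin sumr_const card_ord [N%:R * _]mulr_natl.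
rewrite lee_fin -ler_pdivlMr// => /le_trans; apply.
rewrite -expr_div_n lerXn2r ?nnegrE//.
rewrite ler_pdivrMr// -{1}eh; lra.
Qed.

(** The part of the cone between heights 1/2 and 1 has volume at least [gc] q^d / 2, as its sections
    contain cubes of half-side q/2, and it is contained in a cube of half-side h. *)
Lemma gc_bound i (k : R) : h <= k * gq G -> gc (i : 'I_N) <= 4 * (2 * k) ^+ d * h.
Proof.
move=> kq; have q0 := g_q0 G; have h0 := g_h0 G; have [c0 _] := gcP i.
have k0 : 0 < k by rewrite -(pmulr_lgt0 _ q0) (lt_le_trans h0).
have mc := @gcdom_measurable R d G i.
have half : 0 <= 1 / 2 :> R by [].
have PD : gP i (1 / 2) `<=` D by exact: gP_D.
have := @polar R d G i (1 / 2) (fun=> 1%E) half (measurable_cst _) (fun=> lee01).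
rewrite integral_cst ?mul1e; last exact: gP_measurable.
set I := (\int[_]_(s in _) _)%E => E.
have I1 : ((gq G ^+ d / 2)%:E <= I)%E.
  have -> : ((gq G ^+ d / 2)%:E = \int[@lebesgue_measure R]_(s in `](1 / 2)%R, 1%R]) (gq G ^+ d)%:E)%E.
    rewrite integral_cst; last exact: measurable_itv.
    rewrite EFinM; congr (_ * _)%E; rewrite [RHS]left_open_measure; last lra.
    by congr (_%:E); lra.
  apply: ge0_le_integral => //.
  - by move=> s _; rewrite lee_fin.
  - have E2 : (fun s : R => \int[lebn]_(t in cdom (bd i)) ((s ^+ d)%:E * 1))%E = (fun s => (s ^+ d * fine (lebn (cdom (bd i))))%:E).
      apply/funext => s; rewrite integral_cst// ?mulr1 [in RHS]EFinM fineK//.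
      by rewrite ge0_fin_numE ?gbd_fin.
    rewrite E2; apply: measurable_funTS; apply/measurable_EFinP; apply: measurable_funM => //.
  - move=> s; rewrite /= in_itv/= => /andP[s0 _]; have s00 : 0 < s by lra.
    rewrite integral_cst//; have := gbd_area i.
    rewrite -lee_fin fineK; last by rewrite ge0_fin_numE ?gbd_fin.
    move=> h1; apply: (@le_trans _ _ ((s ^+ d)%:E * ((2 * gq G) ^+ d)%:E)%E).
      rewrite -EFinM lee_fin -exprMn lerXn2r ?nnegrE//; nra.
    by rewrite mulr1 lee_wpmul2l// lee_fin.
have Dle : (lebn (gP i (1 / 2)) <= ((2 * h) ^+ n)%:E)%E.
  apply: (@leb_fin_bounded _ _ _ x0); [exact: gP_measurable|exact: ltW|].
  by move=> y /PD; exact: g_near.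
have : ((gc i * (gq G ^+ d / 2))%:E <= ((2 * h) ^+ n)%:E)%E.
  by apply: le_trans Dle; rewrite E EFinM lee_wpmul2l// lee_fin.
rewrite lee_fin => h2.
have qd : 0 < gq G ^+ d by [].
rewrite -(ler_pM2r qd); have -> : gc i * gq G ^+ d = 2 * (gc i * (gq G ^+ d / 2)) by field.
apply: (@le_trans _ _ (2 * (2 * h) ^+ n)); first by lra.
have : (2 * h) ^+ d <= (2 * (k * gq G)) ^+ d by rewrite lerXn2r ?nnegrE// ler_pM2l.
move=> h3; have -> : 4 * (2 * k) ^+ d * h * gq G ^+ d = 2 * (2 * h) * (2 * (k * gq G)) ^+ d.
  by rewrite !exprMn; ring.
by rewrite exprS mulrA ler_pM2l.
Qed.

End PolynomialsOnDomain.

(** * Estimates for virtual functions *)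

Lemma smooth_lip {R : realType} n (f : 'rV[R]_n -> R) (x y : 'rV[R]_n) (L : R) : smooth f -> 0 <= L ->
  (forall s, 0 <= s <= 1 -> forall b, `|pd b f (x + s *: (y - x))| <= L) ->
  `|f y - f x| <= n%:R * L * `|y - x|.
Proof.
move=> sf L0 hL; set v := y - x.
pose g s := f (x + s *: v); pose g' s := \sum_b v 0 b * pd b f (x + s *: v).
have hd s : hasder g s (g' s) by exact: (hasgrad_line (smooth_hasgrad _ sf)).
have gi s : is_derive (s : R) (1 : R) g (g' s) by apply/hasder_is_derive.
have cg : {within `[0, 1], continuous g}.
  apply: continuous_subspaceT => s; apply: differentiable_continuous.
  by apply/derivable1_diffP; case: (gi s).
have [s s01 E] := MVT_segment ler01 (fun x _ => gi x) cg.
have -> : f y - f x = g' s.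
  have xy : x + v = y by rewrite /v addrCA subrr addr0.
  by move: E; rewrite subr0 mulr1 /g scale1r scale0r addr0 xy.
rewrite (le_trans (ler_norm_sum _ _ _))//.
have -> : n%:R * L * `|v| = \sum_(b < n) L * `|v| by rewrite sumr_const card_ord -mulrA mulr_natl.
apply: ler_sum => b _; rewrite normrM mulrC ler_pM//; last exact: coord_le_norm.
by apply: hL; move: s01; rewrite in_itv.
Qed.

Lemma sqr_le_lin {R : realType} (x c : R) : 0 <= x -> 0 <= c -> x ^+ 2 <= c * x -> x <= c.
Proof.
move=> x0 c0 h; have [->//|xn] := eqVneq x 0.
by nra.
Qed.

Lemma degree_split (e k : nat) : let e' := e%:Z in let k' := k%:Z in
  [/\ ~~ (e' <= k' - 2) && (e' == k') = (e' == k'),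
      ~~ (e' <= k' - 2) && (e' != k') && (e' == k' - 1) = (e' == k' - 1) &
      ~~ (e' <= k' - 2) && (e' != k') && (e' != k' - 1) -> (e' <= k') = false].
Proof. by split; lia. Qed.

Section Scaling.
Context {R : realType} {d : nat}.
Local Notation n := d.+1.
Implicit Types G : gdom R d.

(** The L^2 scale of the domain: up to shape constants, a polynomial of size M has norm [vol G]
    M. *)
Definition vol G : R := Num.sqrt (gr G ^+ n).

Lemma vol_gt0 G : 0 < vol G.
Proof. by rewrite sqrtr_gt0 exprn_gt0// g_r0. Qed.

Lemma vol_sqr G : vol G ^+ 2 = gr G ^+ n.
Proof. by rewrite sqr_sqrtr// exprn_ge0// ltW// g_r0. Qed.

Lemma K_ge1 G (K : R) : gh G <= K * gr G -> 1 <= K.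
Proof. by move=> h; rewrite -(ler_pM2r (g_r0 G)) mul1r (le_trans (@g_rh _ _ G)). Qed.

Lemma sup_nrm (K : R) : exists2 C : R, 0 < C & forall G (f : 'rV[R]_n -> R) (M : R), gh G <= K * gr G ->
  measurable_fun (gD G) f -> 0 <= M -> (forall x, gD G x -> `|f x| <= M) -> nrm lebn (gD G) f <= C * vol G * M.
Proof.
exists (Num.sqrt ((2 * `|K|) ^+ n) + 1) => //.
move=> G f M hK mf M0 fM; have mD := @g_measurable R d G; have r0 := g_r0 G; have h0 := g_h0 G.
apply: le_trans (nrm_bounded mD (gD_fin G) mf M0 fM) _; rewrite mulrC ler_wpM2r//.
apply: (@le_trans _ _ (Num.sqrt ((2 * gh G) ^+ n))).
  rewrite ler_wsqrtr// -lee_fin fineK; last by rewrite ge0_fin_numE ?gD_fin.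
  by apply: (leb_fin_bounded (x := gx0 G) mD (ltW h0)) => y; exact: g_near.
apply: (@le_trans _ _ (Num.sqrt ((2 * `|K|) ^+ n) * vol G)); last by rewrite ler_wpM2r ?lerDl// ltW// vol_gt0.
rewrite -sqrtrM// ler_wsqrtr// -exprMn lerXn2r ?nnegrE//.
by rewrite -mulrA ler_pM2l// (le_trans hK)// ler_wpM2r ?ler_norm//.
Qed.

Lemma pol_sup (k : nat) (K : R) : exists2 C : R, 0 < C & forall G (f : 'rV[R]_n -> R), gh G <= K * gr G -> Pol k f ->
  forall x, `|x - gx0 G| <= 2 * K * gr G ->
  vol G * `|f x| <= C * nrm lebn (gD G) f /\
  forall b, vol G * `|pd b f x| <= C / gr G * nrm lebn (gD G) f.
Proof.
have [C C0 hC] := @inverse_estimate R n k (2 * K); exists C => // G f hK pf x hx.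
have r0 := g_r0 G; have [h1 h2] := hC f _ _ x pf r0 hx.
have V0 := vol_gt0 G.
have e1 : vol G * enm (gx0 G) (gr G) f <= nrm lebn (gD G) f.
  have := enm_le_nrm (smooth_cont (Pol_smooth pf)) r0 (@g_measurable R d G) (@cube_sub _ _ G) (pol_S2 G pf).
  by rewrite -vol_sqr -exprMn ler_pXn2r ?nnegrE ?nrm_ge0 ?mulr_ge0 ?enm_ge0.
split=> [|b].
  by nra.
by apply: (le_trans (ler_wpM2l (ltW V0) (h2 b))); rewrite mulrCA ler_wpM2l//.
Qed.

Lemma barycenter_near G : `|barycenter (gD G) - gx0 G| <= gh G.
Proof.
have h0 := g_h0 G; have mD := @g_measurable R d G; have Df := gD_fin G.
apply/rVnorm_leP; first exact: ltW.
move=> i; rewrite !mxE.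
set a := (\int[lebn]_(x in gD G) 1).
have aE : a = fine (lebn (gD G)) by rewrite /a Rintegral_cst// mul1r.
have a0 : 0 < a.
  rewrite aE; apply: (@lt_le_trans _ _ ((2 * gr G) ^+ n)); first by rewrite exprn_gt0// mulr_gt0// g_r0.
  rewrite -lee_fin fineK; last by rewrite ge0_fin_numE.
  rewrite -(leb_cball (gx0 G) (ltW (g_r0 G))); apply: le_measure; rewrite ?inE//; last exact: cube_sub.
  exact: cball_measurable.
have i1 : I1 lebn (gD G) (fun x => x 0 i).
  apply: (@I1_bounded _ _ _ _ _ _ (`|gx0 G| + gh G)) => //.
    by apply: measurable_funTS; exact: measurable_coord.
  move=> x Dx; apply: le_trans (coord_le_norm _ _) _.
  by rewrite -[x](subrK (gx0 G)) addrC (le_trans (ler_normD _ _))// lerD2l g_near.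
have ic (c : R) : I1 lebn (gD G) (fun=> c) by apply: (@I1_bounded _ _ _ _ _ _ `|c|).
have -> : (\int[lebn]_(x in gD G) x 0 i) / a - gx0 G 0 i = (\int[lebn]_(x in gD G) (x 0 i - gx0 G 0 i)) / a.
  have -> : \int[lebn]_(x in gD G) (x 0 i - gx0 G 0 i) = \int[lebn]_(x in gD G) x 0 i - \int[lebn]_(x in gD G) gx0 G 0 i.
    by rewrite RintegralB//; exact: ic.
  by rewrite mulrBl Rintegral_cst// -aE mulfK//.
rewrite normrM normfV (gtr0_norm a0) ler_pdivrMr//.
apply: (@le_trans _ _ (\int[lebn]_(x in gD G) `|x 0 i - gx0 G 0 i|)).
  by apply: le_normr_Rintegral => //; exact: I1B.
have -> : gh G * a = \int[lebn]_(x in gD G) gh G by rewrite Rintegral_cst// aE.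
apply: le_Rintegral => //; last 1 first.
- by move=> x Dx; have := coord_le_norm (x - gx0 G) i; rewrite !mxE => /le_trans; apply; exact: g_near.
- apply: (@I1_le _ _ _ _ _ _ (fun=> gh G)) => //.
    apply: measurable_funTS; apply: measurableT_comp => //; apply: measurable_funB => //.
    exact: measurable_coord.
  by move=> x Dx; rewrite normr_id; have := coord_le_norm (x - gx0 G) i; rewrite !mxE => /le_trans; apply; exact: g_near.
- exact: ic.
Qed.

(** The splitting is by degree in the expansion about the barycenter, the centre that the
    enhancement uses. The coefficients in scaled coordinates are bounded by [gram_coef] on the cube
    of half-side r about the barycenter; values of f there are under control whether or not the cube
    lies in D. *)
Lemma pol_split (k : nat) (K : R) : exists2 C : R, 0 < C & forall G (f : 'rV[R]_n -> R), gh G <= K * gr G -> Pol k f ->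
  exists f1 q1 q2, [/\ Pol (k%:Z - 2) f1, homfun (gD G) k q1, homfun (gD G) (k%:Z - 1) q2,
    forall x, f x = f1 x + (q1 x + q2 x) & nrm lebn (gD G) f1 <= C * nrm lebn (gD G) f].
Proof.
have [C1 C10 h1] := pol_sup k K; have [C2 C20 h2] := @enm_le_sup R n.
have [C3 C30 h3] := @gram_coef R n k; have [C4 C40 h4] := sup_nrm K.
pose I := {ffun 'I_n -> 'I_k.+1}.
pose C := C4 * (#|{: I}|%:R * (C3 * (C2 * C1) * ((2 * `|K|) ^+ k) ^+ n)).
exists (C + 1).
  have c2 : 0 <= ((2 * `|K|) ^+ k) ^+ n by [].
  rewrite ltr_wpDl// /C; apply: mulr_ge0; first exact: ltW.
  apply: mulr_ge0 => //; apply: mulr_ge0.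
move=> G f hK pf; have r0 := g_r0 G; have h0 := g_h0 G; have K1 := K_ge1 hK.
have K0 : 0 <= K by lra.
have V0 := vol_gt0 G; set A := nrm lebn (gD G) f.
have A0 : 0 <= A by exact: nrm_ge0.
set xb := barycenter (gD G); have xbh : `|xb - gx0 G| <= gh G by exact: barycenter_near.
have /Pol_polyfun[c0 cE0] := Pol_scaled xb (gr G) pf.
pose c (b : I) := if ((mdeg b)%:Z <= k%:Z)%R then c0 b else 0.
have cE y : f (gr G *: y + xb) = \sum_b c b * mono (fun i => b i) y.
  by rewrite cE0 big_mkcond; apply: eq_bigr => b _; rewrite /c; case: ifP => //; rewrite mul0r.
have fE x : f x = \sum_b c b * mono (fun i => b i) ((gr G)^-1 *: (x - xb)).
  by rewrite -cE scalerA mulfV// scale1r subrK.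
have hc b : `|c b| <= C3 * (C2 * C1) * (A / vol G).
  apply: le_trans (h3 c b) _; rewrite -mulrA ler_pM2l//.
  rewrite -(funext cE) -[Num.sqrt _]/(enm xb (gr G) f) -mulrA.
  apply: h2 => //; first exact: (smooth_cont (Pol_smooth pf)).
  move=> x xr; have [] := h1 G f hK pf x.
    rewrite -(subrKA xb) (le_trans (ler_normD _ _))//; apply: le_trans (lerD xr xbh) _.
    apply: le_trans (lerD (_ : gr G <= K * gr G) hK) _; last lra.
    by rewrite ler_peMl//.
  by move=> hx _; rewrite mulrA ler_pdivlMr// mulrC.
pose m (b : I) x := mono (fun i => b i) ((gr G)^-1 *: (x - xb)).
have mE (b : I) x : m b x = (gr G)^-1 ^+ mdeg b * mono (fun i => b i) (x - xb).
  rewrite /m /mono /mdeg -prodrXr -big_split; apply: eq_bigr => i _.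
  by rewrite mxE exprMn.
have pm (b : I) : Pol (mdeg b) (m b).
  have := @Pol_affine R n n _ _ ((gr G)^-1%:M) (- ((gr G)^-1 *: xb)) (@Pol_mono R n (fun i => b i)).
  by apply: Pol_ext => x; rewrite /m mul_mx_scalar scalerBr.
pose S (Q : pred I) x := \sum_(b | Q b) c b * m b x.
exists (S (fun b => (mdeg b)%:Z <= k%:Z - 2)), (S (fun b => (mdeg b)%:Z == k%:Z)), (S (fun b => (mdeg b)%:Z == k%:Z - 1)).
split.
- by apply: Pol_sum => b hb; apply: Pol_scale; exact: PolW hb (pm b).
- rewrite /S; under eq_fun do rewrite big_mkcond.
  apply: homfun_sum => b _; case hb: ((mdeg b)%:Z == k%:Z); last first.
    by exists (fun=> 0) => x; rewrite big1// => ? _; rewrite mul0r.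
  move/eqP: hb => hb; rewrite -hb; under eq_fun do rewrite mE mulrA; exact: homfun_mono.
- rewrite /S; under eq_fun do rewrite big_mkcond.
  apply: homfun_sum => b _; case hb: ((mdeg b)%:Z == k%:Z - 1); last first.
    by exists (fun=> 0) => x; rewrite big1// => ? _; rewrite mul0r.
  move/eqP: hb => hb.
  rewrite -hb; under eq_fun do rewrite mE mulrA; exact: homfun_mono.
- move=> x; rewrite fE (bigID (fun b : I => (mdeg b)%:Z <= k%:Z - 2))/=; congr (_ + _).
  rewrite (bigID (fun b : I => (mdeg b)%:Z == k%:Z))/=; congr (_ + _).
    by apply: eq_bigl => b; case: (degree_split (mdeg b) k).
  rewrite (bigID (fun b : I => (mdeg b)%:Z == k%:Z - 1))/= [X in _ + X]big1 ?addr0.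
    by apply: eq_bigl => b; case: (degree_split (mdeg b) k).
  by move=> b hb; rewrite /c; have [_ _ ->] := degree_split (mdeg b) k; rewrite ?mul0r.
- apply: (@le_trans _ _ (C * A)); last by lra.
  have c2 : 0 <= ((2 * `|K|) ^+ k) ^+ n by [].
  have c1 : 0 <= C3 * (C2 * C1) * (A / vol G) * ((2 * `|K|) ^+ k) ^+ n.
    apply: mulr_ge0 => //; apply: mulr_ge0.
  have M0 : 0 <= #|{: I}|%:R * (C3 * (C2 * C1) * (A / vol G) * ((2 * `|K|) ^+ k) ^+ n).
    by [].
  apply: le_trans (h4 G _ _ hK _ M0 _) _.
  + apply: measurable_funTS; apply: smooth_measurable; apply: smooth_sum => b _; apply: smoothZ; exact: Pol_smooth (pm b).
  + move=> x Dx; rewrite /S (le_trans (ler_norm_sum _ _ _))//.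
    rewrite mulr_natl -sumr_const big_mkcond ler_sum// => b _.
    case: ifP => _; last exact: c1.
    rewrite normrM ler_pM//; rewrite /m /mono normr_prod -[X in _ ^+ X](card_ord n) -prodr_const.
    apply: ler_prod => i _; rewrite normr_ge0/= normrX.
    have h2K : `|((gr G)^-1 *: (x - xb)) 0 i| <= 2 * `|K|.
      apply: le_trans (coord_le_norm _ _) _; rewrite normrZ gtr0_norm// mulrC ler_pdivrMr//.
      rewrite -(subrKA (gx0 G)) (le_trans (ler_normD _ _))// [`|gx0 G - xb|]distrC.
      apply: le_trans (lerD (g_near Dx) xbh) _; rewrite (ger0_norm K0); lra.
    apply: (@le_trans _ _ ((2 * `|K|) ^+ b i)); first by rewrite lerXn2r ?nnegrE.
    by rewrite ler_weXn2l ?(ger0_norm K0) -1?ltnS//; lra.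
  + by rewrite /C; apply: eq_ler; field; rewrite gt_eqF.
Qed.

End Scaling.

(** * The energy estimate, given a lifting of the boundary values *)

Section Core.
Context {R : realType} {d : nat}.
Local Notation n := d.+1.
Implicit Types G : gdom R d.
Local Notation Dnrm G := (nrm lebn (gD G)).
Local Notation Ddot G := (dot lebn (gD G)).
Local Notation Fnrm G i := (nrm lebn (cdom (gbd (g := G) i))).

(* u takes the boundary values of v up to e, with energy E; the scaling of the
   bound on the traces of v is that of E. *)
Definition lifting G (v : 'rV[R]_n -> R) (E : R) :=
  (forall e : R, 0 < e -> exists u, [/\ smooth u,
     forall i, Fnrm G i (fun t => v (chart (gbd i) t) - u (chart (gbd i) t)) <= e,
     forall b, Dnrm G (pd b u) <= E & Dnrm G u <= E * gh G]) /\
  forall i, Fnrm G i (v \o chart (gbd i)) ^+ 2 <= E ^+ 2 * gh G.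

(** The characterization of [PiH1] as a relation, in which v and its gradient are separate:
    subtracting a constant then calls for no uniqueness argument. *)
Definition is_projection (k : nat) G (v : 'rV[R]_n -> R) (g : 'I_n -> 'rV[R]_n -> R) f :=
  [/\ Pol k f, forall q, Pol k q -> \sum_b Ddot G (pd b f) (pd b q) = \sum_b Ddot G (g b) (pd b q) &
      bint (gbds G) f = bint (gbds G) v].

(* What remains of "v is in the virtual element space, with gradient g, and w has
   the same moments": invariant under adding a constant to v and w. *)
Record element (k : nat) G (v w : 'rV[R]_n -> R) (g : 'I_n -> 'rV[R]_n -> R) : Prop := Element {
  el_traced : traced G v g;
  el_div : exists2 p, Pol k p & wdiv G g p;
  el_w : S2 lebn (gD G) w;
  el_low : forall q, Pol (k%:Z - 2) q -> Ddot G v q = Ddot G w q;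
  el_top : exists2 f, is_projection k G v g f & forall q1 q2, homfun (gD G) k q1 -> homfun (gD G) (k%:Z - 1) q2 ->
    Ddot G v (fun x => q1 x + q2 x) = Ddot G f (fun x => q1 x + q2 x) }.

Lemma wdiv_grad G f : smooth f -> wdiv G (fun b => pd b f) (fun x => \sum_b pd b (pd b f) x).
Proof.
move=> sf; have mD := @g_measurable R d G; split.
- by move=> b; exact/smooth_S2/smooth_pd.
- by apply: smooth_S2; apply: smooth_sum => b _; do 2!apply: smooth_pd.
move=> q iq; have [sq _] := iq; rewrite dot_suml//; last 2 first.
- by move=> b _; apply: smooth_S2; do 2!apply: smooth_pd.
- exact: smooth_S2.
by rewrite -sumrN; apply: eq_bigr => b _; apply: smooth_by_parts => //; exact: smooth_pd.
Qed.

(* Testing with the difference of v and its lifting. *)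
Lemma green_lift G v g q p E : traced G v g -> lifting G v E -> wdiv G q p ->
  `|\sum_b Ddot G (q b) (g b) + Ddot G p v| <= (\sum_b Dnrm G (q b)) * E + Dnrm G p * (E * gh G).
Proof.
move=> tv [hl _] wq; have mD := @g_measurable R d G.
have [sv sg _] := tv; have [sq sp _] := wq.
have E0 : 0 <= E by have [u [_ _ h _]] := hl 1 ltr01; exact: le_trans (nrm_ge0 _ _ _) (h ord0).
apply: (@le_eps _ _ _ 1) => // dl dl0; rewrite mul1r.
pose La := \sum_b Dnrm G (g b) + E.
have La0 : 0 <= La by rewrite addr_ge0// sumr_ge0// => b _; exact: nrm_ge0.
have [k k0 hk] := green wq La0 dl0; have [u [su h1 h2 h3]] := hl k k0.
have spd b : S2 lebn (gD G) (pd b u) by exact/smooth_S2/smooth_pd.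
have sU : S2 lebn (gD G) u by exact: smooth_S2.
have := hk _ _ (traced_sub tv su) h1 _; set X := _ + _ => H.
have {H} hX : `|X| <= dl.
  apply: H => b; apply: le_trans (nrmB mD (sg b) (spd b)) _; rewrite /La lerD//.
  by rewrite (bigD1 b)//= lerDl sumr_ge0// => j _; exact: nrm_ge0.
have -> : \sum_b Ddot G (q b) (g b) + Ddot G p v = X + (\sum_b Ddot G (q b) (pd b u) + Ddot G p u).
  have -> : X = (\sum_b Ddot G (q b) (g b) - \sum_b Ddot G (q b) (pd b u)) + (Ddot G p v - Ddot G p u).
    rewrite /X (dotBr mD sv sU sp) -sumrB; congr (_ + _); apply: eq_bigr => b _.
    exact: (dotBr mD (sg b) (spd b) (sq b)).
  ring.
rewrite (le_trans (ler_normD _ _))// addrC lerD// (le_trans (ler_normD _ _))// lerD//.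
  rewrite (le_trans (ler_norm_sum _ _ _))// mulr_suml ler_sum// => b _.
  by apply: le_trans (cauchy_schwarz mD (sq b) (spd b)) _; rewrite ler_wpM2l ?nrm_ge0.
by apply: le_trans (cauchy_schwarz mD sp sU) _; rewrite ler_wpM2l ?nrm_ge0.
Qed.

(** The equation is tested with p times a bump on the cube of half-side r/2. The left side is the
    weighted norm of p squared; on the right, p being polynomial, the derivative of the test
    function costs 1/r times that norm. *)
Lemma laplacian_bound (k : nat) (K : R) : exists2 C : R, 0 < C & forall G g p, gh G <= K * gr G ->
  wdiv G g p -> Pol k p -> Dnrm G p <= C / gr G * \sum_b Dnrm G (g b).
Proof.
have [C1 C10 h1] := @inverse_estimate R n k (4 * K); have [C2 C20 h2] := @sup_nrm R d K.
have [C3 C30 h3] := @qbump_pd R n.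
exists (C2 * C1 * (2 ^+ n * (C2 * (2 * C1 + 2 * C3 * C1)))).
  by [].
move=> G g p hK wg pp; have [sg sp wt] := wg; have mD := @g_measurable R d G.
have r0 := g_r0 G; have h0 := g_h0 G; have V0 := vol_gt0 G.
pose rr := gr G / 2; have rr0 : 0 < rr by rewrite divr_gt0.
pose b0 := qbump (gx0 G) rr; pose e := enm (gx0 G) rr p.
have e0 : 0 <= e by exact: enm_ge0.
have sP := Pol_smooth pp; have sB := qbump_smooth (gx0 G) rr.
have est x : `|x - gx0 G| <= gh G -> `|p x| <= C1 * e /\ forall b, `|pd b p x| <= C1 / rr * e.
  move=> xh; apply: h1 => //; apply: (le_trans xh); apply: (le_trans hK); rewrite /rr.
  have : 0 <= K * gr G by lra.
  lra.
have sBp : smooth (fun x => b0 x * p x) by exact: smoothM.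
have iBp : inner G (fun x => b0 x * p x).
  split=> //; exists rr => // x nz y yx; apply: g_cube.
  have /qbump_out : b0 x != 0 by apply: contraNN nz => /eqP ->; rewrite mul0r.
  rewrite /cball /= => /(_ rr0) xr; rewrite -(subrKA x) (le_trans (ler_normD _ _))//.
  by rewrite (splitr (gr G)) lerD.
have A0 : 0 <= \sum_b Dnrm G (g b) by apply: sumr_ge0 => b _; exact: nrm_ge0.
set A := \sum_b _ in A0 *.
have Mp : Dnrm G p <= C2 * vol G * (C1 * e).
  apply: h2 => //; first by apply: measurable_funTS; exact: smooth_measurable.
  by move=> x /g_near/est[].
have Mb b : Dnrm G (pd b (fun x => b0 x * p x)) <= C2 * vol G * ((2 * C1 + 2 * C3 * C1) * e / gr G).
  apply: h2 => //; first by apply: measurable_funTS; exact: (smooth_measurable (smooth_pd b sBp)).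
  move=> x /g_near/est[ex1 ex2]; rewrite pdM//.
  have -> : (2 * C1 + 2 * C3 * C1) * e / gr G = 1 * (C1 / rr * e) + C1 * e * (C3 / rr).
    by rewrite /rr; field; rewrite gt_eqF.
  rewrite (le_trans (ler_normD _ _))// lerD// normrM ler_pM//; last exact: h3.
  by have /andP[p1 p2] := qbump_itv (gx0 G) rr x; rewrite ger0_norm.
have key : rr ^+ n * e ^+ 2 <= A * (C2 * vol G * ((2 * C1 + 2 * C3 * C1) * e / gr G)).
  rewrite (@enm_integral R n p (gx0 G) rr (gD G) (smooth_cont sP) rr0); last first.
    by move=> x; rewrite /cball /= => xr; apply: g_cube; apply: le_trans xr _; rewrite /rr; lra.
  have -> : \int[lebn]_(x in gD G) (qbump (gx0 G) rr x * p x * p x) = Ddot G p (fun x => b0 x * p x).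
    by apply: eq_Rintegral => x _; rewrite mulrC.
  have := wt _ iBp => /(congr1 -%R); rewrite opprK => <-.
  apply: le_trans (ler_norm _) _; rewrite normrN (le_trans (ler_norm_sum _ _ _))// mulr_suml ler_sum// => b _.
  apply: le_trans (cauchy_schwarz mD (sg b) _) _; first exact/smooth_S2/smooth_pd.
  by rewrite ler_wpM2l ?nrm_ge0.
have e1 : vol G * e <= 2 ^+ n * (C2 * (2 * C1 + 2 * C3 * C1)) * (A / gr G).
  apply: sqr_le_lin; first by [].
    by [].
  have -> : (vol G * e) ^+ 2 = 2 ^+ n * (rr ^+ n * e ^+ 2).
    rewrite exprMn vol_sqr mulrA -exprMn /rr; congr (_ ^+ _ * _); by field.
  have -> : 2 ^+ n * (C2 * (2 * C1 + 2 * C3 * C1)) * (A / gr G) * (vol G * e) =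
    2 ^+ n * (A * (C2 * vol G * ((2 * C1 + 2 * C3 * C1) * e / gr G))) by ring.
  by rewrite ler_pM2l.
apply: (le_trans Mp); have -> : C2 * vol G * (C1 * e) = C2 * C1 * (vol G * e) by ring.
have -> : C2 * C1 * (2 ^+ n * (C2 * (2 * C1 + 2 * C3 * C1))) / gr G * A =
  C2 * C1 * (2 ^+ n * (C2 * (2 * C1 + 2 * C3 * C1)) * (A / gr G)) by ring.
by rewrite ler_pM2l//.
Qed.

(** For the gradient of f, [green_lift] is applied to the field grad f, whose divergence has degree
    k - 2: against it v may be replaced by w. For the constant part, f and v have the same boundary
    integral, which the trace bound in [lifting] controls, and f oscillates by at most its gradient
    times h. *)
Lemma projection_bound (k : nat) (K : R) : exists2 C : R, 0 < C & forall G v g w f E, gh G <= K * gr G -> gh G <= K * gq G ->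
  traced G v g -> lifting G v E -> S2 lebn (gD G) w -> Dnrm G w <= E * gh G ->
  (forall q, Pol (k%:Z - 2) q -> Ddot G v q = Ddot G w q) -> is_projection k G v g f -> Dnrm G f <= C * E * gh G.
Proof.
have [C1 C10 h1] := pol_sup (d := d) k K; have [C2 C20 h2] := @sup_nrm R d K.
(* In units of E, [B] bounds the gradient of f and [B2] its value at the star centre. *)
pose B := n%:R * (1 + 2 * (C2 * C1) * `|K|).
pose B2 := `|K| ^+ d + n%:R * C1 * B.
have B0 : 0 <= B by rewrite mulr_ge0// addr_ge0// mulr_ge0// mulr_ge0.
have B20 : 0 <= B2 by rewrite /B2.
exists (C2 * (B2 + n%:R * C1 * B) + 1) => //.
move=> G v g w f E hK hq tv hl sw wE mom [pf fg fb]; have [lif tr] := hl.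
have mD := @g_measurable R d G; have [sv sg _] := tv.
have r0 := g_r0 G; have h0 := g_h0 G; have q0 := g_q0 G; have V0 := vol_gt0 G; have K1 := K_ge1 hK.
have K0 : 0 <= K by lra.
have E0 : 0 <= E by have [u [_ _ h _]] := lif 1 ltr01; exact: le_trans (nrm_ge0 _ _ _) (h ord0).
have sf := Pol_smooth pf.
have pp b : Pol k (pd b f) by apply: PolW (Pol_pd b pf); rewrite lerBlDr lerDl.
set P := \sum_b Dnrm G (pd b f).
have P0 : 0 <= P by apply: sumr_ge0 => b _; exact: nrm_ge0.
pose L x := \sum_b pd b (pd b f) x.
have pL : Pol (k%:Z - 2) L.
  apply: Pol_sum => b _; have := Pol_pd b (Pol_pd b pf); apply: PolW; by rewrite -addrA.
have Lb : Dnrm G L <= C2 * C1 / gr G * P.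
  have s2 b : smooth (pd b (pd b f)) by do 2!apply: smooth_pd.
  have S2b b : true -> S2 lebn (gD G) (pd b (pd b f)) by move=> _; exact: smooth_S2.
  apply: le_trans (nrm_sum _ mD S2b) _.
  rewrite mulr_sumr ler_sum// => b _.
  have M0 : 0 <= C1 / gr G * Dnrm G (pd b f) / vol G.
    by rewrite divr_ge0// mulr_ge0 ?nrm_ge0//.
  apply: le_trans (h2 G _ _ hK _ M0 _) _.
  - by apply: measurable_funTS; exact: smooth_measurable.
  - move=> x /g_near xh; have [|_ /(_ b)] := h1 G _ hK (pp b) x; last by rewrite ler_pdivlMr// mulrC.
    by lra.
  - apply: eq_ler; field; by lra.
have sL := pol_S2 G pL.
have PE : P <= B * E.
  apply: (sqr_le_lin P0 (mulr_ge0 B0 E0)).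
  apply: le_trans (sum_sqr_le _) _.
  have -> : \sum_b Dnrm G (pd b f) ^+ 2 = \sum_b Ddot G (pd b f) (g b).
    rewrite -[RHS](eq_bigr _ (fun b _ => dotC _ _ (g b) (pd b f))) -(fg f pf).
    by apply: eq_bigr => b _; rewrite nrm_sqr.
  rewrite (_ : B * E * P = n%:R * ((1 + 2 * (C2 * C1) * `|K|) * (E * P))); last by rewrite /B; ring.
  rewrite ler_wpM2l//.
  have := green_lift tv hl (wdiv_grad G sf); rewrite -/P -/L => hg.
  have hw : `|Ddot G L v| <= Dnrm G L * (E * gh G).
    rewrite dotC mom// dotC; apply: le_trans (cauchy_schwarz mD sL sw) _.
    by rewrite ler_wpM2l ?nrm_ge0.
  have hLE : Dnrm G L * (E * gh G) <= C2 * C1 * K * P * E.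
    apply: (@le_trans _ _ (C2 * C1 / gr G * P * (E * gh G))).
      by rewrite ler_wpM2r//.
    rewrite (_ : _ * (E * gh G) = (C2 * C1 * P * E) * (gh G / gr G)); last by ring.
    rewrite (_ : C2 * C1 * K * P * E = (C2 * C1 * P * E) * K); last by ring.
    by apply: ler_wpM2l; [rewrite mulr_ge0// mulr_ge0|rewrite ler_pdivrMr].
  rewrite (ger0_norm K0); move: hg hw; rewrite !ler_norml => /andP[_ hg] /andP[hw _].
  have -> : (1 + 2 * (C2 * C1) * K) * (E * P) = P * E + 2 * (C2 * C1 * K * P * E) by ring.
  lra.
have gb x b : gD G x -> vol G * `|pd b f x| <= C1 * (B * E).
  move=> /g_near xh; have [|hx _] := h1 G _ hK (pp b) x.
    by lra.
  apply: (le_trans hx); rewrite ler_wpM2l//; apply: le_trans PE.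
  by rewrite /P (bigD1 b)//= lerDl sumr_ge0// => j _; exact: nrm_ge0.
pose T := n%:R * C1 * B * E * gh G / vol G.
have T0 : 0 <= T by rewrite divr_ge0// mulr_ge0// mulr_ge0// mulr_ge0// mulr_ge0// ltW.
have osc x : gD G x -> `|f x - f (gx0 G)| <= T.
  move=> Dx; have LL0 : 0 <= C1 * (B * E) / vol G by [].
  apply: le_trans (@smooth_lip R n f (gx0 G) x _ sf LL0 _) _.
    move=> s s01 b; rewrite ler_pdivlMr// mulrC; apply: gb.
    apply: (@g_star _ _ G (gx0 G) _ x Dx); first by rewrite subrr normr0.
    by exists s.
  apply: (@le_trans _ _ (n%:R * (C1 * (B * E) / vol G) * gh G)); last by rewrite /T; apply: eq_ler; ring.
  by apply: ler_wpM2l; [apply: mulr_ge0|exact: g_near].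
pose ar i := fine (lebn (cdom (gbd (g := G) i))).
have mc i := @gcdom_measurable R d G i.
have ar_lb i : (2 * gq G) ^+ d <= ar i by exact: gbd_area.
have ar_ub i : ar i <= (2 * (n%:R * gh G)) ^+ d.
  rewrite -lee_fin fineK; last by rewrite ge0_fin_numE ?gbd_fin.
  have ci : cdom (gbd i) (gt (g := G) i) by apply: g_disc; rewrite subrr normr0.
  apply: (@leb_fin_bounded _ _ _ (gt i)) => //.
  by move=> t ct; exact: (gbd_bounded ct ci).
have arE i (c : R) : \int[lebn]_(t in cdom (gbd (g := G) i)) c = c * ar i by rewrite Rintegral_cst //; exact: mc.
have ic i (c : R) : I1 lebn (cdom (gbd (g := G) i)) (fun=> c).
  by apply: (@I1_bounded _ _ _ _ _ _ `|c|) => //; [exact: mc|exact: gbd_fin].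
set a := \sum_i ar i.
have [i0 _] := @g_piece R d G.
have a_lb : (2 * gq G) ^+ d <= a.
  apply: le_trans (ar_lb i0) _; rewrite /a (bigD1 i0)//= lerDl sumr_ge0// => j _.
  by apply: le_trans (ar_lb j); rewrite exprn_ge0// mulr_ge0// ltW.
have a0 : 0 < a by apply: lt_le_trans a_lb; rewrite exprn_gt0// mulr_gt0.
have bf : `|bint (gbds G) f - f (gx0 G) * a| <= T * a.
  rewrite bintE /a mulr_sumr -sumrB (le_trans (ler_norm_sum _ _ _))// mulr_sumr ler_sum// => i _.
  have i1 := gbd_I1 i sf; have c1 := ic i (f (gx0 G)); have i2 := I1B (mc i) i1 c1.
  rewrite -arE -(RintegralB (mc i) i1 c1); apply: le_trans (le_normr_Rintegral (mc i) i2) _; rewrite -arE.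
  apply: le_Rintegral; [exact: mc| |exact: ic|].
    apply: (I1_le (mc i) _ (ic i T)); first by apply: measurableT_comp => //; exact: I1_meas i2.
    by move=> t ct; rewrite normr_id; apply: osc; case: (bd_in ct).
  by move=> t ct; apply: osc; case: (bd_in ct).
pose Y := `|K| ^+ d * E * gh G / vol G; have Y0 : 0 <= Y by rewrite /Y.
have each i : `|\int[lebn]_(t in cdom (gbd (g := G) i)) v (chart (gbd i) t)| <= ar i * Y.
  have [_ _ /(_ i)[sT _]] := tv; have s1 : S2 lebn (cdom (gbd i)) (fun=> 1) by apply: gbd_S2; exact: smooth_cont (smooth_cst _).
  have := cauchy_schwarz (mc i) s1 sT; rewrite /dot; under eq_Rintegral do rewrite mul1r.
  have ar0 : 0 <= ar i by apply: le_trans (ar_lb i).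
  move=> cs; rewrite -(@ler_pXn2r _ 2) ?nnegrE//.
  apply: (@le_trans _ _ ((nrm lebn (cdom (gbd i)) (fun=> 1) * Fnrm G i (v \o chart (gbd i))) ^+ 2)).
    by rewrite lerXn2r ?nnegrE ?mulr_ge0 ?nrm_ge0.
  rewrite exprMn nrm_sqr /dot mulr1 arE mul1r; apply: (le_trans (ler_wpM2l ar0 (tr i))).
  have -> : (ar i * Y) ^+ 2 = ar i * (ar i * Y ^+ 2) by ring.
  apply: ler_wpM2l => //.
  rewrite (_ : ar i * Y ^+ 2 = (E ^+ 2 * gh G) * (ar i * (`|K| ^+ d) ^+ 2 * gh G / vol G ^+ 2)); last by rewrite /Y; field.
  rewrite vol_sqr ler_peMr// ler_pdivlMr// mul1r.
  apply: (@le_trans _ _ (gh G ^+ n)); first by rewrite lerXn2r ?nnegrE// g_rh.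
  rewrite (exprSr (gh G) d) ler_wpM2r//; apply: (@le_trans _ _ (`|K| ^+ d * gq G ^+ d)).
    by rewrite -exprMn lerXn2r ?nnegrE// (ger0_norm K0).
  rewrite mulrC; apply: ler_pM => //; last by rewrite expr2 ler_peMr// exprn_ege1// (ger0_norm K0).
  by apply: le_trans (ar_lb i); rewrite lerXn2r ?nnegrE// ler_peMl// ler1n.
have bv : `|bint (gbds G) v| <= a * Y.
  by rewrite bintE (le_trans (ler_norm_sum _ _ _))// /a mulr_suml ler_sum.
have f0 : `|f (gx0 G)| <= B2 * E * gh G / vol G.
  rewrite -(ler_pM2r a0) -[X in _ * X <= _](gtr0_norm a0) -normrM.
  rewrite (_ : f (gx0 G) * a = bint (gbds G) v - (bint (gbds G) f - f (gx0 G) * a)); last by lra.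
  rewrite (le_trans (ler_normB _ _))//; apply: le_trans (lerD bv bf) _.
  by rewrite /B2 /T /Y; apply: eq_ler; ring.
have M0 : 0 <= B2 * E * gh G / vol G + T.
  by [].
apply: le_trans (h2 G _ _ hK _ M0 _) _.
- by apply: measurable_funTS; exact: smooth_measurable.
- move=> x Dx; rewrite -[f x](subrK (f (gx0 G))) addrC (le_trans (ler_normD _ _))// lerD//; exact: osc.
- rewrite (_ : C2 * vol G * _ = C2 * (B2 + n%:R * C1 * B) * E * gh G); last by rewrite /T; field; rewrite gt_eqF.
  by apply: ler_wpM2r; [exact: ltW|apply: ler_wpM2r => //; rewrite lerDl].
Qed.

(** [green_lift] is applied to the field g itself, with divergence p of degree k. In (p, v) the part
    of degree k - 2 sees w, and the two top homogeneous parts see the projection, bounded by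
    [projection_bound]; all are linear in |g| by [laplacian_bound], so one power of |g| cancels. The
    bound on v follows from [friedrichs] applied to v - u. *)
Lemma core_estimate (k : nat) (K : R) : exists2 C : R, 0 < C & forall G v w g E, gh G <= K * gr G -> gh G <= K * gq G ->
  element k G v w g -> lifting G v E -> Dnrm G w <= E * gh G -> (forall b, Dnrm G (g b) <= C * E) /\ Dnrm G v <= C * E * gh G.
Proof.
have [C1 C10 h1] := laplacian_bound k K; have [C2 C20 h2] := projection_bound k K; have [C3 C30 h3] := pol_split (d := d) k K.
(* [N0] bounds the number of pieces; [B] is the constant for the gradient and [B'] the one for v. *)
pose N0 := (16 * n%:R * `|K| ^+ 2) ^+ n.
pose B := n%:R * (1 + C1 * `|K| * (1 + C3 + (1 + C3) * C2)).
pose B' := 1 + N0 * Num.sqrt (2 * n%:R) * (B + n%:R).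
have N00 : 0 <= N0 by rewrite exprn_ge0// !mulr_ge0// sqr_ge0.
have B0 : 0 <= B.
  by rewrite mulr_ge0//.
have B'0 : 0 <= B' by rewrite addr_ge0// mulr_ge0.
exists (B + B' + 1) => //.
move=> G v w g E hK hq [tv [p pp wg] sw mom [f hf enh]] hl wE; have [lif _] := hl.
have mD := @g_measurable R d G; have [sv sg _] := tv.
have r0 := g_r0 G; have h0 := g_h0 G; have K1 := K_ge1 hK.
have K0 : 0 <= K by lra.
have E0 : 0 <= E by have [u [_ _ h _]] := lif 1 ltr01; exact: le_trans (nrm_ge0 _ _ _) (h ord0).
set A := \sum_b Dnrm G (g b).
have A0 : 0 <= A by apply: sumr_ge0 => b _; exact: nrm_ge0.
have hp : Dnrm G p <= C1 / gr G * A by exact: h1.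
have [f1 [q1 [q2 [pf1 hq1 hq2 pE hf1]]]] := h3 G p hK pp.
have sp := pol_S2 G pp; have s1 := pol_S2 G pf1.
pose q x := q1 x + q2 x.
have sq : S2 lebn (gD G) q.
  by apply: S2D => //; [exact: (pol_S2 G (homfun_Pol hq1))|exact: (pol_S2 G (homfun_Pol hq2))].
have [pPi _ _] := hf.
have sPi : S2 lebn (gD G) f by exact: (pol_S2 G pPi).
have fb : Dnrm G f <= C2 * E * gh G by exact: (h2 G v g w f E).
have qb : Dnrm G q <= (1 + C3) * Dnrm G p.
  rewrite -(nrm_ext _ (u := fun x => p x - f1 x)); last by move=> x _; rewrite pE /q; ring.
  by apply: le_trans (nrmB mD sp s1) _; rewrite mulrDl mul1r lerD2l.
have pv : `|Ddot G p v| <= (C3 + (1 + C3) * C2) * Dnrm G p * (E * gh G).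
  rewrite dotC (dot_ext _ (u' := v) (v' := fun x => f1 x + q x))//.
  rewrite dotDr// mom// enh// (le_trans (ler_normD _ _))//.
  have h4 : `|Ddot G w f1| <= C3 * Dnrm G p * (E * gh G).
    apply: le_trans (cauchy_schwarz mD sw s1) _; rewrite mulrC ler_pM ?nrm_ge0//.
  have h5 : `|Ddot G f q| <= (1 + C3) * C2 * Dnrm G p * (E * gh G).
    apply: le_trans (cauchy_schwarz mD sPi sq) _; rewrite mulrC.
    apply: le_trans (ler_pM (nrm_ge0 _ _ _) (nrm_ge0 _ _ _) qb fb) _.
    by lra.
  apply: le_trans (lerD h4 h5) _; by lra.
have AE : A <= B * E.
  apply: (sqr_le_lin A0 (mulr_ge0 B0 E0)); apply: le_trans (sum_sqr_le _) _.
  rewrite (_ : B * E * A = n%:R * ((1 + C1 * `|K| * (1 + C3 + (1 + C3) * C2)) * (E * A))); last by rewrite /B; ring.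
  rewrite ler_wpM2l//.
  have -> : \sum_b Dnrm G (g b) ^+ 2 = \sum_b Ddot G (g b) (g b).
    by apply: eq_bigr => b _; rewrite nrm_sqr.
  have := green_lift tv hl wg; rewrite -/A => hg.
  have hh : (1 + C3 + (1 + C3) * C2) * (Dnrm G p * (E * gh G)) <= (1 + C3 + (1 + C3) * C2) * (C1 * K * (A * E)).
    rewrite ler_wpM2l//; apply: (@le_trans _ _ (C1 / gr G * A * (E * gh G))).
      by rewrite ler_wpM2r//.
    rewrite (_ : _ * (E * gh G) = (C1 * A * E) * (gh G / gr G)); last by ring.
    rewrite (_ : C1 * K * (A * E) = (C1 * A * E) * K); last by ring.
    by apply: ler_wpM2l; [rewrite mulr_ge0// mulr_ge0// ltW|rewrite ler_pdivrMr].
  rewrite (ger0_norm K0); move: hg pv; rewrite !ler_norml => /andP[_ hg] /andP[pv _].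
  have -> : (1 + C1 * K * (1 + C3 + (1 + C3) * C2)) * (E * A) = A * E + (1 + C3 + (1 + C3) * C2) * (C1 * K * (A * E)) by ring.
  lra.
split.
  move=> b; apply: (@le_trans _ _ A); first by rewrite /A (bigD1 b)//= lerDl sumr_ge0// => j _; exact: nrm_ge0.
  by apply: (le_trans AE); rewrite ler_wpM2r// -addrA lerDl.
have vb : Dnrm G v <= B' * E * gh G.
  apply: (@le_eps _ _ _ (ctr G 1)); first exact: ctr_ge0.
  move=> e e0; have [u [su h4 h5 h6]] := lif e e0.
  have sU : S2 lebn (gD G) u by exact: smooth_S2.
  apply: le_trans (nrm_triangle_le mD sv sU) _.
  apply: le_trans (lerD h6 (friedrichs (traced_sub tv su) h4)) _.
  rewrite [ctr G 1 * e + _]addrC addrA lerD2r /B' mulrDl mulrDl mul1r lerD2l.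
  apply: (@le_trans _ _ (cgr G * ((B + n%:R) * E))).
    rewrite ler_wpM2l ?cgr_ge0// mulrDl; apply: (@le_trans _ _ (\sum_b (Dnrm G (g b) + E))).
      apply: ler_sum => b _; apply: le_trans (nrmB mD (sg b) _) _; first exact/smooth_S2/smooth_pd.
      by rewrite lerD2l.
    by rewrite big_split /= sumr_const card_ord mulr_natl lerD2r.
  have hN : (gN G)%:R <= N0 by rewrite /N0 (ger0_norm K0); exact: piece_count.
  rewrite /cgr (_ : _ * _ * gh G * _ = (Num.sqrt (2 * n%:R) * (B + n%:R) * E * gh G) * (gN G)%:R); last by ring.
  rewrite (_ : N0 * _ * _ * E * gh G = (Num.sqrt (2 * n%:R) * (B + n%:R) * E * gh G) * N0); last by ring.
  by rewrite ler_wpM2l//.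
apply: (le_trans vb); rewrite -!mulrA ler_wpM2r//.
by lra.
Qed.

End Core.

(** * Smoothing and liftings *)

Section Pieces.
Context {R : realType}.

Lemma closed_avoid (I : eqType) (s : seq I) (A : I -> set R) (c : R) : (forall i, i \in s -> closed (A i)) ->
  (forall i, i \in s -> ~ A i c) -> exists2 e : R, 0 < e & forall y, `|y - c| < e -> forall i, i \in s -> ~ A i y.
Proof.
elim: s => [|i s IH] cA nA; first by exists 1.
have [j js|j js|e e0 he] := IH; [by apply: cA; rewrite inE js orbT|by apply: nA; rewrite inE js orbT|].
have : nbhs c (~` A i).
  apply: open_nbhs_nbhs; split; last by apply: nA; rewrite mem_head.
  by apply: closed_openC; apply: cA; rewrite mem_head.
move=> /nbhs_ballP[e' /= e'0 he']; exists (Num.min e e'); first by rewrite lt_min e0.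
move=> y; rewrite lt_min => /andP[y1 y2] j; rewrite inE => /orP[/eqP->|js]; last exact: he.
by apply: he'; rewrite /ball /= distrC.
Qed.

(* A function that is Lipschitz on each of finitely many closed sets covering an
   interval is Lipschitz, continuous or not: walk from each set to the next one
   through its last point. *)
Lemma piecewise_lip (I : eqType) (L : R) (f : R -> R) (A : I -> set R) (b : R) (s : seq I) (a : R) :
  0 <= L -> a <= b -> (forall i, i \in s -> closed (A i)) ->
  (forall i, i \in s -> forall x y, A i x -> A i y -> `|f x - f y| <= L * `|x - y|) ->
  (forall x, a <= x <= b -> exists2 i, i \in s & A i x) -> `|f b - f a| <= L * (b - a).
Proof.
move=> L0; move: {2}(size s).+1 (ltnSn (size s)) => m; elim: m s a => // m IH s a sm ab cA lA cov.
have [|i si Aa] := cov a; first by rewrite lexx.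
pose S := [set x | A i x /\ a <= x <= b].
have Sa : S a by split=> //; rewrite lexx.
have Sub : ubound S b by move=> x [_ /andP[]].
have hS : has_sup S by split; [exists a|exists b].
set c := sup S; have ac : a <= c by exact: sup_upper_bound Sa.
have cb : c <= b by apply: ge_sup => //; exists a.
have Ac : A i c.
  apply: contrapT => nAc; have [j|j|e e0 he] := @closed_avoid _ [:: i] A c; rewrite ?inE.
  - by move=> /eqP->; exact: cA.
  - by move=> /eqP->.
  have [x [Ax /andP[ax xb]] cx] := sup_adherent e0 hS.
  apply: (he x _ i) => //; last by rewrite mem_head.
  rewrite ltr_distl; apply/andP; split=> //; apply: (@le_lt_trans _ _ c); last by lra.
  by apply: sup_upper_bound => //; split=> //; rewrite ax.
have lac : `|f c - f a| <= L * (c - a) by rewrite -[X in L * X]ger0_norm ?subr_ge0//; exact: lA si _ _ Ac Aa.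
have [<-//|ncb] := eqVneq c b.
have {ncb cb}cb : c < b by lra.
have -> : f b - f a = (f b - f c) + (f c - f a) by ring.
have -> : L * (b - a) = L * (b - c) + L * (c - a) by ring.
rewrite (le_trans (ler_normD _ _))// lerD//.
have after x : c < x <= b -> exists2 j, j \in [seq j <- s | j != i] & A j x.
  move=> /andP[cx xb]; have cx' := cx; have [|j sj Ax] := cov x; first by lra.
  exists j => //; rewrite mem_filter sj andbT; apply/eqP => ji; rewrite ji in Ax.
  move: cx; rewrite ltNge => /negP; apply; apply: sup_upper_bound => //.
  by split=> //; rewrite xb andbT (le_trans ac (ltW cx')).
apply: (IH [seq j <- s | j != i]); rewrite ?(ltW cb)//.
- rewrite -ltnS (leq_trans _ sm)// ltnS size_filter -(count_predC (pred1 i) s) -[X in (X <= _)%N]add1n leq_add2r.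
  by rewrite -has_count has_pred1.
- by move=> j; rewrite mem_filter => /andP[_]; exact: cA.
- by move=> j; rewrite mem_filter => /andP[_]; exact: lA.
move=> x /andP[]; rewrite le_eqVlt => /orP[/eqP<- _|cx xb]; last by apply: after; rewrite cx.
apply: contrapT => nx; have [j|j js Aj|e e0 he] := @closed_avoid _ [seq j <- s | j != i] A c.
- by rewrite mem_filter => /andP[_]; exact: cA.
- by apply: nx; exists j.
pose y := Num.min (c + e / 2) b; have cy : c < y by rewrite lt_min cb ltrDl divr_gt0.
have [|j js Ajy] := after y; first by rewrite cy ge_min lexx orbT.
apply: (he y) js Ajy; rewrite gtr0_norm ?subr_gt0// ltrBlDl gt_min ltrD2l; apply/orP; left; lra.
Qed.

End Pieces.

(** * Smoothing of Lipschitz functions *)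

Section Smoothing.
Context {R : realType} {d : nat}.
Local Notation n := d.+1.

(** A quasi-interpolant: w is sampled at the lattice nodes after contracting them towards x0 by 1 -
    e. By [g_inner] the contraction brings the nodes within [delta] of D into D, so values of w
    outside D never count. In the gradient, w at the contracted x may be subtracted from the samples
    because the derivatives of the partition of unity add up to 0. *)
Lemma smoothing : exists2 C : R, 0 < C & forall (G : gdom R d) (w : 'rV[R]_n -> R) (M L kappa : R),
  0 <= M -> 0 <= L -> 0 < kappa -> (forall x, gD G x -> `|w x| <= M) ->
  (forall x y, seg x y `<=` gD G -> `|w y - w x| <= L * `|y - x|) ->
  exists u, [/\ smooth u, forall x, gD G x -> `|w x - u x| <= kappa, forall x, gD G x -> `|u x| <= M &
    forall x b, gD G x -> `|pd b u x| <= C * L].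
Proof.
have [C C0 hC] := @sum_pd_pou R n; exists C => // G w M L kappa M0 L0 k0 wM wL.
have r0 := g_r0 G; have h0 := g_h0 G; set x0 := gx0 G.
(* Contracting x and passing from x to a node each change w by at most L e h; this e, at most 1,
   makes 2 L e h <= kappa. *)
pose e := kappa / (2 * L * gh G + kappa); pose delta := e * gr G.
have e0 : 0 < e by rewrite divr_gt0.
have e1 : e <= 1 by rewrite ler_pdivrMr// mul1r lerDr.
have Le : 2 * L * gh G * e <= kappa.
  by rewrite /e mulrCA ler_piMr// ler_pdivrMr// mul1r lerDl.
have d0 : 0 < delta by rewrite mulr_gt0.
pose N := Num.bound ((`|x0| + gh G) / delta).
have Nx x : gD G x -> `|x| < delta * N%:R.
  move=> /g_near Dx; rewrite mulrC -ltr_pdivrMr//.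
  have q0 : 0 <= (`|x0| + gh G) / delta by [].
  apply: le_lt_trans (archi_boundP q0).
  by rewrite ler_wpM2r// -[x](subrK x0) addrC (le_trans (ler_normD _ _))// lerD2l.
pose pr y := x0 + (1 - e) *: (y - x0).
have prB x y : pr y - pr x = (1 - e) *: (y - x) by apply/rowP => j; rewrite !mxE; ring.
have e1' : 0 <= 1 - e <= 1 by lra.
have hseg x y : gD G x -> `|x - y| <= delta -> seg (pr x) (pr y) `<=` gD G.
  move=> Dx xy z [t /andP[t0 t1] ->]; apply: (g_inner Dx e1').
  rewrite addrAC -/(pr x) subrr add0r prB !normrZ (ger0_norm t0) ger0_norm; last by lra.
  rewrite opprB addrCA subrr addr0 -/delta distrC; apply: le_trans xy.
  rewrite mulrA ler_piMl// mulr_ile1 ?subr_ge0// gerBl ltW//.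
have prL x y : gD G x -> `|x - y| <= delta -> `|w (pr y) - w (pr x)| <= L * delta.
  move=> Dx xy; apply: le_trans (wL _ _ (hseg _ _ Dx xy)) _; rewrite ler_wpM2l// prB normrZ.
  by rewrite ger0_norm ?subr_ge0// [`|y - x|]distrC (le_trans _ xy)// ler_piMl// gerBl.
have prD x y : gD G x -> `|x - y| <= delta -> gD G (pr y).
  move=> Dx xy; apply: (hseg _ _ Dx xy); exists 1; first by lra.
  by rewrite scale1r addrCA subrr addr0.
have prx x : gD G x -> `|w x - w (pr x)| <= L * (e * gh G).
  move=> Dx; apply: le_trans (wL _ _ _) _.
    move=> z [t /andP[t0 t1] ->].
    have te : 0 <= t * e <= e by rewrite (mulr_ge0 t0 (ltW e0))/= ler_piMl.
    have ar (u v : R) : 0 <= v <= u -> u <= 1 -> 0 <= 1 - u + v <= 1 /\ 0 <= 1 - (1 - u + v) by lra.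
    have [ar1 ar2] := ar _ _ te e1; apply: (@g_inner _ _ G x (1 - e + t * e)) => //.
    rewrite (_ : _ - _ = 0) ?normr0 ?(mulr_ge0 ar2 (ltW r0))//.
    by apply/rowP => j; rewrite !mxE; ring.
  rewrite ler_wpM2l// (_ : x - pr x = e *: (x - x0)); last by apply/rowP => j; rewrite !mxE; ring.
  by rewrite normrZ (gtr0_norm e0) ler_pM2l// g_near.
have near x (k : {ffun 'I_n -> 'I_(N.*2.+1)}) : pou delta k x != 0 -> `|x - node delta k| <= delta by exact: pou_supp.
have pou0 (k : {ffun 'I_n -> 'I_(N.*2.+1)}) x : 0 <= pou delta k x by case/andP: (pou_itv delta k x).
exists (fun x => \sum_k w (pr (node delta k)) * pou (N := N) delta k x); split.
- by apply: smooth_sum => k _; apply: smoothZ; exact: pou_smooth.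
- move=> x Dx; have S1 := sum_pou d0 (ltW (Nx x Dx)).
  rewrite -[X in `|X - _|]mulr1 -S1 mulr_sumr -sumrB (le_trans (ler_norm_sum _ _ _))//.
  rewrite -[X in _ <= X]mulr1 -S1 mulr_sumr; apply: ler_sum => k _.
  have [->|/near xk] := eqVneq (pou delta k x) 0; first by rewrite !mulr0 subrr normr0.
  rewrite -mulrBl normrM (ger0_norm (pou0 _ _)) ler_wpM2r//.
  rewrite -(subrKA (w (pr x))) (le_trans (ler_normD _ _))//.
  apply: le_trans (lerD (prx _ Dx) (_ : _ <= L * (e * gh G))) _; last by lra.
  by rewrite distrC (le_trans (prL _ _ Dx xk))// ler_wpM2l// ler_wpM2l// g_rh.
- move=> x Dx; have S1 := sum_pou d0 (ltW (Nx x Dx)).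
  rewrite (le_trans (ler_norm_sum _ _ _))// -[X in _ <= X]mulr1 -S1 mulr_sumr; apply: ler_sum => k _.
  have [->|/near xk] := eqVneq (pou delta k x) 0; first by rewrite !mulr0 normr0.
  by rewrite normrM (ger0_norm (pou0 _ _)) ler_wpM2r//; apply: wM; exact: prD Dx xk.
- move=> x b Dx; rewrite pd_sum; last by move=> k _; apply: smoothZ; exact: pou_smooth.
  rewrite (eq_bigr (fun k => w (pr (node delta k)) * pd b (pou (N := N) delta k) x)); last first.
    by move=> k _; rewrite pdZ//; exact: pou_smooth.
  have S0 := sum_pd_pou0 d0 b (Nx x Dx).
  rewrite (_ : \sum_i _ = \sum_k (w (pr (node delta k)) - w (pr x)) * pd b (pou (N := N) delta k) x); last first.
    by rewrite (eq_bigr _ (fun k _ => mulrBl _ _ _)) sumrB -mulr_sumr S0 mulr0 subr0.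
  rewrite (le_trans (ler_norm_sum _ _ _))//.
  apply: (@le_trans _ _ (\sum_k L * delta * `|pd b (pou (N := N) delta k) x|)).
    apply: ler_sum => k _; rewrite normrM.
    have [->|/(pd_pou_supp d0) xk] := eqVneq (pd b (pou delta k) x) 0; first by rewrite normr0 !mulr0.
    by rewrite ler_wpM2r//; exact: prL Dx xk.
  rewrite -mulr_sumr; apply: le_trans (ler_wpM2l _ (hC N delta b x d0)) _ => //.
  by apply: eq_ler; field; rewrite gt_eqF.
Qed.

End Smoothing.

(** * Radial extension from the boundary pieces *)

Section Radial.
Context {R : realType}.
Implicit Types l : R.

(** A radial cutoff, 0 below height 1/3 and 1 above height 2/3: the extension constant along rays is
    singular at x0. *)
Definition chi l : R := sstep (3 * l - 1).
(* A smooth function equal to l^-1 for l >= 1/4. *)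
Definition psi l : R := (sstep (8 * l - 1) * (l + - 1) + 1)^-1.

Lemma psi_den l : sstep (8 * l - 1) * (l + - 1) + 1 != 0.
Proof.
have /andP[s0 s1] := sstep_itv (8 * l - 1); have [l1|l1] := lerP l 8^-1.
  by rewrite sstep0//; lra.
rewrite gt_eqF//; have : 0 <= sstep (8 * l - 1) * (l - 8^-1) by rewrite mulr_ge0// subr_ge0 ltW.
lra.
Qed.

Lemma psi_C1k k : C1k k psi.
Proof.
have ci m : C1k m (fun l => l) by case: m => // m; exists (fun=> 1) => [l|]; [exact: is_derive_id|exact: C1k_cst].
apply: C1kV; first exact: psi_den.
apply: C1kD; last exact: C1k_cst.
apply: C1kM; first exact: (C1k_affine 8 (-1) (sstep_C1k k)).
by apply: C1kD; [exact: ci|exact: C1k_cst].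
Qed.

Lemma psi_inv l : 4^-1 <= l -> psi l = l^-1.
Proof. by move=> hl; rewrite /psi sstep1 ?mul1r ?subrK//; lra. Qed.

Lemma psi_hasder l : 3^-1 <= l -> hasder psi l (- (l^-1) ^+ 2).
Proof.
move=> hl; have l0 : l != 0 by lra.
have /hasder_is_derive hi : is_derive l 1 (fun x : R => x^-1) (- (l^-1) ^+ 2).
  by apply: is_derive_eq (is_deriveV l0 (is_derive_id l 1)) _; rewrite /GRing.scale/= mulr1 exprVn.
move=> e e0; have [r r0 hr] := hi e e0; exists (Num.min r 12^-1); first by rewrite lt_min r0/=.
move=> s; rewrite lt_min => /andP[sr]; rewrite ltr_distl => /andP[s1 s2].
by rewrite !psi_inv; [exact: hr|lra|lra].
Qed.

Lemma chi_hasder l : hasder chi l (3 * sstep' (3 * l - 1)).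
Proof.
apply/hasder_is_derive; rewrite mulrC; apply: (@is_derive1_comp _ sstep (fun x => 3 * x - 1)).
  exact: sstep_derive.
apply/hasder_is_derive => e e0; exists 1 => // s _.
by rewrite (_ : _ - _ - _ = 0) ?normr0//; ring.
Qed.

Lemma affine_grad n m (B : 'M[R]_(n, m)) (c : 'rV[R]_m) j x : hasgrad (fun y : 'rV[R]_n => (y *m B + c) 0 j) x (fun b => B b j).
Proof. by apply: hasgrad_ext (@hasgrad_affine R n (fun b => B b j) (c 0 j) x) => // y; rewrite !mxE. Qed.

End Radial.

Section Cone.
Context {R : realType} {d : nat} (G : gdom R d).
Local Notation n := d.+1.
Local Notation D := (gD G).
Local Notation x0 := (gx0 G).
Local Notation r := (gr G).
Local Notation h := (gh G).
Local Notation N := (gN G).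
Local Notation bd := (gbd (g := G)).
Local Notation Dnrm := (nrm lebn D).
Local Notation Fnrm i := (nrm lebn (cdom (bd i))).

(** In polar coordinates the weight s^d and the length of ]a, 1] are at most 1, which leaves [gc]
    times the norm on the piece. *)
Lemma cone_norm (i : 'I_N) (a : R) (f : 'rV[R]_d -> R) (g : 'rV[R]_n -> R) : 0 <= a -> measurable_fun setT f ->
  S2 lebn (cdom (bd i)) f -> S2 lebn D g -> (forall x, gP i a x -> `|g x| <= `|f (gtau i x)|) ->
  (forall x, D x -> ~ gP i a x -> g x = 0) -> Dnrm g <= Num.sqrt (gc i) * Fnrm i f.
Proof.
move=> a0 mf sf sg gf g0; have [c0 _] := gcP i; have mP := gP_measurable i a; have mc := @gcdom_measurable R d G i.
have PD := @gP_D _ _ G i a a0; have sgP := S2_subset (@g_measurable _ _ G) mP PD sg.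
have -> : Dnrm g = nrm lebn (gP i a) g by rewrite /nrm (dot_supp _ _ PD g0).
apply: nrm_le; first by rewrite mulr_ge0 ?nrm_ge0.
rewrite exprMn sqr_sqrtr// -nrm_sqr -lee_fin -integral_sqr//.
have mft : measurable_fun setT (fun x => f (gtau i x)) by apply: measurableT_comp => //; exact: gtau_measurable.
have mF : measurable_fun setT (fun x => (f (gtau i x) ^+ 2)%:E).
  by apply/measurable_EFinP; apply: measurable_funX.
apply: (@le_trans _ _ (\int[lebn]_(x in gP i a) (f (gtau i x) ^+ 2)%:E)%E).
  apply: ge0_le_integral => //.
  - by move=> x _; rewrite lee_fin.
  - by apply/measurable_EFinP; apply: measurable_funX; case: sgP.
  - exact: measurable_funTS.
  - by move=> x /gf gx; rewrite lee_fin -[leLHS]real_normK ?num_real// -[leRHS]real_normK ?num_real// lerXn2r.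
rewrite polar//; last by move=> x; rewrite lee_fin.
rewrite EFinM lee_pmul2l//.
have c2 : (0 <= (Fnrm i f ^+ 2)%:E)%E by rewrite lee_fin.
have -> : (\int[@lebesgue_measure R]_(s in `]a, 1%R]) \int[lebn]_(t in cdom (bd i)) ((s ^+ d)%:E * (f (gtau i (gX i s t)) ^+ 2)%:E) =
    \int[@lebesgue_measure R]_(s in `]a, 1%R]) ((s ^+ d)%:E * (Fnrm i f ^+ 2)%:E))%E.
  apply: eq_integral => s; rewrite inE/= in_itv/= => /andP[as' _]; have s0 : 0 < s by lra.
  rewrite -integral_sqr// -ge0_integralZl//.
  - by apply: eq_integral => t _; rewrite gtau_X//.
  - by apply/measurable_EFinP; apply: measurable_funX; case: sf.
  - by move=> t _; rewrite lee_fin.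
  - by rewrite lee_fin.
apply: (@le_trans _ _ (\int[@lebesgue_measure R]_(s in `]a, 1%R]) (Fnrm i f ^+ 2)%:E)%E).
  apply: ge0_le_integral => //.
  - by move=> s; rewrite /= in_itv/= => /andP[as' _]; rewrite mule_ge0// lee_fin exprn_ge0// (le_trans a0)// ltW.
  - apply: emeasurable_funM; apply/measurable_EFinP; exact: measurable_funX.
  - move=> s; rewrite /= in_itv/= => /andP[as' s1]; rewrite -[leRHS]mul1e lee_wpmul2r// lee_fin.
    by rewrite exprn_ile1// (le_trans a0)// ltW.
rewrite integral_cst//= -[leRHS]mule1 lee_wpmul2l//.
have [a1|a1] := ltP a 1; last by rewrite set_itv_ge ?measure0// -leNgt.
by rewrite lebesgue_measure_itv/= lte_fin a1 -EFinD lee_fin gerBl.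
Qed.

Variable i : 'I_N.
Let U := cdir (bd i).
Let p := chart (bd i) (gt i) - x0.
Let B := invmx (gB i : 'M[R]_n).

Definition gz x : 'rV[R]_d := (rV_uncons (gy i x)).2.
(** The conical projection [gtau] onto the plane of the piece wherever the height is at least 1/4,
    hence on the support of [chi], but smooth on the whole space. *)
Definition coneT x : 'rV[R]_d := gt i + psi (gl i x) *: gz x.
Definition cone (f : 'rV[R]_d -> R) x := chi (gl i x) * f (coneT x).

Lemma gt_in : cdom (bd i) (gt i).
Proof. by apply: g_disc; rewrite subrr normr0 ltW// g_q0. Qed.

Lemma gyE x : gy i x = x *m B + (- x0 *m B). Proof. by rewrite -mulmxDl. Qed.

Lemma gl_grad x : hasgrad (gl i) x (fun b => B b ord0).
Proof. by apply: hasgrad_ext (affine_grad B (- x0 *m B) ord0 x) => // y; rewrite -gyE. Qed.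

Lemma gz_grad x a : hasgrad (fun y => gz y 0 a) x (fun b => B b (lift ord0 a)).
Proof. by apply: hasgrad_ext (affine_grad B (- x0 *m B) (lift ord0 a) x) => // y; rewrite -gyE [RHS]mxE. Qed.

Lemma gl_smooth : smooth (gl i).
Proof.
rewrite (_ : gl i = fun x => (x *m B + (- x0 *m B)) 0 ord0); first exact: smooth_affine_map.
by apply/funext => x; rewrite -gyE.
Qed.

Lemma gz_smooth a : smooth (fun x => gz x 0 a).
Proof.
rewrite (_ : (fun x => _) = fun x => (x *m B + (- x0 *m B)) 0 (lift ord0 a)); first exact: smooth_affine_map.
by apply/funext => x; rewrite -gyE mxE.
Qed.

Lemma ev_norm (b : 'I_n) : `|ev b : 'rV[R]_n| <= 1.
Proof. by apply/rVnorm_leP => // j; rewrite mxE eqxx/=; case: eqP => _; rewrite ?normr1 ?normr0. Qed.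

Lemma gyB b j : B b j = gy i (ev b) 0 j - gy i 0 0 j.
Proof. by rewrite !gyE mul0mx add0r mxE addrK /ev -rowE mxE. Qed.

Lemma gl_coef b : `|B b ord0| <= r^-1.
Proof.
rewrite gyB; apply: le_trans (gl_lip i (ev b) 0) _.
by rewrite subr0 -[leRHS]mul1r ler_wpM2r ?invr_ge0 ?ev_norm// ltW// g_r0.
Qed.

Lemma gz_coef b a : `|B b (lift ord0 a)| <= n%:R * (1 + h / r).
Proof.
have r0 := g_r0 G; have h0 := g_h0 G.
have E x : x - x0 = gl i x *: p + gz x *m U.
  rewrite -gB_mul (_ : rV_cons _ = gy i x); last by rewrite -[RHS]rV_unconsK.
  by rewrite /gy mulmxKV// gB_unit.
have -> : B b (lift ord0 a) = (gz (ev b) - gz 0) 0 a by rewrite gyB !mxE.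
apply: le_trans (coord_le_norm _ _) _; apply: le_trans (chart_coord i _ _) _.
rewrite ler_wpM2l//.
have -> : chart (bd i) (gz (ev b)) - chart (bd i) (gz 0) = (ev b - 0) - (gl i (ev b) - gl i 0) *: p.
  have := E (ev b); have := E 0; rewrite /chart -/U => E0 E1.
  have -> : ev b - 0 = (ev b - x0) - (0 - x0) by rewrite opprB addrA subrK.
  by rewrite E0 E1; apply/rowP => k; rewrite !mxE; ring.
rewrite (le_trans (ler_normB _ _))// lerD//; first by rewrite subr0 ev_norm.
rewrite normrZ mulrC ler_pM//; first by apply: g_near; case: (bd_in gt_in).
apply: le_trans (gl_lip i (ev b) 0) _.
by rewrite subr0 -[leRHS]mul1r ler_wpM2r ?ev_norm//.
Qed.

Lemma coneT_smooth a : smooth (fun x => coneT x 0 a).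
Proof.
rewrite (_ : (fun x => _) = fun x => gt i 0 a + psi (gl i x) * gz x 0 a).
  apply: smoothD; first exact: smooth_cst.
  apply: smoothM; last exact: gz_smooth.
  by apply: smooth_scalar gl_smooth => k; exact: psi_C1k.
by apply/funext => x; rewrite !mxE.
Qed.

Lemma chi_smooth : smooth (fun x => chi (gl i x)).
Proof. by apply: smooth_scalar gl_smooth => k; exact: (C1k_affine 3 (-1) (sstep_C1k k)). Qed.

Lemma cone_smooth f : smooth f -> smooth (cone f).
Proof.
by move=> sf; apply: smoothM; [exact: chi_smooth|apply: smooth_compose => //; exact: coneT_smooth].
Qed.

Lemma coneT_E x : 4^-1 <= gl i x -> coneT x = gtau i x.
Proof. by move=> hl; rewrite /coneT psi_inv. Qed.

Lemma cone_pd f b x : smooth f -> pd b (cone f) x =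
  3 * sstep' (3 * gl i x - 1) * B b ord0 * f (coneT x) + chi (gl i x) * pd b (fun y => f (coneT y)) x.
Proof.
move=> sf; rewrite pdM; [|exact: chi_smooth|by apply: smooth_compose => //; exact: coneT_smooth].
rewrite addrC [_ * f _]mulrC; congr (_ + _).
by rewrite (hasgrad_pd b (hasgrad_comp1 (chi_hasder (gl i x)) (gl_grad x))).
Qed.

Lemma coneT_pd f b x : smooth f -> 3^-1 <= gl i x -> pd b (fun y => f (coneT y)) x =
  \sum_a pd a f (gtau i x) * (- (gl i x)^-1 ^+ 2 * B b ord0 * gz x 0 a + (gl i x)^-1 * B b (lift ord0 a)).
Proof.
move=> sf hl; have hl4 : 4^-1 <= gl i x by lra.
have gT a : hasgrad (fun y => coneT y 0 a) x
    (fun b => - (gl i x)^-1 ^+ 2 * B b ord0 * gz x 0 a + (gl i x)^-1 * B b (lift ord0 a)).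
  have h1 := hasgradM (hasgrad_comp1 (psi_hasder hl) (gl_grad x)) (gz_grad x a).
  have := hasgradD (hasgrad_cst (gt i 0 a) x) h1; apply: hasgrad_ext => [y|c]; first by rewrite !mxE.
  by rewrite psi_inv//; ring.
have sfx : hasgrad f (coneT x) (fun a => pd a f (gtau i x)) by rewrite -coneT_E//; exact: smooth_hasgrad.
by rewrite (hasgrad_pd b (hasgrad_comp sfx gT)).
Qed.

Lemma margin_pd (f : 'rV[R]_d -> R) (S : set 'rV[R]_d) m : smooth f -> 0 < m ->
  (forall t, f t != 0 -> forall u, `|u - t| <= m -> S u) -> forall t, ~ S t -> f t = 0 /\ forall a, pd a f t = 0.
Proof.
move=> sf m0 hm t nS; split.
  by apply: contrapT => /eqP /hm/(_ t); rewrite subrr normr0 => /(_ (ltW m0)).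
move=> a; apply: (hasgrad_pd a (a := fun=> 0)); apply: (hasgrad_near m0 _ (hasgrad_cst 0 t)) => u ut.
by apply/esym; apply: contrapT => /eqP /hm/(_ t); rewrite distrC => /(_ (ltW ut)).
Qed.

Lemma gtau_gP x : D x -> 4^-1 < gl i x -> cdom (bd i) (gtau i x) -> gP i 4^-1 x.
Proof.
move=> Dx lx ct; split=> //; rewrite lx/= leNgt; apply/negP => l1.
have l0 : 0 < gl i x by lra.
have [_] := bd_in ct; apply; rewrite (_ : chart _ _ = x0 + (gl i x)^-1 *: (x - x0)).
  by apply: g_inner_int => //; rewrite invr_ge0 (ltW l0)/= invf_lt1.
rewrite -{3}(gX_K (lt0r_neq0 l0)) /gX addrAC subrr add0r scalerA mulVf// scale1r.
by rewrite addrCA subrr addr0.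
Qed.

(** A bound on the derivatives of [coneT] where [chi] is nonzero. There 1/l <= 3, so 3 multiplies
    the bound of [gz_coef], and 9 comes from the derivative of 1/l. *)
Definition cone_coef : R := 9 * (n%:R * h / r) + 3 * (n%:R * (1 + h / r)).

Lemma cone_coef_ge0 : 0 <= cone_coef.
Proof.
have r0 := g_r0 G; have h0 := g_h0 G.
have ? : 0 <= h / r by [].
by rewrite addr_ge0.
Qed.

Lemma cone_bounds (C : R) f m : (forall x : R, `|sstep' x| <= C) -> smooth f -> 0 < m ->
  (forall t, f t != 0 -> forall u, `|u - t| <= m -> cdom (bd i) u) ->
  Dnrm (cone f) <= Num.sqrt (gc i) * Fnrm i f /\
  forall b, Dnrm (pd b (cone f)) <= Num.sqrt (gc i) * (3 * C / r * Fnrm i f + cone_coef * \sum_a Fnrm i (pd a f)).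
Proof.
move=> hC sf m0 hm; have r0 := g_r0 G; have h0 := g_h0 G; have C0 : 0 <= C by exact: le_trans (normr_ge0 _) (hC 0).
have out := margin_pd sf m0 hm; have mc := @gcdom_measurable R d G i.
have cf := gbd_S2 i (smooth_cont sf).
have a4 : 0 <= 4^-1 :> R by [].
have chi0 l : l < 3^-1 -> chi l = 0 by move=> hl; rewrite /chi sstep0//; lra.
split.
  apply: (cone_norm a4 (smooth_measurable sf) cf).
  - by apply: smooth_S2; exact: cone_smooth.
  - move=> x [/andP[l1 l2] _]; rewrite /cone coneT_E ?(ltW l1)// normrM ler_piMl//.
    by have /andP[s0 s1] := sstep_itv (3 * gl i x - 1); rewrite /chi ger0_norm.
  - move=> x Dx nP; rewrite /cone; have [l1|l1] := ltP (gl i x) 3^-1; first by rewrite chi0// mul0r.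
    have l4 : 4^-1 < gl i x by lra.
    rewrite coneT_E ?(ltW l4)// (out _ _).1 ?mulr0// => ct; exact/nP/gtau_gP.
move=> b; pose F t := 3 * C / r * `|f t| + cone_coef * \sum_a `|pd a f t|.
have cpd a : S2 lebn (cdom (bd i)) (fun t => `|pd a f t|).
  apply: gbd_S2 => t; apply: continuous_comp; last exact: norm_continuous.
  exact: smooth_cont (smooth_pd a sf) t.
have cf' : S2 lebn (cdom (bd i)) (fun t => `|f t|).
  apply: gbd_S2 => t; apply: continuous_comp; last exact: norm_continuous.
  exact: smooth_cont sf t.
have nn (g : 'rV[R]_d -> R) : Fnrm i (fun t => `|g t|) = Fnrm i g.
  rewrite /nrm; congr Num.sqrt; rewrite /dot; apply: eq_Rintegral => t _.
  by rewrite -!expr2 real_normK// num_real.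
have sS : S2 lebn (cdom (bd i)) (fun t => \sum_a `|pd a f t|) by apply: S2_sum.
have s1 := S2Z (3 * C / r) mc cf'; have s2 := S2Z cone_coef mc sS.
have FE : Fnrm i F <= 3 * C / r * Fnrm i f + cone_coef * \sum_a Fnrm i (pd a f).
  apply: le_trans (nrmD mc s1 s2) _; rewrite !nrmZ// ger0_norm//.
  rewrite ger0_norm ?cone_coef_ge0// nn lerD2l ler_wpM2l ?cone_coef_ge0//.
  by apply: le_trans (nrm_sum _ mc (fun a _ => cpd a)) _; apply: ler_sum => a _; rewrite nn.
apply: (@le_trans _ _ (Num.sqrt (gc i) * Fnrm i F)); last by rewrite ler_wpM2l//.
have F0 t : 0 <= F t.
  by apply: addr_ge0; apply: mulr_ge0; rewrite ?cone_coef_ge0.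
have small x : gl i x < 3^-1 -> pd b (cone f) x = 0.
  move=> lx; rewrite cone_pd// chi0// mul0r addr0 sstep'_out ?mulr0 ?mul0r//; left; lra.
apply: (@cone_norm i 4^-1 F) => //.
- apply: measurable_funD; apply: measurable_funM => //.
    by apply: measurableT_comp => //; exact: smooth_measurable.
  apply: measurable_sum => a; apply: measurableT_comp => //; exact: smooth_measurable (smooth_pd a sf).
- by apply: S2D.
- exact/smooth_S2/smooth_pd/cone_smooth.
- move=> x [/andP[l1 l2] ct]; have [ls|ls] := ltP (gl i x) 3^-1; first by rewrite small// normr0.
  have l0 : 0 < gl i x by lra.
  rewrite cone_pd// coneT_E ?(ltW l1)// [leRHS]ger0_norm// (le_trans (ler_normD _ _))// lerD//.
    rewrite normrM ler_wpM2r// !normrM ger0_norm// ler_pM//; first by rewrite ler_pM2l.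
    exact: gl_coef.
  rewrite normrM coneT_pd//.
  have X1 : `|chi (gl i x)| <= 1 by have /andP[s0 s1'] := sstep_itv (3 * gl i x - 1); rewrite /chi ger0_norm.
  apply: le_trans (ler_piMl _ X1) _ => //; rewrite (le_trans (ler_norm_sum _ _ _))// mulr_sumr ler_sum// => a _.
  rewrite normrM mulrC ler_wpM2r//.
  have i3 : (gl i x)^-1 <= 3 by rewrite -[leRHS]invrK lef_pV2 ?posrE.
  have i0 : 0 <= (gl i x)^-1 by [].
  have gzb : `|gz x 0 a| <= n%:R * h.
    have -> : gz x = gl i x *: (gtau i x - gt i) by rewrite /gtau addrAC subrr add0r scalerA mulfV// scale1r.
    rewrite mxE normrM -[leRHS]mul1r ler_pM//; first by rewrite ger0_norm//.
    by apply: le_trans (coord_le_norm _ _) _; exact: (gbd_bounded ct gt_in).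
  rewrite (le_trans (ler_normD _ _))// lerD//.
    have i9 : (gl i x)^-1 ^+ 2 <= 9 by rewrite (_ : 9 = 3 ^+ 2) ?lerXn2r ?nnegrE// -natrX.
    have Bz : `|B b ord0| * `|gz x 0 a| <= r^-1 * (n%:R * h) by rewrite ler_pM// gl_coef.
    rewrite !normrM normrN normrX (ger0_norm i0) -(mulrA _ `|B b ord0|) (_ : n%:R * h / r = r^-1 * (n%:R * h)); last by lra.
    by apply: ler_pM i9 Bz; [exact: exprn_ge0|exact: mulr_ge0].
  by rewrite normrM (ger0_norm i0) ler_pM// gz_coef.
- move=> x Dx nP; have [ls|ls] := ltP (gl i x) 3^-1; first by rewrite small.
  have l4 : 4^-1 < gl i x by lra.
  have [|o1 o2] := out (gtau i x); first by move=> ct; exact/nP/gtau_gP.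
  by rewrite cone_pd// coneT_E ?(ltW l4)// o1 coneT_pd// big1 ?mulr0 ?addr0// => a _; rewrite o2 mul0r.
Qed.

(** If the cone over piece i were nonzero at a point of piece j, the ray of that point would meet
    the interior of piece i; by [ray_unique] both would be the same boundary point, which [g_sep]
    excludes. *)
Lemma cone_trace f m j t : 0 < m -> (forall t, f t != 0 -> forall u, `|u - t| <= m -> cdom (bd i) u) ->
  cdom (bd j) t -> cone f (chart (bd j) t) = if i == j then f t else 0.
Proof.
move=> m0 hm ct; have E1 : gX j 1 t = chart (bd j) t by exact: gX1.
case: eqP => [ij|/eqP ij].
  subst j; rewrite -E1 /cone coneT_E gl_X ?gtau_X//; last lra.
  by rewrite /chi sstep1//; lra.
rewrite /cone; have [l1|l1] := ltP (gl i (chart (bd j) t)) 3^-1; first by rewrite /chi sstep0//; lra.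
have l0 : 0 < gl i (chart (bd j) t) by lra.
rewrite coneT_E; last lra.
have [->|nz] := eqVneq (f (gtau i (chart (bd j) t))) 0; first by lra.
have ct' : interior (cdom (bd i)) (gtau i (chart (bd j) t)).
  apply/nbhs_ballP; exists m => //= u; rewrite ball_rVE /= distrC => ut; exact: hm nz _ (ltW ut).
have [_ ch] := ray_unique l0 ltr01 (interior_subset ct') ct (etrans (gX_K (lt0r_neq0 l0)) (esym E1)).
by case: (g_sep ij ct'); exists t.
Qed.

End Cone.

Lemma small_factor {R : realType} (a1 a2 a3 b1 b2 b3 : R) : 0 <= a1 -> 0 <= a2 -> 0 <= a3 -> 0 < b1 -> 0 < b2 -> 0 < b3 ->
  exists2 k : R, 0 < k & [/\ a1 * k <= b1, a2 * k <= b2 & a3 * k <= b3].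
Proof.
move=> a10 a20 a30 b10 b20 b30.
have key (a b k : R) : 0 <= a -> 0 < b -> k <= b / (a + 1) -> 0 < k -> a * k <= b.
  move=> a0 b0; rewrite ler_pdivlMr ?ltr_wpDl// mulrDr mulr1 mulrC => kb k0.
  by rewrite (le_trans _ kb)// lerDl.
have p (a b : R) : 0 <= a -> 0 < b -> 0 < b / (a + 1) by [].
pose k := Num.min (b1 / (a1 + 1)) (Num.min (b2 / (a2 + 1)) (b3 / (a3 + 1))).
have k0 : 0 < k by rewrite !lt_min !p.
by exists k => //; split; apply: key => //; rewrite !ge_min lexx ?orbT.
Qed.

(** * Liftings of boundary values *)

Section Lifting.
Context {R : realType} {d : nat}.
Local Notation n := d.+1.
Implicit Types G : gdom R d.
Local Notation Dnrm G := (nrm lebn (gD G)).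
Local Notation Fnrm G i := (nrm lebn (cdom (gbd (g := G) i))).

(** D is star-shaped but not necessarily convex, so the Lipschitz condition is restricted to
    segments contained in D. *)
Definition lip_bound G (w : 'rV[R]_n -> R) (M : R) :=
  (forall x, gD G x -> `|w x| <= M) /\
  (forall x y, seg x y `<=` gD G -> `|w y - w x| <= M / gh G * `|y - x|).

Lemma gbd_area_le G i : Num.sqrt (fine (lebn (cdom (gbd (g := G) i)))) <= Num.sqrt ((2 * (n%:R * gh G)) ^+ d).
Proof.
rewrite ler_wsqrtr// -lee_fin fineK; last by rewrite ge0_fin_numE ?measure_ge0 ?gbd_fin.
apply: (@leb_fin_bounded _ _ _ (gt i)); [exact: gcdom_measurable|by rewrite mulr_ge0// ltW// g_h0|].
by move=> t ct; exact: (gbd_bounded ct (gt_in i)).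
Qed.

Lemma area_vol G (K : R) : gh G <= K * gr G ->
  Num.sqrt ((2 * (n%:R * gh G)) ^+ d) <= Num.sqrt ((2 * n%:R) ^+ d * K ^+ n) * (vol G / gh G) * Num.sqrt (gh G).
Proof.
move=> hK; have h0 := g_h0 G; have r0 := g_r0 G; have K1 := K_ge1 hK; have K0 := le_trans ler01 K1.
have V0 := vol_gt0 G; have Z0 : 0 <= (2 * n%:R) ^+ d :> R by apply: exprn_ge0; rewrite mulr_ge0.
have R0 : 0 <= Num.sqrt ((2 * n%:R) ^+ d * K ^+ n) * (vol G / gh G) * Num.sqrt (gh G).
  by [].
set P := (2 * n%:R) ^+ d * K ^+ n in R0 *; have P0 : 0 <= P by rewrite mulr_ge0// exprn_ge0.
have E : (Num.sqrt P * (vol G / gh G) * Num.sqrt (gh G)) ^+ 2 = (2 * n%:R) ^+ d * ((K * gr G) ^+ n / gh G).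
  rewrite exprMn [X in X * _]exprMn [(vol G / _) ^+ 2]exprMn exprVn vol_sqr (sqr_sqrtr P0) (sqr_sqrtr (ltW h0)).
  by rewrite /P [(K * _) ^+ n]exprMn; field; rewrite gt_eqF.
rewrite -[leRHS](ger0_norm R0) -sqrtr_sqr E ler_wsqrtr// mulrA exprMn ler_wpM2l//.
by rewrite ler_pdivlMr// -exprSr lerXn2r ?nnegrE.
Qed.

(* The lifting is a smoothing of w plus, for each boundary piece, the cone over
   an approximation of the difference of the boundary values. *)
Lemma cone_lifting (K : R) : exists2 C : R, 0 < C & forall G v w M A, gh G <= K * gr G -> gh G <= K * gq G ->
  0 <= M -> 0 <= A -> lip_bound G w M -> (forall i, S2 lebn (cdom (gbd i)) (v \o chart (gbd (g := G) i))) ->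
  (forall i, S2 lebn (cdom (gbd i)) (w \o chart (gbd (g := G) i))) ->
  (forall i (e : R), 0 < e -> exists f, [/\ smooth f,
     exists2 m : R, 0 < m & forall t, f t != 0 -> forall u, `|u - t| <= m -> cdom (gbd (g := G) i) u,
     Fnrm G i (fun t => v (chart (gbd i) t) - w (chart (gbd i) t) - f t) <= e,
     forall b, Fnrm G i (pd b f) <= A & Fnrm G i f <= A * gh G]) ->
  lifting G v (C * (vol G * M / gh G + Num.sqrt (gh G) * A)).
Proof.
have [CL CL0 hL] := @smoothing R d; have [Cs Cs0 hs] := @sup_nrm R d K; have [C1 C10 h1] := @sstep'_bounded R.
pose N0 := (16 * n%:R * `|K| ^+ 2) ^+ n; pose sg : R := Num.sqrt (4 * (2 * `|K|) ^+ d).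
pose c2 := 9 * (n%:R * `|K|) + 3 * (n%:R * (1 + `|K|)).
pose T0 : R := Num.sqrt ((2 * n%:R) ^+ d * `|K| ^+ n).
have N00 : 0 <= N0 by rewrite exprn_ge0// !mulr_ge0// sqr_ge0.
have sg0 : 0 <= sg by exact: sqrtr_ge0.
have c20 : 0 <= c2 by rewrite addr_ge0// mulr_ge0// mulr_ge0// addr_ge0.
have T00 : 0 <= T0 by exact: sqrtr_ge0.
(* [ca] and [Cs] are for the gradient and the norm of the smoothing of w, [cb] and [cc] for those of
   the cones, [T0] for the traces of w. *)
pose ca := Cs * CL; pose cb := N0 * sg * (3 * C1 * `|K| + c2 * d%:R); pose cc := N0 * sg.
have ca0 : 0 <= ca by rewrite mulr_ge0// ltW.
have cb0 : 0 <= cb by rewrite mulr_ge0// addr_ge0// ltW.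
have cc0 : 0 <= cc by rewrite mulr_ge0.
pose C := ca + Cs + cb + cc + T0 + 1.
have C0 : 0 < C by rewrite /C; lra.
have comb (a b X Y : R) : 0 <= X -> 0 <= Y -> a <= C -> b <= C -> a * X + b * Y <= C * (X + Y).
  by move=> X0 Y0 aC bC; rewrite mulrDr lerD// ler_wpM2r.
exists C => // G v w M A hK hq M0 A0 [wM wL] sv sw hth.
have mD := @g_measurable R d G; have r0 := g_r0 G; have h0 := g_h0 G; have V0 := vol_gt0 G.
have K1 := K_ge1 hK; have K0 : 0 <= K by exact: le_trans K1.
have mc i := @gcdom_measurable R d G i.
set X := vol G * M / gh G; set Y := Num.sqrt (gh G) * A.
have X0 : 0 <= X by rewrite divr_ge0// ltW.
have Y0 : 0 <= Y by rewrite mulr_ge0// sqrtr_ge0.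
set T := Num.sqrt ((2 * (n%:R * gh G)) ^+ d); have T1 : 0 <= T by exact: sqrtr_ge0.
have bnd i (f : 'rV[R]_n -> R) (k : R) : 0 <= k -> S2 lebn (cdom (gbd i)) (f \o chart (gbd i)) ->
    (forall x, gD G x -> `|f x| <= k) -> Fnrm G i (f \o chart (gbd i)) <= k * T.
  move=> k0 [mf _] fk; apply: (@le_trans _ _ (k * Num.sqrt (fine (lebn (cdom (gbd i)))))); last by rewrite ler_wpM2l// gbd_area_le.
  apply: (nrm_bounded (mc i) (gbd_fin i) mf k0) => t ct; apply: fk; by case: (bd_in ct).
have gcb i : Num.sqrt (gc (i : 'I_(gN G))) <= sg * Num.sqrt (gh G).
  rewrite /sg -sqrtrM// ler_wsqrtr// (ger0_norm K0); exact: gc_bound.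
have hN : (gN G)%:R <= N0 by rewrite /N0 (ger0_norm K0); exact: piece_count.
have sumN (c : R) (F : 'I_(gN G) -> R) : 0 <= c -> (forall i, F i <= c) -> \sum_i F i <= N0 * c.
  move=> c0 Fc; apply: le_trans (ler_sum _ (fun i _ => Fc i)) _.
  by rewrite sumr_const card_ord -[_ *+ gN G]mulr_natl ler_wpM2r.
have hr : gh G / gr G <= `|K| by rewrite (ger0_norm K0) ler_pdivrMr.
have cfc : cone_coef G <= c2.
  rewrite /cone_coef /c2 lerD// ler_wpM2l// -?mulrA ler_wpM2l// lerD2l.
  exact: hr.
split.
  move=> e e0; have e20 : 0 < e / 2 by [].
  have [k k0 [kT _ _]] := small_factor T1 (lexx 0) (lexx 0) e20 ltr01 ltr01.
  have Mh : 0 <= M / gh G by [].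
  have [u [su u1 u2 u3]] := hL G w M (M / gh G) k M0 Mh k0 wM wL.
  have [f hf] := choice (fun i => hth i (e / 2) e20).
  have sf i : smooth (f i) by case: (hf i).
  have sc i : smooth (cone i (f i)) by exact: cone_smooth.
  have sS : smooth (fun x => \sum_i cone i (f i) x) by apply: smooth_sum.
  have est i : Dnrm G (cone i (f i)) <= sg * Num.sqrt (gh G) * (A * gh G) /\
      forall b, Dnrm G (pd b (cone i (f i))) <= sg * Num.sqrt (gh G) * ((3 * C1 * `|K| + c2 * d%:R) * A).
    have [_ [m m0 hm] _ f2 f3] := hf i; have [e1 e2] := cone_bounds h1 (sf i) m0 hm; split.
      by apply: (le_trans e1); rewrite ler_pM ?nrm_ge0.
    move=> b; apply: (le_trans (e2 b)); rewrite ler_pM//.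
      by rewrite addr_ge0 ?mulr_ge0 ?nrm_ge0 ?cone_coef_ge0 ?sumr_ge0// => a _; exact: nrm_ge0.
    rewrite [leRHS]mulrDl lerD//.
      apply: (@le_trans _ _ (3 * C1 / gr G * (A * gh G))); first by rewrite ler_wpM2l//.
      rewrite (_ : _ / _ * _ = 3 * C1 * A * (gh G / gr G)); last by ring.
      by rewrite [leRHS]mulrAC; apply: ler_wpM2l hr; rewrite mulr_ge0// mulr_ge0// ltW.
    rewrite -mulrA ler_pM ?cone_coef_ge0 ?sumr_ge0//; first by move=> a _; exact: nrm_ge0.
    by apply: le_trans (ler_sum _ (fun a _ => f2 a)) _; rewrite sumr_const card_ord -[_ *+ d]mulr_natl.
  exists (fun x => u x + \sum_i cone i (f i) x); split.
  - exact: smoothD.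
  - move=> i; have [_ [m m0 hm] f1 _ _] := hf i.
    have s1 : S2 lebn (cdom (gbd i)) (fun t => v (chart (gbd i) t) - w (chart (gbd i) t) - f i t).
      exact: S2B (mc i) (S2B (mc i) (sv i) (sw i)) (gbd_S2 i (smooth_cont (sf i))).
    have s2 : S2 lebn (cdom (gbd i)) ((fun x => w x - u x) \o chart (gbd i)).
      exact: S2B (mc i) (sw i) (gbd_S2 i (smooth_cont (smooth_chart (gbd i) su))).
    rewrite (nrm_ext lebn (u' := fun t => (v (chart (gbd i) t) - w (chart (gbd i) t) - f i t) + (w (chart (gbd i) t) - u (chart (gbd i) t)))).
      rewrite (splitr e); apply: le_trans (nrmD (mc i) s1 s2) _; rewrite lerD//.
      apply: (@le_trans _ _ (k * T)); last by rewrite mulrC.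
      by apply: (bnd i (fun x => w x - u x)) s2 _ => //; exact: ltW.
    move=> t ct; rewrite (bigD1 i)//= (cone_trace m0 hm ct) eqxx big1 ?addr0; first by ring.
    move=> j ji; have [_ [m' m'0 hm'] _ _ _] := hf j.
    by rewrite (cone_trace m'0 hm' ct) (negbTE ji).
  - move=> b; rewrite pdD//.
    have s1 : S2 lebn (gD G) (pd b u) by exact/smooth_S2/smooth_pd.
    have s2 : S2 lebn (gD G) (pd b (fun x => \sum_i cone i (f i) x)) by exact/smooth_S2/smooth_pd.
    apply: le_trans (nrmD mD s1 s2) _.
    apply: (@le_trans _ _ (ca * X + cb * Y)); last by apply: comb => //; rewrite /C; lra.
    rewrite lerD//.
      apply: le_trans (hs G _ (CL * (M / gh G)) hK _ _ _) _.
      + by case: s1.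
      + by [].
      + by move=> x Dx; exact: u3.
      + by rewrite /ca /X; apply: eq_ler; ring.
    have -> : pd b (fun x => \sum_i cone i (f i) x) = fun x => \sum_i pd b (cone i (f i)) x.
      by apply/funext => x; rewrite pd_sum.
    have s3 i : true -> S2 lebn (gD G) (pd b (cone i (f i))) by move=> _; exact/smooth_S2/smooth_pd.
    apply: le_trans (nrm_sum _ mD s3) _.
    apply: le_trans (sumN _ _ _ (fun i => (est i).2 b)) _.
      by [].
    by rewrite /cb /Y; apply: eq_ler; ring.
  - have s1 : S2 lebn (gD G) u by exact: smooth_S2.
    have s2 : S2 lebn (gD G) (fun x => \sum_i cone i (f i) x) by exact: smooth_S2.
    apply: le_trans (nrmD mD s1 s2) _.
    apply: (@le_trans _ _ ((Cs * X + cc * Y) * gh G)); last first.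
      by rewrite ler_wpM2r//; apply: comb => //; rewrite /C; lra.
    rewrite mulrDl lerD//.
      apply: le_trans (hs G _ M hK _ M0 u2) _; first by case: s1.
      by rewrite /X; apply: eq_ler; field; rewrite gt_eqF.
    have s3 i : true -> S2 lebn (gD G) (cone i (f i)) by move=> _; exact: smooth_S2.
    apply: le_trans (nrm_sum _ mD s3) _.
    apply: le_trans (sumN _ _ _ (fun i => (est i).1)) _.
      by [].
    by rewrite /cc /Y; apply: eq_ler; ring.
move=> i.
suff Hv : Fnrm G i (v \o chart (gbd i)) <= C * (X + Y) * Num.sqrt (gh G).
  rewrite -[X in _ * X](sqr_sqrtr (ltW h0)) -exprMn lerXn2r ?nnegrE ?nrm_ge0//.
apply: (@le_trans _ _ ((T0 * X + 1 * Y) * Num.sqrt (gh G))); last first.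
  by rewrite ler_wpM2r//; apply: comb => //; rewrite /C; lra.
apply: (@le_eps _ _ _ 1) => // e e0; have [f [sf _ f1 _ f3]] := hth i e e0.
have s1 := gbd_S2 i (smooth_cont sf).
have s2 := S2B (mc i) (sv i) (sw i).
rewrite mul1r; apply: le_trans (nrm_triangle_le (mc i) (sv i) (sw i)) _.
apply: le_trans (lerD (bnd i w M M0 (sw i) wM) (nrm_triangle_le (mc i) s2 s1)) _.
rewrite addrA mul1r lerD// mulrDl lerD//.
  apply: (@le_trans _ _ (M * (T0 * (vol G / gh G) * Num.sqrt (gh G)))).
    by rewrite ler_wpM2l// /T0 (ger0_norm K0); exact: area_vol.
  by rewrite /X; apply: eq_ler; ring.
apply: (le_trans f3); rewrite /Y mulrC mulrAC -expr2 sqr_sqrtr//; exact: ltW.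
Qed.

(* Cutting off v - u near the boundary, u a smoothing of w. *)
Lemma zero_trace_approx (K : R) : exists2 C : R, 0 < C & forall G v g w M, gh G <= K * gr G -> gh G <= K * gq G ->
  0 < M -> lip_bound G w M -> S2 lebn (gD G) w -> traced G v g ->
  (forall i t, cdom (gbd (g := G) i) t -> v (chart (gbd i) t) = w (chart (gbd i) t)) ->
  forall e : R, 0 < e -> exists f, [/\ inner G f, Dnrm G (fun x => v x - w x - f x) <= e,
    forall b, Dnrm G (pd b f) <= C * (\sum_b Dnrm G (g b) + vol G * M / gh G) &
    Dnrm G f <= C * (\sum_b Dnrm G (g b) + vol G * M / gh G) * gh G].
Proof.
have [CL CL0 hL] := @smoothing R d; have [Cs Cs0 hs] := @sup_nrm R d K; have [Ce' Ce'0 hE] := @sum_pd_pou R n.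
pose Ce := Ce' * 4; have Ce0 : 0 < Ce by rewrite mulr_gt0.
pose N0 := (16 * n%:R * `|K| ^+ 2) ^+ n; pose c0 := N0 * Num.sqrt (2 * n%:R).
have N00 : 0 <= N0 by rewrite exprn_ge0// !mulr_ge0// sqr_ge0.
have c00 : 0 <= c0 by rewrite mulr_ge0// sqrtr_ge0.
(* [cl] bounds the gradient of v - u, [c0] is the Friedrichs constant, and [cg] bounds (v - u) grad
   eta, where the 1/[ep'] of the cutoff is cancelled by the width of the layer. *)
pose cl := 1 + n%:R * (Cs * CL); have cl0 : 0 <= cl by rewrite addr_ge0// mulr_ge0// mulr_ge0// ltW.
pose cg := Ce * c0 * `|K|; have cg0 : 0 <= cg by rewrite mulr_ge0// mulr_ge0// ltW.
pose C := cl * (1 + cg + c0) + Cs * CL + 2.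
have csl : 0 <= Cs * CL by [].
have cgc : 0 <= cl * (1 + cg + c0) by [].
exists C; first by rewrite /C; lra.
move=> G v g w M hK hq M0 wl sw tv vw e e0; have [wM wL] := wl.
have mD := @g_measurable R d G; have r0 := g_r0 G; have h0 := g_h0 G; have V0 := vol_gt0 G.
have K1 := K_ge1 hK; have K0 : 0 <= K by exact: le_trans K1.
have mc i := @gcdom_measurable R d G i.
set X := vol G * M / gh G; have X0 : 0 < X by rewrite divr_gt0// mulr_gt0.
set S := \sum_b Dnrm G (g b); have S0 : 0 <= S by apply: sumr_ge0 => b _; exact: nrm_ge0.
pose L := S + n%:R * (Cs * CL) * X; have L0 : 0 <= L by rewrite addr_ge0// mulr_ge0// mulr_ge0.
have LE : L <= cl * (S + X).
  rewrite /cl mulrDl mul1r [n%:R * _ * (S + X)]mulrDr /L.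
  have : 0 <= n%:R * (Cs * CL) * S by [].
  by move: (ltW X0); lra.
have hN : (gN G)%:R <= N0 by rewrite /N0 (ger0_norm K0); exact: piece_count.
have cgrE : cgr G <= c0 * gh G by rewrite /cgr /c0 ler_wpM2r// ler_wpM2r.
have gL0 : 0 <= cgr G * L by rewrite mulr_ge0// cgr_ge0.
(* Order of the choices: the layer width [ep'], which makes the gradient part of [layer_bound] at
   most e/6; then the approximation error [k] and the trace size [t1] of v - u, both after the
   cutoff; last the smoothing error [ka], which brings the traces below [t1]. *)
have [ep' ep'0 [epE ep1 _]] := small_factor gL0 ler01 (lexx 0) (divr_gt0 e0 (ltr0n R 6)) ltr01 ltr01.
have {ep1} ep1 : ep' <= 1 by rewrite mul1r in ep1.
have ep01 : 0 <= ep' <= 1 by rewrite (ltW ep'0).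
have [|eta [seta eta01 [m m0 hm] eta1 etad]] := cutoff G hE (e := ep'); first by rewrite ep'0.
pose B := Ce / (ep' * gr G); have B0 : 0 <= B by rewrite divr_ge0// ltW.
have [k k0 [kE kX kXh]] := small_factor (@ler01 R) (addr_ge0 ler01 B0) (@ler01 R) (divr_gt0 e0 (ltr0n R 3))
  (divr_gt0 X0 (ltr0n R 2)) (divr_gt0 (mulr_gt0 X0 h0) (ltr0n R 2)).
rewrite !mul1r in kE kXh.
have [t1 t10 [t1E t1X t1h]] := small_factor (ctr_ge0 G ep') (mulr_ge0 B0 (ctr_ge0 G ep')) (ctr_ge0 G 1)
  (divr_gt0 e0 (ltr0n R 6)) (divr_gt0 X0 (ltr0n R 2)) (divr_gt0 (mulr_gt0 X0 h0) (ltr0n R 2)).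
set T := Num.sqrt ((2 * (n%:R * gh G)) ^+ d); have T1 : 0 <= T by exact: sqrtr_ge0.
have CV0 : 0 <= Cs * vol G by [].
have [ka ka0 [kaT kaE _]] := small_factor T1 CV0 (lexx 0) t10 (divr_gt0 e0 (ltr0n R 3)) ltr01.
have Mh : 0 <= M / gh G by [].
have [u [su u1 u2 u3]] := hL G w M (M / gh G) ka (ltW M0) Mh ka0 wM wL.
pose z x := v x - u x; pose gz b x := g b x - pd b u x.
have tz : traced G z gz by exact: traced_sub tv su.
have [sz sgz _] := tz; have [sv sg trv] := tv.
have sU : S2 lebn (gD G) u by exact: smooth_S2.
have spd b : S2 lebn (gD G) (pd b u) by exact/smooth_S2/smooth_pd.
have gzE b : Dnrm G (gz b) <= Dnrm G (g b) + Cs * CL * X.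
  apply: le_trans (nrmB mD (sg b) (spd b)) _; rewrite lerD2l.
  apply: le_trans (hs G _ (CL * (M / gh G)) hK _ _ _) _.
  - by case: (spd b).
  - by [].
  - by move=> x Dx; exact: u3.
  - by rewrite /X; apply: eq_ler; ring.
have gzL : \sum_b Dnrm G (gz b) <= L.
  apply: le_trans (ler_sum _ (fun b _ => gzE b)) _.
  by rewrite big_split /= sumr_const card_ord -[_ *+ n]mulr_natl mulrA.
have hz i : Fnrm G i (z \o chart (gbd i)) <= t1.
  apply: (@le_trans _ _ (ka * Num.sqrt (fine (lebn (cdom (gbd i)))))).
    apply: (nrm_bounded (mc i) (gbd_fin i) _ (ltW ka0)).
      case: (trv i) => -[mv _] _; apply: measurable_funB => //; apply: measurable_funTS.
      exact: smooth_measurable (smooth_chart (gbd i) su).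
    by move=> t ct; rewrite /z /= vw//; apply: u1; case: (bd_in ct).
  by apply: (le_trans (ler_wpM2l (ltW ka0) (gbd_area_le i))); rewrite mulrC.
have mLy := @glayer_measurable R d G ep'; have LyD := @glayer_D R d G ep' ep01.
have lay : nrm lebn (glayer G ep') z <= ctr G ep' * t1 + cgr G * ep' * L.
  apply: le_trans (layer_bound tz ep01 hz) _; rewrite lerD2l; apply: ler_wpM2l; first exact: mulr_ge0 (cgr_ge0 G) (ltW ep'0).
  by apply: le_trans gzL; apply: ler_sum => b _; exact: nrm_subset.
have szL := S2_subset mD mLy LyD sz.
have etab x b : `|pd b eta x| <= B by [].
have [f [fi f1 f2]] := cutoff_test tz seta m0 hm eta01 B0 etab k0.
have sf : S2 lebn (gD G) f by case: fi => + _ => sf; exact: smooth_S2.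
have meta : measurable_fun (gD G) eta by apply: measurable_funTS; exact: smooth_measurable.
have etaN x : `|eta x| <= 1 by have /andP[p1 p2] := eta01 x; rewrite ger0_norm.
have sez : S2 lebn (gD G) (fun x => eta x * z x) by apply: S2_mulb => //.
have ez : Dnrm G (fun x => eta x * z x) <= Dnrm G z by rewrite -[leRHS]mul1r; exact: nrm_mulb.
exists f; split=> //.
- have s1 : S2 lebn (gD G) (fun x => (1 - eta x) * z x).
    by apply: S2_ext (S2B mD sz sez) => // x _; rewrite mulrBl mul1r.
  have s2 := S2B mD sez sf; have s3 : S2 lebn (gD G) (fun x => u x - w x) by exact: S2B.
  rewrite (nrm_ext lebn (u' := fun x => ((1 - eta x) * z x + (eta x * z x - f x)) + (u x - w x))); last first.
    by move=> x _; rewrite /z; ring.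
  apply: le_trans (nrmD mD (S2D mD s1 s2) s3) _; apply: le_trans (lerD (nrmD mD s1 s2) (lexx _)) _.
  have e1 : Dnrm G (fun x => (1 - eta x) * z x) <= ctr G ep' * t1 + cgr G * ep' * L.
    apply: le_trans lay; rewrite /nrm (dot_supp _ _ LyD); last first.
      by move=> x Dx nL; have [-> _] := eta1 x Dx nL; rewrite subrr mul0r.
    rewrite -[X in _ <= X]mul1r; apply: nrm_mulb => //.
      by apply: measurable_funB => //; exact: measurable_funTS (smooth_measurable seta).
    by move=> x _; have /andP[p1 p2] := eta01 x; rewrite ger0_norm ?subr_ge0// gerBl.
  have e2 : Dnrm G (fun x => eta x * z x - f x) <= e / 3.
    apply: le_trans kE; apply: le_trans f1; rewrite -nrmN; apply: eq_ler.
    by apply: nrm_ext => x _; rewrite opprB.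
  have e3 : Dnrm G (fun x => u x - w x) <= e / 3.
    apply: le_trans kaE; apply: hs => //; first by case: s3.
    by move=> x Dx; rewrite distrC; exact: u1.
  have -> : e = (e / 6 + e / 6 + e / 3) + e / 3 by field.
  rewrite lerD// lerD//; apply: (le_trans e1); rewrite lerD//.
  by rewrite mulrAC.
- move=> b; have s1 : S2 lebn (gD G) (fun x => eta x * gz b x) by apply: S2_mulb => //; exact: sgz.
  have mb : measurable_fun (gD G) (pd b eta) by apply: measurable_funTS; exact: smooth_measurable (smooth_pd b seta).
  have s2 : S2 lebn (gD G) (fun x => pd b eta x * z x) by apply: (S2_mulb (M := B)).
  have sp : S2 lebn (gD G) (pd b f) by case: fi => + _ => sf'; exact/smooth_S2/smooth_pd.
  have s12 := S2D mD s1 s2.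
  apply: le_trans (nrm_triangle_le mD sp s12) _; apply: le_trans (lerD (nrmD mD s1 s2) (f2 b)) _.
  have e1 : Dnrm G (fun x => eta x * gz b x) <= S + Cs * CL * X.
    apply: (@le_trans _ _ (1 * Dnrm G (gz b))); first exact: nrm_mulb.
    rewrite mul1r; apply: (le_trans (gzE b)); rewrite lerD2r /S (bigD1 b)//= lerDl sumr_ge0// => j _; exact: nrm_ge0.
  have e2 : Dnrm G (fun x => pd b eta x * z x) <= X / 2 + cg * L.
    rewrite /nrm (dot_supp _ _ LyD); last first.
      by move=> x Dx nL; have [_ ->] := eta1 x Dx nL; rewrite mul0r.
    apply: (@le_trans _ _ (B * nrm lebn (glayer G ep') z)).
      by apply: nrm_mulb => //; exact: measurable_funTS (smooth_measurable (smooth_pd b seta)).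
    apply: le_trans (ler_wpM2l B0 lay) _; rewrite mulrDr lerD//; first by rewrite mulrA.
    rewrite (_ : B * _ = Ce * (cgr G / gr G) * L); last by rewrite /B; field; rewrite !gt_eqF.
    rewrite ler_wpM2r// /cg -mulrA ler_wpM2l// ler_pdivrMr// -mulrA (ger0_norm K0).
    by apply: (le_trans cgrE); rewrite ler_wpM2l.
  apply: le_trans (lerD (lerD e1 e2) kX) _.
  have cL : cg * L <= cg * (cl * (S + X)) by rewrite ler_wpM2l.
  have : 0 <= Cs * CL * S by [].
  have : 0 <= cl * (S + X) by [].
  have : 0 <= c0 * (cl * (S + X)) by [].
  rewrite /C (_ : (cl * (1 + cg + c0) + Cs * CL + 2) * (S + X) =
    cl * (S + X) + cg * (cl * (S + X)) + c0 * (cl * (S + X)) + Cs * CL * S + Cs * CL * X + 2 * (S + X)); last by ring.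
  by move: (ltW X0) S0 cL; lra.
- apply: le_trans (nrm_triangle_le mD sf sez) _; apply: le_trans (lerD ez f1) _.
  apply: le_trans (lerD (friedrichs tz hz) kXh) _.
  have cL : cgr G * \sum_b Dnrm G (gz b) <= c0 * gh G * (cl * (S + X)).
    apply: ler_pM => //; [exact: cgr_ge0|by apply: sumr_ge0 => b _; exact: nrm_ge0|exact: le_trans gzL LE].
  apply: (@le_trans _ _ ((c0 * (cl * (S + X)) + 2 * (S + X)) * gh G)).
    rewrite mulrDl [c0 * _ * gh G]mulrAC.
    have : 0 <= S * gh G by [].
    have : 0 <= X * gh G by [].
    by move: cL t1h; rewrite -[2 * _ * gh G]mulrA [(S + X) * gh G]mulrDl; lra.
  rewrite ler_wpM2r// /C.
  have : 0 <= cl * (1 + cg) * (S + X) by [].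
  have : 0 <= Cs * CL * (S + X) by [].
  rewrite (_ : (cl * (1 + cg + c0) + Cs * CL + 2) * (S + X) =
    cl * (1 + cg) * (S + X) + c0 * (cl * (S + X)) + Cs * CL * (S + X) + 2 * (S + X)); last by ring.
  lra.
Qed.

Definition boundary_gap G (v w : 'rV[R]_n -> R) (A : R) :=
  forall (i : 'I_(gN G)) (e : R), 0 < e -> exists f, [/\ smooth f,
     exists2 m : R, 0 < m & forall t, f t != 0 -> forall u, `|u - t| <= m -> cdom (gbd i) u,
     Fnrm G i (fun t => v (chart (gbd i) t) - w (chart (gbd i) t) - f t) <= e,
     forall b, Fnrm G i (pd b f) <= A & Fnrm G i f <= A * gh G].

Lemma lifted_estimate (k : nat) (K : R) : exists2 C : R, 0 < C & forall G v w g M A,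
  gh G <= K * gr G -> gh G <= K * gq G -> 0 <= M -> 0 <= A -> lip_bound G w M -> element k G v w g ->
  (forall i, S2 lebn (cdom (gbd i)) (w \o chart (gbd (g := G) i))) -> boundary_gap G v w A ->
  let X := vol G * M / gh G + Num.sqrt (gh G) * A in
  (forall b, Dnrm G (g b) <= C * X) /\ Dnrm G v <= C * X * gh G.
Proof.
have [C1 C10 h1] := @core_estimate R d k K; have [C2 C20 h2] := cone_lifting K; have [Cs Cs0 hs] := @sup_nrm R d K.
exists (C1 * (C2 + Cs)) => //.
move=> G v w g M A hK hq M0 A0 wl el swi gap X; have [tv _ sw _ _] := el.
have h0 := g_h0 G; have V0 := vol_gt0 G; have [_ _ tvi] := tv.
have X0 : 0 <= X by rewrite addr_ge0// ltW.
have [l1 l2] := h2 G v w M A hK hq M0 A0 wl (fun i => (tvi i).1) swi gap.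
have EE : C2 * X <= (C2 + Cs) * X by rewrite ler_wpM2r// lerDl.
have lif : lifting G v ((C2 + Cs) * X).
  split=> [e e0|i].
    have [u [u1 u2 u3 u4]] := l1 e e0; exists u; split=> //.
      by move=> b; exact: le_trans (u3 b) EE.
    by apply: (le_trans u4); rewrite ler_wpM2r//.
  apply: (le_trans (l2 i)); rewrite ler_wpM2r// lerXn2r ?nnegrE//; exact: le_trans EE.
have [|c1 c2] := h1 G v w g _ hK hq el lif.
  apply: le_trans (hs G w M hK _ M0 wl.1) _; first by case: sw.
  apply: (@le_trans _ _ (Cs * (vol G * M / gh G) * gh G)).
    by apply: eq_ler; field; rewrite gt_eqF.
  rewrite ler_wpM2r// ler_pM ?lerDr//.
  by rewrite lerDl.
by split=> [b|]; rewrite -(mulrA C1).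
Qed.

(** Meant for a face, where v = w on the edges and the gap is 0. The gradient bound of
    [lifted_estimate], fed into [zero_trace_approx], produces exactly the functions that
    [boundary_gap] asks for one dimension higher. *)
Lemma boundary_matching (k : nat) (K : R) : exists2 C : R, 0 < C & forall G v w g M,
  gh G <= K * gr G -> gh G <= K * gq G -> 0 < M -> lip_bound G w M -> element k G v w g ->
  (forall i t, cdom (gbd (g := G) i) t -> v (chart (gbd i) t) = w (chart (gbd i) t)) ->
  forall e : R, 0 < e -> exists f, [/\ inner G f, Dnrm G (fun x => v x - w x - f x) <= e,
    forall b, Dnrm G (pd b f) <= C * (vol G * M / gh G) & Dnrm G f <= C * (vol G * M / gh G) * gh G].
Proof.
have [C1 C10 h1] := lifted_estimate k K; have [C2 C20 h2] := zero_trace_approx K.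
exists (C2 * (n%:R * C1 + 1)) => //.
move=> G v w g M hK hq M0 wl el vw e e0; have [tv _ sw _ _] := el.
have h0 := g_h0 G; have V0 := vol_gt0 G; have [_ _ tvi] := tv.
have mc i := @gcdom_measurable R d G i.
have swi i : S2 lebn (cdom (gbd i)) (w \o chart (gbd (g := G) i)).
  by apply: (S2_ext (mc i) _ (tvi i).1) => t ct; rewrite /= vw.
have gap : boundary_gap G v w 0.
  move=> i e1 e10; exists (fun=> 0); have z0 (f : 'rV[R]_d -> R) : (forall t, cdom (gbd i) t -> f t = 0) -> Fnrm G i f = 0.
    move=> f0; rewrite (nrm_ext _ f0); apply/eqP; rewrite eq_le nrm_ge0 andbT.
    rewrite -[leRHS](mul0r (Num.sqrt (fine (lebn (cdom (gbd i)))))); apply: nrm_bounded => //; [exact: mc|exact: gbd_fin|].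
    by move=> ? _; rewrite normr0.
  split; first exact: smooth_cst.
  - by exists 1 => // t; rewrite eqxx.
  - by rewrite z0// => t ct; rewrite vw// !subrr.
  - by move=> b; rewrite z0// => t _; rewrite pd_cst.
  - by rewrite z0// mul0r.
have [g1 _] := h1 G v w g M 0 hK hq (ltW M0) (lexx 0) wl el swi gap.
have [f [f1 f2 f3 f4]] := h2 G v _ w M hK hq M0 wl sw tv vw e e0.
set X := vol G * M / gh G in g1 f3 f4 *; have X0 : 0 <= X by rewrite mulr_ge0// ltW.
have S1 : \sum_b Dnrm G (g b) + X <= (n%:R * C1 + 1) * X.
  rewrite mulrDl mul1r lerD2r; apply: le_trans (ler_sum _ (fun b _ => g1 b)) _.
  by rewrite mulr0 addr0 sumr_const card_ord -[_ *+ n]mulr_natl mulrA.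
exists f; split=> // [b|].
  by apply: (le_trans (f3 b)); rewrite -mulrA ler_wpM2l//.
by apply: (le_trans f4); rewrite ler_wpM2r// -mulrA ler_wpM2l//.
Qed.

End Lifting.

(** * From Sobolev functions to estimates *)

Section FromSobolev.
Context {R : realType} {d : nat} (G : gdom R d).
Local Notation n := d.+1.
Local Notation D := (gD G).
Local Notation Ddot := (dot lebn D).
Implicit Types (v w f : 'rV[R]_n -> R) (c : R).

(** Compactness of the support makes the distance to the complement of D uniform. *)
Lemma test_inner f : test_fun D f -> inner G f.
Proof.
move=> [sf cpt sub]; split=> //.
have h : \forall m \near (0 : R)^'+, closure [set x | f x != 0] `<=` [set x | forall y, `|y - x| <= m -> D y].
  move: cpt => /compact_near_coveringP/(_ R (0 : R)^'+ (fun m x => forall y, `|y - x| <= m -> D y)); apply.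
  move=> x /sub/interior_rV[e e0 he]; exists (ball x (e / 2), [set m | m < e / 2]) => /=.
    by split; [apply: nbhsx_ballx; exact: divr_gt0|apply: nbhs_right_lt; exact: divr_gt0].
  move=> [x' m] /= [+ lm] y ym; rewrite ball_rVE /= => xx'; apply: he.
  by rewrite -(subrKA x') (le_lt_trans (ler_normD _ _))// (splitr e) ltrD ?(le_lt_trans ym)// distrC.
have [m [/= m0 hm]] := filter_ex (filterI (nbhs_right_gt (0 : R)) h).
by exists m => // x fx; apply: hm; exact: subset_closure.
Qed.

Lemma inner_pd b f : inner G f -> inner G (pd b f).
Proof.
move=> [sf [m m0 hm]]; split; first exact: smooth_pd.
have m20 : 0 < m / 2 by [].
exists (m / 2) => // x; have := @margin_pd R d.+1 f [set x | forall y, `|y - x| <= m / 2 -> D y] (m / 2) sf m20.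
move=> /(_ _ x) h nz; apply: contrapT => nx; move/eqP: nz; apply; apply: (h _ nx).2 => t ft u ut y yu.
by apply: (hm t ft); rewrite -(subrKA u) (le_trans (ler_normD _ _))// (splitr m) lerD.
Qed.

Lemma wgradP v : H1 D v -> [/\ S2 lebn D v, is_wgrad D v (wgrad D v) & forall b, S2 lebn D (wgrad D v b)].
Proof.
move=> [sv ex]; have gP' : is_wgrad D v (wgrad D v) := xgetPex _ ex.
by split=> // b; case: (gP' b).
Qed.

(** The hypothesis puts two derivatives on f. Each [pd b f] is again a test function, so one of them
    can be moved onto v as its weak gradient. *)
Lemma wdiv_laplacian k v p : H1 D v -> Pol k p -> laplacian_eq D v p -> wdiv G (wgrad D v) p.
Proof.
move=> /wgradP[sv wg sg] pp lap; have mD := @g_measurable R d G.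
split=> //; first exact: (pol_S2 G pp).
move=> f fi; have [sf [m m0 hm]] := fi.
have t0 := margin_test (G := G) sf (ex_intro2 _ _ m m0 hm).
have spp b : S2 lebn D (pd b (pd b f)) by apply: smooth_S2; do 2!apply: smooth_pd.
transitivity (\sum_b - Ddot v (pd b (pd b f))).
  apply: eq_bigr => b _; have [_ /(_ (pd b f))] := wg b.
  have [sfb hmb] := inner_pd b fi; move=> /(_ (margin_test sfb hmb)) E.
  have ar (x y : R) : y = - x -> x = - y by move=> ->; rewrite opprK.
  exact: ar E.
have lapE : Ddot v (fun x => \sum_i pd i (pd i f) x) = Ddot p f := lap f t0.
rewrite sumrN -lapE; congr (- _); rewrite dotC dot_suml//.
by apply: eq_bigr => b _; rewrite dotC.
Qed.

Lemma traced_own v : H1 D v -> (forall i, has_own_trace D v (gbd (g := G) i)) -> traced G v (wgrad D v).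
Proof.
move=> /wgradP[sv wg sg] tr; split=> // i; have [sT [phi [sphi c1 c2 c3]]] := tr i.
split=> // e e0.
have near0 (u : nat -> R) : u j @[j --> \oo] --> (0 : R) -> \forall j \near \oo, u j <= e.
  move=> /cvgrPdist_le /(_ e e0); apply: filterS => j; rewrite sub0r normrN => /(le_trans _); apply; exact: ler_norm.
have h2 : \forall j \near \oo, forall b, L2norm D (pd b (phi j) \- wgrad D v b) <= e.
  by apply: filter_forall => b; exact: near0 (c2 b).
have [j [[j1 j2] j3]] := filter_ex (filterI (filterI (near0 _ c1) h2) (near0 _ c3)).
by exists (phi j).
Qed.

Lemma S2_cst c : S2 lebn D (fun=> c).
Proof. exact/smooth_S2/smooth_cst. Qed.

Lemma element_intro (k : nat) v w : H1 D v -> (forall i, has_own_trace D v (gbd (g := G) i)) ->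
  (exists2 p, Pol k p & laplacian_eq D v p) -> S2 lebn D w ->
  (forall q, Pol (k%:Z - 2) q -> Ddot v q = Ddot w q) -> enhanced D (gbds G) k v -> element k G v w (wgrad D v).
Proof.
move=> hv tr [p pp lap] sw low enh; have [_ _ sg] := wgradP hv; split=> //; first exact: traced_own.
  by exists p => //; exact: wdiv_laplacian hv pp lap.
by exists (PiH1 D (gbds G) k v); [exact: PiH1P|exact: enh].
Qed.

(** Both sides of each moment condition lose the same term, and since boundary integrals are linear
    the projection of v - c is that of v minus c. *)
Lemma element_shift (k : nat) v w g c : element k G v w g -> element k G (fun x => v x - c) (fun x => w x - c) g.
Proof.
move=> [tv wd sw low [f [pf fg fb] top]]; have mD := @g_measurable R d G; have [sv sg tvi] := tv; have sc := S2_cst c.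
have gE : (fun b x => g b x - pd b (fun=> c) x) = g by apply/funext => b; apply/funext => x; rewrite pd_cst subr0.
have bs u : (forall i, I1 lebn (cdom (gbd (g := G) i)) (fun t => u (chart (gbd i) t))) ->
    bint (gbds G) (fun x => u x - c) = bint (gbds G) u - bint (gbds G) (fun=> c).
  move=> iu; rewrite !bintE -sumrB; apply: eq_bigr => i _.
  by rewrite (RintegralB (@gcdom_measurable R d G i) (iu i) (gbd_I1 i (smooth_cst c))).
split=> //; first by have := traced_sub tv (smooth_cst c); rewrite gE.
- exact: S2B.
- by move=> q pq; have sq := pol_S2 G pq; rewrite (dotBl mD sv sc sq) (dotBl mD sw sc sq) low.
exists (fun x => f x - c); last first.
  move=> q1 q2 h1 h2; have sq : S2 lebn D (fun x => q1 x + q2 x).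
    by apply: S2D => //; [exact: (pol_S2 G (homfun_Pol h1))|exact: (pol_S2 G (homfun_Pol h2))].
  by rewrite (dotBl mD sv sc sq) (dotBl mD (pol_S2 G pf) sc sq) top.
split; first by apply: Pol_sub => //; exact: Pol_cst.
  have pE b : pd b (fun x => f x - c) = pd b f.
    by rewrite (pdB b (Pol_smooth pf) (smooth_cst c)) pd_cst; apply/funext => x; rewrite subr0.
  by move=> q pq; apply: etrans (fg q pq); apply: eq_bigr => b _; rewrite pE.
rewrite !bs ?fb// => i; last exact: gbd_I1 (Pol_smooth pf).
have s1 : S2 lebn (cdom (gbd i)) (fun=> 1) by apply: gbd_S2; exact: smooth_cont (smooth_cst _).
have := S2_mul (@gcdom_measurable R d G i) (tvi i).1 s1; rewrite (_ : (fun x => _) = fun t => v (chart (gbd i) t))//.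
by apply/funext => t; rewrite mulr1.
Qed.

End FromSobolev.

(** * Polygons and polyhedra *)

Section Euclid.
Context {R : realType}.

Lemma enorm_ge0 n (x : 'rV[R]_n) : 0 <= enorm x. Proof. exact: sqrtr_ge0. Qed.

Lemma enorm_sqr n (x : 'rV[R]_n) : enorm x ^+ 2 = \sum_i x 0 i ^+ 2.
Proof. by rewrite sqr_sqrtr// sumr_ge0// => i _; exact: sqr_ge0. Qed.

Lemma norm_le_enorm n (x : 'rV[R]_n) : `|x| <= enorm x.
Proof.
apply/rVnorm_leP; first exact: enorm_ge0.
move=> i; rewrite -sqrtr_sqr ler_wsqrtr// (bigD1 i)//= lerDl sumr_ge0// => j _; exact: sqr_ge0.
Qed.

Lemma enorm_le_norm n (x : 'rV[R]_n) : enorm x <= n%:R * `|x|.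
Proof.
rewrite -[leRHS]ger0_norm// -sqrtr_sqr ler_wsqrtr//.
apply: (@le_trans _ _ (\sum_(i < n) `|x| ^+ 2)).
  by apply: ler_sum => i _; rewrite -[leLHS]real_normK ?num_real// lerXn2r ?nnegrE// coord_le_norm.
rewrite sumr_const card_ord -[_ *+ n]mulr_natl exprMn ler_wpM2r// -natrX ler_nat.
by case: n {x} => // n; rewrite expnS expn1 leq_pmulr.
Qed.

Lemma enormZ n (a : R) (x : 'rV[R]_n) : enorm (a *: x) = `|a| * enorm x.
Proof.
rewrite -sqrtr_sqr -sqrtrM// mulr_sumr; congr Num.sqrt.
by apply: eq_bigr => i _; rewrite mxE exprMn.
Qed.

Lemma enorm_isometry d n (U : 'M[R]_(d, n)) (x : 'rV[R]_d) : U *m U^T = 1%:M -> enorm (x *m U) = enorm x.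
Proof.
have E m (y : 'rV[R]_m) : \sum_i y 0 i ^+ 2 = (y *m y^T) 0 0 by rewrite mxE; apply: eq_bigr => i _; rewrite mxE expr2.
by move=> iU; rewrite /enorm !E trmx_mul -mulmxA (mulmxA U) iU mul1mx.
Qed.

Lemma chartB d n (c : cell R d n) t u : chart c t - chart c u = (t - u) *m cdir c.
Proof. by rewrite /chart opprD addrACA subrr add0r mulmxBl. Qed.

Lemma chart_affine d n (c : cell R d n) t u s : chart c (t + s *: (u - t)) = chart c t + s *: (chart c u - chart c t).
Proof. by rewrite chartB /chart mulmxDl -scalemxAl addrA. Qed.

Lemma chart_inj d n (c : cell R d n) : isometric c -> injective (chart c).
Proof.
move=> ic t u /eqP; rewrite -subr_eq0 chartB => /eqP /(congr1 (mulmx^~ (cdir c)^T)).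
by rewrite -mulmxA ic mulmx1 mul0mx => /eqP; rewrite subr_eq0 => /eqP.
Qed.

Lemma coordK d n (c : cell R d n) : isometric c -> cancel (chart c) (Defs.coord c).
Proof. by move=> ic t; rewrite /Defs.coord /chart addrC addKr -mulmxA ic mulmx1. Qed.

Lemma chart_enorm d n (c : cell R d n) t u : isometric c -> enorm (chart c t - chart c u) = enorm (t - u).
Proof. by move=> ic; rewrite chartB enorm_isometry. Qed.

Lemma compact_bound n (D : set 'rV[R]_n.+1) : compact D -> exists2 M : R, 0 <= M & forall x, D x -> `|x| <= M.
Proof.
move=> /compact_bounded[M [_ hM]]; exists (`|M| + 1) => //.
by move=> x Dx; apply: hM Dx; rewrite (le_lt_trans (ler_norm M))// ltrDl.
Qed.

Lemma le_diam n (D : set 'rV[R]_n.+1) x y : compact D -> D x -> D y -> enorm (x - y) <= diam D.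
Proof.
move=> /compact_bound[M M0 hM] Dx Dy; apply: sup_upper_bound; last by exists x, y.
split; first by exists (enorm (x - y)), x, y.
exists (n.+1%:R * (M + M)) => _ [u [u' [Du Du' ->]]]; apply: le_trans (enorm_le_norm _) _.
by rewrite ler_wpM2l// (le_trans (ler_normB _ _))// lerD ?hM.
Qed.

Lemma segcell_chart n (p q : 'rV[R]_n) t :
  chart (segcell p q) t = p + (t 0 0 / enorm (q - p)) *: (q - p).
Proof. by rewrite /chart /= [t in t *m _]mx11_scalar mul_scalar_mx scalerA. Qed.

Lemma seg_left n (p q : 'rV[R]_n) : seg p q p.
Proof. by exists 0; rewrite ?lexx ?ler01// scale0r addr0. Qed.

Lemma seg_right n (p q : 'rV[R]_n) : seg p q q.
Proof. by exists 1; rewrite ?lexx ?ler01// scale1r addrCA subrr addr0. Qed.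

Lemma segcell_cset n (p q : 'rV[R]_n) : 0 < enorm (q - p) -> cset (segcell p q) = seg p q.
Proof.
move=> L0; apply/seteqP; split=> [_ [t /andP[t0 t1] <-]|_ [s /andP[s0 s1] ->]].
  exists (t 0 0 / enorm (q - p)); last exact: segcell_chart.
  by rewrite divr_ge0//= ler_pdivrMr// mul1r.
exists (const_mx (s * enorm (q - p))); last by rewrite segcell_chart mxE mulfK//.
by rewrite /= mxE mulr_ge0//= ler_piMl//.
Qed.

Lemma segcell_iso n (p q : 'rV[R]_n) : 0 < enorm (q - p) -> isometric (segcell p q).
Proof.
move=> L0; rewrite /isometric /= linearZ /= -scalemxAl -scalemxAr scalerA.
rewrite [X in _ *: X]mx11_scalar mxE (eq_bigr (fun i => (q - p) 0 i ^+ 2)); last by move=> i _; rewrite [X in _ * X]mxE.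
by rewrite -enorm_sqr scale_scalar_mx -expr2 -exprMn mulVf ?expr1n//.
Qed.

Lemma rV1_norm (t : 'rV[R]_1) : `|t| = `|t 0 0|.
Proof.
apply/eqP; rewrite eq_le coord_le_norm andbT; apply/rVnorm_leP => // i; by rewrite (ord1 i).
Qed.

Lemma segcell_cdom n (p q : 'rV[R]_n) (t : 'rV[R]_1) :
  cdom (segcell p q) t <-> `|t - const_mx (enorm (q - p) / 2)| <= enorm (q - p) / 2.
Proof.
rewrite rV1_norm !mxE ler_distl /=; set L := enorm _.
by lra.
Qed.

Lemma cball_compact n (x : 'rV[R]_n.+1) (r : R) : compact [set y | `|y - x| <= r].
Proof.
apply: bounded_closed_compact; last exact: closed_cball.
exists (`|x| + r); split; first exact: num_real.
move=> M hM y /= yx; rewrite -(subrK x y) (le_trans (ler_normD _ _))// addrC (le_trans _ (ltW hM))//.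
by lra.
Qed.

Lemma segcell_compact n (p q : 'rV[R]_n) : compact (cdom (segcell p q)).
Proof.
rewrite (_ : cdom _ = [set t | `|t - const_mx (enorm (q - p) / 2)| <= enorm (q - p) / 2]).
  exact: cball_compact.
by apply/seteqP; split=> t /segcell_cdom.
Qed.

Lemma segcell_interior n (p q : 'rV[R]_n) t : interior (cdom (segcell p q)) t -> 0 < t 0 0 < enorm (q - p).
Proof.
move=> /nbhs_ballP[e /= e0 he].
have h s : `|s| < e -> 0 <= t 0 0 + s <= enorm (q - p).
  move=> se; have := he (t + const_mx s); rewrite ball_rVE /= opprD addrA subrr add0r normrN rV1_norm mxE.
  by move=> /(_ se); rewrite !mxE.
have a0 : `|e / 2| < e by rewrite gtr0_norm// ltr_pdivrMr// ltr_pMr// ltr1n.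
have := h _ a0; have := h (- (e / 2)); rewrite normrN => /(_ a0).
by lra.
Qed.

Lemma map_enum_nth (T U : Type) (x0 : T) (f : T -> U) (s : seq T) :
  [seq f (nth x0 s (i : 'I_(size s))) | i <- enum 'I_(size s)] = map f s.
Proof.
rewrite -[in RHS](mkseq_nth x0 s) /mkseq -map_comp -val_enum_ord -map_comp.
by [].
Qed.

End Euclid.

Section MeshDomains.
Context {R : realType}.
Implicit Types (F : face R) (K : polyhedron R) (rho H : R).

Lemma fedges_uniq F : uniq (fvs F) -> uniq (fedges F).
Proof. by move=> u; rewrite map_inj_uniq// => p q []. Qed.

Lemma fedge_bd F e : is_polygon F -> e \in fedges F -> seg e.1 e.2 `<=` boundary (cdom F).
Proof. by move=> [_ _ _ _ ->] he x xs; exists e. Qed.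

Lemma fvertex_edge F p : p \in fvs F -> exists2 e, e \in fedges F & e.1 = p.
Proof. by move=> hp; exists (p, next (fvs F) p) => //; apply/mapP; exists p. Qed.

Lemma polygon_closed_bd F x : is_polygon F -> boundary (cdom F) x -> cdom F x /\ ~ interior (cdom F) x.
Proof.
move=> [_ _ cF _ _] [cx nx]; split=> //.
by have /closure_id -> : closed (cdom F) by apply: compact_closed cF; exact: norm_hausdorff.
Qed.

Lemma polygon_diam F rho H : is_polygon F -> (forall e, e \in fedges F -> rho * H <= enorm (e.2 - e.1)) ->
  rho * H <= diam (cdom F).
Proof.
move=> pF he; have [[sz _] _ cF _ _] := pF.
case E : (fvs F) sz => [|p s]// _; have [|e ee e1] := @fvertex_edge F p; first by rewrite E mem_head.
apply: (le_trans (he e ee)); apply: le_diam => //.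
  by have [] := polygon_closed_bd pF (fedge_bd pF ee (@seg_right _ _ _ _)).
by have [] := polygon_closed_bd pF (fedge_bd pF ee (@seg_left _ _ _ _)).
Qed.

Lemma star_cube n (D : set 'rV[R]_n.+1) rho (s : R) : star_shaped rho D -> n.+1%:R * s <= rho * diam D ->
  exists x0, forall y, `|y - x0| <= s -> forall x, D x -> seg y x `<=` D.
Proof.
move=> [x0 [r [hr hs]]] sr; exists x0 => y ys; apply: hs.
by apply: le_trans (enorm_le_norm _) _; apply: le_trans _ hr; apply: le_trans _ sr; rewrite ler_wpM2l.
Qed.

(** A face contains an edge, so its diameter is at least rho H and it is star-shaped with respect to
    a ball of radius rho^2 H; half of this is the half-side of a cube in the ball, in dimension 2.
    The centres of the pieces are midpoints of edges, of length at least rho H. The size [gh] is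
    that of K, to have one scale for all faces. *)
Lemma face_gdom F rho H : 0 < rho -> 0 < H -> is_polygon F -> star_shaped rho (cdom F) ->
  (forall e, e \in fedges F -> rho * H <= enorm (e.2 - e.1)) ->
  (forall x y, cdom F x -> cdom F y -> enorm (x - y) <= H) ->
  exists G : gdom R 1, [/\ gD G = cdom F, gbds G = fbd F, gh G = H, gr G = rho ^+ 2 * H / 2 & gq G = rho * H / 2 /\
    forall i, exists2 e, e \in fedges F & gbd (g := G) i = segcell e.1 e.2].
Proof.
move=> rho0 H0 pF sF he hH; have [[sz uF] eF cF _ bF] := pF.
pose z0 : 'rV[R]_2 * 'rV[R]_2 := (0, 0); pose E i := nth z0 (fedges F) (i : 'I_(size (fedges F))).
have EE i : E i \in fedges F by exact: mem_nth.
have L0 e : e \in fedges F -> 0 < enorm (e.2 - e.1) by move=> /he; exact: lt_le_trans.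
have [x0 hx0] : exists x0, forall y, `|y - x0| <= rho ^+ 2 * H / 2 -> forall x, cdom F x -> seg y x `<=` cdom F.
  apply: star_cube sF _; rewrite mulrCA mulfV ?mulr1// expr2 -mulrA ler_pM2l//.
  exact: polygon_diam.
have ne : exists x, cdom F x.
  case Ev : (fvs F) sz => [|p s]// _; have [|e ee e1] := @fvertex_edge F p; first by rewrite Ev mem_head.
  by exists e.1; have [] := polygon_closed_bd pF (fedge_bd pF ee (@seg_left _ _ _ _)).
have a1 : 0 < rho ^+ 2 * H / 2.
  by [].
have a2 : 0 < rho * H / 2.
  by [].
have a3 : forall x y, cdom F x -> cdom F y -> `|x - y| <= H.
  by move=> x y Dx Dy; apply: le_trans (norm_le_enorm _) _; exact: hH.
have a4 : forall i, isometric (segcell (E i).1 (E i).2).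
  by move=> i; apply: segcell_iso; exact: L0.
have a5 : forall i, compact (cdom (segcell (E i).1 (E i).2)).
  by move=> i; exact: segcell_compact.
have a6 : boundary (cdom F) = [set x | exists i, cset (segcell (E i).1 (E i).2) x].
  rewrite bF; apply/seteqP; split=> x [].
    move=> e ee; rewrite -segcell_cset ?L0// => xe; have := ee; rewrite -index_mem => hi.
    by exists (Ordinal hi); rewrite /E nth_index.
  by move=> i; rewrite segcell_cset ?L0// => xe; exists (E i).
have a7 : forall i t, `|t - const_mx (enorm ((E i).2 - (E i).1) / 2)| <= rho * H / 2 -> cdom (segcell (E i).1 (E i).2) t.
  move=> i t ht; apply/segcell_cdom; apply: (le_trans ht); rewrite ler_pM2r//; exact: he.
have a8 : forall i j, i != j -> forall t, interior (cdom (segcell (E i).1 (E i).2)) t -> ~ cset (segcell (E j).1 (E j).2) (chart (segcell (E i).1 (E i).2) t).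
  move=> i j ij t ti; rewrite segcell_cset ?L0// => tj; have /andP[t0 t1] := segcell_interior ti.
  have L := L0 _ (EE i).
  have tI : seg (E i).1 (E i).2 (chart (segcell (E i).1 (E i).2) t).
    by rewrite -segcell_cset//; exists t => //; exact: interior_subset.
  have nE : E i != E j by rewrite /E nth_uniq ?fedges_uniq.
  have /andP[+ _] := eF _ _ (EE i) (EE j) nE _ tI tj.
  rewrite segcell_chart !inE => /orP[] /eqP X.
    have Z : (t 0 0 / enorm ((E i).2 - (E i).1)) *: ((E i).2 - (E i).1) = 0.
      by apply: (@addrI _ (E i).1); rewrite X addr0.
    have := enormZ (t 0 0 / enorm ((E i).2 - (E i).1)) ((E i).2 - (E i).1); rewrite Z.
    rewrite -[X in enorm X](scale0r ((E i).2 - (E i).1)) enormZ normr0 mul0r => /esym/eqP.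
    by rewrite mulf_eq0 normr_eq0 mulf_eq0 invr_eq0 !gt_eqF.
  have Z : (1 - t 0 0 / enorm ((E i).2 - (E i).1)) *: ((E i).2 - (E i).1) = 0.
    by rewrite scalerBl scale1r; apply/eqP; rewrite subr_eq0 -{1}[(E i).2]X addrC addKr.
  have := enormZ (1 - t 0 0 / enorm ((E i).2 - (E i).1)) ((E i).2 - (E i).1); rewrite Z.
  rewrite -[X in enorm X](scale0r ((E i).2 - (E i).1)) enormZ normr0 mul0r => /esym/eqP.
  rewrite mulf_eq0 normr_eq0 (gt_eqF L) orbF subr_eq0 => /eqP/(congr1 (fun s => s * enorm ((E i).2 - (E i).1))).
  by rewrite mul1r mulfVK// => tE; move: t1; rewrite -tE ltxx.
pose G := @GDom R 1 (size (fedges F)) (cdom F) x0 (rho ^+ 2 * H / 2) H (rho * H / 2)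
  (fun i => segcell (E i).1 (E i).2) (fun i => const_mx (enorm ((E i).2 - (E i).1) / 2)) cF ne a1 a2 a3 hx0 a4 a5 a6 a7 a8.
exists G; split=> //; last by split=> // i; exists (E i).
rewrite /gbds /=; exact: (map_enum_nth z0 (fun e => segcell e.1 e.2)).
Qed.

Lemma polyhedron_diam_gt0 K : is_polyhedron K -> (exists x, pdom K x) -> 0 < diam K.
Proof.
move=> [cK iK _ _ _] [x Kx0]; have Kx : closure (interior (pdom K)) x by rewrite iK.
have [y [iy _]] : (interior (pdom K) `&` setT) !=set0 by apply: Kx; exact: filterT.
have /nbhs_ballP[e /= e0 he] := iy.
have Ky : pdom K y by exact: interior_subset.
pose z : 'rV[R]_3 := y + (e / 2) *: ev ord0.
have zy : enorm (z - y) = e / 2.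
  rewrite /z addrAC subrr add0r enormZ gtr0_norm// /enorm (bigD1 ord0)//= mxE !eqxx expr1n.
  rewrite big1 ?addr0 ?sqrtr1 ?mulr1// => i i0; rewrite mxE (negbTE i0) andbF expr0n//.
have Kz : pdom K z.
  apply: he; rewrite ball_rVE /= distrC (le_lt_trans (norm_le_enorm _))// zy ltr_pdivrMr// ltr_pMr// ltr1n//.
by apply: lt_le_trans (le_diam cK Kz Ky); rewrite zy.
Qed.

Lemma face_in K l t : is_polyhedron K -> cdom (pface K l) t -> pdom K (chart (pface K l) t).
Proof.
move=> [cK _ _ bK _] ct; have : boundary K (chart (pface K l) t) by rewrite bK; exists l; exists t.
case=> + _; have /closure_id cE : closed K by apply: compact_closed cK; exact: norm_hausdorff.
by rewrite -cE.
Qed.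

(** The factor 1/3 passes from Euclidean balls to cubes of R^3. The cubes in the faces are those
    about their own star centres, with the half-side found in [face_gdom]. *)
Lemma polyhedron_gdom K rho : 0 < rho -> mesh_assumption rho K -> (exists x, pdom K x) ->
  exists G : gdom R 2, [/\ gD G = pdom K, gbds G = pbd K, gh G = diam K, gr G = rho * diam K / 3 &
    gq G = rho ^+ 2 * diam K / 2 /\ forall i, exists l, gbd (g := G) i = fcell (pface K l)].
Proof.
move=> rho0 [pK sK he sF] ne; have H0 := polyhedron_diam_gt0 pK ne; set H := diam K in H0 he *.
have [cK iK fK bK sep] := pK.
have [x0 hx0] : exists x0, forall y, `|y - x0| <= rho * H / 3 -> forall x, pdom K x -> seg y x `<=` pdom K.
  by apply: star_cube sK _; rewrite mulrCA mulfV ?mulr1.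
have /choice[t0 ht0] : forall l, exists t0, forall t, `|t - t0| <= rho ^+ 2 * H / 2 -> cdom (pface K l) t.
  move=> l; have [_ pF] := fK l; have [|x1 h1] := @star_cube _ _ rho (rho ^+ 2 * H / 2) (sF l).
    rewrite mulrCA mulfV ?mulr1// expr2 -mulrA ler_pM2l//; apply: polygon_diam => //; exact: he.
  exists x1 => t ht; have [[sz _] _ _ _ _] := pF.
  case Ev : (fvs (pface K l)) sz => [|p s]// _; have [|e ee e1] := @fvertex_edge (pface K l) p; first by rewrite Ev mem_head.
  have [De _] := polygon_closed_bd pF (fedge_bd pF ee (@seg_left _ _ _ _)).
  by apply: (h1 t ht _ De); exact: seg_left.
have a1 : 0 < rho * H / 3.
  by [].
have a2 : 0 < rho ^+ 2 * H / 2.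
  by [].
have a3 : forall x y, pdom K x -> pdom K y -> `|x - y| <= H.
  by move=> x y Dx Dy; apply: le_trans (norm_le_enorm _) _; exact: le_diam.
have a4 : forall l, isometric (pface K l).
  by move=> l; case: (fK l).
have a5 : forall l, compact (cdom (pface K l)).
  by move=> l; case: (fK l) => _ [].
(* Two faces share only vertices and edges, and these lie on the boundary of the polygon. *)
have a6 : forall i j, i != j -> forall t, interior (cdom (pface K i)) t -> ~ cset (pface K j) (chart (pface K i) t).
  move=> i j ij t ti tj; have [isoF pF] := fK i.
  have inj := chart_inj isoF.
  have nbd e s : e \in fedges (pface K i) -> seg e.1 e.2 s -> s <> t.
    by move=> ee es st; subst s; have [_ []] := polygon_closed_bd pF (fedge_bd pF ee es).
  have ci : cset (pface K i) (chart (pface K i) t) by exists t => //; exact: interior_subset ti.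
  have [[[p pv /inj tp] _]|[S [[e ee ->] _ [s s01]]]] := sep i j ij _ ci tj.
    have [e ee e1] := fvertex_edge pv; apply: (nbd e p ee) => //; rewrite -e1; exact: seg_left.
  rewrite -chart_affine => /inj ts; apply: (nbd e _ ee) (esym ts); by exists s.
pose G := @GDom R 2 (nfaces K) (pdom K) x0 (rho * H / 3) H (rho ^+ 2 * H / 2)
  (fun l => fcell (pface K l)) t0 cK ne a1 a2 a3 hx0 a4 a5 bK ht0 a6.
by exists G; split=> //; split=> // i; exists i.
Qed.

End MeshDomains.

(** * Simplices and conforming meshes *)

Section Unions.
Context {dd : measure_display} {T : measurableType dd} {R : realType} (mu : {measure set T -> \bar R}) {I : eqType}.
Implicit Types (A : I -> set T) (s : seq I).

Definition union s A : set T := [set x | exists2 i, i \in s & A i x].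

Lemma union_cons i s A : union (i :: s) A = A i `|` union s A.
Proof.
apply/seteqP; split=> x; first by case=> j; rewrite inE => /orP[/eqP->|js] Ax; [left|right; exists j].
by case=> [Ax|[j js Ax]]; [exists i; rewrite ?mem_head|exists j; rewrite ?inE ?js ?orbT].
Qed.

Lemma union_nil A : union [::] A = set0.
Proof. by apply/seteqP; split=> x // []. Qed.

Lemma union_measurable s A : (forall i, i \in s -> measurable (A i)) -> measurable (union s A).
Proof.
elim: s => [|i s IH] h; first by rewrite union_nil.
rewrite union_cons; apply: measurableU; first by apply: h; rewrite mem_head.
by apply: IH => j js; apply: h; rewrite inE js orbT.
Qed.

Lemma union_measurable_fun s A (w : T -> R) : (forall i, i \in s -> measurable (A i)) ->
  (forall i, i \in s -> measurable_fun (A i) w) -> measurable_fun (union s A) w.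
Proof.
elim: s => [|i s IH] h1 h2; first by rewrite union_nil; exact: measurable_fun_set0.
have h1' j : j \in s -> measurable (A j) by move=> js; apply: h1; rewrite inE js orbT.
rewrite union_cons; apply/measurable_funU; [by apply: h1; rewrite mem_head|exact: union_measurable|].
split; first by apply: h2; rewrite mem_head.
by apply: IH => // j js; apply: h2; rewrite inE js orbT.
Qed.

Lemma union_null s A B : measurable B -> (forall i, i \in s -> measurable (A i)) ->
  (forall i, i \in s -> mu (B `&` A i) = 0%E) -> mu (B `&` union s A) = 0%E.
Proof.
move=> mB h1 h2; apply/measure_negligible; first by apply: measurableI => //; exact: union_measurable.
elim: s h1 h2 => [|i s IH] h1 h2; first by rewrite union_nil setI0; exact: negligible_set0.
rewrite union_cons setIUr; apply: negligibleU.
  have mi : measurable (A i) by apply: h1; rewrite mem_head.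
  by apply/negligibleP; [exact: measurableI|apply: h2; rewrite mem_head].
by apply: IH => j js; [apply: h1|apply: h2]; rewrite inE js orbT.
Qed.

(** The list may contain the same set several times, so each new piece is either already in the
    union or meets it in a null set. *)
Lemma union_integral0 s A (h : T -> R) : (forall i, i \in s -> measurable (A i)) ->
  (forall i j, i \in s -> j \in s -> A i = A j \/ mu (A i `&` A j) = 0%E) ->
  I1 mu (union s A) h -> (forall i, i \in s -> \int[mu]_(x in A i) h x = 0) -> \int[mu]_(x in union s A) h x = 0.
Proof.
elim: s => [|i s IH] mA eqA ih h0; first by rewrite union_nil Rintegral_set0.
have sub j : j \in s -> j \in i :: s by rewrite inE orbC => ->.
have mA' j : j \in s -> measurable (A j) by move=> /sub; exact: mA.
have mi : measurable (A i) by apply: mA; rewrite mem_head.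
have mU : measurable (union s A) by exact: union_measurable.
have mT : measurable (A i `|` union s A) by exact: measurableU.
rewrite union_cons in ih *.
have iU : I1 mu (union s A) h by apply: integrableS ih => // x; right.
have U0 : \int[mu]_(x in union s A) h x = 0.
  by apply: IH => // [j l /sub js /sub ls|j /sub]; [exact: eqA|exact: h0].
have [[j js ij]|ne] := pselect (exists2 j, j \in s & A i = A j).
  by rewrite (_ : _ `|` _ = union s A)// setUidr// ij => x Ax; exists j.
have N0 : mu (A i `&` union s A) = 0%E.
  apply: union_null => // j js; have [E|//] := eqA i j (mem_head _ _) (sub j js).
  by case: ne; exists j.
have mD : measurable (union s A `\` A i) by exact: measurableD.
rewrite (_ : _ `|` _ = A i `|` (union s A `\` A i)); last by rewrite setUDr setDv setD0.
rewrite Rintegral_setU//; last 2 first.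
- by apply: integrableS ih => //; [exact: measurableU|rewrite setUDr setDv setD0].
- by apply/disj_set2P; rewrite setIDA setIC -setIDA setDv setI0.
rewrite h0 ?mem_head// add0r -[RHS]U0 /Rintegral; congr fine.
rewrite [RHS](negligible_integral (N := A i `&` union s A))//; last exact: measurableI.
by congr (integral _ _ _); rewrite setDIr setDv setU0.
Qed.

End Unions.

(** * Barycentric coordinates, faces and edges of tetrahedra *)

Section Simplices.
Context {R : realType}.
Implicit Types (p : 'I_4 -> 'rV[R]_3) (A : {set 'I_4}).

Definition bB p : 'M[R]_(3, 4) := usubmx (invmx (vertex_mx p)).
Definition bC p : 'rV[R]_4 := dsubmx (invmx (vertex_mx p)).

Lemma bcoordE p i x : bcoord p i x = (x *m bB p + bC p) 0 i.
Proof. by rewrite /bcoord -{1}(vsubmxK (invmx (vertex_mx p))) mul_row_col mul1mx. Qed.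

Lemma bcoord_Pol p i : Pol 1 (bcoord p i).
Proof.
rewrite (funext (bcoordE p i)); exact: (Pol_affine (bB p) (bC p) (Pol_coord i)).
Qed.

Lemma bcoord_vertex p i j : nondegenerate_tet p -> bcoord p i (p j) = (i == j)%:R.
Proof.
move=> np; rewrite /bcoord (_ : row_mx (p j) 1%:M = row (j : 'I_(3 + 1)) (vertex_mx p)); last first.
  by apply/rowP => l; rewrite [RHS]mxE /vertex_mx [RHS]mxE.
by rewrite -row_mul mulmxV// !mxE eq_sym.
Qed.

Lemma bcoord_comb p i (J : finType) (a : J -> R) (y : J -> 'rV[R]_3) : \sum_j a j = 1 ->
  bcoord p i (\sum_j a j *: y j) = \sum_j a j * bcoord p i (y j).
Proof.
move=> a1; rewrite bcoordE mulmx_suml mxE summxE -[X in _ + X]mul1r -a1 mulr_suml -big_split /=.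
by apply: eq_bigr => j _; rewrite bcoordE -scalemxAl !mxE mulrDr.
Qed.

Lemma bcoord_sum p x : nondegenerate_tet p -> \sum_i bcoord p i x = 1 /\ x = \sum_i bcoord p i x *: p i.
Proof.
move=> np; set b := row_mx x 1%:M *m invmx (vertex_mx p).
have E : b *m vertex_mx p = row_mx x 1%:M by rewrite mulmxKV.
split.
  have : (b *m vertex_mx p) 0 (rshift 3 ord0) = 1 by rewrite E row_mxEr mxE eqxx.
  by move=> <-; rewrite [RHS]mxE; apply: eq_bigr => i _; rewrite [X in _ = _ * X]mxE row_mxEr [X in _ = _ * X]mxE eqxx mulr1.
apply/rowP => l; have : (b *m vertex_mx p) 0 (lshift 1 l) = x 0 l by rewrite E row_mxEl.
by move=> <-; rewrite summxE [LHS]mxE; apply: eq_bigr => i _; rewrite [RHS]mxE [X in _ * X = _]mxE row_mxEl.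
Qed.

Lemma subsimplexP p A x : nondegenerate_tet p ->
  subsimplex p A x <-> (forall i, 0 <= bcoord p i x) /\ forall i, i \notin A -> bcoord p i x = 0.
Proof.
move=> np; split=> [[a [a0 aA a1 ->]]|[b0 bA]].
  have E i : bcoord p i (\sum_j a j *: p j) = a i.
    rewrite bcoord_comb// (bigD1 i)//= bcoord_vertex// eqxx mulr1 big1 ?addr0// => j ji.
    by rewrite bcoord_vertex// eq_sym (negbTE ji) mulr0.
  by split=> i; rewrite E//; exact: aA.
by have [s1 s2] := bcoord_sum x np; exists (fun i => bcoord p i x).
Qed.

Lemma vertex_in p A a : nondegenerate_tet p -> a \in A -> subsimplex p A (p a).
Proof.
move=> np aA; apply/subsimplexP => //; split=> i; rewrite bcoord_vertex//.
by move=> iA; case: eqP iA => // ->; rewrite aA.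
Qed.

Lemma vertex_inj p : nondegenerate_tet p -> injective p.
Proof.
move=> np a b ab; apply/eqP; have := bcoord_vertex a b np; rewrite -ab bcoord_vertex// eqxx.
by case: eqP => // _ /eqP; rewrite oner_eq0.
Qed.

Lemma subsimplex_sub p q A (B : {set 'I_4}) : nondegenerate_tet p -> nondegenerate_tet q ->
  (forall a, a \in A -> exists2 b, b \in B & p a = q b) -> subsimplex p A `<=` subsimplex q B.
Proof.
move=> np nq h x [a [a0 aA a1 ->]]; apply/subsimplexP => //; split=> i; rewrite bcoord_comb//.
  apply: sumr_ge0 => j _; have [jA|jA] := boolP (j \in A); last by rewrite aA// mul0r.
  by have [b bB ->] := h j jA; rewrite bcoord_vertex//.
move=> iB; apply: big1 => j _; have [jA|jA] := boolP (j \in A); last by rewrite aA// mul0r.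
have [b bB' ->] := h j jA; rewrite bcoord_vertex//; case: eqP iB => [->|_ _]; first by rewrite bB'.
by rewrite mulr0.
Qed.

Lemma tet_convex p x y : nondegenerate_tet p -> tet p x -> tet p y -> seg x y `<=` tet p.
Proof.
move=> np /subsimplexP[]// x0 _ /subsimplexP[]// y0 _ _ [t /andP[t0 t1] ->].
apply/subsimplexP => //; split=> i; last by rewrite inE.
have -> : bcoord p i (x + t *: (y - x)) = (1 - t) * bcoord p i x + t * bcoord p i y.
  by rewrite !bcoordE mulmxDl -scalemxAl mulmxBl !mxE; ring.
by rewrite addr_ge0 ?mulr_ge0 ?subr_ge0.
Qed.

(** A simplex in the coordinates of a flat piece. With [idcell] it is the simplex itself, so that
    one argument covers the triangulations of the faces and the subdivision of K. *)
Definition slice d (F : cell R d 3) p A : set 'rV[R]_d := [set t | subsimplex p A (chart F t)].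

Lemma bcoord_chart_Pol d (F : cell R d 3) p i : Pol 1 (fun t => bcoord p i (chart F t)).
Proof.
rewrite (_ : (fun t => _) = fun t => bcoord p i (t *m cdir F + corg F)); last by apply/funext => t; rewrite addrC.
exact: Pol_affine (bcoord_Pol p i).
Qed.

Lemma slice_closed d (F : cell R d 3) p A : nondegenerate_tet p -> closed (slice F p A).
Proof.
move=> np; have cg i : continuous (fun t => bcoord p i (chart F t)) by exact: smooth_cont (Pol_smooth (bcoord_chart_Pol F p i)).
rewrite (_ : slice F p A = (\bigcap_i [set t | 0 <= bcoord p i (chart F t)]) `&`
    (\bigcap_(i in [set i | i \notin A]) [set t | bcoord p i (chart F t) = 0])).
  apply: closedI; apply: closed_bigI => i _.
    by apply: (@preimage_closed _ _ (fun t => bcoord p i (chart F t)) [set u | 0 <= u]); [move=> t _; exact: cg|exact: closed_ge].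
  by apply: (@preimage_closed _ _ (fun t => bcoord p i (chart F t)) [set u | u = 0]); [move=> t _; exact: cg|exact: closed_eq].
apply/seteqP; split=> t.
  by move=> /(subsimplexP _ _ np)[h1 h2]; split=> i; [move=> _; exact: h1|move=> iA; exact: h2].
by move=> [h1 h2]; apply/(subsimplexP _ _ np); split=> i; [exact: h1|move=> iA; exact: (h2 i iA)].
Qed.

Definition idcell : cell R 3 3 := Cell setT 0 1%:M.
Lemma chart_id x : chart idcell x = x. Proof. by rewrite /chart /= mulmx1 add0r. Qed.

Lemma slice_id p A : slice idcell p A = subsimplex p A.
Proof. by apply/seteqP; split=> x; rewrite /slice /= chart_id. Qed.

Lemma affine_null n (f : 'rV[R]_n -> R) (B : 'cV[R]_n) c t u : (forall t, f t = (t *m B) 0 0 + c) -> f t != f u ->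
  mrV [set t | f t = 0] /\ lebn [set t | f t = 0] = 0%E.
Proof.
move=> fE ft; rewrite (_ : [set t | f t = 0] = [set t | (t *m B) 0 0 = - c]).
  split; first exact: measurable_hyperplane.
  apply: leb_hyperplane; apply: contraNneq ft => B0; by rewrite !fE B0 !mulmx0.
apply/seteqP; split=> s /=; rewrite fE => /eqP; first by lra.
by lra.
Qed.

Lemma bcoord_null d (F : cell R d 3) p a t u : bcoord p a (chart F t) != bcoord p a (chart F u) ->
  mrV [set t | bcoord p a (chart F t) = 0] /\ lebn [set t | bcoord p a (chart F t) = 0] = 0%E.
Proof.
apply: (@affine_null d (fun t => bcoord p a (chart F t)) (cdir F *m col a (bB p)) (bcoord p a (corg F))) => s.
by rewrite !bcoordE /chart mulmxDl [LHS]mxE [X in X + _]mxE addrAC mxE addrC mulmxA colE mulmxA -colE !mxE.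
Qed.

(** The tetrahedra meet inside the simplex spanned by [C]. If a vertex of A is not in [C], its
    barycentric coordinate vanishes on the overlap, which is null: that coordinate is not constant
    on the plane, A having another vertex there. If A is contained in [C], its vertices are vertices
    of q; either they are those of B, or the coordinate of an extra one vanishes on the overlap. *)
Lemma slices_disjoint d (F : cell R d 3) p q A (B C : {set 'I_4}) : nondegenerate_tet p -> nondegenerate_tet q ->
  #|A| = #|B| -> (1 < #|A|)%N -> (forall a, a \in A -> exists t, chart F t = p a) ->
  (forall b, b \in B -> exists t, chart F t = q b) ->
  (forall a, a \in C -> exists b, p a = q b) -> tet p `&` tet q `<=` subsimplex p C ->
  slice F p A = slice F q B \/ lebn (slice F p A `&` slice F q B) = 0%E.
Proof.
move=> np nq AB A1 tA tB pq cap.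
have null r (D : {set 'I_4}) a (S : set 'rV[R]_d) : nondegenerate_tet r -> (1 < #|D|)%N -> (forall a, a \in D -> exists t, chart F t = r a) ->
    a \in D -> mrV S -> (forall t, S t -> bcoord r a (chart F t) = 0) -> lebn S = 0%E.
  move=> nr D1 tD aD mS h.
  have [b /andP[bD ba]] : exists b, (b \in D) && (b != a).
    apply/existsP; apply: contraLR D1; rewrite negb_exists => /forallP Da; rewrite -leqNgt.
    apply: (@leq_trans #|[set a]%SET|); last by rewrite cards1.
    apply: subset_leq_card; apply/fintype.subsetP => b bD; rewrite inE.
    by have := Da b; rewrite bD /= negbK.
  have [ta Ea] := tD a aD; have [tb Eb] := tD b bD.
  have [|mN N0] := @bcoord_null d F r a ta tb.
    by rewrite Ea Eb !bcoord_vertex// eqxx [a == b]eq_sym (negbTE ba) oner_neq0.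
  by apply: (subset_measure0 (B := [set t | bcoord r a (chart F t) = 0])).
have mI : mrV (slice F p A `&` slice F q B).
  by apply: measurableI; apply: closed_rV_measurable; exact: slice_closed.
have sub t : slice F p A t -> tet p (chart F t).
  by move=> /(subsimplexP _ _ np)[h _]; apply/(subsimplexP _ _ np); split=> // i; rewrite inE.
have sub' t : slice F q B t -> tet q (chart F t).
  by move=> /(subsimplexP _ _ nq)[h _]; apply/(subsimplexP _ _ nq); split=> // i; rewrite inE.
have [AC|/subsetPn[a aA aC]] := boolP (A \subset C); last first.
  right; apply: (null p A a) => // t [pt qt].
  by have /(subsimplexP _ _ np)[_ ->] := cap _ (conj (sub t pt) (sub' t qt)).
have /fin_all_exists[s0 hs0] : forall a : 'I_4, exists b, a \in A -> p a = q b.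
  move=> a; have [aA|_] := boolP (a \in A); last by exists a.
  by have [b ab] := pq a (fintype.subsetP AC a aA); exists b.
have sI : {in A &, injective s0} by move=> a b aA bA e; apply: (vertex_inj np); rewrite hs0// e -hs0.
pose A' := s0 @: A.
have EA : slice F p A = slice F q A'.
  apply/seteqP; split=> t; apply: subsimplex_sub => // a aA.
    by exists (s0 a); [exact: imset_f|exact: hs0].
  by move: aA => /imsetP[b bA ->]; exists b => //; rewrite hs0.
have [A'B|/subsetPn[a aA' aB]] := boolP (A' \subset B).
  left; rewrite EA (_ : A' = B)//; by apply/eqP; rewrite eqEcard A'B /A' card_in_imset// AB leqnn.
right; apply: (null q A' a) => //.
- by rewrite card_in_imset.
- by move=> b /imsetP[c cA ->]; have [t tc] := tA c cA; exists t; rewrite tc hs0.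
- by move=> t [_ /(subsimplexP _ _ nq)[_ ->]].
Qed.

Lemma bounded_compact n (D : set 'rV[R]_n.+1) M : closed D -> (forall x, D x -> `|x| <= M) -> compact D.
Proof.
move=> cD h; apply: bounded_closed_compact cD; exists M; split; first exact: num_real.
by move=> M' MM' x Dx; exact: le_trans (h x Dx) (ltW MM').
Qed.

Lemma scaled_span n (D : set 'rV[R]_n.+1) m (u q : 'rV[R]_n.+1 -> R) : compact D -> diam D != 0 -> S2 lebn D u ->
  (forall q, scaled_monomial D m q -> ip D u q = 0) -> Pol m q -> ip D u q = 0.
Proof.
move=> cD dD su h pq; have mD := compact_rV_measurable cD; have [M M0 hM] := compact_bound cD.
have [s [hs qE]] := Pol_centered (barycenter D) dD pq.
rewrite (funext qE); elim: s hs {q pq qE} => [|a s IH] hs.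
  rewrite /ip; under eq_Rintegral do rewrite big_nil mulr0; by rewrite Rintegral_cst// mul0r.
have cS (f : 'rV[R]_n.+1 -> R) : smooth f -> S2 lebn D f.
  by move=> sf; apply: (@cont_S2 R _ f 0 M) => // [|x Dx]; [exact: smooth_cont|rewrite subr0 hM].
have sm (e : R * ('I_n.+1 -> nat)) : smooth (fun x => e.1 * mono e.2 ((diam D)^-1 *: (x - barycenter D))).
  apply: smoothZ; apply: (@Pol_smooth R n.+1 (mdg e.2)).
  have := @Pol_affine R _ _ _ _ ((diam D)^-1%:M) (- ((diam D)^-1 *: barycenter D)) (@Pol_mono R _ e.2).
  by apply: Pol_ext => x; rewrite mul_mx_scalar scalerBr.
rewrite (_ : (fun x => _) = fun x => a.1 * mono a.2 ((diam D)^-1 *: (x - barycenter D)) +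
  \sum_(p <- s) p.1 * mono p.2 ((diam D)^-1 *: (x - barycenter D))); last by apply/funext => x; rewrite big_cons.
rewrite -[LHS]/(dot _ _ _ _) dotDr//; last 2 first.
- exact: cS (sm a).
- by apply: cS; apply: smooth_sum => p _; exact: sm.
have E : dot lebn D u (fun x => \sum_(p <- s) p.1 * mono p.2 ((diam D)^-1 *: (x - barycenter D))) = 0.
  by apply: IH => p ps; apply: hs; right.
rewrite E addr0.
have sm1 : smooth (fun x => mono a.2 ((diam D)^-1 *: (x - barycenter D))) by have := sm (1, a.2); under eq_fun do rewrite mul1r.
rewrite dotZr//; last exact: cS.
rewrite -[dot _ _ _ _]/(ip _ _ _) h ?mulr0//.
by exists a.2; [exact: hs (or_introl erefl)|].
Qed.

Lemma cover_moments n (D : set 'rV[R]_n.+1) (I : eqType) (s : seq I) (A : I -> set 'rV[R]_n.+1) m (u q : 'rV[R]_n.+1 -> R) :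
  D = union s A -> (forall i, i \in s -> compact (A i) /\ diam (A i) != 0) ->
  (forall i j, i \in s -> j \in s -> A i = A j \/ lebn (A i `&` A j) = 0%E) -> S2 lebn D u -> S2 lebn D q ->
  (forall i, i \in s -> forall q, scaled_monomial (A i) m q -> ip (A i) u q = 0) -> Pol m q -> ip D u q = 0.
Proof.
move=> DE cA eqA su sq h pq.
have mA i : i \in s -> mrV (A i) by move=> /cA[c _]; exact: compact_rV_measurable.
have mD : mrV D by rewrite DE; exact: union_measurable.
have sub i : i \in s -> A i `<=` D by move=> si x Ax; rewrite DE; exists i.
rewrite /ip DE; apply: union_integral0 => //; first by rewrite -DE; exact: S2_mul.
by move=> i si; have [c d] := cA i si; exact: (scaled_span c d (S2_subset mD (mA i si) (sub i si) su) (h i si) pq).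
Qed.

(** At least two vertices are missing from A, hence at least one other than i, and its barycentric
    coordinate is a factor of the bubble. *)
Lemma bubble_edge p A x : nondegenerate_tet p -> (#|A| <= 2)%N -> subsimplex p A x ->
  b_tet p x = 0 /\ forall i, b_face p i x = 0.
Proof.
move=> np A2 /(subsimplexP _ _ np)[_ h].
have ex (i : 'I_4) : exists j, (j != i) && (j \notin A).
  apply/existsP; apply: contraT; rewrite negb_exists => /forallP al.
  have : (#|'I_4| <= #|i |: A|)%N.
    apply: subset_leq_card; apply/fintype.subsetP => j _; have := al j.
    by rewrite negb_and !negbK !inE.
  by rewrite card_ord cardsU1 => /leq_trans/(_ (leq_add (leq_b1 _) A2)).
split=> [|i].
  by have [j /andP[_ jA]] := ex ord0; rewrite /b_tet (bigD1 j)//= h// mul0r.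
by have [j /andP[ji jA]] := ex i; rewrite /b_face (bigD1 j)//= h// mul0r.
Qed.

Lemma subsimplex_pair p a b : a != b -> subsimplex p [set a; b]%SET = seg (p a) (p b).
Proof.
move=> ab; have S2' (V : nmodType) (f : 'I_4 -> V) : (forall j, j \notin [set a; b]%SET -> f j = 0) -> \sum_j f j = f a + f b.
  move=> f0; rewrite (bigD1 a)//= (bigD1 b)/=; last by rewrite eq_sym.
  by rewrite big1 ?addr0// => j /andP[ja jb]; apply: f0; rewrite !inE negb_or ja.
apply/seteqP; split=> [x [c [c0 cA c1 ->]]|_ [t /andP[t0 t1] ->]].
  have {}c1 : c a = 1 - c b by rewrite -c1 S2'// addrK.
  exists (c b); first by rewrite c0/= -subr_ge0 -c1.
  by rewrite S2' => [|j /cA->]; rewrite ?scale0r// c1 scalerBl scale1r scalerBr addrA addrAC.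
pose c (j : 'I_4) : R := if j == a then 1 - t else if j == b then t else 0.
have cb : c b = t by rewrite /c eq_sym (negbTE ab) eqxx.
have ca : c a = 1 - t by rewrite /c eqxx.
have c0 j : j \notin [set a; b]%SET -> c j = 0 by rewrite !inE negb_or /c => /andP[/negbTE-> /negbTE->].
exists c; split=> //.
- by move=> j; rewrite /c; case: ifP => // _; [rewrite subr_ge0|case: ifP].
- by rewrite S2'// ca cb subrK.
- rewrite S2' => [|j /c0->]; rewrite ?scale0r// ca cb scalerBl scale1r scalerBr addrA addrAC//.
Qed.

(** Each segment contains the ends of the other, so neither is longer. The parameters of P and Q on
    the second segment are then 1 apart, hence 0 and 1. *)
Lemma seg_ends n (P Q P' Q' : 'rV[R]_n) : seg P Q = seg P' Q' -> 0 < enorm (Q - P) -> P = P' \/ P = Q'.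
Proof.
move=> E D0.
have [s /andP[s0 s1] Ps] : seg P' Q' P by rewrite -E; exact: seg_left.
have [t /andP[t0 t1] Qt] : seg P' Q' Q by rewrite -E; exact: seg_right.
have [s' /andP[s'0 s'1] Ps'] : seg P Q P' by rewrite E; exact: seg_left.
have [t' /andP[t'0 t'1] Qt'] : seg P Q Q' by rewrite E; exact: seg_right.
have e1 : enorm (Q - P) = `|t - s| * enorm (Q' - P').
  by rewrite -enormZ {1}Qt {1}Ps opprD addrACA subrr add0r scalerBl.
have e2 : enorm (Q' - P') = `|t' - s'| * enorm (Q - P).
  by rewrite -enormZ {1}Qt' {1}Ps' opprD addrACA subrr add0r scalerBl.
have b2 : `|t' - s'| <= 1 by rewrite ler_norml; apply/andP; split; lra.
have D'D : enorm (Q' - P') <= enorm (Q - P) by rewrite e2 ler_piMl//.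
have D'0 : 0 < enorm (Q' - P').
  rewrite lt_neqAle enorm_ge0 andbT eq_sym; apply: contraTneq D0 => Z; by rewrite e1 Z mulr0 ltxx.
have ts : 1 <= `|t - s|.
  by nra.
move: ts; rewrite ler_normr => /orP[h|h].
  by left; rewrite Ps (_ : s = 0) ?scale0r ?addr0//; lra.
by right; rewrite Ps (_ : s = 1) ?scale1r 1?addrC ?subrK//; lra.
Qed.

Lemma Pol_root1 m (f : 'rV[R]_1 -> R) c : Pol m f -> exists2 g, Pol (m - 1) g &
  forall t, f t = f (const_mx c) + (t 0 0 - c) * g t.
Proof.
move=> pf; elim: pf => {m f} [m|m e m0|m f g _ [f' pf' fE] _ [g' pg' gE]|m i f pf [f' pf' fE]].
- by exists (fun=> 0) => [|t]; [exact: Pol_0|rewrite mulr0 addr0].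
- by exists (fun=> 0) => [|t]; [exact: Pol_0|rewrite mulr0 addr0].
- exists (fun t => f' t + g' t) => [|t]; first exact: Pol_add.
  by rewrite {1}fE {1}gE; ring.
rewrite addrK; have [m0|m0] := ltP m 0.
  by exists (fun=> 0) => [|t]; [exact: Pol_0|rewrite (Pol_neg m0 pf) !mulr0 addr0].
exists (fun t : 'rV[R]_1 => f (const_mx c) + t 0 i * f' t) => [|t].
  by apply: Pol_add; [exact: Pol_cst|rewrite -(subrK 1 m); exact: Pol_X].
by rewrite {1}fE mxE (ord1 i); ring.
Qed.

(* A polynomial of degree k on a segment is determined by its end values and its
   moments of degree k - 2: factor out the end points and test with the quotient. *)
Lemma edge_unisolvence (k : nat) (L : R) (z : 'rV[R]_1 -> R) : let S := [set t : 'rV[R]_1 | 0 <= t 0 0 <= L] in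
  0 < L -> compact S -> Pol k z -> z (const_mx 0) = 0 -> z (const_mx L) = 0 ->
  (forall q, Pol (k%:Z - 2) q -> ip S z q = 0) -> forall t, S t -> z t = 0.
Proof.
move=> S L0 cS pz z0 zL mz; have mS := compact_rV_measurable cS.
have [M M0 hM] := compact_bound cS.
have [y1 py1 y1E] := Pol_root1 0 pz; rewrite z0 in y1E.
have [y py yE] := Pol_root1 L py1.
have y1L : y1 (const_mx L) = 0.
  by have := y1E (const_mx L); rewrite zL mxE add0r subr0 => /esym/eqP; rewrite mulf_eq0 gt_eqF//= => /eqP.
rewrite y1L in yE.
have zE t : z t = t 0 0 * ((t 0 0 - L) * y t) by rewrite y1E yE !add0r subr0.
have py' : Pol (k%:Z - 2) y by rewrite -addrA in py.
have sz := smooth_cont (Pol_smooth pz); have sy := smooth_cont (Pol_smooth py).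
have h0 x : S x -> `|x - 0| <= M by move=> Sx; rewrite subr0 hM.
pose F t := (-1) * (z t * y t).
have cF : continuous F.
  by apply: smooth_cont; apply: smoothZ; apply: smoothM; [exact: Pol_smooth pz|exact: Pol_smooth py].
have iF : I1 lebn S F.
  by apply: I1Z => //; apply: S2_mul => //; apply: (cont_S2 (x0 := 0) (r := M)).
have F0 : \int[lebn]_(x in S) F x = 0.
  have := mz y py'; rewrite /ip => E; rewrite RintegralZl ?E ?mulr0//.
  by apply: S2_mul => //; apply: (cont_S2 (x0 := 0) (r := M)).
have FE t : F t = t 0 0 * (L - t 0 0) * y t ^+ 2 by rewrite /F zE; ring.
have Fp t : S t -> 0 <= F t.
  move=> /andP[t0 tL]; rewrite FE.
  by rewrite mulr_ge0// mulr_ge0// subr_ge0.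
move=> t /andP[]; rewrite le_eqVlt => /orP[/eqP t0 _|t0].
  by rewrite (_ : t = const_mx 0)//; apply/rowP => i; rewrite (ord1 i) mxE.
rewrite le_eqVlt => /orP[/eqP tL|tL].
  by rewrite (_ : t = const_mx L)//; apply/rowP => i; rewrite (ord1 i) mxE.
pose r := Num.min (t 0 0) (L - t 0 0); have r0 : 0 < r by rewrite lt_min t0 subr_gt0.
have hS u : `|u - t| < r -> S u.
  by rewrite rV1_norm !mxE lt_min !ltr_norml /S /= => /andP[/andP[? ?] /andP[? ?]]; apply/andP; split; lra.
have /eqP := @integral0_cont R 1 S F t r mS r0 hS cF Fp iF F0; rewrite FE zE.
rewrite mulf_eq0 mulf_eq0 subr_eq0 (gt_eqF t0) (gt_eqF tL) sqrf_eq0 /= => /eqP ->.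
by lra.
Qed.

End Simplices.

(** A measurable selection on overlapping pieces: at each point of the union, the value of some
    piece that contains it. It yields measurable versions of w and of its piecewise gradient. *)
Lemma union_select {dd : measure_display} {T : measurableType dd} {R : realType} {I : eqType} (s : seq I)
  (A : I -> set T) (F : I -> T -> R) : (forall i, measurable (A i)) -> (forall i, measurable_fun setT (F i)) ->
  exists2 g : T -> R, measurable_fun setT g & (forall x, union s A x -> exists2 i, A i x & g x = F i x) /\
    forall x, ~ union s A x -> g x = 0.
Proof.
move=> mA mF; elim: s => [|i s [g mg [gU g0]]].
  by exists (fun=> 0) => //; split=> // x [].
exists (fun x => \1_(A i) x * F i x + (1 - \1_(A i) x) * g x).
  by apply: measurable_funD; apply: measurable_funM => //; exact: measurable_funB.
split=> x; rewrite union_cons indicE.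
  have [ax _|nax [//|ux]] := pselect (A i x); first by exists i; rewrite // mem_set// mul1r subrr mul0r addr0.
  by rewrite memNset// mul0r subr0 mul1r add0r; exact: gU.
move=> nu; rewrite memNset; last by move=> ax; apply: nu; left.
by rewrite mul0r subr0 mul1r add0r; apply: g0 => ux; apply: nu; right.
Qed.

Section Pieces.
Context {R : realType}.

Lemma bcoord_monomial_Pol p (e : 'I_4 -> nat) : Pol (\sum_i e i)%N (fun x => \prod_i @bcoord R p i x ^+ e i).
Proof. by apply: Pol_prod => i; apply: Pol_exp; exact: bcoord_Pol. Qed.

(** The degree k + 2 is reached by [b_tet], of degree 4, times a polynomial of degree k - 2. For
    negative degrees the other factor is 0 and the bound still holds. *)
Lemma Wloc_Pol k (p : 'I_4 -> 'rV[R]_3) f : Wloc k p f -> Pol (k + 2)%N f.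
Proof.
move=> [q0 [q1 [q2 [qF [pq0 h1 h2 hF fE]]]]]; rewrite (funext fE).
have pb : Pol 4 (b_tet p).
  have := bcoord_monomial_Pol p (fun=> 1%N); rewrite sum_nat_const card_ord muln1.
  by [].
have pbF i : Pol 4 (b_face p i).
  rewrite (_ : b_face p i = fun x => \prod_j (if j != i then bcoord p j x else 1)).
    have := @Pol_prod R 3 'I_4 (index_enum _) (fun=> 1%N) (fun j x => if j != i then bcoord p j x else 1).
    by rewrite sum_nat_const card_ord muln1; apply => j; case: (_ != _); [exact: bcoord_Pol|exact: Pol_cst].
  by apply/funext => x; rewrite /b_face big_mkcond.
apply: Pol_add; first apply: Pol_add; first apply: Pol_add.
- by apply: PolW ((Pol_polyfun _ _).2 pq0); lia.
- by apply: PolW (Pol_mul pb (homfun_Pol h1)); lia.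
- by apply: PolW (Pol_mul pb (homfun_Pol h2)); lia.
apply: Pol_sum => i _.
have pF : Pol (k%:Z - 2) (qF i).
  have [[c cE] _] := hF i; rewrite (funext cE); apply: Pol_sum => a /andP[/eqP ad _].
  by apply: Pol_scale; apply: PolW (bcoord_monomial_Pol p (fun j => a j)); apply: eq_ler; exact: ad.
by apply: PolW (Pol_mul (pbF i) pF); lia.
Qed.

Lemma Wloc_edge k (p : 'I_4 -> 'rV[R]_3) f : nondegenerate_tet p -> Wloc k p f ->
  exists2 q, Pol k q & forall (A : {set 'I_4}) x, (#|A| <= 2)%N -> subsimplex p A x -> f x = q x.
Proof.
move=> np [q0 [q1 [q2 [qF [pq0 h1 h2 hF fE]]]]]; exists q0; first exact/Pol_polyfun.
move=> A x A2 xA; have [b0 bF] := bubble_edge np A2 xA.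
by rewrite fE b0 !mul0r !addr0 big1 ?addr0// => i _; rewrite bF mul0r.
Qed.

Lemma chart_Pol d n (c : cell R d n) m f : Pol m f -> Pol m (fun t => f (chart c t)).
Proof.
move=> pf; rewrite (_ : (fun t => _) = fun t => f (t *m cdir c + corg c)); first exact: Pol_affine.
by apply/funext => t; rewrite addrC.
Qed.

Lemma seg_sym n (P Q : 'rV[R]_n) : seg P Q = seg Q P.
Proof.
have h (X Y : 'rV[R]_n) : seg X Y `<=` seg Y X.
  move=> x [t /andP[t0 t1] ->]; exists (1 - t); first by lra.
  by apply/rowP => i; rewrite !mxE; ring.
by apply/seteqP; split; exact: h.
Qed.

Lemma diam_neq0 n (D : set 'rV[R]_n.+1) x y : compact D -> D x -> D y -> x != y -> diam D != 0.
Proof.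
move=> cD Dx Dy xy; rewrite gt_eqF//; apply: lt_le_trans (le_diam cD Dx Dy).
by apply: lt_le_trans (norm_le_enorm _); rewrite normr_gt0 subr_eq0.
Qed.

End Pieces.

(** * The subdivision of K and the interpolant *)

Section Mesh.
Context {R : realType} (k : nat) (rho sigma gamma : R) (K : polyhedron R) (T : tmesh R).
Context (rho0 : 0 < rho) (sigma0 : 0 < sigma) (gamma0 : 0 < gamma)
  (hm : mesh_assumption rho K) (hs : subdivision sigma gamma K T) (ne : exists x, pdom K x).
Local Notation H := (diam K).
Local Notation tt i := (tets T i).

Let pK : is_polyhedron K. Proof. by case: hm. Qed.
Let cK : compact (pdom K). Proof. by case: pK. Qed.
Let H0 : 0 < H. Proof. exact: polyhedron_diam_gt0. Qed.
Let mK : mrV (pdom K). Proof. exact: compact_rV_measurable. Qed.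

Lemma tet_nondegenerate i : nondegenerate_tet (tt i).
Proof. by case: hs => _ /(_ i)[]. Qed.

Lemma tet_sub i : tet (tt i) `<=` pdom K.
Proof. by case: hs => -> _ _ _ _ x xi; exists i. Qed.

Lemma tet_cover : pdom K = union (enum 'I_(ntets T)) (fun i => tet (tt i)).
Proof.
case: hs => -> _ _ _ _; apply/seteqP; split=> x; first by case=> i xi; exists i => //; rewrite mem_enum.
by case=> i _ xi; exists i.
Qed.

Lemma tet_closed i : closed (tet (tt i)).
Proof. by rewrite /tet -slice_id; apply: slice_closed; exact: tet_nondegenerate. Qed.

Lemma tet_compact i : compact (tet (tt i)).
Proof.
have [M M0 hM] := compact_bound cK; apply: (bounded_compact (M := M)); first exact: tet_closed.
by move=> x /tet_sub; exact: hM.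
Qed.

Lemma tet_measurable i : mrV (tet (tt i)).
Proof. exact: compact_rV_measurable (@tet_compact i). Qed.

(** The inscribed ball has radius at least sigma gamma H, and a third of it fits a cube. Writing the
    half-side as twice delta leaves a margin delta around the cube of half-side delta that carries
    the bump. *)
Lemma tet_center i : exists y, forall x, `|x - y| <= 2 * (sigma * gamma * H / 6) -> tet (tt i) x.
Proof.
have [_ reg _ _ _] := hs; have [_ [y hy] gH] := reg i; exists y => x xy; apply: hy.
apply: le_trans (enorm_le_norm _) _; apply: (@le_trans _ _ (sigma * (gamma * H))); last by rewrite ler_pM2l.
by lra.
Qed.

Lemma conforming d (F : cell R d 3) i j (A B : {set 'I_4}) : #|A| = #|B| -> (1 < #|A|)%N ->
  (forall a, a \in A -> exists t, chart F t = tt i a) -> (forall b, b \in B -> exists t, chart F t = tt j b) ->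
  slice F (tt i) A = slice F (tt j) B \/ lebn (slice F (tt i) A `&` slice F (tt j) B) = 0%E.
Proof.
move=> AB A1 tA tB; have ni := tet_nondegenerate i; have nj := tet_nondegenerate j.
have [ij|ij] := eqVneq i j.
  subst j; apply: (@slices_disjoint R d F (tt i) (tt i) A B ([set: 'I_4]%SET)) => //; first by move=> a _; exists a.
have [_ _ conf _ _] := hs; have [_ cap] := conf i j ij.
apply: (slices_disjoint ni nj AB A1 tA tB _ (C := [set a | `[< range (tt j) (tt i a) >]]%SET)).
  by move=> a; rewrite inE => /asboolP[b _ <-]; exists b.
by rewrite cap.
Qed.

Section Function.
Context (v w : 'rV[R]_3 -> R) (hv : Vc k K v) (hw : is_interpolant k K T v w).

Lemma interpolant_pieces : exists f : 'I_(ntets T) -> 'rV[R]_3 -> R,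
  forall i, Pol (k + 2)%N (f i) /\ forall x, tet (tt i) x -> w x = f i x.
Proof.
have [[_ hW] _ _ _ _] := hw.
have /choice[f hf] : forall i, exists f, Wloc k (tt i) f /\ forall x, tet (tt i) x -> w x = f x.
  by move=> i; have [f f1 f2] := hW i; exists f.
by exists f => i; have [/Wloc_Pol] := hf i.
Qed.

(** On each tetrahedron w has the moments of the projection of v onto degree k; these add up over K,
    where the projection has the moments of v. *)
Lemma volume_moments (G : gdom R 2) : gD G = pdom K -> S2 lebn (pdom K) w -> S2 lebn (pdom K) v ->
  forall q, Pol (k%:Z - 2) q -> dot lebn (pdom K) v q = dot lebn (pdom K) w q.
Proof.
move=> GK sw sv q pq; have [_ _ _ _ hT] := hw.
have [] := @QL2P R 2 G k v; rewrite GK// => pQ mQ.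
have pqk : Pol k q by apply: PolW pq; lia.
have sq : S2 lebn (pdom K) q by rewrite -GK; exact: (pol_S2 G pq).
have sQ : S2 lebn (pdom K) (QL2 K k v) by have := pol_S2 G pQ; rewrite GK.
rewrite mQ//; apply/esym/eqP; rewrite -subr_eq0 -(dotBl mK sw sQ sq); apply/eqP.
apply: (@cover_moments R 2 (pdom K) 'I_(ntets T) _ _ (k%:Z - 2) (fun x => w x - QL2 K k v x) q tet_cover) => //.
- move=> i _; split; first exact: tet_compact.
  by have [_ /(_ i)[_ _ h] _ _ _] := hs; rewrite gt_eqF//; apply: lt_le_trans h; rewrite mulr_gt0.
- move=> i j _ _; have := @conforming 3 idcell i j ([set: 'I_4]%SET) ([set: 'I_4]%SET); rewrite !slice_id; apply => //.
  + by rewrite cardsT card_ord.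
  + by move=> a _; exists (tt i a); rewrite chart_id.
  + by move=> a _; exists (tt j a); rewrite chart_id.
- exact: S2B.
by move=> i _ q' hq'; exact: hT.
Qed.

Section OnFace.
Variable l : 'I_(nfaces K).
Let F := pface K l.
Let isoF : isometric F. Proof. by case: pK => _ _ /(_ l)[]. Qed.
Let pF : is_polygon F. Proof. by case: pK => _ _ /(_ l)[]. Qed.
Let cF : compact (cdom F). Proof. by case: pF. Qed.

(** The triangulation induced on the face, as pairs of a tetrahedron and three of its vertices; two
    pairs may describe the same triangle. *)
Definition triangles : seq ('I_(ntets T) * {set 'I_4}) :=
  [seq a : 'I_(ntets T) * {set 'I_4} <- enum {: 'I_(ntets T) * {set 'I_4}} | (#|a.2| == 3%N) && `[< subsimplex (tt a.1) a.2 `<=` cset F >]].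
Definition triangle (a : 'I_(ntets T) * {set 'I_4}) := slice F (tt a.1) a.2.

Lemma triangleP a : a \in triangles -> #|a.2| = 3%N /\ subsimplex (tt a.1) a.2 `<=` cset F.
Proof. by rewrite mem_filter => /andP[/andP[/eqP-> /asboolP]]. Qed.

Lemma triangle_sub a : a \in triangles -> triangle a `<=` cdom F.
Proof. by move=> /triangleP[_ h] t /h[u cu /(chart_inj isoF) <-]. Qed.

Lemma triangle_cover : cdom F = union triangles triangle.
Proof.
apply/seteqP; split=> [t ct|t [a aT]]; last exact: triangle_sub.
have [_ _ _ _ fac] := hs; have [|i [A [A3 sub xA]]] := fac l (chart F t); first by exists t.
by exists (i, A) => //; rewrite mem_filter mem_enum inE A3 eqxx/= andbT; apply/asboolP.
Qed.

Lemma triangle_vertex a b : a \in triangles -> b \in a.2 -> exists t, chart F t = tt a.1 b.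
Proof.
move=> /triangleP[_ h] ba; have [|t ct <-] := h (tt a.1 b); last by exists t.
by apply: vertex_in => //; exact: tet_nondegenerate.
Qed.

Lemma triangle_compact a : a \in triangles -> compact (triangle a).
Proof.
move=> aT; have [M M0 hM] := compact_bound cF; apply: (bounded_compact (M := M)).
  by apply: slice_closed; exact: tet_nondegenerate.
by move=> t /(triangle_sub aT); exact: hM.
Qed.

Lemma triangle_tet a t : triangle a t -> tet (tt a.1) (chart F t).
Proof.
have na := tet_nondegenerate a.1; move=> /(subsimplexP _ _ na)[h _].
by apply/(subsimplexP _ _ na); split=> // i; rewrite inE.
Qed.

Lemma face_moments (G : gdom R 1) : gD G = cdom F -> S2 lebn (cdom F) (w \o chart F) ->
  S2 lebn (cdom F) (v \o chart F) -> forall q, Pol (k%:Z - 2) q ->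
  dot lebn (cdom F) (v \o chart F) q = dot lebn (cdom F) (w \o chart F) q.
Proof.
move=> GF sw sv q pq; have mF := compact_rV_measurable cF; have [_ _ _ hT _] := hw.
have [] := @QL2P R 1 G k (v \o chart F); rewrite GF// => pQ mQ.
have pqk : Pol k q by apply: PolW pq; lia.
have sq : S2 lebn (cdom F) q by rewrite -GF; exact: (pol_S2 G pq).
set Q := QL2 _ _ _ in pQ mQ; have sQ : S2 lebn (cdom F) Q by have := pol_S2 G pQ; rewrite GF.
rewrite mQ//; apply/esym/eqP; rewrite -subr_eq0 -(dotBl mF sw sQ sq); apply/eqP.
apply: (@cover_moments R 1 (cdom F) _ triangles triangle (k%:Z - 2) (fun x => (w \o chart F) x - Q x) q triangle_cover) => //.
- move=> a aT; have ca := triangle_compact aT; split=> //.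
  have [a3 sub] := triangleP aT.
  have [b [c [ba cA bc]]] : exists b c, [/\ b \in a.2, c \in a.2 & b != c].
    have : (1 < #|a.2|)%N by rewrite a3.
    by move=> /card_gt1P[b [c [h1 h2 h3]]]; exists b, c.
  have [tb Eb] := triangle_vertex aT ba; have [tc Ec] := triangle_vertex aT cA.
  have na := tet_nondegenerate a.1.
  apply: (@diam_neq0 R 1 _ tb tc ca); [by rewrite /triangle /slice /= Eb; exact: vertex_in|by rewrite /triangle /slice /= Ec; exact: vertex_in|].
  by apply: contraNneq bc => E; rewrite -(inj_eq (vertex_inj na)) -Eb -Ec E.
- move=> a b aT bT; have [a3 _] := triangleP aT; have [b3 _] := triangleP bT.
  apply: conforming; rewrite ?a3//; first by move=> c; exact: triangle_vertex aT.
  by move=> c; exact: triangle_vertex bT.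
- exact: S2B.
move=> a aT q' hq'; have [a3 sub] := triangleP aT.
have [/(_ l sub) h _] := hT a.1 a.2 a3.
(* [moments0] holds in every orthonormal chart of the triangle; the chart of the whole face makes
   the moments of the triangles add up. *)
pose c := Cell (triangle a) (corg F) (cdir F).
have cset_c : cset c = subsimplex (tt a.1) a.2.
  apply/seteqP; split=> [_ [t ct <-]//|x xa]; have [t ct E] := sub x xa; exists t => //.
  by rewrite /= /triangle /slice /= E.
rewrite -[RHS](h c isoF cset_c q' hq'); congr (ip _ _ _); apply/funext => t /=.
by rewrite /Q_face /= coordK.
Qed.

Lemma boundary_values e : e \in fedges F -> forall t, cdom (segcell e.1 e.2) t ->
  v (chart F (chart (segcell e.1 e.2) t)) = w (chart F (chart (segcell e.1 e.2) t)).
Proof.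
move=> eF; pose P := chart F e.1; pose Q := chart F e.2.
have [_ _ lenE _] := hm; have rH : 0 < rho * H by [].
have L0 : 0 < enorm (e.2 - e.1) by exact: lt_le_trans (lenE l e eF).
have LE : enorm (Q - P) = enorm (e.2 - e.1) by exact: chart_enorm.
have [[_ hW] hV hE _ _] := hw; have [_ _ _ edg _] := hs.
(* Edges of K are not subdivided, so this edge is one of a single tetrahedron, on which w has the
   form [Wloc]. *)
have [i [A [A2 SE]]] : exists i (A : {set 'I_4}), #|A| = 2%N /\ seg P Q = subsimplex (tt i) A.
  by apply: edg; exists l, e.
have ni := tet_nondegenerate i.
have isE : is_edge K (subsimplex (tt i) A) by rewrite -SE; exists l, e.
pose c := segcell P Q; have L1 : 0 < enorm (Q - P) by rewrite LE.
have cE t : chart c t = chart F (chart (segcell e.1 e.2) t) by rewrite !segcell_chart chart_affine LE.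
have [/(_ isE) mom _ _] := hE i A A2; rewrite -SE in mom.
have {}mom := mom c (segcell_iso L1) (segcell_cset L1).
have [_ _ _ [_ /(_ l)[_ _ _ [_ /(_ e eF)[qv pqv vE]] _]] _] := hv.
have [f hf wf] := hW i; have [q0 pq0 fq] := Wloc_edge ni hf.
have inS t : cdom c t -> subsimplex (tt i) A (chart c t) by move=> ct; rewrite -SE -segcell_cset//; exists t.
have cdE : cdom c = cdom (segcell e.1 e.2) by rewrite /= LE.
have wE t : cdom c t -> w (chart c t) = q0 (chart c t).
  move=> /inS h; rewrite wf ?(fq A)// ?A2//; have [h1 _] := (subsimplexP _ _ ni).1 h.
  by apply/(subsimplexP _ _ ni); split=> // j; rewrite inE.
pose z t := q0 (chart c t) - qv t.
have pz : Pol k z by apply: Pol_sub; [exact: chart_Pol|exact/Pol_polyfun].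
have zE t : cdom c t -> z t = ((w \- v) \o chart c) t.
  by move=> ct; rewrite /z /= wE// cE -vE// -cdE.
have cc : compact (cdom c) by exact: segcell_compact.
have cdom0 : cdom c (const_mx 0) by rewrite /= mxE lexx ltW.
have cdomL : cdom c (const_mx (enorm (Q - P))) by rewrite /= mxE lexx ltW.
have cP : chart c (const_mx 0) = P by rewrite segcell_chart mxE mul0r scale0r addr0.
have cQ : chart c (const_mx (enorm (Q - P))) = Q.
  by rewrite segcell_chart mxE mulfV// scale1r addrC subrK.
have [a [b [ab AE]]] : exists a b, a != b /\ A = [set a; b]%SET by apply/cards2P; rewrite A2.
(* The degrees of freedom of w are attached to the vertices of tetrahedra; the ends of the edge of K
   are such vertices because equal segments have equal ends. *)
have SE' : seg P Q = seg (tt i a) (tt i b) by rewrite SE AE subsimplex_pair.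
have vtx x : is_vertex K x -> (x = tt i a \/ x = tt i b) -> w x = v x.
  by move=> vx [E|E]; subst x; [case: (hV i a)|case: (hV i b)] => h _ _; exact: h.
have e1v : e.1 \in fvs F by case/mapP: eF => p pv ->.
have e2v : e.2 \in fvs F by case/mapP: eF => p pv ->; rewrite /= mem_next.
have wP : w P = v P by apply: vtx; [exists l, e.1|exact: seg_ends SE' L1].
have wQ : w Q = v Q.
  apply: vtx; first by exists l, e.2.
  by apply: (@seg_ends R 3 Q P); [rewrite seg_sym|rewrite -opprB -scaleN1r enormZ normrN1 mul1r].
have z0 : z (const_mx 0) = 0 by rewrite zE// /= cP wP subrr.
have zL : z (const_mx (enorm (Q - P))) = 0 by rewrite zE// /= cQ wQ subrr.
have dc : diam (cdom c) != 0.
  apply: (@diam_neq0 R 0 _ (const_mx 0) (const_mx (enorm (Q - P))) cc) => //.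
  apply/eqP => /rowP/(_ ord0); rewrite !mxE => /esym/eqP; by lra.
have sz : S2 lebn (cdom c) z.
  have [M M0 hM] := compact_bound cc; apply: (cont_S2 (x0 := 0) (r := M)) => //.
  - exact: smooth_cont (Pol_smooth pz).
  - exact: compact_rV_measurable.
  - by move=> t ct; rewrite subr0 hM.
have mz q : Pol (k%:Z - 2) q -> ip (cdom c) z q = 0.
  apply: (scaled_span cc dc sz) => q' hq'; rewrite -[RHS](mom q' hq'); exact: (dot_ext _ zE).
move=> t ct; have ct' : cdom c t by rewrite cdE.
have := @edge_unisolvence R k (enorm (Q - P)) z L1 cc pz z0 zL mz t ct'.
by rewrite zE// /= -cE => /eqP; rewrite subr_eq0 => /eqP.
Qed.

End OnFace.

End Function.

(** Two points of the segment in the same tetrahedron are joined inside it, by convexity, where w is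
    smooth with gradient bounded by L. The tetrahedra cut the segment into closed sets covering it,
    and [piecewise_lip] joins them. *)
Lemma piecewise_smooth_lip (w : 'rV[R]_3 -> R) (f : 'I_(ntets T) -> 'rV[R]_3 -> R) (L : R) : 0 <= L ->
  (forall i, smooth (f i) /\ forall x, tet (tt i) x -> w x = f i x) ->
  (forall i x b, tet (tt i) x -> `|pd b (f i) x| <= L) ->
  forall x y, seg x y `<=` pdom K -> `|w y - w x| <= 3 * L * `|y - x|.
Proof.
move=> L0 hf hL x y xy; set u := y - x.
have cu : continuous (fun s : R => x + s *: u).
  move=> s; apply: cvgD; first exact: cvg_cst.
  exact: scalel_continuous.
have := @piecewise_lip R 'I_(ntets T) (3 * L * `|u|) (fun s => w (x + s *: u)) (fun i => [set s | tet (tt i) (x + s *: u)])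
  1 (enum 'I_(ntets T)) 0.
rewrite subr0 mulr1 scale1r scale0r addr0 (_ : x + u = y); last by rewrite /u addrC subrK.
apply=> //.
- move=> i _; apply: (@preimage_closed _ _ (fun s : R => x + s *: u) (tet (tt i))); last exact: tet_closed.
  by [].
- move=> i _ s s' /= hs1 hs2; have [sf wf] := hf i; rewrite wf// wf//.
  apply: le_trans (@smooth_lip R 3 (f i) (x + s' *: u) (x + s *: u) L sf L0 _) _.
    move=> r r01 b; apply: hL; apply: (tet_convex (tet_nondegenerate i) hs2 hs1); by exists r.
  rewrite opprD addrACA subrr add0r -scalerBl normrZ.
  by lra.
- move=> s s01; have : pdom K (x + s *: u) by apply: xy; exists s.
  by rewrite tet_cover => -[i si hi]; exists i.
Qed.

(** * Weak gradient and inverse estimates for the interpolant *)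

Section Piecewise.
Context (w : 'rV[R]_3 -> R) (f : 'I_(ntets T) -> 'rV[R]_3 -> R).
Context (pf : forall i, Pol (k + 2)%N (f i)) (wf : forall i x, tet (tt i) x -> w x = f i x).

Let sf i : smooth (f i). Proof. exact: Pol_smooth (pf i). Qed.

Lemma tets_bound (q : 'I_(ntets T) -> 'rV[R]_3 -> R) : (forall i, smooth (q i)) ->
  exists2 L : R, 0 < L & forall i x, tet (tt i) x -> `|q i x| <= L.
Proof.
move=> sq; have [M M0 hM] := compact_bound cK.
have /choice[B hB] : forall i, exists B : R, 0 < B /\ forall x, `|x - 0| <= M -> `|q i x| <= B.
  by move=> i; have [B B0 h] := @cont_rV_bounded R 3 (q i) 0 M (smooth_cont (sq i)); exists B.
exists (1 + \sum_i B i); first by rewrite ltr_pwDl// sumr_ge0// => i _; case: (hB i) => /ltW.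
move=> i x xi; have [_ h] := hB i; apply: le_trans (h x _) _; first by rewrite subr0 hM//; exact: tet_sub xi.
by rewrite (bigD1 i)//= addrCA lerDl addr_ge0// sumr_ge0// => j _; case: (hB j) => /ltW.
Qed.

Lemma tets_select (q : 'I_(ntets T) -> 'rV[R]_3 -> R) : (forall i, smooth (q i)) ->
  exists2 g : 'rV[R]_3 -> R, measurable_fun setT g &
    [/\ forall x, pdom K x -> exists2 i, tet (tt i) x & g x = q i x, forall x, ~ pdom K x -> g x = 0 &
        exists2 L : R, 0 < L & forall x, `|g x| <= L].
Proof.
move=> sq; have mq i := smooth_measurable (sq i).
have [g mg [gU g0]] := union_select (enum 'I_(ntets T)) tet_measurable mq.
rewrite -tet_cover in gU g0; exists g => //; split=> //.
have [L L0 hL] := tets_bound sq; exists L => // x.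
have [Kx|nKx] := pselect (pdom K x); last by rewrite g0// normr0.
by have [i xi ->] := gU x Kx; exact: hL.
Qed.

(** The null set is the union of the planes of all the faces of the tetrahedra; off it, the
    barycentric coordinates of a point of a tetrahedron are all positive. *)
Lemma tets_interior : exists N : set 'rV[R]_3, [/\ mrV N, lebn N = 0%E &
  forall i x, ~ N x -> tet (tt i) x -> exists2 r : R, 0 < r & forall y, `|y - x| < r -> tet (tt i) y].
Proof.
have null (ia : 'I_(ntets T) * 'I_4) : mrV [set t | bcoord (tt ia.1) ia.2 (chart idcell t) = 0] /\
    lebn [set t | bcoord (tt ia.1) ia.2 (chart idcell t) = 0] = 0%E.
  have n1 := tet_nondegenerate ia.1; pose j : 'I_4 := lift ia.2 ord0.
  apply: (@bcoord_null R 3 idcell _ _ (tt ia.1 ia.2) (tt ia.1 j)).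
  rewrite !chart_id !bcoord_vertex// eqxx (negbTE (neq_lift _ _)); exact: oner_neq0.
have [mN N0] := fin_null (mu := lebn) (fun ia => (null ia).1) (fun ia => (null ia).2).
eexists; split; [exact: mN|exact: N0|move=> i x nx xi].
have ni := tet_nondegenerate i; have [b0 _] := (subsimplexP _ _ ni).1 xi.
have bp a : 0 < bcoord (tt i) a x.
  rewrite lt_neqAle b0 andbT eq_sym; apply/eqP => E; apply: nx; exists (i, a) => //=.
  by rewrite chart_id.
have /choice[r hr] : forall a, exists r : R, 0 < r /\ forall y, `|y - x| < r -> 0 <= bcoord (tt i) a y.
  move=> a; have ca := smooth_cont (Pol_smooth (bcoord_Pol (tt i) a)).
  have [r r0 h] := @cont_rV_eps R 3 _ x _ (ca x) (bp a); exists r; split=> // y /h.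
  by rewrite ler_norml => /andP[+ _]; rewrite lerBrDr addrC subrr.
have [d d0 hd] := pos_lower_bound (fun a => (hr a).1); exists d => // y yx.
apply/(subsimplexP _ _ ni); split=> a; last by rewrite inE.
by apply: (hr a).2; exact: lt_le_trans (hd a).
Qed.

(** The piecewise derivative is classical off a null set, and the Lipschitz bound along segments in
    K bounds the difference quotients, so [by_parts] applies. Hence [wgrad K w] is a genuine weak
    gradient and not the default value of [xget]. *)
Lemma piecewise_gradient (G : gdom R 2) : gD G = pdom K -> exists g : 'I_3 -> 'rV[R]_3 -> R, forall b,
  S2 lebn (pdom K) (g b) /\ forall phi, inner G phi -> dot lebn (pdom K) w (pd b phi) = - dot lebn (pdom K) (g b) phi.
Proof.
move=> GK; suff h b : exists g, S2 lebn (pdom K) g /\ forall phi, inner G phi ->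
    dot lebn (pdom K) w (pd b phi) = - dot lebn (pdom K) g phi by have [g hg] := choice h; exists g.
have Kfin : (lebn (pdom K) < +oo)%E by rewrite -GK; exact: gD_fin.
have sp i := smooth_pd b (sf i).
have [g mg [gE g0 [Lg Lg0 hLg]]] := tets_select sp.
have [W mW [WE W0 [LW LW0 hLW]]] := tets_select sf.
have Ww x : pdom K x -> W x = w x by move=> /WE[i xi ->]; rewrite (wf xi).
have /choice[Lb hLb] : forall b, exists L : R, 0 < L /\ forall i x, tet (tt i) x -> `|pd b (f i) x| <= L.
  move=> a; have sa i := smooth_pd a (sf i); by have [L L0 hL] := tets_bound sa; exists L.
pose L := \sum_a Lb a; have L0 : 0 <= L by apply: sumr_ge0 => a _; apply: ltW; case: (hLb a).
have hL i x a : tet (tt i) x -> `|pd a (f i) x| <= L.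
  move=> xi; apply: le_trans ((hLb a).2 i x xi) _; rewrite /L (bigD1 a)//= lerDl.
  by apply: sumr_ge0 => c _; apply: ltW; case: (hLb c).
exists g; split; first by apply: (S2_bounded (M := Lg)) => //; exact: measurable_funTS.
move=> phi [sphi [m m0 supp]]; rewrite GK in supp.
have [M M0 hM] := compact_bound cK.
have [B1 B10 hB1] := @cont_rV_bounded R 3 phi 0 M (smooth_cont sphi).
have [B2 B20 hB2] := @cont_rV_bounded R 3 _ 0 M (smooth_cont (smooth_pd b sphi)).
have out := margin_pd sphi m0 supp.
have inK x : phi x != 0 -> forall y, `|y - x| <= m -> seg x y `<=` pdom K.
  move=> fx y yx _ [s /andP[s0 s1] ->]; apply: (supp x fx).
  by rewrite addrAC subrr add0r normrZ ger0_norm//; apply: le_trans yx; rewrite ler_piMl.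
have step x t : x + t *: delta_mx 0 b - x = t *: (delta_mx 0 b : 'rV[R]_3) by rewrite addrAC subrr add0r.
have self x : phi x != 0 -> pdom K x by move=> fx; apply: (supp x fx); rewrite subrr normr0.
transitivity (dot lebn (pdom K) W (pd b phi)); first by apply: dot_ext => // x /Ww ->.
apply: (@by_parts R 3 (pdom K) W g phi b m LW (3 * L) (B1 + B2)) => //.
- move=> x; have [Kx|nKx] := pselect (pdom K x); last by rewrite (out x nKx).1 normr0.
  by apply: le_trans (hB1 x _) _; rewrite ?subr0 ?hM// lerDl.
- move=> x; have [Kx|nKx] := pselect (pdom K x); last by rewrite (out x nKx).2 normr0.
  by apply: le_trans (hB2 x _) _; rewrite ?subr0 ?hM// lerDr.
- exact: measurable_funTS.
- move=> x fx t tm; have sK : seg x (x + t *: delta_mx 0 b) `<=` pdom K.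
    by apply: inK => //; rewrite step (le_trans (norm_delta _ _)).
  have Ky : pdom K (x + t *: delta_mx 0 b) by apply: (supp x fx); rewrite step (le_trans (norm_delta _ _)).
  rewrite !Ww//; last exact: self.
  have sfw i : smooth (f i) /\ forall x, tet (tt i) x -> w x = f i x by split=> // y; exact: wf.
  apply: le_trans (piecewise_smooth_lip L0 sfw hL sK) _; rewrite step.
  by rewrite ler_wpM2l ?norm_delta.
have [N [mN N0 hN]] := tets_interior; exists N; split=> // x nx; apply: contrapT => Nx; apply: nx => fx.
have [i xi ->] := gE x (self x fx); have [r' r'0 hr'] := hN i x Nx xi.
move=> e e0; have := @hasgrad_line R 3 (f i) x (delta_mx 0 b) 0 (fun j => pd j (f i) (x + 0 *: delta_mx 0 b)) (smooth_hasgrad _ (sf i)).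
rewrite scale0r addr0 (bigD1 b)//= !mxE !eqxx mul1r big1 ?addr0; last first.
  by move=> j jb; rewrite !mxE (negbTE jb) andbF mul0r.
move=> /(_ e e0)[d d0 hd]; exists (Num.min d r'); first by rewrite lt_min d0.
move=> t; rewrite lt_min => /andP[td tr].
have WF s : `|s - 0| < r' -> W (x + s *: delta_mx 0 b) = f i (x + s *: delta_mx 0 b).
  move=> sr; have yi : tet (tt i) (x + s *: delta_mx 0 b).
    by apply: hr'; rewrite step; apply: le_lt_trans (norm_delta _ _) _; rewrite subr0 in sr.
  by rewrite Ww ?(wf yi)//; exact: tet_sub yi.
by have := hd t td; rewrite scale0r addr0 (WF t tr) (Ww x (self x fx)) (wf xi).
Qed.

Lemma piecewise_S2 : S2 lebn (pdom K) w.
Proof.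
have [W mW [WE _ [LW LW0 hLW]]] := tets_select sf.
apply: (S2_ext (u := W)) => // [x /WE[i xi ->]|]; first by rewrite (wf xi).
apply: (S2_bounded (M := LW)) => //; last exact: measurable_funTS.
have [M M0 hM] := compact_bound cK; apply: le_lt_trans (leb_fin_bounded (x := 0) (r := M) mK M0 _) (ltry _).
by move=> x /hM; rewrite subr0.
Qed.

Lemma face_S2 l : S2 lebn (cdom (pface K l)) (w \o chart (pface K l)).
Proof.
set F := pface K l; have cF : compact (cdom F) by case: pK => _ _ /(_ l)[_ []].
have mF := compact_rV_measurable cF; have [L L0 hL] := tets_bound sf.
apply: (S2_bounded (M := L)) => //.
- have [M M0 hM] := compact_bound cF; apply: le_lt_trans (leb_fin_bounded (x := 0) (r := M) mF M0 _) (ltry _).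
  by move=> x /hM; rewrite subr0.
- have E : cdom F = union (triangles l) (triangle l) := triangle_cover l.
  rewrite E; apply: union_measurable_fun => a aT.
    exact: compact_rV_measurable (@triangle_compact l a aT).
  apply: (eq_measurable_fun (f a.1 \o chart F)); last exact: measurable_funTS (smooth_measurable (smooth_chart F (sf a.1))).
  by move=> t /set_mem ta; rewrite /= (wf (triangle_tet ta)).
move=> t ct /=; have : pdom K (chart F t) by exact: face_in.
by rewrite tet_cover => -[i _ ti]; rewrite (wf ti); exact: hL.
Qed.

Lemma lip_bound_cell (G : gdom R 2) (L c M : R) : gD G = pdom K -> gh G = H -> 0 <= L ->
  (forall i x b, tet (tt i) x -> `|pd b (f i) x| <= L) -> (forall x, pdom K x -> `|w x - c| <= M) -> 6 * L * H <= M ->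
  lip_bound G (fun x => w x - c) M.
Proof.
move=> GK Gh L0 hL hM LM; split=> [x|x y]; rewrite GK; first exact: hM.
move=> xy; rewrite Gh opprB addrA subrK.
apply: le_trans (piecewise_smooth_lip L0 (fun i => conj (sf i) (wf (i:=i))) hL xy) _; rewrite ler_wpM2r// ler_pdivlMr//.
by apply: le_trans LM; rewrite ler_wpM2r// ler_wpM2r// ler_nat.
Qed.

(** In the factor 6, 3 is the dimension, from [piecewise_smooth_lip], and 2 comes from the chart of
    the face, an isometry for Euclidean lengths only. *)
Lemma lip_bound_face l (G : gdom R 1) (L c M : R) : gD G = cdom (pface K l) -> gh G = H -> 0 <= L ->
  (forall i x b, tet (tt i) x -> `|pd b (f i) x| <= L) -> (forall x, pdom K x -> `|w x - c| <= M) -> 6 * L * H <= M ->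
  lip_bound G (fun t => (w \o chart (pface K l)) t - c) M.
Proof.
move=> GF Gh L0 hL hM LM; split=> [t|t u]; rewrite GF; first by move=> /(face_in pK); exact: hM.
have isoF : isometric (pface K l) by case: pK => _ _ /(_ l)[].
move=> tu; rewrite /= Gh opprB addrA subrK.
have xy : seg (chart (pface K l) t) (chart (pface K l) u) `<=` pdom K.
  by move=> _ [s s01 ->]; rewrite -chart_affine; apply: (face_in pK); apply: tu; exists s.
apply: le_trans (piecewise_smooth_lip L0 (fun i => conj (sf i) (wf (i:=i))) hL xy) _.
have lu : `|chart (pface K l) u - chart (pface K l) t| <= 2 * `|u - t|.
  by rewrite (le_trans (norm_le_enorm _))// chart_enorm// enorm_le_norm.
apply: (@le_trans _ _ (3 * L * (2 * `|u - t|))); first by rewrite ler_wpM2l//.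
rewrite mulrA ler_wpM2r// ler_pdivlMr//; apply: le_trans LM.
by lra.
Qed.

Section InverseEstimate.
Context (CI : R) (CI0 : 0 < CI) (hI : forall (q : 'rV[R]_3 -> R) (y : 'rV[R]_3) (d : R) x, Pol (k + 2)%N q -> 0 < d ->
  `|x - y| <= 6 / (sigma * gamma) * d -> `|q x| <= CI * enm y d q /\ forall i, `|pd i q x| <= CI / d * enm y d q).
Local Notation delta := (sigma * gamma * H / 6).
Local Notation S := (Num.sqrt (delta ^+ 3)).

Let d0 : 0 < delta. Proof. by []. Qed.
Let S0 : 0 < S. Proof. by rewrite sqrtr_gt0. Qed.
Let SS : S ^+ 2 = delta ^+ 3. Proof. by rewrite sqr_sqrtr//. Qed.

(** The ratio 6/(sigma gamma) is that of the diameter of K to delta, and the diameter of K bounds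
    the distance between any two points of the tetrahedron. *)
Lemma tet_ball i : exists y, (forall x, `|x - y| <= 2 * delta -> tet (tt i) x) /\
  forall x, tet (tt i) x -> `|x - y| <= 6 / (sigma * gamma) * delta.
Proof.
have [y hy] := tet_center i; exists y; split=> // x xi.
have yi : tet (tt i) y by apply: hy; rewrite subrr normr0.
apply: le_trans (norm_le_enorm _) _; apply: le_trans (le_diam cK (@tet_sub i _ xi) (@tet_sub i _ yi)) _.
by apply: eq_ler; field; rewrite !gt_eqF.
Qed.

Lemma ball_sub i y : (forall x, `|x - y| <= 2 * delta -> tet (tt i) x) -> cball y delta `<=` tet (tt i).
Proof. by move=> hy x xy; apply: hy; apply: le_trans xy _; rewrite ler_peMl ?ler1n//. Qed.

Lemma enm_value i y : (forall x, `|x - y| <= 2 * delta -> tet (tt i) x) -> S * enm y delta (f i) <= nrm lebn (pdom K) w.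
Proof.
move=> /ball_sub cb; have cf := smooth_cont (sf i).
have mb : mrV (cball y delta) by exact: cball_measurable.
have h1 := enm_le_nrm cf d0 mb (@subset_refl _ _) (cball_le_S2 _ cf d0).
have E : nrm lebn (cball y delta) (f i) = nrm lebn (cball y delta) w.
  by apply: nrm_ext => x /cb xi; rewrite (wf xi).
rewrite E in h1; have h2 := nrm_subset mK mb (subset_trans cb (@tet_sub i)) piecewise_S2.
apply: le_trans h2; rewrite -(@ler_pXn2r _ 2) ?nnegrE ?mulr_ge0 ?sqrtr_ge0//.
by rewrite exprMn SS.
Qed.

(** The weak gradient g is compared with the derivative p of the polynomial only through test
    functions. With phi the bump times p, supported in the tetrahedron, the square X^2 of the left
    side is (p, phi) = (g, phi) <= |g| |phi|, and |phi| <= X because the bump is at most 1. *)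
Lemma enm_gradient (G : gdom R 2) g b i y : gD G = pdom K -> S2 lebn (pdom K) g ->
  (forall phi, inner G phi -> dot lebn (pdom K) w (pd b phi) = - dot lebn (pdom K) g phi) ->
  (forall x, `|x - y| <= 2 * delta -> tet (tt i) x) -> S * enm y delta (pd b (f i)) <= nrm lebn (pdom K) g.
Proof.
move=> GK sg hg hy; have cb := ball_sub hy; have sp := smooth_pd b (sf i); set p := pd b (f i) in sp *.
pose phi x := qbump y delta x * p x.
have sphi : smooth phi by apply: smoothM => //; exact: qbump_smooth.
have supp x : phi x != 0 -> forall u, `|u - x| <= delta -> tet (tt i) u.
  rewrite mulf_eq0 negb_or => /andP[/(qbump_out d0) xy _] u ux; apply: hy; rewrite -(subrKA x).
  by rewrite (le_trans (ler_normD _ _))// (_ : 2 * delta = delta + delta) ?lerD//; ring.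
have iphi : inner G phi.
  by split=> //; exists delta => // x px u ux; rewrite GK; apply: (@tet_sub i); exact: supp px u ux.
have S2s q : smooth q -> S2 lebn (pdom K) q by move=> sq; rewrite -GK; exact: smooth_S2.
have E : dot lebn (pdom K) g phi = dot lebn (pdom K) p phi.
  have := hg phi iphi; have -> : dot lebn (pdom K) w (pd b phi) = dot lebn (pdom K) (f i) (pd b phi).
    apply: eq_Rintegral => x /set_mem Kx; have [xi|nxi] := pselect (tet (tt i) x); first by rewrite (wf xi).
    by rewrite (margin_pd sphi d0 supp nxi).2 !mulr0.
  have := smooth_by_parts (G := G) b (sf i) iphi; rewrite GK => -> /eqP; rewrite eqr_opp => /eqP ->; exact: erefl.
set X := S * _; have X0 : 0 <= X by rewrite mulr_ge0 ?sqrtr_ge0.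
have XE : X ^+ 2 = \int[lebn]_(x in pdom K) (qbump y delta x * p x * p x).
  rewrite exprMn SS; apply: enm_integral => //; [exact: smooth_cont|exact: subset_trans cb (@tet_sub i)].
have XE' : X ^+ 2 = dot lebn (pdom K) p phi.
  by rewrite XE; apply: eq_Rintegral => x _; rewrite mulrC.
apply: sqr_le_lin => //.
rewrite XE' -E; apply: le_trans (ler_norm _) _; apply: le_trans (cauchy_schwarz mK sg (S2s _ sphi)) _.
rewrite ler_wpM2l ?nrm_ge0//; apply: nrm_le => //; rewrite XE'.
apply: le_Rintegral => //.
- exact: (S2_mul mK (S2s _ sphi) (S2s _ sphi)).
- exact: (S2_mul mK (S2s _ sp) (S2s _ sphi)).
move=> x _; have /andP[q0 q1] := qbump_itv y delta x; rewrite /phi.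
rewrite (_ : _ * _ * (_ * _) = qbump y delta x ^+ 2 * p x ^+ 2); last by ring.
by rewrite (_ : p x * _ = qbump y delta x * p x ^+ 2); [rewrite ler_wpM2r// expr2 ler_piMr|ring].
Qed.

Lemma value_bound i x : tet (tt i) x -> `|f i x| <= CI * (nrm lebn (pdom K) w / S) /\
  forall b, `|pd b (f i) x| <= CI / delta * (nrm lebn (pdom K) w / S).
Proof.
move=> xi; have [y [hy hx]] := tet_ball i; have [h1 h2] := hI (pf i) d0 (hx x xi).
have hE : enm y delta (f i) <= nrm lebn (pdom K) w / S by rewrite ler_pdivlMr// mulrC; exact: enm_value.
split=> [|b]; first by apply: le_trans h1 _; rewrite ler_pM2l.
by apply: le_trans (h2 b) _; rewrite ler_pM2l//.
Qed.

Lemma gradient_bound (G : gdom R 2) g b i x : gD G = pdom K -> S2 lebn (pdom K) g ->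
  (forall phi, inner G phi -> dot lebn (pdom K) w (pd b phi) = - dot lebn (pdom K) g phi) ->
  tet (tt i) x -> `|pd b (f i) x| <= CI * (nrm lebn (pdom K) g / S).
Proof.
move=> GK sg hg xi; have [y [hy hx]] := tet_ball i.
have pp : Pol (k + 2)%N (pd b (f i)) by apply: PolW (Pol_pd b (pf i)); rewrite lerBlDr lerDl.
have [h1 _] := hI pp d0 (hx x xi); apply: le_trans h1 _; rewrite ler_pM2l//.
by rewrite ler_pdivlMr// mulrC; exact: (enm_gradient GK).
Qed.

End InverseEstimate.

End Piecewise.

Section Elements.
Context (v w : 'rV[R]_3 -> R) (hv : Vc k K v) (hw : is_interpolant k K T v w).

Let pieces : exists f : 'I_(ntets T) -> 'rV[R]_3 -> R,
  (forall i, Pol (k + 2)%N (f i)) /\ forall i x, tet (tt i) x -> w x = f i x.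
Proof. by have [f hf] := interpolant_pieces hw; exists f; split=> [i|i x]; have [] := hf i => // _; apply. Qed.

Lemma cell_element (G : gdom R 2) : gD G = pdom K -> gbds G = pbd K ->
  (forall i, exists l, gbd (g := G) i = fcell (pface K l)) -> element k G v w (wgrad K v).
Proof.
move=> GK Gb Gi; have [f [pf wf]] := pieces; have [h1 [p pp lp] tr _ enh] := hv.
have sw : S2 lebn (pdom K) w := piecewise_S2 pf wf.
have sv : S2 lebn (pdom K) v by case: h1.
rewrite -GK; apply: element_intro; rewrite ?GK ?Gb//.
- by move=> i; have [l ->] := Gi i; exact: tr.
- by exists p => //; exact/Pol_polyfun.
exact: (volume_moments hw GK).
Qed.

Lemma face_element l (G : gdom R 1) : gD G = cdom (pface K l) -> gbds G = fbd (pface K l) ->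
  (forall i, exists2 e, e \in fedges (pface K l) & gbd (g := G) i = segcell e.1 e.2) ->
  element k G (v \o chart (pface K l)) (w \o chart (pface K l)) (wgrad (cdom (pface K l)) (v \o chart (pface K l))).
Proof.
move=> GK Gb Gi; have [f [pf wf]] := pieces; have [_ _ _ [_ /(_ l)[h1 [p pp lp] tr _ enh]] _] := hv.
have sw := face_S2 pf wf l.
have sv : S2 lebn (cdom (pface K l)) (v \o chart (pface K l)) by case: h1.
rewrite -[X in wgrad X]GK; apply: element_intro; rewrite ?GK ?Gb//.
- by move=> i; have [e eF ->] := Gi i; exact: tr.
- by exists p => //; exact/Pol_polyfun.
exact: (face_moments hw GK).
Qed.

End Elements.

End Mesh.

Lemma sqrt_cube {R : realType} (a h : R) : 0 <= a -> 0 <= h -> Num.sqrt ((a * h) ^+ 3) = Num.sqrt (a ^+ 3) * (h * Num.sqrt h).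
Proof.
move=> a0 h0; rewrite exprMn sqrtrM//; congr (_ * _).
by rewrite exprSr sqrtrM// sqrtr_sqr ger0_norm.
Qed.

(** The two dimensions meet here: [boundary_matching] on each face supplies the [boundary_gap] that
    [lifted_estimate] takes in K. *)
Lemma virtual_bound {R : realType} (k : nat) (rho : R) : 0 < rho -> exists2 C : R, 0 < C &
  forall (sigma gamma : R) (K : polyhedron R) (T : tmesh R) v w f (c L M : R), 0 < sigma -> 0 < gamma ->
    mesh_assumption rho K -> subdivision sigma gamma K T -> (exists x, pdom K x) -> Vc k K v -> is_interpolant k K T v w ->
    (forall i, Pol (k + 2)%N (f i)) -> (forall i x, tet (tets T i) x -> w x = f i x) -> 0 <= L ->
    (forall i x b, tet (tets T i) x -> `|pd b (f i) x| <= L) -> 0 < M -> (forall x, pdom K x -> `|w x - c| <= M) ->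
    6 * L * diam K <= M ->
    (forall b, nrm lebn (pdom K) (wgrad K v b) <= C * (Num.sqrt (diam K) * M)) /\
    nrm lebn (pdom K) (fun x => v x - c) <= C * (Num.sqrt (diam K) * M) * diam K.
Proof.
(* The ratios h/r and h/q are 3/rho and 2/rho^2 in K, 2/rho^2 and 2/rho on the faces; [kap] is above
   all of them. *)
move=> rho0; pose kap := 2 / rho ^+ 2 + 3 / rho.
have [C1 C10 h1] := @boundary_matching R 1 k kap.
have [C2 C20 h2] := @lifted_estimate R 2 k kap.
pose X0 := Num.sqrt ((rho / 3) ^+ 3) + C1 * (rho ^+ 2 / 2).
have X00 : 0 < X0 by rewrite ltr_wpDl//.
exists (C2 * X0); first exact: mulr_gt0.
move=> sigma gamma K T v w f c L M sigma0 gamma0 hm hs ne hv hw pf wf L0 hL M0 hM LM.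
have pK : is_polyhedron K by case: hm.
have H0 : 0 < diam K by exact: polyhedron_diam_gt0.
have [cK _ fK _ _] := pK.
have [G [GK Gb Gh Gr [Gq Gi]]] := polyhedron_gdom rho0 hm ne.
have rk1 : gh G <= kap * gr G.
  rewrite Gh Gr (_ : kap * _ = diam K + 2 / (3 * rho) * diam K); first by rewrite lerDl.
  by rewrite /kap; field; rewrite gt_eqF.
have rk2 : gh G <= kap * gq G.
  rewrite Gh Gq (_ : kap * _ = diam K + 3 * rho / 2 * diam K); first by rewrite lerDl.
  by rewrite /kap; field; rewrite gt_eqF.
(* In dimension 2 [vol] is the half-side rho^2 H / 2 itself, so the bound [vol] M / h of
   [boundary_matching] does not depend on H. *)
pose A := C1 * (rho ^+ 2 / 2 * M).
have A0 : 0 <= A by rewrite mulr_ge0// mulr_ge0// divr_ge0// sqr_ge0.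
have lipG : lip_bound G (fun x => w x - c) M by exact: (lip_bound_cell hm hs ne pf wf GK Gh L0 hL hM LM).
have elG := element_shift c (cell_element rho0 sigma0 gamma0 hm hs ne hv hw GK Gb Gi).
have sF i : S2 lebn (cdom (gbd i)) ((fun x => w x - c) \o chart (gbd (g := G) i)).
  have sw : S2 lebn (cdom (gbd i)) (w \o chart (gbd i)) by have [l ->] := Gi i; exact: (face_S2 hm hs pf wf).
  exact: S2B (@gcdom_measurable R 2 G i) sw (gbd_S2 i (smooth_cont (smooth_cst c))).
have gap : boundary_gap G (fun x => v x - c) (fun x => w x - c) A.
  move=> i e e0; have [l ->] := Gi i; set F := pface K l.
  have [isoF pF] := fK l; have [_ _ lenF starF] := hm.
  have hH x y : cdom F x -> cdom F y -> enorm (x - y) <= diam K.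
    by move=> Fx Fy; rewrite -(chart_enorm _ _ isoF); apply: le_diam => //; exact: face_in.
  have [GF [GFK GFb GFh GFr [GFq GFi]]] := face_gdom rho0 H0 pF (starF l) (lenF l) hH.
  have rk3 : gh GF <= kap * gr GF.
    rewrite GFh GFr (_ : kap * _ = diam K + 3 * rho / 2 * diam K); first by rewrite lerDl.
    by rewrite /kap; field; rewrite gt_eqF.
  have rk4 : gh GF <= kap * gq GF.
    rewrite GFh GFq (_ : kap * _ = diam K + (1 / rho + 1 / 2) * diam K).
      by rewrite lerDl.
    by rewrite /kap; field; rewrite gt_eqF.
  have lipF := lip_bound_face hm hs ne pf wf GFK GFh L0 hL hM LM.
  have elF := element_shift c (face_element rho0 sigma0 gamma0 hm hs ne hv hw GFK GFb GFi).
  have vwE j t : cdom (gbd j) t -> (v \o chart F) (chart (gbd (g := GF) j) t) - c = (w \o chart F) (chart (gbd j) t) - c.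
    by have [a aF ->] := GFi j => ct; congr (_ - c); exact: (boundary_values rho0 hm hs ne hv hw aF ct).
  have [g [[sg [m m0 hmg]] g1 g2 g3]] := h1 GF _ _ _ M rk3 rk4 M0 lipF elF vwE e e0.
  have VA : C1 * (vol GF * M / gh GF) = A.
    rewrite /vol GFr GFh sqrtr_sqr ger0_norm//.
    by rewrite /A; field; rewrite gt_eqF.
  rewrite GFK VA GFh in g1 g2 g3 hmg.
  exists g; split=> //; first by exists m.
  by rewrite Gh.
have [r1 r2] := h2 G _ _ _ M A rk1 rk2 (ltW M0) A0 lipG elG sF gap.
have XE : vol G * M / gh G + Num.sqrt (gh G) * A = X0 * (Num.sqrt (diam K) * M).
  rewrite /vol Gr Gh (_ : rho * diam K / 3 = rho / 3 * diam K); last by lra.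
  rewrite sqrt_cube//.
  by rewrite /A /X0; field; rewrite gt_eqF.
rewrite GK XE Gh in r1 r2.
split=> [b|]; first by rewrite -[_ * X0 * _]mulrA; exact: r1.
by lra.
Qed.

Lemma test_null {R : realType} n (D : set 'rV[R]_n) (u : 'rV[R]_n -> R) : ~ (exists x, D x) -> L2norm D u = 0 /\ forall v, H1seminorm D v = 0.
Proof.
move=> nD; have -> : D = set0 by apply/seteqP; split=> x // Dx; apply: nD; exists x.
have i0 (a b : 'rV[R]_n -> R) : ip set0 a b = 0 by rewrite /ip Rintegral_set0.
by split=> [|v']; rewrite /L2norm /H1seminorm ?i0 ?sqrtr0// big1 ?sqrtr0// => i _; rewrite i0.
Qed.

Theorem lemma4p3 (R : realType) (k : nat) (rho sigma gamma : R)
    (hk : (1 <= k)%N) (hrho : 0 < rho) (hsigma : 0 < sigma)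
    (hgamma : 0 < gamma) :
  exists C : R, 0 < C /\
    forall (K : polyhedron R) (T : tmesh R),
      mesh_assumption rho K -> subdivision sigma gamma K T ->
      forall v w : 'rV[R]_3 -> R,
        Vc k K v -> is_interpolant k K T v w ->
        L2norm K v <= C * L2norm K w /\
        H1seminorm K v <= C * H1seminorm K w.
Proof.
(* The degree includes the bubbles of w, and 6/(sigma gamma) is the ratio found in [tet_ball]. *)
have [CI CI0 hI] := @inverse_estimate R 3 (k + 2) (6 / (sigma * gamma)).
have [C C0 hC] := @virtual_bound R k rho hrho.
pose t := sigma * gamma / 6; have t0 : 0 < t by rewrite divr_gt0// mulr_gt0.
pose s := Num.sqrt (t ^+ 3); have s0 : 0 < s by rewrite sqrtr_gt0.
(* [S] below is s H^(3/2), so the powers of H cancel. In [D1], one 3 sums the components of the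
   gradient of v and the other those of w. *)
pose D0 := C * (CI + 6 * (CI / t)) / s; pose D1 := 3 * (C * (6 * CI) / s) * 3.
have D00 : 0 < D0 by rewrite divr_gt0// mulr_gt0// addr_gt0// mulr_gt0// divr_gt0.
have D10 : 0 < D1 by rewrite !mulr_gt0//.
exists (D0 + D1); split; first exact: addr_gt0.
move=> K T hm hs v w hv hw.
(* The definitions allow an empty K; all norms are then 0. *)
have [ne|nK] := pselect (exists x, pdom K x); last first.
  have n0 u := test_null u nK; have [a1 b1] := n0 v; have [a2 _] := n0 w.
  by rewrite a1 a2 !b1.
have pK : is_polyhedron K by case: hm.
have H0 : 0 < diam K by exact: polyhedron_diam_gt0.
have [G [GK Gb Gh Gr [Gq Gi]]] := polyhedron_gdom hrho hm ne.
have [f hf] := interpolant_pieces hw.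
have pf i : Pol (k + 2)%N (f i) by case: (hf i).
have wf i x : tet (tets T i) x -> w x = f i x by case: (hf i) => _; apply.
have cov x : pdom K x -> exists i, tet (tets T i) x by rewrite (tet_cover hs) => -[i _ xi]; exists i.
have dE : sigma * gamma * diam K / 6 = t * diam K by rewrite /t mulrAC.
have SE : Num.sqrt ((t * diam K) ^+ 3) = s * (diam K * Num.sqrt (diam K)) by rewrite sqrt_cube//.
set S := Num.sqrt ((t * diam K) ^+ 3) in SE.
have q0 : 0 < Num.sqrt (diam K) by rewrite sqrtr_gt0.
have S0 : 0 < S by rewrite SE.
have mK : mrV (pdom K) by apply: compact_rV_measurable; case: pK.
have bound := fun c L M => hC sigma gamma K T v w f c L M hsigma hgamma hm hs ne hv hw pf wf.
split.
- set N := L2norm K w; have N0 : 0 <= N by exact: sqrtr_ge0.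
  have vb i x : tet (tets T i) x -> `|f i x| <= CI * (N / S) /\ forall b, `|pd b (f i) x| <= CI / (t * diam K) * (N / S).
    by move=> xi; have := value_bound hsigma hgamma hm hs ne pf wf CI0 hI xi; rewrite dE.
  have L0 : 0 <= CI / (t * diam K) * (N / S) by [].
  pose M0 := (CI + 6 * (CI / t)) * (N / S).
  have LH : 6 * (CI / (t * diam K) * (N / S)) * diam K = 6 * (CI / t) * (N / S).
    by field; rewrite !gt_eqF.
  have M00 : 0 <= M0 by rewrite mulr_ge0// addr_ge0// ltW.
  apply: (@le_trans _ _ (D0 * N)); last by rewrite ler_wpM2r// lerDl.
  have K0 : 0 <= C * (Num.sqrt (diam K) * diam K) by [].
  (* [virtual_bound] takes a positive M while w may be 0, so M is increased by e and e tends to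
     0. *)
  apply: (le_eps K0) => e e0.
  have [||||_ h] := bound 0 _ (M0 + e) L0.
  + by move=> i x b /vb[_]; apply.
  + by [].
  + move=> x /cov[i xi]; rewrite subr0 (wf i x xi); apply: le_trans (vb i x xi).1 _.
    by rewrite /M0 mulrDl -addrA lerDl.
  + by rewrite LH (@le_trans _ _ M0) ?lerDl// /M0 ler_wpM2r// lerDr.
  apply: le_trans (le_trans _ h) _.
    rewrite (_ : (fun x => v x - 0) = v); first exact: lexx.
    by apply/funext => x; rewrite subr0.
  rewrite (_ : D0 * N = C * (Num.sqrt (diam K) * M0) * diam K).
    by lra.
  by rewrite /M0 /D0 SE; field; rewrite !gt_eqF.
(* Having a weak gradient, w gives [H1seminorm] its proper meaning on the right-hand side. *)
- have [g hg] := piecewise_gradient hm hs pf wf GK.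
  have wg : is_wgrad K w g.
    move=> b; have [sg hgb] := hg b; split; first exact: sg.
    by move=> phi hphi; apply: hgb; apply: test_inner; rewrite GK.
  have wG : is_wgrad K w (wgrad K w) := xgetPex _ (ex_intro _ g wg).
  have sg b : S2 lebn (pdom K) (wgrad K w b) by case: (wG b).
  have hgb b phi : inner G phi -> dot lebn (pdom K) w (pd b phi) = - dot lebn (pdom K) (wgrad K w b) phi.
    move=> iphi; have [sp mp] := iphi; have [_ h] := wG b; apply: h.
    by have := margin_test sp mp; rewrite GK.
  pose Gs := \sum_b nrm lebn (pdom K) (wgrad K w b).
  have Gs0 : 0 <= Gs by apply: sumr_ge0 => b _; exact: nrm_ge0.
  have L0 : 0 <= CI * (Gs / S) by [].
  have vb i x b : tet (tets T i) x -> `|pd b (f i) x| <= CI * (Gs / S).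
    move=> xi; have := gradient_bound hsigma hgamma hm hs ne pf wf CI0 hI GK (sg b) (hgb b) xi.
    rewrite dE => h; apply: (le_trans h); rewrite ler_wpM2l// ler_wpM2r//.
    by rewrite /Gs (bigD1 b)//= lerDl sumr_ge0// => j _; exact: nrm_ge0.
  pose M0 := 6 * (CI * (Gs / S)) * diam K.
  have M00 : 0 <= M0 by rewrite mulr_ge0// mulr_ge0.
  have vgb b : nrm lebn (pdom K) (wgrad K v b) <= C * (6 * CI) / s * Gs.
    have K0 : 0 <= C * Num.sqrt (diam K) by [].
    apply: (le_eps K0) => e e0.
    (* The constant subtracted is the value of w at the star centre, from which every point of K is
       reached by a segment in K; w then differs from it by at most 3 times the gradient bound times
       H. *)
    have [||||h _] := bound (w (gx0 G)) _ (M0 + e) L0.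
    + by [].
    + by [].
    + move=> x Kx; have Gx : gD G x by rewrite GK.
      have sx : seg (gx0 G) x `<=` pdom K.
        by rewrite -GK; apply: (g_star (g := G)) => //; rewrite subrr normr0 ltW// g_r0.
      have sfw i : smooth (f i) /\ forall x, tet (tets T i) x -> w x = f i x by split; [exact: Pol_smooth (pf i)|exact: wf].
      apply: le_trans (piecewise_smooth_lip hs L0 sfw vb sx) _.
      have := g_near Gx; rewrite Gh => xh; apply: (@le_trans _ _ (3 * (CI * (Gs / S)) * diam K)).
        by rewrite ler_wpM2l//.
      by rewrite (le_trans (y := M0)) ?lerDl// /M0 ler_wpM2r// ler_wpM2r// ler_nat.
    + by rewrite lerDl.
    apply: le_trans (h b) _.
    rewrite (_ : C * (6 * CI) / s * Gs = C * (Num.sqrt (diam K) * M0)).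
      by lra.
    by rewrite /M0 SE; field; rewrite !gt_eqF.
  have semi (u : 'I_3 -> 'rV[R]_3 -> R) : Num.sqrt (\sum_i ip (pdom K) (u i) (u i)) <= \sum_i nrm lebn (pdom K) (u i).
    have u0 : 0 <= \sum_i nrm lebn (pdom K) (u i) by apply: sumr_ge0 => i _; exact: nrm_ge0.
    rewrite -[leRHS]ger0_norm// -sqrtr_sqr ler_wsqrtr// expr2 mulr_suml; apply: ler_sum => i _.
    rewrite (_ : ip _ _ _ = nrm lebn (pdom K) (u i) ^+ 2); last by rewrite nrm_sqr.
    by rewrite expr2 ler_wpM2l ?nrm_ge0// (bigD1 i)//= lerDl sumr_ge0// => j _; exact: nrm_ge0.
  have wb b : nrm lebn (pdom K) (wgrad K w b) <= H1seminorm K w.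
    by rewrite ler_wsqrtr// (bigD1 b)//= lerDl sumr_ge0// => j _; exact: dot_ge0.
  apply: (@le_trans _ _ (D1 * H1seminorm K w)); last by rewrite ler_wpM2r ?sqrtr_ge0// lerDr.
  apply: le_trans (semi _) _; apply: (@le_trans _ _ (\sum_(b < 3) (C * (6 * CI) / s * Gs))).
    by apply: ler_sum => b _; exact: vgb.
  have GsH : Gs <= 3 * H1seminorm K w.
    apply: (@le_trans _ _ (\sum_(b < 3) H1seminorm K w)); first by apply: ler_sum => b _; exact: wb.
    by rewrite sumr_const card_ord mulr_natl.
  have ar (a b : R) : 3 * a * 3 * b = 3 * (a * (3 * b)) by ring.
  by rewrite sumr_const card_ord -[leLHS]mulr_natl /D1 ar; apply: ler_wpM2l => //; exact: ler_wpM2l.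
Qed.
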